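(* Let $K$ be a polygon satisfying the mesh assumptions with parameter $\rho$, with triangulation $\mathcal T_K$, let $k\ge1$, let $V_k^{\mathrm c}(K)$ be the enhanced conforming virtual element space, and let $\widetilde J_k^K:V_k^{\mathrm c}(K)\to\widetilde W_k(\mathcal T_K)$ be the interpolation operator, all as defined in the context. Then there is a constant $C>0$, depending only on $k$, $\rho$ and the regularity constants of $\mathcal T_K$ (not on $h_K$), such that for all $v_h\in V_k^{\mathrm c}(K)$ $$|v_h|_{m,K}\le C|\widetilde J_k^Kv_h|_{m,K},\qquad m=0,1.$$
   Context: Notation: $(\cdot,\cdot)_S$, $\|\cdot\|_S$ are the $L^2(S)$ inner product and norm; $|\cdot|_{1,S}$ is the $H^1(S)$ seminorm and $|\cdot|_{0,S}=\|\cdot\|_S$. $\mathbb P_m(S)$ is the space of polynomials of degree $\le m$ on $S$ ($\{0\}$ if $m<0$); $\overline{\mathbb P}_m(S)$ is the subspace of homogeneous polynomials of degree $m$ in $\bm x-\bm x_S$ ($\{0\}$ if $m<0$), with $\bm x_S$ the barycenter of $S$. $\mathbb M_m(S)=\{((\bm x-\bm x_S)/h_S)^{\bm\beta}:|\bm\beta|\le m\}$ is the scaled monomial basis of $\mathbb P_m(S)$ ($h_S$ the diameter; empty if $m<0$). Mesh assumptions: $K\subset\mathbb R^2$ is a polygon of diameter $h_K$, star-shaped with respect to a disc of radius $\ge\rho h_K$, all of whose edges have length $\ge\rho h_K$ ($\rho>0$ fixed). $\mathcal T_K$ is a conforming shape-regular triangulation of $K$ whose triangles have diameters comparable to $h_K$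 and such that the edges of $K$ are not subdivided. $\mathcal V(K),\mathcal E(K)$ are the vertices and edges of $K$; $\mathcal V^{\mathrm{int}}(\mathcal T_K)$, $\mathcal E^{\mathrm{int}}(\mathcal T_K)$ are the vertices and edges of $\mathcal T_K$ in the interior of $K$; $\mathcal E^\partial(\mathcal T_K)=\mathcal E(K)$ are the boundary edges. Projections: $Q_k^K$ is the $L^2(K)$ projection onto $\mathbb P_k(K)$. For $v\in H^1(K)$, $\Pi_k^Kv\in\mathbb P_k(K)$ is defined by $(\nabla\Pi_k^Kv,\nabla q)_K=(\nabla v,\nabla q)_K$ for all $q\in\mathbb P_k(K)$ and $\int_{\partial K}\Pi_k^Kv\,\mathrm ds=\int_{\partial K}v\,\mathrm ds$. Virtual element space: with $\mathbb B_k(\partial K)=\{v\in C^0(\partial K):v|_e\in\mathbb P_k(e)\ \forall e\in\mathcal E(K)\}$, $$V_k^{\mathrm c}(K)=\{v\in H^1(K):\Delta v\in\mathbb P_k(K),\ v|_{\partial K}\in\mathbb B_k(\partial K),\ (v,q)_K=(\Pi_k^Kv,q)_K\ \forall q\in\overline{\mathbb P}_k(K)\oplus\overline{\mathbb P}_{k-1}(K)\}.$$ Macro finite element space: for a triangle $T$ with cubic bubble $b_T$ (product of the three barycentric coordinates), $\widetilde W_k(T)=\mathbb P_k(T)\oplus b_T\overline{\mathbb P}_{k-2}(T)$, with unisolvent degrees of freedom: values at the vertices of $T$, moments $\frac1{|e|}(v,q)_e$, $q\in\mathbb M_{k-2}(e)$, on the edges of $T$, and moments $\frac1{|T|}(v,q)_T$,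 $q\in\mathbb M_{k-2}(T)$. $\widetilde W_k(\mathcal T_K)=\{v\in C^0(K):v|_T\in\widetilde W_k(T)\ \forall T\in\mathcal T_K\}$. Interpolation: for $v_h\in V_k^{\mathrm c}(K)$, $\widetilde J_k^Kv_h\in\widetilde W_k(\mathcal T_K)$ is determined by - $\widetilde J_k^Kv_h(\delta)=v_h(\delta)$, $\delta\in\mathcal V(K)$; - $\widetilde J_k^Kv_h(\delta)=\Pi_k^Kv_h(\delta)$, $\delta\in\mathcal V^{\mathrm{int}}(\mathcal T_K)$; - $(\widetilde J_k^Kv_h-v_h,q)_e=0$, $q\in\mathbb M_{k-2}(e)$, $e\in\mathcal E^\partial(\mathcal T_K)$; - $(\widetilde J_k^Kv_h-\Pi_k^Kv_h,q)_e=0$, $q\in\mathbb M_{k-2}(e)$, $e\in\mathcal E^{\mathrm{int}}(\mathcal T_K)$; - $(\widetilde J_k^Kv_h-Q_k^Kv_h,q)_T=0$, $q\in\mathbb M_{k-2}(T)$, $T\in\mathcal T_K$. *)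

(* Defs.v *)
From HB Require Import structures.
From mathcomp Require Import all_boot all_order all_algebra.
From mathcomp Require Import all_classical all_reals all_analysis.

Set Implicit Arguments.
Unset Strict Implicit.
Unset Printing Implicit Defensive.

Import Order.TTheory GRing.Theory Num.Theory.
Import numFieldNormedType.Exports.

Local Open Scope classical_set_scope.
Local Open Scope ring_scope.

Section Plane.
Context {R : realType}.

(* The library norm on [R * R] is the sup norm: it gives the right topology,
   but lengths, discs and diameters need the Euclidean norm. *)
Definition dot (x y : R * R) : R := x.1 * y.1 + x.2 * y.2.
Definition enorm (x : R * R) : R := Num.sqrt (dot x x).
Definition diam (S : set (R * R)) : R :=
  sup [set enorm (x - y) | x in S & y in S].
Definition disc (c : R * R) (r : R) : set (R * R) :=
  [set x | enorm (x - c) < r].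

Definition seg_pt (a b : R * R) (t : R) : R * R := a + t *: (b - a).
Definition segment (a b : R * R) : set (R * R) := seg_pt a b @` `[0, 1].
Definition open_segment (a b : R * R) : set (R * R) := seg_pt a b @` `]0, 1[.

Definition star_shaped_disc (K : set (R * R)) (c : R * R) (r : R) : Prop :=
  forall x y, K x -> disc c r y -> segment x y `<=` K.

Definition leb2 := (@lebesgue_measure R \x @lebesgue_measure R)%E.

Definition area (S : set (R * R)) : R := fine (leb2 S).
Definition centroid (S : set (R * R)) : R * R :=
  ((\int[leb2]_(x in S) x.1) / area S, (\int[leb2]_(x in S) x.2) / area S).

Definition det2 (u v : R * R) : R := u.1 * v.2 - u.2 * v.1.

Definition nondeg_triangle (T : 'I_3 -> R * R) : Prop :=
  forall i, det2 (T (ordS i) - T i) (T (ordS (ordS i)) - T i) != 0.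

(* Barycentric coordinates as quotients of signed areas. *)
Definition bary (T : 'I_3 -> R * R) (i : 'I_3) (x : R * R) : R :=
  det2 (T (ordS i) - x) (T (ordS (ordS i)) - x) /
  det2 (T (ordS i) - T i) (T (ordS (ordS i)) - T i).

Definition triangle (T : 'I_3 -> R * R) : set (R * R) :=
  [set x | forall i, 0 <= bary T i x].

Definition bubble (T : 'I_3 -> R * R) (x : R * R) : R :=
  \prod_(i < 3) bary T i x.

(* The degree bound is an integer, so that the spaces below are [{0}], and the
   sets of monomials empty, when it is negative. *)

Definition poly_le (m : int) : set (R * R -> R) :=
  [set f | exists c : nat -> nat -> R, forall x,
    f x = \sum_(i < `|m|%N.+1) \sum_(j < `|m|%N.+1 | (i + j)%N%:Z <= m)
            c i j * x.1 ^+ i * x.2 ^+ j].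

Definition poly_hom (S : set (R * R)) (m : int) : set (R * R -> R) :=
  [set f | exists c : nat -> nat -> R, forall x,
    f x = \sum_(i < `|m|%N.+1) \sum_(j < `|m|%N.+1 | (i + j)%N%:Z == m)
            c i j * (x - centroid S).1 ^+ i * (x - centroid S).2 ^+ j].

Definition monomials (S : set (R * R)) (m : int) : set (R * R -> R) :=
  [set f | exists i j : nat, (i + j)%N%:Z <= m /\
    f = fun x => ((x - centroid S).1 / diam S) ^+ i *
                 ((x - centroid S).2 / diam S) ^+ j].

(* On the edge [a, b], with length h and unit tangent (b - a) / h, the scaled
   coordinate with origin at the midpoint is (x - mid) . (b - a) / h ^ 2. *)
Definition edge_monomials (a b : R * R) (m : int) : set (R * R -> R) :=
  [set f | exists j : nat, j%:Z <= m /\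
    f = fun x => (dot (x - seg_pt a b 2^-1) (b - a) / dot (b - a) (b - a)) ^+ j].

Definition inner (S : set (R * R)) (f g : R * R -> R) : R :=
  \int[leb2]_(x in S) (f x * g x).

Definition edge_int (a b : R * R) (f : R * R -> R) : R :=
  enorm (b - a) * \int[@lebesgue_measure R]_(t in `[0, 1]) f (seg_pt a b t).

Definition L2 (S : set (R * R)) (f : R * R -> R) : Prop :=
  measurable_fun S f /\ leb2.-integrable S (fun x => (f x ^+ 2)%:E).

Definition L2_edge (a b : R * R) (f : R * R -> R) : Prop :=
  measurable_fun (`[0, 1] : set R) (f \o seg_pt a b) /\
  (@lebesgue_measure R).-integrable `[0, 1]
    (fun t => (f (seg_pt a b t) ^+ 2)%:E).

Definition d1 (f : R * R -> R) (x : R * R) : R := 'D_((1, 0) : R * R) f x.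
Definition d2 (f : R * R -> R) (x : R * R) : R := 'D_((0, 1) : R * R) f x.

Fixpoint Cn (n : nat) (f : R * R -> R) : Prop :=
  continuous f /\
  if n is n'.+1 then
    [/\ forall x, derivable f x ((1, 0) : R * R),
        forall x, derivable f x ((0, 1) : R * R),
        Cn n' (d1 f) & Cn n' (d2 f)]
  else True.

Definition smooth (f : R * R -> R) : Prop := forall n, Cn n f.

Definition test_fun (K : set (R * R)) (f : R * R -> R) : Prop :=
  smooth f /\
  exists A : set (R * R), [/\ compact A, A `<=` K & forall x, ~ A x -> f x = 0].

Record H1 (K : set (R * R)) := MkH1 {
  H1_val :> R * R -> R;
  H1_d1 : R * R -> R;
  H1_d2 : R * R -> R;
  H1_L2 : L2 K H1_val;
  H1_L2_d1 : L2 K H1_d1;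
  H1_L2_d2 : L2 K H1_d2;
  H1_weak_d1 : forall phi, test_fun K phi ->
    inner K H1_val (d1 phi) = - inner K H1_d1 phi;
  H1_weak_d2 : forall phi, test_fun K phi ->
    inner K H1_val (d2 phi) = - inner K H1_d2 phi }.

Definition L2norm (S : set (R * R)) (f : R * R -> R) : R :=
  Num.sqrt (inner S f f).

Definition H1seminorm (K : set (R * R)) (v : H1 K) : R :=
  Num.sqrt (inner K (H1_d1 v) (H1_d1 v) + inner K (H1_d2 v) (H1_d2 v)).

(* Distributional Laplacian: <Delta v, phi> = - (grad v, grad phi). *)
Definition weak_laplacian (K : set (R * R)) (v : H1 K) (f : R * R -> R) : Prop :=
  forall phi, test_fun K phi ->
    inner K f phi =
    - (inner K (H1_d1 v) (d1 phi) + inner K (H1_d2 v) (d2 phi)).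

(* An open polygon, given by the cyclic list of its vertices.  By the Jordan
   curve theorem, a nonempty bounded open set whose boundary is a simple closed
   polygonal line is the region enclosed by that line.  Flat angles are
   allowed. *)
Record polygon := Polygon {
  pol_dom :> set (R * R);
  pol_n : nat;
  pol_vtx : 'I_pol_n -> R * R;
  pol_n_ge3 : (3 <= pol_n)%N;
  pol_open : open pol_dom;
  pol_nonempty : pol_dom !=set0;
  pol_bounded : exists M, pol_dom `<=` disc 0 M;
  pol_inj : injective pol_vtx;
  pol_simple : forall i j x, i != j ->
    segment (pol_vtx i) (pol_vtx (ordS i)) x ->
    segment (pol_vtx j) (pol_vtx (ordS j)) x ->
    (j = ordS i /\ x = pol_vtx j) \/ (i = ordS j /\ x = pol_vtx i);
  pol_boundary : closure pol_dom `\` pol_dom =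
    \bigcup_i segment (pol_vtx i) (pol_vtx (ordS i)) }.

Definition boundary (K : polygon) : set (R * R) := closure K `\` K.

Definition mesh_regular (rho : R) (K : polygon) : Prop :=
  (exists c r, [/\ rho * diam K <= r, disc c r `<=` K
     & star_shaped_disc K c r]) /\
  forall i, rho * diam K <= enorm (pol_vtx (ordS i) - @pol_vtx K i).

Record triangulation (K : polygon) := Triangulation {
  tri_n : nat;
  tri : 'I_tri_n -> 'I_3 -> R * R;
  tri_nondegenerate : forall t, nondeg_triangle (tri t);
  tri_cover : \bigcup_t triangle (tri t) = closure K;
  tri_conforming : forall s t, s != t ->
    let I := triangle (tri s) `&` triangle (tri t) in
    [\/ I = set0,
        exists a b, tri s a = tri t b /\ I = [set tri s a]
      | exists a b a' b', [/\ a != b, a' != b', tri s a = tri t a',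
          tri s b = tri t b' & I = segment (tri s a) (tri s b)]];
  tri_boundary_edges : forall i : 'I_(pol_n K), exists t a,
    segment (tri t a) (tri t (ordS a)) =
    segment (pol_vtx i) (pol_vtx (ordS i)) }.

(* [gamma] is the shape-regularity constant; [c1] and [c2] express that the
   diameters of the triangles are comparable to that of [K]. *)
Definition tri_regular (gamma c1 c2 : R) (K : polygon) (TK : triangulation K)
  : Prop :=
  forall t, let T := triangle (@tri K TK t) in
    [/\ exists c r, gamma * diam T <= r /\ disc c r `<=` T,
        c1 * diam K <= diam T & diam T <= c2 * diam K].

Definition boundary_int (K : polygon) (f : R * R -> R) : R :=
  \sum_(i < pol_n K) edge_int (pol_vtx i) (pol_vtx (ordS i)) f.

(* [g] is the trace of [v]: the trace operator is the continuous extension to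
   [H1 K] of the restriction of smooth functions to the boundary. *)
Definition is_trace (K : polygon) (v : H1 K) (g : R * R -> R) : Prop :=
  (forall i : 'I_(pol_n K), L2_edge (pol_vtx i) (pol_vtx (ordS i)) g) /\
  exists phi : nat -> R * R -> R,
    [/\ forall n, smooth (phi n),
        (fun n => L2norm K (fun x => phi n x - v x)) @ \oo --> (0 : R),
        (fun n => L2norm K (fun x => d1 (phi n) x - H1_d1 v x)) @ \oo --> (0 : R),
        (fun n => L2norm K (fun x => d2 (phi n) x - H1_d2 v x)) @ \oo --> (0 : R)
      & (fun n => boundary_int K (fun x => (phi n x - g x) ^+ 2)) @ \oo --> (0 : R)].

Definition is_Q (K : polygon) (k : nat) (v p : R * R -> R) : Prop :=
  poly_le k%:Z p /\
  forall q, poly_le k%:Z q -> inner K p q = inner K v q.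

Definition is_Pi (K : polygon) (k : nat) (v : H1 K) (p : R * R -> R) : Prop :=
  [/\ poly_le k%:Z p,
      forall q, poly_le k%:Z q ->
        inner K (d1 p) (d1 q) + inner K (d2 p) (d2 q) =
        inner K (H1_d1 v) (d1 q) + inner K (H1_d2 v) (d2 q)
    & exists g, is_trace v g /\ boundary_int K p = boundary_int K g].

Definition poly_on_segment (k : nat) (a b : R * R) (g : R * R -> R) : Prop :=
  exists q : {poly R}, (size q <= k.+1)%N /\
    forall t, t \in `[0, 1] -> g (seg_pt a b t) = q.[t].

Definition B_space (K : polygon) (k : nat) (g : R * R -> R) : Prop :=
  {within boundary K, continuous g} /\
  forall i : 'I_(pol_n K), poly_on_segment k (pol_vtx i) (pol_vtx (ordS i)) g.

Definition vem (K : polygon) (k : nat) (v : H1 K) : Prop :=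
  [/\ exists p, poly_le k%:Z p /\ weak_laplacian v p,
      exists g, is_trace v g /\ B_space K k g
    & exists p, is_Pi k v p /\
        forall q1 q2, poly_hom K k%:Z q1 -> poly_hom K (k%:Z - 1) q2 ->
          inner K v (q1 \+ q2) = inner K p (q1 \+ q2)].

Definition W_local (k : nat) (T : 'I_3 -> R * R) (w : R * R -> R) : Prop :=
  exists p q, [/\ poly_le k%:Z p, poly_hom (triangle T) (k%:Z - 2) q
    & forall x, triangle T x -> w x = p x + bubble T x * q x].

Definition W_space (K : polygon) (TK : triangulation K) (k : nat)
    (w : R * R -> R) : Prop :=
  {within closure K, continuous w} /\ forall t, W_local k (@tri K TK t) w.

(* [w] is the interpolant of [v].  Point values and edge moments of [v] on the
   boundary are those of its continuous trace [g]; [p] and [r] are the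
   projections of [v]. *)
Definition is_interp (K : polygon) (TK : triangulation K) (k : nat)
    (v : H1 K) (w : R * R -> R) : Prop :=
  W_space TK k w /\
  exists g p r,
  [/\ is_trace v g /\ B_space K k g, is_Pi k v p, is_Q K k v r &
  [/\ forall i : 'I_(pol_n K), w (pol_vtx i) = g (pol_vtx i),
      forall t a, pol_dom K (@tri K TK t a) -> w (tri t a) = p (tri t a),
      forall i : 'I_(pol_n K),
        let a := pol_vtx i in let b := pol_vtx (ordS i) in
        forall q, edge_monomials a b (k%:Z - 2) q ->
          edge_int a b (fun x => (w x - g x) * q x) = 0,
      forall t i,
        let a := @tri K TK t i in let b := @tri K TK t (ordS i) in
        open_segment a b `<=` K ->
        forall q, edge_monomials a b (k%:Z - 2) q ->
          edge_int a b (fun x => (w x - p x) * q x) = 0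
    & forall t q, let T := triangle (@tri K TK t) in
        monomials T (k%:Z - 2) q -> inner T (w \- r) q = 0]].

End Plane.

(* Main.v *)
Require Import Defs.
From HB Require Import structures.
From mathcomp Require Import all_boot all_order all_algebra.
From mathcomp Require Import all_classical all_reals all_analysis.
From mathcomp Require Import measurable_realfun.
From mathcomp Require Import ring lra zify.

Set Implicit Arguments.
Unset Strict Implicit.
Unset Printing Implicit Defensive.

Import Order.TTheory GRing.Theory Num.Theory.
Import numFieldNormedType.Exports.

Local Open Scope classical_set_scope.
Local Open Scope ring_scope.

(* Let h be the diameter of K and w the interpolant of v.  Pairing the
   polynomial pieces of w with test functions supported in inscribed discs shows
   that w is Lipschitz with a constant G bounded by C |w|_1 / h and also by
   C ||w|| / h^2.  It remains to bound v by G.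
   The boundary degrees of freedom give w = v on the boundary.  Cutting v - w
   off near the boundary and smoothing w by a quasi-interpolation on a grid, one
   approximates v - w in H^1, up to a smooth function with gradient of order G,
   by test functions; this gives Green's formula and Friedrichs' inequality for
   v - w in terms of G.  The interior moments make v - w orthogonal to
   polynomials of degree k - 2.  Hence p = Pi v, whose Laplacian has such a
   degree, has a gradient of order G, and since p and w have the same boundary
   mean, p - w is of order G h.  Finally (Delta v, v - w) = (f', p - w), where f'
   collects the two leading homogeneous parts of Delta v, and Green's formula
   yields |v|_1 <= C G h and ||v - w|| <= C G h^2. *)

(** * Square-integrable functions *)

(** Two kinds of constants have to be kept apart. Those of the final estimate may depend only on the
    degree and the regularity parameters: they come from pairing polynomials with fixed bumps scaled
    to discs of radius proportional to h, and from a partition of unity on a grid, whose gradient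
    bound does not see the mesh size. The constants of the strip and trace inequalities depend on
    the polygon in an uncontrolled way; they are used only in limits, to make approximation errors
    arbitrarily small and to identify traces, and so leave no mark on the result. Derivatives of v
    exist only weakly, so every estimate is obtained by testing. The smooth substitute W of w enters
    solely through the size of its gradient: Green's formula for v - w holds up to the pairing with
    grad W, a term of order G that is absorbed at the end. The number G is the only quantity through
    which w controls v. This is why one argument serves both seminorms: it yields G h for the
    gradient of v and G h^2 for the norm of v - w, and the two bounds on G turn these into the
    seminorm and the norm of w. *)

Section Lebesgue_affine.
Context {R : realType}.
Notation mu := (@lebesgue_measure R).

Lemma measurable_affine (a b : R) :
  measurable_fun (setT : set R) (fun x => a * x + b : R).
Proof. by apply: measurable_funD => //; apply: measurable_funM. Qed.

(** The scaled pushforward on the right agrees with Lebesgue measure on half-open intervals, hence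
    everywhere. A negative [a] turns the preimage into an interval closed on the left instead of on
    the right, which does not change its length. *)
Lemma lebesgue_affine (a b : R) (A : set R) : a != 0 -> measurable A ->
  mu A = (`|a|%:E * mu ((fun x => a * x + b)%R @^-1` A))%E.
Proof.
move=> a0 mA; pose f : R -> R := fun x => a * x + b.
have mf : measurable_fun (setT : set R) f by exact: measurable_affine.
pose nu0 := (pushforward (mu : {measure set (measurableTypeR R) -> \bar R})
  (f : measurableTypeR R -> measurableTypeR R) : {measure set (measurableTypeR R) -> \bar R}).
pose nu1 : {measure set (measurableTypeR R) -> \bar R} := nu0 mf.
pose nu : {measure set (measurableTypeR R) -> \bar R} :=
  mscale (NngNum (normr_ge0 a)) nu1.
have -> : mu A = nu A.
  apply: lebesgue_measure_unique => //= X [[x y] /=].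
  move=> _ <-; rewrite /nu /nu1 /nu0 /mscale /pushforward/=.
  have [yx|xy] := leP y x.
    have -> : [set` `]x, y]] = set0 :> set R by rewrite set_itv_ge// -leNgt bnd_simp.
    by rewrite /pushforward preimage_set0 !measure0 mule0.
  have [ap|an|a00] := ltgtP 0 a; last by rewrite -a00 eqxx in a0.
    rewrite /pushforward; have -> : f @^-1` `]x, y] = `](x - b) / a, (y - b) / a]%classic.
      apply/seteqP; split=> z /=; rewrite /f !in_itv/= => /andP[h1 h2];
        rewrite ?ltr_pdivrMr ?ler_pdivlMr // in h1 h2 *; apply/andP; split; lra.
    rewrite !lebesgue_measure_itv/= !lte_fin xy ltr_pM2r ?invr_gt0//.
    by rewrite ltrD2r xy -!EFinD -EFinM gtr0_norm// -mulrBl mulrC divfK//; congr EFin; lra.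
  rewrite /pushforward; have -> : f @^-1` `]x, y] = `[(y - b) / a, (x - b) / a[%classic.
    apply/seteqP; split=> z /=; rewrite /f !in_itv/= => /andP[h1 h2];
      rewrite ?ltr_ndivlMr ?ler_ndivrMr // in h1 h2 *; apply/andP; split; lra.
  rewrite !lebesgue_measure_itv/= !lte_fin xy ltr_nM2r ?invr_lt0//.
  rewrite ltrD2r xy -!EFinD -EFinM ltr0_norm// -mulrBl; congr EFin.
  by field; rewrite lt_eqF.
by rewrite /nu /nu1 /mscale /pushforward/=.
Qed.

Lemma ge0_integral_affine (a b : R) (f : R -> \bar R) : a != 0 ->
  measurable_fun setT f -> (forall x, (0 <= f x)%E) ->
  (\int[mu]_x f x = `|a|%:E * \int[mu]_x f (a * x + b)%R)%E.
Proof.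
move=> a0 mf f0; pose g : R -> R := fun x => a * x + b.
have mg : measurable_fun (setT : set R) g by exact: measurable_affine.
pose nu0 := (pushforward (mu : {measure set (measurableTypeR R) -> \bar R})
  (g : measurableTypeR R -> measurableTypeR R) : {measure set (measurableTypeR R) -> \bar R}).
pose nu1 : {measure set (measurableTypeR R) -> \bar R} := nu0 mg.
pose nu : {measure set (measurableTypeR R) -> \bar R} :=
  mscale (NngNum (normr_ge0 a)) nu1.
transitivity (\int[nu]_x f x)%E.
  apply: eq_measure_integral => A mA _.
  by rewrite /nu /nu1 /mscale/= /pushforward (lebesgue_affine b a0).
rewrite ge0_integral_mscale//= ge0_integral_pushforward//.
Qed.

Lemma measurable_fun_swap (H : R * R -> \bar R) :
  measurable_fun setT H -> measurable_fun setT (fun x : R * R => H (x.2, x.1)).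
Proof.
move=> mH; apply: measurableT_comp => //.
exact: measurable_fun_pair.
Qed.

Lemma measurable_frame (c a d : R * R) :
  measurable_fun setT (fun x : R * R => c + x.1 *: a + x.2 *: d).
Proof.
apply: measurable_fun_pair => /=.
  by apply: measurable_funD; [apply: measurable_funD => //|];
    apply: measurable_funM.
by apply: measurable_funD; [apply: measurable_funD => //|];
  apply: measurable_funM.
Qed.

(** Two one-dimensional substitutions through the mixed coordinates consisting of the frame
    coordinate [s] and the Cartesian abscissa. For fixed [s] the abscissa is affine in [t] with
    slope [d.1]; for fixed abscissa the ordinate is affine in [s] with slope [- det2 a d / d.1].
    Tonelli's theorem exchanges the two integrations in between. *)
Lemma ge0_integral_frame1 (c a d : R * R) (H : R * R -> \bar R) :
  measurable_fun setT H -> (forall x, (0 <= H x)%E) ->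
  d.1 != 0 -> det2 a d != 0 ->
  (\int[leb2]_x H x =
   `|det2 a d|%:E * \int[mu]_s \int[mu]_t H (c + s *: a + t *: d)%R)%E.
Proof.
move=> mH H0 d0 dt0.
pose h (z : R * R) := H (z.2, c.2 + z.1 * a.2 + (z.2 - c.1 - z.1 * a.1) * (d.2 / d.1)).
have mh : measurable_fun setT h.
  apply: measurableT_comp => //; apply: measurable_fun_pair => //=.
  apply: measurable_funD; first by apply: measurable_funD => //; apply: measurable_funM.
  by apply: measurable_funM => //; apply: measurable_funB => //;
    [apply: measurable_funB|apply: measurable_funM].
have E1 s : (\int[mu]_x h (s, x) = `|d.1|%:E * \int[mu]_t H (c + s *: a + t *: d)%R)%E.
  rewrite (@ge0_integral_affine d.1 (c.1 + s * a.1) (fun x => h (s, x)))//;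
    [|exact: (measurable_fun_pair2 _ mh)|by move=> x; exact: H0].
  congr (_ * _)%E; apply: eq_integral => t _; rewrite /h/=; congr H.
  rewrite [RHS]surjective_pairing/=; congr pair; first by rewrite /GRing.scale /=; ring.
  by rewrite /GRing.scale /=; field.
have E2 x : (\int[mu]_y H (x, y) = `|det2 a d / d.1|%:E * \int[mu]_s h (s, x))%E.
  have e0 : a.2 - a.1 * (d.2 / d.1) != 0.
    apply: contra_neq dt0; rewrite /det2 => e.
    by rewrite -[RHS](mulr0 (- d.1)) -[in RHS]e; field.
  rewrite (@ge0_integral_affine (a.2 - a.1 * (d.2 / d.1)) (c.2 + (x - c.1) * (d.2 / d.1))
    (fun y => H (x, y)))//; last exact: (measurable_fun_pair2 _ mH).
  congr (_ * _)%E; first by rewrite -normrN /det2; congr (EFin `|_|); field.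
  by apply: eq_integral => t _; rewrite /h/=; congr (H (_, _)); ring.
rewrite /leb2 fubini_tonelli1// /fubini_F.
transitivity (\int[mu]_x (`|det2 a d / d.1|%:E * \int[mu]_s h (s, x)))%E.
  by apply: eq_integral.
rewrite ge0_integralZl //; last 2 first.
- by apply: (@measurable_fun_fubini_tonelli_G _ _ _ _ _ mu _ mh) => x; exact: H0.
- by move=> x _; apply: integral_ge0 => y _; exact: H0.
have FT : (\int[mu]_s \int[mu]_x h (s, x) = \int[mu]_x \int[mu]_s h (s, x))%E.
  by apply: (@fubini_tonelli _ _ _ _ _ mu mu h mh) => x; exact: H0.
rewrite -FT.
under eq_integral do rewrite E1.
rewrite ge0_integralZl//=; last 2 first.
- apply: (@measurable_fun_fubini_tonelli_F _ _ _ _ _ mu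
    (fun z : R * R => H (c + z.1 *: a + z.2 *: d))) => //.
  by apply: measurableT_comp => //; exact: measurable_frame.
- by move=> x _; apply: integral_ge0.
by rewrite muleA -EFinM -normrM divfK.
Qed.

Lemma ge0_integral_frame (c a d : R * R) (H : R * R -> \bar R) :
  measurable_fun setT H -> (forall x, (0 <= H x)%E) -> det2 a d != 0 ->
  (\int[leb2]_x H x =
   `|det2 a d|%:E * \int[mu]_s \int[mu]_t H (c + s *: a + t *: d)%R)%E.
Proof.
move=> mH H0 dt0; have [d10|d10] := eqVneq d.1 0; last exact: ge0_integral_frame1.
have d20 : d.2 != 0 by apply: contra_neq dt0; rewrite /det2 d10 => ->; ring.
pose H' (x : R * R) := H (x.2, x.1).
have mH' : measurable_fun setT H' by exact: measurable_fun_swap.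
have -> : (\int[leb2]_x H x = \int[leb2]_x H' x)%E.
  rewrite /leb2 fubini_tonelli1// fubini_tonelli2// => x; exact: H0.
rewrite (@ge0_integral_frame1 (c.2, c.1) (a.2, a.1) (d.2, d.1) H')//; last 2 first.
- by move=> x; exact: H0.
- by move: dt0; rewrite /det2 /= -oppr_eq0 opprB mulrC [X in _ - X]mulrC.
congr (_ * _)%E; first by rewrite /det2/= -normrN; congr (EFin `|_|); ring.
Qed.

(** Replacing [t] by [s * t] in the frame coordinates gives coordinates of polar type with Jacobian
    [|s|]. The substitution degenerates at [s = 0], which is removed first as a null set. *)
Lemma ge0_integral_fan (c a d : R * R) (H : R * R -> \bar R) :
  measurable_fun setT H -> (forall x, (0 <= H x)%E) -> det2 a d != 0 ->
  (\int[leb2]_x H x = `|det2 a d|%:E *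
     \int[mu]_s \int[mu]_t (`|s|%:E * H (c + s *: (a + t *: d))%R))%E.
Proof.
move=> mH H0 dt0; rewrite (ge0_integral_frame c mH H0 dt0); congr (_ * _)%E.
have mF : measurable_fun setT (fun z : R * R => H (c + z.1 *: a + z.2 *: d)).
  by apply: measurableT_comp => //; exact: measurable_frame.
have mF2 : measurable_fun setT (fun z : R * R => `|z.1|%:E * H (c + z.1 *: (a + z.2 *: d))%R)%E.
  apply: emeasurable_funM; first by apply/measurable_EFinP; apply: measurableT_comp.
  apply: (measurableT_comp mH); apply: measurable_fun_pair => /=.
    by apply: measurable_funD => //; apply: measurable_funM => //;
      apply: measurable_funD => //; apply: measurable_funM.
  by apply: measurable_funD => //; apply: measurable_funM => //;
      apply: measurable_funD => //; apply: measurable_funM.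
rewrite -(@integral_setD1 _ (fun s => \int[mu]_t H (c + s *: a + t *: d)%R)%E 0 setT); last 2 first.
- exact: measurableD.
- apply: measurable_funTS.
  exact: (@measurable_fun_fubini_tonelli_F _ _ _ _ _ mu _ mF).
rewrite -(@integral_setD1 _ (fun s => \int[mu]_t (`|s|%:E * H (c + s *: (a + t *: d))%R))%E 0 setT); last 2 first.
- exact: measurableD.
- apply: measurable_funTS.
  by apply: (@measurable_fun_fubini_tonelli_F _ _ _ _ _ mu _ mF2) => x; apply: mule_ge0.
apply: eq_integral => s; rewrite inE/= => -[_ /eqP s0].
rewrite (@ge0_integral_affine s 0 (fun t => H (c + s *: a + t *: d)%R))//;
  last exact: (measurable_fun_pair2 _ mF).
rewrite -ge0_integralZl//=; last first.
  have mFs : measurable_fun [set: R] (fun t : R => H (c + s *: a + t *: d)%R).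
    exact: (measurable_fun_pair2 s mF).
  by apply: (measurableT_comp mFs); exact: measurable_affine.
by apply: eq_integral => t _; rewrite addr0 scalerDr scalerA addrA.
Qed.

End Lebesgue_affine.

Lemma countable_union_measurable d (T : measurableType d) (I : countType)
    (F : I -> set T) : (forall i, measurable (F i)) -> measurable (\bigcup_i F i).
Proof.
move=> mF; pose G n := if unpickle n is Some i then F i else set0.
have -> : \bigcup_i F i = \bigcup_n G n.
  apply/seteqP; split=> x [i _ Fx].
    by exists (pickle i) => //; rewrite /G pickleK.
  by move: Fx; rewrite /G; case: unpickle => // j Fx; exists j.
by apply: bigcupT_measurable => n; rewrite /G; case: unpickle => // i; exact: mF.
Qed.

Section Square_integrable.
Context {d : measure_display} {T : measurableType d} {R : realType}.
Variables (mu : {measure set T -> \bar R}) (D : set T).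
Hypothesis mD : measurable D.

(** Over [leb2] this and the next two definitions unfold to [L2], [inner] and [L2norm]. The general
    measure is there because traces on edges need the same inequalities over the unit interval. *)
Definition sqint (f : T -> R) : Prop :=
  measurable_fun D f /\ mu.-integrable D (fun x => (f x ^+ 2)%:E).
Definition ip (f g : T -> R) : R := \int[mu]_(x in D) (f x * g x).
Definition nrm (f : T -> R) : R := Num.sqrt (ip f f).

Lemma integrable_le (f g : T -> R) : measurable_fun D f ->
  mu.-integrable D (EFin \o g) -> (forall x, D x -> `|f x| <= g x) ->
  mu.-integrable D (EFin \o f).
Proof.
move=> mf ig fg; apply: le_integrable ig => //; first exact/measurable_EFinP.
by move=> x Dx /=; rewrite lee_fin (le_trans (fg x Dx))// ler_norm.
Qed.

Lemma integrable_const (r : R) : (mu D < +oo)%E ->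
  mu.-integrable D (EFin \o (fun=> r)).
Proof.
move=> fD; apply/integrableP; split; first exact/measurable_EFinP.
under eq_integral do rewrite /=.
by rewrite (integral_cst mu mD `|r%:E|%E) lte_mul_pinfty.
Qed.

Lemma sqint_sqr f : sqint f -> mu.-integrable D (EFin \o (fun x => f x ^+ 2)).
Proof. by case. Qed.

Lemma sqint_mul f g : sqint f -> sqint g ->
  mu.-integrable D (EFin \o (fun x => f x * g x)).
Proof.
move=> [mf If] [mg Ig].
apply: (@integrable_le _ (fun x => f x ^+ 2 + g x ^+ 2)).
- exact: measurable_funM.
- exact: (integrableD mD If Ig).
- move=> x _; rewrite ler_norml; apply/andP; split;
    have := sqr_ge0 (f x + g x); have := sqr_ge0 (f x - g x);
    have := sqr_ge0 (f x); have := sqr_ge0 (g x); nra.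
Qed.

Lemma sqintD f g : sqint f -> sqint g -> sqint (fun x => f x + g x).
Proof.
move=> hf hg; split; first by apply: measurable_funD; [case: hf|case: hg].
apply: (@integrable_le _ (fun x => 2 * (f x ^+ 2 + g x ^+ 2))).
- by apply: measurable_funX; apply: measurable_funD; [case: hf|case: hg].
- apply: (eq_integrable mD (fun x => 2%:E * ((f x ^+ 2)%:E + (g x ^+ 2)%:E))%E) => //.
  by apply: integrableZl => //; apply: integrableD => //; [case: hf|case: hg].
- move=> x _; rewrite ger0_norm ?sqr_ge0//.
  by have := sqr_ge0 (f x - g x); nra.
Qed.

Lemma sqint_bounded_mul (f g : T -> R) (M : R) : sqint f -> measurable_fun D g ->
  (forall x, D x -> `|g x| <= M) -> sqint (fun x => g x * f x).
Proof.
move=> hf mg gM; have mgf : measurable_fun D (fun x => g x * f x).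
  by apply: measurable_funM => //; case: hf.
split=> //; apply: (@integrable_le _ (fun x => M ^+ 2 * f x ^+ 2)).
- exact: measurable_funX.
- apply: (eq_integrable mD (fun x => (M ^+ 2)%:E * (f x ^+ 2)%:E)%E) => //.
  by apply: integrableZl => //; case: hf.
- move=> x Dx; rewrite ger0_norm ?sqr_ge0// exprMn ler_wpM2r ?sqr_ge0//.
  by rewrite -[_ ^+ 2]ger0_norm ?sqr_ge0// normrX lerXn2r ?nnegrE// ?gM//
     (le_trans _ (gM _ Dx)).
Qed.

Lemma sqintZ (a : R) f : sqint f -> sqint (fun x => a * f x).
Proof. by move=> hf; apply: (@sqint_bounded_mul _ _ `|a|). Qed.

Lemma sqintB f g : sqint f -> sqint g -> sqint (fun x => f x - g x).
Proof.
move=> hf hg; have := sqintD hf (sqintZ (-1) hg).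
by congr sqint; apply/funext => x; rewrite mulN1r.
Qed.

Lemma sqint_bounded (g : T -> R) (M : R) : (mu D < +oo)%E -> measurable_fun D g ->
  (forall x, D x -> `|g x| <= M) -> sqint g.
Proof.
move=> fD mg gM; split=> //.
apply: (@integrable_le _ (fun=> M ^+ 2)).
- exact: measurable_funX.
- exact: integrable_const.
- move=> x Dx; rewrite normrX lerXn2r ?nnegrE// ?gM//.
  exact: (le_trans _ (gM _ Dx)).
Qed.

Lemma ipC f g : ip f g = ip g f.
Proof. by apply: eq_Rintegral => x _; rewrite mulrC. Qed.

Lemma ipDl f g h : sqint f -> sqint g -> sqint h ->
  ip (fun x => f x + g x) h = ip f h + ip g h.
Proof.
move=> hf hg hh; rewrite /ip -RintegralD//; [|exact: sqint_mul..].
by apply: eq_Rintegral => x _; rewrite mulrDl.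
Qed.

Lemma ipZl a f h : sqint f -> sqint h -> ip (fun x => a * f x) h = a * ip f h.
Proof.
move=> hf hh; rewrite /ip -RintegralZl//; last exact: sqint_mul.
by apply: eq_Rintegral => x _; rewrite mulrA.
Qed.

Lemma ipBl f g h : sqint f -> sqint g -> sqint h ->
  ip (fun x => f x - g x) h = ip f h - ip g h.
Proof.
move=> hf hg hh; have -> : (fun x => f x - g x) = (fun x => f x + -1 * g x).
  by apply/funext => x; rewrite mulN1r.
by rewrite ipDl// ?ipZl// ?mulN1r//; exact: sqintZ.
Qed.

Lemma ip_ge0 f : 0 <= ip f f.
Proof. by apply: Rintegral_ge0 => x _; rewrite -expr2 sqr_ge0. Qed.

Lemma nrm_ge0 f : 0 <= nrm f. Proof. exact: sqrtr_ge0. Qed.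

Lemma nrm_sqr f : nrm f ^+ 2 = ip f f.
Proof. by rewrite /nrm sqr_sqrtr// ip_ge0. Qed.

(** The quadratic form of [a f + b g] is evaluated at [a = (g, g)], [b = - (f, g)]. When
    [(g, g) = 0] this says nothing; if then [(f, g)] were nonzero, the choice
    [b = - ((f, f) + 1) / (f, g)] would make the form negative. *)
Lemma ip_sqr_le f g : sqint f -> sqint g -> ip f g ^+ 2 <= ip f f * ip g g.
Proof.
move=> hf hg.
have key (a b : R) : 0 <= a ^+ 2 * ip f f + 2 * a * b * ip f g + b ^+ 2 * ip g g.
  have hs : sqint (fun x => a * f x + b * g x) by apply: sqintD; exact: sqintZ.
  have := ip_ge0 (fun x => a * f x + b * g x).
  rewrite ipDl//; [|exact: sqintZ..].
  rewrite !ipZl// ![ip _ (fun x => _ + _)]ipC !ipDl//; [|exact: sqintZ..].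
  by rewrite !ipZl// [ip g f]ipC; lra.
have k1 := key (ip g g) (- ip f g); have f0 := ip_ge0 f; have g0 := ip_ge0 g.
have [gp|] := ltP 0 (ip g g).
  by rewrite -subr_ge0 -(pmulr_lge0 _ gp); nra.
move=> gn; have g00 : ip g g = 0 by lra.
have [->|p0] := eqVneq (ip f g) 0; first by rewrite expr0n g00 mulr0.
have := key 1 (- (ip f f + 1) / ip f g); rewrite g00 mulr0 addr0.
by rewrite mulr1 -mulrA divfK//; lra.
Qed.

Lemma ip_le f g : sqint f -> sqint g -> `|ip f g| <= nrm f * nrm g.
Proof.
move=> hf hg; rewrite -(ler_pXn2r (n := 2)) ?nnegrE ?mulr_ge0 ?nrm_ge0//.
by rewrite exprMn !nrm_sqr real_normK ?num_real// ip_sqr_le.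
Qed.

Lemma nrmD f g : sqint f -> sqint g -> nrm (fun x => f x + g x) <= nrm f + nrm g.
Proof.
move=> hf hg; have hfg := sqintD hf hg.
rewrite -(ler_pXn2r (n := 2)) ?nnegrE ?addr_ge0 ?nrm_ge0// nrm_sqr.
rewrite ipDl// ![ip _ (fun x => _ + _)]ipC !ipDl// [ip g f]ipC -!nrm_sqr.
have := ip_le hf hg; have := ler_norm (ip f g); lra.
Qed.

Lemma nrmZ a f : sqint f -> nrm (fun x => a * f x) = `|a| * nrm f.
Proof.
move=> hf; rewrite /nrm ipZl//; last exact: sqintZ.
by rewrite ipC ipZl// mulrA -expr2 sqrtrM ?sqr_ge0// sqrtr_sqr.
Qed.

Lemma nrmB f g : sqint f -> sqint g -> nrm (fun x => f x - g x) <= nrm f + nrm g.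
Proof.
move=> hf hg; have -> : (fun x => f x - g x) = (fun x => f x + -1 * g x).
  by apply/funext => x; rewrite mulN1r.
apply: le_trans (nrmD hf (sqintZ _ hg)) _.
by rewrite nrmZ// normrN normr1 mul1r.
Qed.

Lemma nrm_le (f g : T -> R) : sqint f -> sqint g -> (forall x, D x -> `|f x| <= `|g x|) ->
  nrm f <= nrm g.
Proof.
move=> hf hg fg; rewrite ler_sqrt ?ip_ge0//.
apply: le_Rintegral => //; [exact: sqint_mul..|move=> x Dx].
by rewrite -!expr2 -(real_normK (num_real (f x))) -(real_normK (num_real (g x))) lerXn2r ?nnegrE ?fg.
Qed.

Lemma eq_sqint (f g : T -> R) : (forall x, D x -> f x = g x) -> sqint f -> sqint g.
Proof.
move=> fg [mf If]; split; first by apply: eq_measurable_fun mf => x /set_mem/fg.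
by apply: eq_integrable If => // x /set_mem /fg ->.
Qed.

End Square_integrable.

Lemma sqintS d (T : measurableType d) (R : realType)
    (mu : {measure set T -> \bar R}) (A D : set T) (f : T -> R) :
  measurable A -> measurable D -> A `<=` D -> sqint mu D f -> sqint mu A f.
Proof.
move=> mA mD AD [mf If]; split; first exact: measurable_funS mf.
exact: integrableS If.
Qed.

Lemma nrmS d (T : measurableType d) (R : realType)
    (mu : {measure set T -> \bar R}) (A D : set T) (f : T -> R) :
  measurable A -> measurable D -> A `<=` D -> sqint mu D f ->
  nrm mu A f <= nrm mu D f.
Proof.
move=> mA mD AD hf; rewrite ler_sqrt ?ip_ge0// /ip.
have i1 := sqint_mul mA (sqintS mA mD AD hf) (sqintS mA mD AD hf).
have i2 := sqint_mul mD hf hf.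
rewrite -lee_fin /Rintegral !fineK ?integrable_fin_num//; apply: ge0_subset_integral => //.
- by apply: measurable_int i2.
- by move=> x _ /=; rewrite lee_fin -expr2 sqr_ge0.
Qed.

Section Plane_measure.
Context {R : realType}.
Implicit Types (x y c d : R * R) (e M : R) (A U K : set (R * R)).
Notation mu := (@lebesgue_measure R).

Lemma norm2_le x e : (`|x| <= e) = (`|x.1| <= e) && (`|x.2| <= e).
Proof. by rewrite prod_normE /= ge_max. Qed.

Lemma norm2_lt x e : (`|x| < e) = (`|x.1| < e) && (`|x.2| < e).
Proof. by rewrite prod_normE /= gt_max. Qed.

Lemma norm2_fst x : `|x.1| <= `|x|.
Proof. by rewrite prod_normE /= le_max lexx. Qed.

Lemma norm2_snd x : `|x.2| <= `|x|.
Proof. by rewrite prod_normE /= le_max lexx orbT. Qed.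

Lemma ball2E x e y : ball x e y = (`|x - y| < e).
Proof. by rewrite -ball_normE. Qed.

Lemma open2P A : open A <-> forall x, A x -> exists2 e, 0 < e & forall y, `|x - y| < e -> A y.
Proof.
rewrite openE; split=> oA x Ax.
  have /nbhs_ballP[e/= e0 be] := oA _ Ax; exists e => // y.
  by rewrite -ball2E => /be.
have [e e0 be] := oA _ Ax; apply/nbhs_ballP; exists e => // y.
by rewrite ball2E => /be.
Qed.

(** The measurable sets of the plane are generated by products, so an open set is written as the
    countable union of the boxes with rational corners that it contains. *)
Lemma open2_measurable A : open A -> measurable A.
Proof.
move=> /open2P oA.
pose I := ((rat * rat) * (rat * rat))%type.
pose B (i : I) : set (R * R) :=
  `]ratr i.1.1, ratr i.1.2[ `*` `]ratr i.2.1, ratr i.2.2[.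
pose F (i : I) := if `[< B i `<=` A >] then B i else set0.
have -> : A = \bigcup_i F i.
  apply/seteqP; split=> [x Ax|x [i _]]; last by rewrite /F; case: asboolP => // + ; apply.
  have [e e0 be] := oA _ Ax.
  have r1 (t : R) : exists i : rat * rat, [/\ t - e < ratr i.1, ratr i.1 < t, t < ratr i.2 & ratr i.2 < t + e].
    have lt1 : t - e < t by rewrite gtrBl.
    have lt2 : t < t + e by rewrite ltrDl.
    have [p] := rat_in_itvoo lt1; have [q] := rat_in_itvoo lt2.
    by rewrite !in_itv/= => /andP[? ?] /andP[? ?]; exists (p, q).
  have [i [i1 i2 i3 i4]] := r1 x.1; have [j [j1 j2 j3 j4]] := r1 x.2.
  exists (i, j) => //; rewrite /F; case: asboolP => [hB|nB].
    by split; rewrite /= in_itv/=; apply/andP.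
  exfalso; apply: nB => y [/=]; rewrite !in_itv/= => /andP[? ?] /andP[? ?].
  by apply: be; rewrite norm2_lt/= !ltr_norml; apply/andP; split; apply/andP; split; lra.
apply: countable_union_measurable => i; rewrite /F; case: asboolP => // _.
by apply: measurableX.
Qed.

Lemma closed2_measurable A : closed A -> measurable A.
Proof. by move/closed_openC/open2_measurable/measurableC; rewrite setCK. Qed.

Lemma continuous2_measurable (f : R * R -> R) : continuous f -> measurable_fun setT f.
Proof.
move=> /continuousP cf; apply: (measurability _ (RGenOpens.measurableE R)).
move=> _ [_ [a [b ->] <-]]; rewrite setTI; apply: open2_measurable.
exact/cf/interval_open.
Qed.

Lemma leb2_box_le A c M : 0 <= M -> measurable A -> (forall x, A x -> `|x - c| <= M) ->
  (leb2 A <= ((2 * M) ^+ 2)%:E)%E.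
Proof.
move=> M0 mA AM.
have sA : A `<=` `[c.1 - M, c.1 + M] `*` `[c.2 - M, c.2 + M].
  move=> x /AM; rewrite norm2_le/= !ler_norml => /andP[/andP[? ?] /andP[? ?]].
  by split; rewrite /= in_itv/=; apply/andP; split; lra.
have mB : measurable (`[c.1 - M, c.1 + M] `*` `[c.2 - M, c.2 + M]) by exact: measurableX.
have E : leb2 (`[c.1 - M, c.1 + M] `*` `[c.2 - M, c.2 + M]) =
    (mu `[(c.1 - M)%R, (c.1 + M)%R] * mu `[(c.2 - M)%R, (c.2 + M)%R])%E.
  exact: product_measure1E.
have H : (leb2 A <= leb2 (`[(c.1 - M)%R, (c.1 + M)%R] `*` `[(c.2 - M)%R, (c.2 + M)%R]))%E.
  by apply: (le_measure leb2); rewrite ?inE.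
rewrite E in H; apply: le_trans H _; rewrite !lebesgue_measure_itv/=.
have [M00|Mn] := eqVneq M 0.
  by rewrite M00 !addr0 subr0 ltxx mul0e mulr0 expr0n.
rewrite !lte_fin !ifT; [|by rewrite ltrBlDr; have : 0 < M by [rewrite lt_neqAle eq_sym Mn]; lra..].
by rewrite -!EFinD -EFinM lee_fin; lra.
Qed.

(** In the orthogonal frame of [d] and its normal, every slice along the normal meets the line in
    the single parameter 0. *)
Lemma line_null x d : d != 0 -> leb2 [set y | det2 d (y - x) = 0] = 0%E.
Proof.
move=> d0; set L := [set y | _].
have mL : measurable L.
  have -> : L = (fun y => det2 d (y - x)) @^-1` [set 0] by [].
  rewrite -[X in measurable X]setTI.
  apply: (_ : measurable_fun setT (fun y : R * R => det2 d (y - x))) => //.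
  by rewrite /det2; apply: measurable_funB; apply: measurable_funM => //=;
    apply: measurable_funB.
have dd : det2 d (- d.2, d.1) = d.1 ^+ 2 + d.2 ^+ 2 by rewrite /det2/=; ring.
have dd0 : d.1 ^+ 2 + d.2 ^+ 2 != 0.
  apply: contra_neq d0 => /eqP; rewrite paddr_eq0 ?sqr_ge0// !sqrf_eq0.
  by move=> /andP[/eqP d1 /eqP d2]; rewrite [d]surjective_pairing d1 d2.
have -> : leb2 L = (\int[leb2]_y (\1_L y)%:E)%E by rewrite integral_indic// setIT.
rewrite (ge0_integral_frame x (a := d) (d := (- d.2, d.1)))//; last 2 first.
- exact/measurable_EFinP.
- by rewrite dd.
rewrite -[RHS](mule0 `|det2 d (- d.2, d.1)|%:E); congr (_ * _)%E.
apply: integral0_eq => s _.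
have -> : (\int[mu]_t (\1_L (x + s *: d + t *: (- d.2, d.1))%R)%:E =
           \int[mu]_t (\1_[set 0%R] t)%:E)%E.
  apply: eq_integral => t _; congr (_ %:E); rewrite !indicE; congr ((_ : bool)%:R).
  apply/idP/idP; rewrite !inE /L /=.
    have -> : det2 d (x + s *: d + t *: (- d.2, d.1) - x) = t * (d.1 ^+ 2 + d.2 ^+ 2).
      by rewrite /det2/= /GRing.scale/=; ring.
    by move/eqP; rewrite mulf_eq0 (negbTE dd0) orbF => /eqP.
  by move=> ->; rewrite scale0r addr0 /det2/= /GRing.scale/=; ring.
by rewrite integral_indic// setIT; exact: lebesgue_measure_set1.
Qed.

End Plane_measure.

(** * Smooth functions *)

Section Smooth_line.
Context {R : realType}.
Implicit Types (f g : R -> R) (n : nat).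

Fixpoint Cline (n : nat) (f : R -> R) : Prop :=
  continuous f /\
  if n is n'.+1 then (forall x, derivable f x 1) /\ Cline n' f^`()%classic else True.

Lemma derivable_line_continuous f : (forall x, derivable f x 1) -> continuous f.
Proof. by move=> df x; apply: differentiable_continuous; exact/derivable1_diffP. Qed.

Lemma ClineS n f : (forall x, derivable f x 1) -> Cline n f^`()%classic -> Cline n.+1 f.
Proof. by move=> df cf; split=> //; exact: derivable_line_continuous. Qed.

Lemma Cline_cont n f : Cline n f -> continuous f.
Proof. by case: n => [|n] []. Qed.

Lemma ClineW n f : Cline n.+1 f -> Cline n f.
Proof.
elim: n f => [|n IH] f [cf [df C]]; split=> //.
by split=> //; exact: IH.
Qed.

Lemma derive1_is f f' : (forall x, is_derive x (1 : R) f (f' x)) ->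
  (forall x, derivable f x 1) /\ f^`()%classic = f'.
Proof.
move=> H; split=> [x|]; first by case: (H x).
by apply/funext => x; rewrite derive1E; case: (H x).
Qed.

Lemma Cline_is f f' : (forall x, is_derive x (1 : R) f (f' x)) ->
  forall n, Cline n f' -> Cline n.+1 f.
Proof. by move=> /derive1_is [df <-] n; exact: ClineS. Qed.

Lemma Cline_derive n f : Cline n.+1 f ->
  (forall x, is_derive x (1 : R) f (f^`()%classic x)) /\ Cline n f^`()%classic.
Proof.
case=> _ [df C]; split=> // x; rewrite derive1E; exact: derivableP.
Qed.

Lemma Cline_cst n (a : R) : Cline n (fun=> a).
Proof.
elim: n a => [|n IH] a; first by split=> // x; exact: cst_continuous.
by apply: (@Cline_is _ (fun=> 0)) (IH 0) => x; exact: is_derive_cst.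
Qed.

Lemma ClineD n f g : Cline n f -> Cline n g -> Cline n (fun x => f x + g x).
Proof.
elim: n f g => [|n IH] f g hf hg.
  by split=> // x; apply: continuousD; [exact: Cline_cont hf _|exact: Cline_cont hg _].
have [df Cf] := Cline_derive hf; have [dg Cg] := Cline_derive hg.
apply: (Cline_is _ (IH _ _ Cf Cg)) => x.
Qed.

Lemma ClineM n f g : Cline n f -> Cline n g -> Cline n (fun x => f x * g x).
Proof.
elim: n f g => [|n IH] f g hf hg.
  by split=> // x; apply: continuousM; [exact: Cline_cont hf _|exact: Cline_cont hg _].
have [df Cf] := Cline_derive hf; have [dg Cg] := Cline_derive hg.
apply: (Cline_is _ (ClineD (IH _ _ (ClineW hf) Cg) (IH _ _ (ClineW hg) Cf))) => x.
Qed.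

Lemma ClineV n f : (forall x, f x != 0) -> Cline n f -> Cline n (fun x => (f x)^-1).
Proof.
move=> f0; elim: n => [|n IH] hf.
  by split=> // x; apply: continuousV => //; exact: Cline_cont hf _.
have [df Cf] := Cline_derive hf; have iv := IH (ClineW hf).
apply: (Cline_is _ (ClineM (ClineM (ClineM (Cline_cst n (-1)) iv) iv) Cf)) => x.
apply: (is_derive_eq (is_deriveV (f0 x) (df x))).
by rewrite /GRing.scale /= expr2 invfM; ring.
Qed.

Lemma Cline_affine n f (a b : R) : Cline n f -> Cline n (fun x => f (a * x + b)).
Proof.
elim: n f => [|n IH] f hf.
  split=> // x; apply: (@continuous_comp _ _ _ (fun x => a * x + b)); last exact: Cline_cont hf _.
  by apply: continuousD; [apply: continuousM|]; try exact: cst_continuous.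
have [df Cf] := Cline_derive hf.
apply: (Cline_is _ (ClineM (Cline_cst n a) (IH _ Cf))) => x.
have d1 : is_derive x (1 : R) (fun x => a * x + b) a.
  have := is_derive_poly (a%:P * 'X + b%:P) x.
  rewrite derivD derivM !derivC derivX mul0r add0r mulr1 addr0 hornerC.
  by congr is_derive; apply/funext => y; rewrite !hornerE.
apply: (is_derive_eq (@is_derive1_comp _ f (fun x => a * x + b) x _ _ (df _) d1)).
by rewrite mulrC.
Qed.

Lemma Cline_poly n (p : {poly R}) : Cline n (horner p).
Proof.
elim: n p => [|n IH] p; last by apply: Cline_is (IH p^`()%R) => x; exact: is_derive_poly.
by split=> //; apply: derivable_line_continuous => x; case: (is_derive_poly p x).
Qed.

(** The polynomial parameter makes the family closed under differentiation: the derivative of p(1/x)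
    exp(-1/x) has the same form with X^2 (p - p') in place of p. Smoothness of all members then
    follows by one induction. *)
Definition flat (p : {poly R}) (x : R) : R :=
  if 0 < x then p.[x^-1] * expR (- x^-1) else 0.

(** Coefficient by coefficient, from y^i / i! <= exp(y). *)
Lemma expR_poly_bound (p : {poly R}) : exists C, forall y : R, 0 <= y -> `|p.[y]| * expR (- y) <= C.
Proof.
exists (\sum_(i < size p) `|p`_i| * i`!%:R) => y y0.
rewrite horner_coef.
apply: (@le_trans _ _ ((\sum_(i < size p) `|p`_i * y ^+ i|) * expR (- y))).
  by rewrite ler_wpM2r ?expR_ge0// ler_norm_sum.
rewrite mulr_suml; apply: ler_sum => i _.
rewrite normrM -mulrA ler_wpM2l//.
rewrite expRN ler_pdivrMr ?expR_gt0// ger0_norm ?exprn_ge0//.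
case: (nat_of_ord i) => [|j].
  rewrite expr0 fact0 mul1r; apply: le_trans (expR_ge1Dx y); lra.
have := expR_ge1Dxn j y0; have f0 : (0 : R) < j.+1`!%:R by rewrite ltr0n fact_gt0.
move=> h; rewrite mulrC -ler_pdivrMr//; lra.
Qed.

(** The exponential bound is applied to p X^2: the two spare powers of 1/x become the factor x^2. *)
Lemma flat_bound (p : {poly R}) : exists C, forall x, `|flat p x| <= C * x ^+ 2.
Proof.
have [C HC] := expR_poly_bound (p * 'X^2).
have C0 : 0 <= C by apply: le_trans (HC 0 _) => //; rewrite mulr_ge0 ?expR_ge0.
exists C => x; rewrite /flat; case: ifPn => x0; last by rewrite normr0 mulr_ge0 ?sqr_ge0.
have := HC x^-1; rewrite invr_ge0 ltW// => /(_ isT).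
rewrite hornerM hornerXn normrM [`|_ ^+ 2|]ger0_norm ?sqr_ge0// => h.
rewrite normrM [`|expR _|]ger0_norm ?expR_ge0// -ler_pdivrMr ?exprn_gt0//.
by move: h; rewrite exprVn mulrAC.
Qed.

Lemma is_derive_flat (p : {poly R}) (x : R) :
  is_derive x (1 : R) (flat p) (flat ('X^2 * (p - p^`()%R)) x).
Proof.
have [x0|x0|<-] := ltgtP 0 x.
- have D : is_derive x (1 : R) (fun x => p.[x^-1] * expR (- x^-1))
      (flat ('X^2 * (p - p^`()%R)) x).
    have dV : is_derive x (1 : R) (fun y : R => y^-1) (- x ^- 2).
      have := @is_deriveV R id x 1 1 (lt0r_neq0 x0) _.
      by rewrite /GRing.scale/= mulr1; apply; exact: is_derive_id.
    have dN : is_derive x (1 : R) (fun y : R => - y^-1) (x ^- 2).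
      by have := is_deriveN dV; rewrite opprK.
    have d1 := is_derive1_comp (is_derive_poly p x^-1) dV.
    have d2 := @is_derive1_comp R expR (fun y => - y^-1) x _ _ (is_derive_expR (- x^-1)) dN.
    apply: (is_derive_eq (is_deriveM d1 d2)).
    change (p.[x^-1] * (expR (- x^-1) / x ^+ 2) +
      expR (- x^-1) * (p^`().[x^-1] * - x ^- 2) = flat ('X^2 * (p - p^`())) x).
    by rewrite /flat x0 hornerM hornerXn hornerD hornerN exprVn; ring.
  have E : \forall y \near x, (fun x => p.[x^-1] * expR (- x^-1)) y = flat p y.
    near=> y; rewrite /flat ifT//; near: y; exact: lt_nbhsr.
  exact: near_eq_is_derive D.
- have D : is_derive x (1 : R) (fun=> 0 : R) (flat ('X^2 * (p - p^`()%R)) x).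
    by rewrite /flat ltNge ltW//=; exact: is_derive_cst.
  have E : \forall y \near x, (fun=> 0 : R) y = flat p y.
    near=> y; rewrite /flat ifF//; apply/negbTE; rewrite -leNgt ltW//.
    by near: y; exact: lt_nbhsl.
  exact: near_eq_is_derive D.
- have F0 q : flat q 0 = 0 by rewrite /flat ltxx.
  rewrite F0; have [C HC] := flat_bound p.
  (* At the origin the quadratic bound makes the difference quotient at most [C * |h|]. *)
  have cv : (h^-1 *: ((flat p \o shift 0) (h *: (1 : R)) - flat p 0)) @[h --> 0^'] --> (0 : R).
    apply/cvgrPdist_le => e e0; have C1 : 0 < `|C| + 1 by rewrite ltr_wpDl.
    exists (e / (`|C| + 1)); first by rewrite /= divr_gt0.
    move=> h /=; rewrite !sub0r normrN F0 subr0 addr0 => he h0.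
    rewrite /GRing.scale/= mulr1 normrN normrM normfV ler_pdivrMl ?normr_gt0//.
    apply: (le_trans (HC h)); rewrite -(real_normK (num_real h)).
    move: he; rewrite ltr_pdivlMr// => he.
    have := normr_ge0 h; have := ler_norm C; nra.
  split; first by apply/cvg_ex; exists 0.
  by apply: cvg_lim => //.
Unshelve. all: by end_near. Qed.

Lemma Cline_flat n (p : {poly R}) : Cline n (flat p).
Proof.
elim: n p => [|n IH] p; last by apply: (Cline_is (is_derive_flat p)); exact: IH.
by split=> //; apply: derivable_line_continuous => x; case: (is_derive_flat p x).
Qed.

Definition step (x : R) : R := flat 1 x / (flat 1 x + flat 1 (1 - x)).

Lemma flat1_ge0 x : 0 <= flat 1 x.
Proof. by rewrite /flat; case: ifP => // _; rewrite hornerE mul1r expR_ge0. Qed.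

Lemma flat1_gt0 x : 0 < x -> 0 < flat 1 x.
Proof. by rewrite /flat => ->; rewrite hornerE mul1r expR_gt0. Qed.

Lemma flat1_eq0 x : x <= 0 -> flat 1 x = 0.
Proof. by rewrite /flat leNgt => /negbTE ->. Qed.

Lemma step_den x : 0 < flat 1 x + flat 1 (1 - x).
Proof.
have := flat1_ge0 x; have := flat1_ge0 (1 - x).
have [x0|x0] := ltP 0 x; first by have := flat1_gt0 x0; lra.
have : 0 < 1 - x by lra.
by move/flat1_gt0; lra.
Qed.

Lemma Cline_step n : Cline n step.
Proof.
apply: ClineM; first exact: Cline_flat.
apply: ClineV => [x|]; first by rewrite gt_eqF ?step_den.
apply: ClineD; first exact: Cline_flat.
have := @Cline_affine n (flat 1) (-1) 1 (Cline_flat n 1).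
by congr Cline; apply/funext => x; congr flat; ring.
Qed.

Lemma step_eq0 x : x <= 0 -> step x = 0.
Proof. by move=> x0; rewrite /step flat1_eq0// mul0r. Qed.

Lemma step_eq1 x : 1 <= x -> step x = 1.
Proof.
move=> x1; have := step_den x; rewrite /step (flat1_eq0 (x := 1 - x)); last by lra.
by rewrite addr0 => /lt0r_neq0/divff.
Qed.

Lemma step_ge0 x : 0 <= step x.
Proof. by rewrite divr_ge0 ?flat1_ge0 ?ltW ?step_den. Qed.

Lemma step_le1 x : step x <= 1.
Proof. by rewrite ler_pdivrMr ?step_den// mul1r lerDl flat1_ge0. Qed.

Lemma step_gt0 x : 0 < x -> 0 < step x.
Proof. by move=> x0; rewrite divr_gt0 ?flat1_gt0 ?step_den. Qed.

(** A bump on [-1, 1] written as a difference of two translates of [step], so that the sum of its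
    integer translates telescopes to a partition of unity. *)
Definition hat (x : R) : R := step (x + 1) - step x.

Lemma Cline_hat n : Cline n hat.
Proof.
have := ClineD (@Cline_affine n _ 1 1 (Cline_step n)) (ClineM (Cline_cst n (-1)) (Cline_step n)).
by congr Cline; apply/funext => x; rewrite /hat mul1r mulN1r.
Qed.

Lemma hat_eq0 x : 1 <= `|x| -> hat x = 0.
Proof.
rewrite ler_normr /hat => /orP[x1|x1].
  by rewrite !step_eq1 ?subrr//; lra.
by rewrite !step_eq0 ?subrr//; lra.
Qed.

Lemma hat_ge0 x : 0 <= hat x.
Proof.
rewrite /hat subr_ge0; have [x0|x0] := leP x 0; first by rewrite (step_eq0 x0) step_ge0.
by rewrite (@step_eq1 (x + 1)) ?step_le1//; lra.
Qed.

End Smooth_line.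

Section Smooth_plane.
Context {R : realType}.
Implicit Types (f g : R * R -> R) (n : nat).
Notation e1 := ((1, 0) : R * R).
Notation e2 := ((0, 1) : R * R).

Lemma CnW n f : Cn n.+1 f -> Cn n f.
Proof.
elim: n f => [|n IH] f; first by case.
case=> cf [a1 a2 b1 b2]; split; first exact: cf.
by split; [exact: a1|exact: a2|exact: IH b1|exact: IH b2].
Qed.

Lemma Cn_cont n f : Cn n f -> continuous f.
Proof. by case: n => [|n] []. Qed.

Lemma Cn_is n f (f1 f2 : R * R -> R) : continuous f ->
  (forall x, is_derive x e1 f (f1 x)) -> (forall x, is_derive x e2 f (f2 x)) ->
  Cn n f1 -> Cn n f2 -> Cn n.+1 f.
Proof.
move=> cf h1 h2 C1 C2; split=> //.
have -> : d1 f = f1 by apply/funext => x; rewrite /d1; case: (h1 x).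
have -> : d2 f = f2 by apply/funext => x; rewrite /d2; case: (h2 x).
split; [|  |exact: C1|exact: C2].
  by move=> x; case: (h1 x).
by move=> x; case: (h2 x).
Qed.

Lemma Cn_derive n f : Cn n.+1 f ->
  [/\ forall x, is_derive x e1 f (d1 f x), forall x, is_derive x e2 f (d2 f x),
      Cn n (d1 f) & Cn n (d2 f)].
Proof. by case=> _ [a1 a2 b1 b2]; split=> // x; exact: derivableP. Qed.

Lemma Cn_cst n (a : R) : Cn n (fun=> a).
Proof.
elim: n a => [|n IH] a; first by split=> // x; exact: cst_continuous.
by apply: (@Cn_is _ _ (fun=> 0) (fun=> 0)) => // x; exact: cst_continuous.
Qed.

Lemma CnD n f g : Cn n f -> Cn n g -> Cn n (fun x => f x + g x).
Proof.
elim: n f g => [|n IH] f g hf hg.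
  by split=> // x; apply: continuousD; [exact: Cn_cont hf _|exact: Cn_cont hg _].
have [df1 df2 C1 C2] := Cn_derive hf; have [dg1 dg2 C3 C4] := Cn_derive hg.
apply: (@Cn_is _ _ (fun x => d1 f x + d1 g x) (fun x => d2 f x + d2 g x)).
- by move=> x; apply: continuousD; [exact: Cn_cont hf _|exact: Cn_cont hg _].
- exact: IH.
- exact: IH.
Qed.

Lemma is_derive_mul2 f g (x v : R * R) (a b : R) : is_derive x v f a ->
  is_derive x v g b -> is_derive x v (fun x => f x * g x) (f x * b + g x * a).
Proof. by move=> hf hg; exact: is_deriveM. Qed.

Lemma CnM n f g : Cn n f -> Cn n g -> Cn n (fun x => f x * g x).
Proof.
elim: n f g => [|n IH] f g hf hg.
  by split=> // x; apply: continuousM; [exact: Cn_cont hf _|exact: Cn_cont hg _].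
have [df1 df2 C1 C2] := Cn_derive hf; have [dg1 dg2 C3 C4] := Cn_derive hg.
apply: (@Cn_is _ _ (fun x => f x * d1 g x + g x * d1 f x)
                   (fun x => f x * d2 g x + g x * d2 f x)).
- by move=> x; apply: continuousM; [exact: Cn_cont hf _|exact: Cn_cont hg _].
- by apply: CnD; apply: IH => //; exact: CnW.
- by apply: CnD; apply: IH => //; exact: CnW.
Qed.

Lemma is_derive_fst1 (u : R -> R) (x : R * R) (a : R) :
  is_derive x.1 (1 : R) u a -> is_derive x e1 (fun y => u y.1) a.
Proof.
by case=> du <-; split; move: du; rewrite /derivable /derive /comp/=.
Qed.

Lemma is_derive_snd2 (u : R -> R) (x : R * R) (a : R) :
  is_derive x.2 (1 : R) u a -> is_derive x e2 (fun y => u y.2) a.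
Proof.
by case=> du <-; split; move: du; rewrite /derivable /derive /comp/=.
Qed.

Lemma is_derive_const_line f (x v : R * R) :
  (forall h : R, f (h *: v + x) = f x) -> is_derive x v f 0.
Proof.
move=> fE; have cv : (h^-1 *: ((f \o shift x) (h *: v) - f x) @[h --> 0^']) --> (0 : R).
  apply: cvg_near_cst; near=> h; rewrite /= fE subrr scaler0//.
split; first by apply/cvg_ex; exists 0.
exact: cvg_lim cv.
Unshelve. all: by end_near. Qed.

Lemma is_derive_fst2 (u : R -> R) (x : R * R) : is_derive x e2 (fun y => u y.1) 0.
Proof. by apply: is_derive_const_line => h; rewrite /= scaler0 add0r. Qed.

Lemma is_derive_snd1 (u : R -> R) (x : R * R) : is_derive x e1 (fun y => u y.2) 0.
Proof. by apply: is_derive_const_line => h; rewrite /= scaler0 add0r. Qed.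

Lemma continuous_fst2 (u : R -> R) : continuous u -> continuous (fun x : R * R => u x.1).
Proof. by move=> cu x; apply: continuous_comp; [exact: cvg_fst|exact: cu]. Qed.

Lemma continuous_snd2 (u : R -> R) : continuous u -> continuous (fun x : R * R => u x.2).
Proof. by move=> cu x; apply: continuous_comp; [exact: cvg_snd|exact: cu]. Qed.

Lemma Cn_fst n (u : R -> R) : Cline n u -> Cn n (fun x => u x.1).
Proof.
elim: n u => [|n IH] u hu; first by split=> //; apply: continuous_fst2; exact: Cline_cont hu.
have [du Cu] := Cline_derive hu.
apply: (@Cn_is _ _ (fun x => u^`()%classic x.1) (fun=> 0)).
- by apply: continuous_fst2; exact: Cline_cont hu.
- by move=> x; exact: is_derive_fst1.
- by move=> x; exact: is_derive_fst2.
- exact: IH.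
- exact: Cn_cst.
Qed.

Lemma Cn_snd n (u : R -> R) : Cline n u -> Cn n (fun x => u x.2).
Proof.
elim: n u => [|n IH] u hu; first by split=> //; apply: continuous_snd2; exact: Cline_cont hu.
have [du Cu] := Cline_derive hu.
apply: (@Cn_is _ _ (fun=> 0) (fun x => u^`()%classic x.2)).
- by apply: continuous_snd2; exact: Cline_cont hu.
- by move=> x; exact: is_derive_snd1.
- by move=> x; exact: is_derive_snd2.
- exact: Cn_cst.
- exact: IH.
Qed.

Lemma smooth_cont f : smooth f -> continuous f.
Proof. by move=> /(_ 0%N) []. Qed.

Lemma smooth_cst (a : R) : smooth (fun=> a).
Proof. by move=> n; exact: Cn_cst. Qed.

Lemma smoothD f g : smooth f -> smooth g -> smooth (fun x => f x + g x).
Proof. by move=> hf hg n; exact: CnD. Qed.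

Lemma smoothM f g : smooth f -> smooth g -> smooth (fun x => f x * g x).
Proof. by move=> hf hg n; exact: CnM. Qed.

Lemma smoothZ (a : R) f : smooth f -> smooth (fun x => a * f x).
Proof. by move=> hf; apply: smoothM => //; exact: smooth_cst. Qed.

Lemma smoothB f g : smooth f -> smooth g -> smooth (fun x => f x - g x).
Proof.
move=> hf hg; have := smoothD hf (smoothZ (-1) hg).
by congr smooth; apply/funext => x; rewrite mulN1r.
Qed.

Lemma smooth_d1 f : smooth f -> smooth (d1 f).
Proof. by move=> hf n; have [] := Cn_derive (hf n.+1). Qed.

Lemma smooth_d2 f : smooth f -> smooth (d2 f).
Proof. by move=> hf n; have [] := Cn_derive (hf n.+1). Qed.

Lemma smooth_is1 f : smooth f -> forall x, is_derive x e1 f (d1 f x).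
Proof. by move=> hf; have [] := Cn_derive (hf 1%N). Qed.

Lemma smooth_is2 f : smooth f -> forall x, is_derive x e2 f (d2 f x).
Proof. by move=> hf; have [] := Cn_derive (hf 1%N). Qed.

Lemma smooth_tensor (u v : R -> R) : (forall n, Cline n u) -> (forall n, Cline n v) ->
  smooth (fun x => u x.1 * v x.2).
Proof. by move=> hu hv; apply: smoothM => n; [exact: Cn_fst|exact: Cn_snd]. Qed.

Lemma smooth_sum (I : Type) (r : seq I) (P : pred I) (F : I -> R * R -> R) :
  (forall i, smooth (F i)) -> smooth (fun x => \sum_(i <- r | P i) F i x).
Proof.
move=> sF; elim: r => [|i r IH].
  have -> : (fun x => \sum_(i <- [::] | P i) F i x) = (fun=> 0).
    by apply/funext => x; rewrite big_nil.
  exact: smooth_cst.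
have -> : (fun x => \sum_(i <- i :: r | P i) F i x) =
    (fun x => (if P i then F i x else 0) + \sum_(i <- r | P i) F i x).
  by apply/funext => x; rewrite big_cons; case: ifP => // _; rewrite add0r.
by apply: smoothD => //; case: (P i) => //; exact: smooth_cst.
Qed.

Lemma d1D f g : smooth f -> smooth g -> d1 (fun x => f x + g x) = (fun x => d1 f x + d1 g x).
Proof.
move=> hf hg; apply/funext => x.
by have [_ <-] := is_deriveD (smooth_is1 hf x) (smooth_is1 hg x).
Qed.

Lemma d2D f g : smooth f -> smooth g -> d2 (fun x => f x + g x) = (fun x => d2 f x + d2 g x).
Proof.
move=> hf hg; apply/funext => x.
by have [_ <-] := is_deriveD (smooth_is2 hf x) (smooth_is2 hg x).
Qed.

Lemma d1M f g : smooth f -> smooth g ->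
  d1 (fun x => f x * g x) = (fun x => f x * d1 g x + g x * d1 f x).
Proof.
move=> hf hg; apply/funext => x.
by have [_ <-] := is_derive_mul2 (smooth_is1 hf x) (smooth_is1 hg x).
Qed.

Lemma d2M f g : smooth f -> smooth g ->
  d2 (fun x => f x * g x) = (fun x => f x * d2 g x + g x * d2 f x).
Proof.
move=> hf hg; apply/funext => x.
by have [_ <-] := is_derive_mul2 (smooth_is2 hf x) (smooth_is2 hg x).
Qed.

Lemma d1_cst (a : R) : d1 (fun=> a) = (fun=> 0).
Proof. by apply/funext => x; rewrite /d1 derive_cst. Qed.

Lemma d2_cst (a : R) : d2 (fun=> a) = (fun=> 0).
Proof. by apply/funext => x; rewrite /d2 derive_cst. Qed.

Lemma d1Z (a : R) f : smooth f -> d1 (fun x => a * f x) = (fun x => a * d1 f x).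
Proof.
move=> hf; rewrite (d1M (smooth_cst a) hf) d1_cst.
by apply/funext => x; rewrite mulr0 addr0.
Qed.

Lemma d2Z (a : R) f : smooth f -> d2 (fun x => a * f x) = (fun x => a * d2 f x).
Proof.
move=> hf; rewrite (d2M (smooth_cst a) hf) d2_cst.
by apply/funext => x; rewrite mulr0 addr0.
Qed.

Lemma d1B f g : smooth f -> smooth g -> d1 (fun x => f x - g x) = (fun x => d1 f x - d1 g x).
Proof.
move=> hf hg; have -> : (fun x => f x - g x) = (fun x => f x + -1 * g x).
  by apply/funext => x; rewrite mulN1r.
by rewrite (d1D hf (smoothZ _ hg)) d1Z//; apply/funext => x; rewrite mulN1r.
Qed.

Lemma d2B f g : smooth f -> smooth g -> d2 (fun x => f x - g x) = (fun x => d2 f x - d2 g x).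
Proof.
move=> hf hg; have -> : (fun x => f x - g x) = (fun x => f x + -1 * g x).
  by apply/funext => x; rewrite mulN1r.
by rewrite (d2D hf (smoothZ _ hg)) d2Z//; apply/funext => x; rewrite mulN1r.
Qed.

Lemma d1_sum (I : Type) (r : seq I) (F : I -> R * R -> R) : (forall i, smooth (F i)) ->
  d1 (fun x => \sum_(i <- r) F i x) = (fun x => \sum_(i <- r) d1 (F i) x).
Proof.
move=> sF; elim: r => [|i r IH].
  by under eq_fun do rewrite big_nil; rewrite d1_cst; apply/funext => x; rewrite big_nil.
under eq_fun do rewrite big_cons.
by rewrite d1D ?IH//; [apply/funext => x; rewrite big_cons|exact: smooth_sum].
Qed.

Lemma d2_sum (I : Type) (r : seq I) (F : I -> R * R -> R) : (forall i, smooth (F i)) ->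
  d2 (fun x => \sum_(i <- r) F i x) = (fun x => \sum_(i <- r) d2 (F i) x).
Proof.
move=> sF; elim: r => [|i r IH].
  by under eq_fun do rewrite big_nil; rewrite d2_cst; apply/funext => x; rewrite big_nil.
under eq_fun do rewrite big_cons.
by rewrite d2D ?IH//; [apply/funext => x; rewrite big_cons|exact: smooth_sum].
Qed.

Lemma d1_tensor (u v : R -> R) (x : R * R) (a : R) : is_derive x.1 (1 : R) u a ->
  d1 (fun x => u x.1 * v x.2) x = a * v x.2.
Proof.
move=> du; have [_ H] := is_derive_mul2 (is_derive_fst1 du) (is_derive_snd1 v x).
by rewrite /d1 H mulr0 add0r mulrC.
Qed.

Lemma d2_tensor (u v : R -> R) (x : R * R) (a : R) : is_derive x.2 (1 : R) v a ->
  d2 (fun x => u x.1 * v x.2) x = u x.1 * a.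
Proof.
move=> du; have [_ H] := is_derive_mul2 (is_derive_fst2 u x) (is_derive_snd2 du).
by rewrite /d2 H mulr0 addr0.
Qed.

Lemma mean_value_bound (g dg : R -> R) (a b D e : R) :
  (forall s, is_derive s (1 : R) g (dg s)) ->
  (forall s, `|s - a| <= `|b - a| -> `|dg s - D| <= e) ->
  `|g b - g a - D * (b - a)| <= e * `|b - a|.
Proof.
move=> hg hD; have cg : continuous g.
  by apply: derivable_line_continuous => s; case: (hg s).
have [ab|ba|<-] := ltgtP a b; last by rewrite !subrr mulr0 subrr normr0 mulr0.
- have [s] := MVT ab (fun s _ => hg s) (continuous_subspaceT cg).
  rewrite in_itv/= => /andP[s1 s2] ->; rewrite -mulrBl normrM ler_wpM2r// hD//.
  by rewrite !ger0_norm ?subr_ge0 ?ltW//; lra.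
- have [s] := MVT ba (fun s _ => hg s) (continuous_subspaceT cg).
  rewrite in_itv/= => /andP[s1 s2] E.
  have -> : g b - g a = dg s * (b - a) by rewrite -opprB E -mulrN opprB.
  rewrite -mulrBl normrM ler_wpM2r// hD//.
  by rewrite !ler0_norm ?subr_le0 ?ltW//; lra.
Qed.

Lemma smooth_row f (s q : R) : smooth f ->
  is_derive s (1 : R) (fun s => f (s, q)) (d1 f (s, q)).
Proof.
move=> sf; case: (smooth_is1 sf (s, q)) => dv <-.
have E : (fun h : R => h^-1 *: ((f \o shift (s, q)) (h *: e1) - f (s, q))) =
         (fun h : R => h^-1 *: (((fun s => f (s, q)) \o shift s) (h *: (1 : R)) - f (s, q))).
  apply/funext => h /=; congr (_ *: (f _ - _)).
  by rewrite [LHS]surjective_pairing /= scaler0 add0r.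
by move: dv; rewrite /derivable /derive E.
Qed.

Lemma smooth_col f (p s : R) : smooth f ->
  is_derive s (1 : R) (fun s => f (p, s)) (d2 f (p, s)).
Proof.
move=> sf; case: (smooth_is2 sf (p, s)) => dv <-.
have E : (fun h : R => h^-1 *: ((f \o shift (p, s)) (h *: e2) - f (p, s))) =
         (fun h : R => h^-1 *: (((fun s => f (p, s)) \o shift s) (h *: (1 : R)) - f (p, s))).
  apply/funext => h /=; congr (_ *: (f _ - _)).
  by rewrite [LHS]surjective_pairing /= scaler0 add0r.
by move: dv; rewrite /derivable /derive E.
Qed.

(** The increment passes through the corner [(y.1, z.2)]. In the sup norm both legs stay within
    distance [|z - y|] of [y], where the partial derivatives are controlled. *)
Lemma smooth_increment f (y z : R * R) (e : R) : smooth f ->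
  (forall u, `|u - y| <= `|z - y| -> `|d1 f u - d1 f y| <= e) ->
  (forall u, `|u - y| <= `|z - y| -> `|d2 f u - d2 f y| <= e) ->
  `|f z - f y - (d1 f y * (z.1 - y.1) + d2 f y * (z.2 - y.2))| <= e * (2 * `|z - y|).
Proof.
move=> sf h1 h2.
have z1 := norm2_fst (z - y); have z2 := norm2_snd (z - y).
have e0 : 0 <= e by apply: le_trans (h1 z _).
have i1 : `|f (z.1, z.2) - f (y.1, z.2) - d1 f y * (z.1 - y.1)| <= e * `|z.1 - y.1|.
  apply: (@mean_value_bound (fun s => f (s, z.2)) (fun s => d1 f (s, z.2))) => [s|s hs].
    exact: smooth_row.
  by apply: h1; rewrite norm2_le/= z2 (le_trans hs).
have i2 : `|f (y.1, z.2) - f (y.1, y.2) - d2 f y * (z.2 - y.2)| <= e * `|z.2 - y.2|.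
  apply: (@mean_value_bound (fun s => f (y.1, s)) (fun s => d2 f (y.1, s))) => [s|s hs].
    exact: smooth_col.
  by apply: h2; rewrite norm2_le/= subrr normr0 normr_ge0 (le_trans hs).
rewrite -!surjective_pairing in i1 i2.
have -> : f z - f y - (d1 f y * (z.1 - y.1) + d2 f y * (z.2 - y.2)) =
  (f z - f (y.1, z.2) - d1 f y * (z.1 - y.1)) +
  (f (y.1, z.2) - f y - d2 f y * (z.2 - y.2)) by ring.
apply: le_trans (ler_normD _ _) _; apply: le_trans (lerD i1 i2) _.
by rewrite -mulrDr ler_wpM2l//; move: z1 z2 => /=; lra.
Qed.

Lemma continuous2P f : continuous f <-> forall (y : R * R) (e : R), 0 < e ->
  exists2 d : R, 0 < d & forall u : R * R, `|u - y| < d -> `|f u - f y| <= e.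
Proof.
split=> [cf y e e0|H y].
  have /cvgrPdist_le /(_ _ e0) /nbhs_ballP[d /= d0 hd] := cf y; exists d => // u uy.
  by rewrite distrC; apply: hd; rewrite ball2E distrC.
apply/cvgrPdist_le => e e0; have [d d0 hd] := H y e e0.
have nb : nbhs y (ball y d) by exact: nbhsx_ballx.
by apply: filterS nb => u; rewrite ball2E distrC => /hd; rewrite distrC.
Qed.

Lemma smooth_line_cvg f (x v : R * R) (t : R) : smooth f ->
  (h^-1 *: (((fun s => f (x + s *: v)) \o shift t) (h *: (1 : R)) - f (x + t *: v)))
    @[h --> 0^'] --> (d1 f (x + t *: v) * v.1 + d2 f (x + t *: v) * v.2 : R).
Proof.
move=> sf; set y := x + t *: v; apply/cvgrPdist_le => e e0.
have v0 := normr_ge0 v.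
have et0 : 0 < e / (2 * `|v| + 1) by rewrite divr_gt0//; lra.
have [a a0 ha] := (continuous2P _).1 (smooth_cont (smooth_d1 sf)) y _ et0.
have [b b0 hb] := (continuous2P _).1 (smooth_cont (smooth_d2 sf)) y _ et0.
have m0 : 0 < Num.min a b / (`|v| + 1) by rewrite divr_gt0// ?lt_min ?a0//; lra.
exists (Num.min a b / (`|v| + 1)) => // h /=; rewrite sub0r normrN => hm h0.
have -> : x + (h%:A + t) *: v = y + h *: v.
  have hA : h%:A = h :> R by exact: mulr1.
  by rewrite hA scalerDl [h *: v + _]addrC addrA.
have hv : `|y + h *: v - y| = `|h| * `|v| by rewrite addrAC subrr add0r normrZ.
have hm' : `|h| * `|v| < Num.min a b.
  by move: hm; rewrite ltr_pdivlMr; last lra; have := normr_ge0 h; nra.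
have := @smooth_increment f y (y + h *: v) _ sf
  (fun u hu => ha u (le_lt_trans hu (lt_le_trans (eq_ind _ (fun z => z < _) hm' _ (esym hv)) _)))
  (fun u hu => hb u (le_lt_trans hu (lt_le_trans (eq_ind _ (fun z => z < _) hm' _ (esym hv)) _))).
rewrite !ge_min !lexx orbT => /(_ isT isT); rewrite hv.
have -> : (y + h *: v).1 - y.1 = h * v.1 by rewrite /= addrAC subrr add0r.
have -> : (y + h *: v).2 - y.2 = h * v.2 by rewrite /= addrAC subrr add0r.
set X := f _ - f y => H.
rewrite [_ *: _]/(h^-1 * X); have h00 : 0 < `|h| by rewrite normr_gt0.
rewrite -(ler_pM2l h00) -normrM mulrBr mulVKf// distrC.
have -> : h * (d1 f y * v.1 + d2 f y * v.2) = d1 f y * (h * v.1) + d2 f y * (h * v.2) by ring.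
apply: (le_trans H).
have -> : e / (2 * `|v| + 1) * (2 * (`|h| * `|v|)) =
    `|h| * e * (2 * `|v| / (2 * `|v| + 1)) by ring.
rewrite ger_pMr ?mulr_gt0// ler_pdivrMr; lra.
Qed.

(* [C^1] in the sense of partial derivatives gives the chain rule along lines:
   the increment is split into a horizontal and a vertical mean value. *)
Lemma smooth_line f (x v : R * R) (t : R) : smooth f ->
  is_derive t (1 : R) (fun s => f (x + s *: v))
    (d1 f (x + t *: v) * v.1 + d2 f (x + t *: v) * v.2).
Proof.
move=> sf; set y := x + t *: v; split.
  by apply/cvg_ex; eexists; exact: smooth_line_cvg.
apply: cvg_lim => //; exact: smooth_line_cvg.
Qed.

End Smooth_plane.

(** * Test functions and their integrals *)

Section Compact_support.
Context {R : realType}.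
Notation mu := (@lebesgue_measure R).
Implicit Types (f g psi : R * R -> R) (K A : set (R * R)).

Lemma bounded_on_box f (M : R) : continuous f ->
  exists2 B, 0 <= B & forall x, `|x| <= M -> `|f x| <= B.
Proof.
move=> cf; pose Q : set (R * R) := `[- M, M]%classic `*` `[- M, M]%classic.
have cQ : compact Q by apply: compact_setX; exact: segment_compact.
have /compact_bounded[B [_ HB]] : compact (f @` Q).
  by apply: continuous_compact => //; exact: continuous_subspaceT.
exists (`|B| + 1) => [|x xM]; first by rewrite addr_ge0.
apply: HB; first by have := ler_norm B; lra.
exists x => //; move: xM; rewrite norm2_le !ler_norml => /andP[? ?].
by split; rewrite /= in_itv.
Qed.

Lemma sqint_continuous K f (M : R) : measurable K -> (forall x, K x -> `|x| <= M) ->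
  continuous f -> sqint leb2 K f.
Proof.
move=> mK KM cf; have [B B0 HB] := bounded_on_box M cf.
apply: (@sqint_bounded _ _ _ leb2 _ mK f B).
- apply: le_lt_trans (leb2_box_le (c := 0) (normr_ge0 M) mK _) (ltry _).
  by move=> x /KM xM; rewrite subr0 (le_trans xM)// ler_norm.
- exact: measurable_funTS (continuous2_measurable cf).
- by move=> x /KM; exact: HB.
Qed.

Lemma test_bounded K psi : test_fun K psi ->
  exists2 M : R, 0 < M & forall x, M <= `|x| -> psi x = 0.
Proof.
move=> [_ [A [cA AK A0]]]; have [B [_ HB]] := compact_bounded cA.
exists (`|B| + 2) => [|x xM]; first by rewrite ltr_wpDl.
apply: A0 => /(HB (`|B| + 1)); have := ler_norm B.
move=> h H; have : `|x| <= `|B| + 1 by apply: H; lra.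
by lra.
Qed.

Lemma test_off K psi : test_fun K psi -> forall x, ~ K x -> psi x = 0.
Proof. by move=> [_ [A [_ AK A0]]] x nK; apply: A0 => /AK. Qed.

Lemma testM K f psi : smooth f -> test_fun K psi -> test_fun K (fun x => f x * psi x).
Proof.
move=> sf [sp [A [cA AK A0]]]; split; first exact: smoothM.
by exists A; split=> // x nA; rewrite A0// mulr0.
Qed.

Lemma near_zero_derive f (x v : R * R) : (\forall y \near x, f y = 0) -> 'D_v f x = 0.
Proof.
move=> fx; rewrite -[RHS](@derive_cst R (R * R)%type R 0 v x).
apply: near_eq_derive; exact: fx.
Qed.

(** The complement of the compact support is open, so a test function vanishes near each of its
    points and its derivatives vanish there too: derivatives of test functions are test
    functions. *)
Lemma test_compl_near K psi : test_fun K psi -> exists A, [/\ compact A, A `<=` K,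
  (forall x, ~ A x -> psi x = 0) & forall x, ~ A x -> \forall y \near x, psi y = 0].
Proof.
move=> [sp [A [cA AK A0]]]; exists A; split=> // x nA.
have oA : open (~` A) by apply: closed_openC; apply: compact_closed => //; exact: norm_hausdorff.
by have : nbhs x (~` A) by [exact: open_nbhs_nbhs]; apply: filterS => y /A0.
Qed.

Lemma test_d1 K psi : test_fun K psi -> test_fun K (d1 psi).
Proof.
move=> tp; have [A [cA AK _ nA]] := test_compl_near tp; case: tp => sp _.
split; first exact: smooth_d1.
by exists A; split=> // x /nA; exact: near_zero_derive.
Qed.

Lemma test_d2 K psi : test_fun K psi -> test_fun K (d2 psi).
Proof.
move=> tp; have [A [cA AK _ nA]] := test_compl_near tp; case: tp => sp _.
split; first exact: smooth_d2.
by exists A; split=> // x /nA; exact: near_zero_derive.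
Qed.

Lemma inner_plane K f : measurable K -> (forall x, ~ K x -> f x = 0) ->
  \int[leb2]_(x in K) f x = \int[leb2]_x f x.
Proof.
move=> mK f0; rewrite Rintegral_mkcond; apply: eq_Rintegral => x _.
by rewrite patchE; case: ifPn => // /negP; rewrite inE => /f0 ->.
Qed.

Lemma integrable_plane f (M : R) : continuous f -> (forall x, M <= `|x| -> f x = 0) ->
  leb2.-integrable setT (EFin \o f).
Proof.
move=> cf f0; pose Q : set (R * R) := [set x | `|x| <= M].
have mQ : measurable Q.
  apply: closed2_measurable.
  have -> : Q = (fun x : R * R => `|x|) @^-1` [set t | t <= M] by [].
  apply: preimage_closed; last exact: closed_le.
  by move=> x _; exact: norm_continuous.
have fE : EFin \o f = (EFin \o f) \_ Q.
  apply/funext => x; rewrite patchE; case: ifPn => // /negP; rewrite inE /Q/= => xM.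
  by rewrite f0//= ltW// ltNge; apply/negP.
have [B B0 HB] := bounded_on_box M cf.
rewrite fE; apply: (@integrable_mkcond _ _ _ leb2 Q (EFin \o f) mQ).1.
apply: (@integrable_le _ _ _ leb2 _ mQ _ (fun=> B)) => //.
- exact: measurable_funTS (continuous2_measurable cf).
- apply: integrable_const => //.
  apply: le_lt_trans (leb2_box_le (c := 0) (normr_ge0 M) mQ _) (ltry _).
  by move=> x /= xM; rewrite subr0 (le_trans xM)// ler_norm.
Qed.

Lemma line_integral_derivative (g dg : R -> R) (M : R) : 0 < M ->
  (forall s, is_derive s (1 : R) g (dg s)) -> continuous dg ->
  (forall s, M <= `|s| -> g s = 0) -> (forall s, M <= `|s| -> dg s = 0) ->
  (\int[mu]_s (dg s)%:E = 0)%E.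
Proof.
move=> M0 hg cdg g0 dg0.
have -> : (\int[mu]_s (dg s)%:E = \int[mu]_(s in `[(- M)%R, M]) (dg s)%:E)%E.
  rewrite [RHS]integral_mkcond; apply: eq_integral => s _; rewrite patchE.
  case: ifPn => // /negP; rewrite inE/= in_itv/= -ler_norml => sM.
  by rewrite dg0// ltW// ltNge; apply/negP.
have cg : continuous g by apply: derivable_line_continuous => s; case: (hg s).
rewrite (@continuous_FTC2 _ dg g)//.
- by rewrite !g0 ?subee// ?normrN ger0_norm// ltW.
- lra.
- exact: continuous_subspaceT.
- split; [by move=> s _; case: (hg s)|exact: cvg_at_right_filter (cg _)|
    exact: cvg_at_left_filter (cg _)].
- by move=> s _; rewrite derive1E; case: (hg s).
Qed.

(** The source of all integration by parts below: smooth functions and Friedrichs' inequality reduce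
    to it by the product rule. By Fubini's theorem each horizontal line contributes the increment of
    a compactly supported function. *)
Lemma test_int_d1 K psi : measurable K -> test_fun K psi ->
  \int[leb2]_(x in K) d1 psi x = 0.
Proof.
move=> mK tp; rewrite (inner_plane mK (test_off (test_d1 tp))) /Rintegral.
have [M M0 HM] := test_bounded tp; have [N N0 HN] := test_bounded (test_d1 tp).
have sp := tp.1; pose L := Num.max M N.
have ML : M <= L by rewrite le_max lexx. have NL : N <= L by rewrite le_max lexx orbT.
have I := integrable_plane (smooth_cont (smooth_d1 sp)) HN.
rewrite /leb2 -(fubini2 I) /fubini_G.
rewrite [X in fine X](_ : _ = 0%E)//; apply: integral0_eq => y _.
apply: (@line_integral_derivative (fun s => psi (s, y)) (fun s => d1 psi (s, y)) L).
- exact: lt_le_trans M0 ML.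
- by move=> s; exact: smooth_row.
- by apply: derivable_line_continuous => s; case: (smooth_row s y (smooth_d1 sp)).
- by move=> s /(le_trans ML) sM; apply: HM; rewrite (le_trans sM)// (norm2_fst (s, y)).
- by move=> s /(le_trans NL) sM; apply: HN; rewrite (le_trans sM)// (norm2_fst (s, y)).
Qed.

Lemma test_int_d2 K psi : measurable K -> test_fun K psi ->
  \int[leb2]_(x in K) d2 psi x = 0.
Proof.
move=> mK tp; rewrite (inner_plane mK (test_off (test_d2 tp))) /Rintegral.
have [M M0 HM] := test_bounded tp; have [N N0 HN] := test_bounded (test_d2 tp).
have sp := tp.1; pose L := Num.max M N.
have ML : M <= L by rewrite le_max lexx. have NL : N <= L by rewrite le_max lexx orbT.
have I := integrable_plane (smooth_cont (smooth_d2 sp)) HN.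
rewrite /leb2 -(fubini1 I) /fubini_F.
rewrite [X in fine X](_ : _ = 0%E)//; apply: integral0_eq => y _.
apply: (@line_integral_derivative (fun s => psi (y, s)) (fun s => d2 psi (y, s)) L).
- exact: lt_le_trans M0 ML.
- by move=> s; exact: smooth_col.
- by apply: derivable_line_continuous => s; case: (smooth_col y s (smooth_d2 sp)).
- by move=> s /(le_trans ML) sM; apply: HM; rewrite (le_trans sM)// (norm2_snd (y, s)).
- by move=> s /(le_trans NL) sM; apply: HN; rewrite (le_trans sM)// (norm2_snd (y, s)).
Qed.

Lemma line_integrable (w : R -> R) (M : R) : continuous w ->
  (forall s, M <= `|s| -> w s = 0) -> mu.-integrable setT (EFin \o w).
Proof.
move=> cw w0; have -> : EFin \o w = (EFin \o w) \_ `[- M, M].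
  apply/funext => s; rewrite patchE; case: ifPn => // /negP.
  rewrite inE/= in_itv/= -ler_norml => sM.
  by rewrite w0//= ltW// ltNge; apply/negP.
apply: (integrable_mkcond _ _).1 => //; apply: continuous_compact_integrable.
  exact: segment_compact.
exact: continuous_subspaceT.
Qed.

Lemma tensor_integral (u v : R -> R) (M : R) : continuous u -> continuous v ->
  (forall s, M <= `|s| -> u s = 0) -> (forall s, M <= `|s| -> v s = 0) ->
  \int[leb2]_x (u x.1 * v x.2) = (\int[mu]_s u s) * (\int[mu]_s v s).
Proof.
move=> cu cv u0 v0.
have I : leb2.-integrable setT (EFin \o (fun x : R * R => u x.1 * v x.2)).
  apply: (@integrable_plane _ M).
    by move=> x; apply: continuousM; [exact: continuous_fst2|exact: continuous_snd2].
  move=> x; rewrite prod_normE/= le_max => /orP[/u0 ->|/v0 ->]; by rewrite ?mul0r ?mulr0.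
have iu := line_integrable cu u0; have iv := line_integrable cv v0.
rewrite /Rintegral /leb2 -(fubini1 I) /fubini_F.
have E s : (\int[mu]_t (EFin \o (fun x : R * R => (u x.1 * v x.2)%R)) (s, t) =
    (fine (\int[mu]_t (v t)%:E))%:E * (u s)%:E)%E.
  rewrite [RHS]muleC fineK ?integrable_fin_num// -integralZl//.
transitivity (fine (\int[mu]_s ((fine (\int[mu]_t (v t)%:E))%:E * (u s)%:E))%E).
  by congr fine; apply: eq_integral => s _; exact: E.
rewrite integralZl// fineM//; first by rewrite mulrC.
exact: integrable_fin_num.
Qed.

Lemma integral_affine (a b : R) (u : R -> R) (M : R) : 0 < a -> continuous u ->
  (forall s, M <= `|s| -> u s = 0) ->
  \int[mu]_s u ((s - b) / a) = a * \int[mu]_s u s.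
Proof.
move=> a0 cu u0.
pose u' s := u ((s - b) / a).
have mu' : measurable_fun setT (EFin \o u').
  apply/measurable_EFinP; apply: measurableT_comp; first exact: continuous_measurable_fun.
  by apply: measurable_funM => //; exact: measurable_funB.
have u'E s : u' (a * s + b) = u s by rewrite /u' addrK mulrAC divff ?gt_eqF// mul1r.
have Ep : (\int[mu]_s (EFin \o u')^\+ s = a%:E * \int[mu]_s (EFin \o u)^\+ s)%E.
  rewrite (@ge0_integral_affine _ a b (EFin \o u')^\+%E); last 3 first.
  - by rewrite gt_eqF.
  - exact: measurable_funepos.
  - by move=> s; exact: funepos_ge0.
  rewrite gtr0_norm//; congr (_ * _)%E; apply: eq_integral => s _.
  by rewrite !funeposE /= u'E.
have En : (\int[mu]_s (EFin \o u')^\- s = a%:E * \int[mu]_s (EFin \o u)^\- s)%E.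
  rewrite (@ge0_integral_affine _ a b (EFin \o u')^\-%E); last 3 first.
  - by rewrite gt_eqF.
  - exact: measurable_funeneg.
  - by move=> s; exact: funeneg_ge0.
  rewrite gtr0_norm//; congr (_ * _)%E; apply: eq_integral => s _.
  by rewrite !funenegE /= u'E.
have iu := line_integrable cu u0.
rewrite -[LHS]/(fine (\int[mu]_s (EFin \o u') s)) integralE Ep En -muleBr//.
  by rewrite -integralE fineM// integrable_fin_num.
by rewrite fin_num_adde_defr// integrable_pos_fin_num.
Qed.

End Compact_support.

(** * Polynomials tested against bumps *)

Section Plane_polynomials.
Context {R : realType}.
Implicit Types (f g : R * R -> R) (n i j : nat).

Definition mono i j (x : R * R) : R := x.1 ^+ i * x.2 ^+ j.

Lemma poly_leE n f : poly_le n%:Z f <-> exists c : nat -> nat -> R, forall x,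
  f x = \sum_(i < n.+1) \sum_(j < n.+1 | (i + j <= n)%N) c i j * mono i j x.
Proof.
split=> -[c H]; exists c => x; rewrite H; apply: eq_bigr => i _; apply: eq_bigr => j _;
  by rewrite /mono mulrA.
Qed.

Lemma poly_neg (m : int) f : m < 0 -> poly_le m f -> f = fun=> 0.
Proof.
move=> m0 [c H]; apply/funext => x; rewrite H big1// => i _; rewrite big_pred0// => j.
apply/negbTE; rewrite -ltNge; exact: lt_le_trans m0 _.
Qed.

Lemma poly_zero (m : int) : poly_le m (fun=> 0 : R).
Proof.
exists (fun _ _ => 0) => x; rewrite big1// => i _; rewrite big1// => j _.
by rewrite !mul0r.
Qed.

Lemma polyD (m : int) f g : poly_le m f -> poly_le m g -> poly_le m (fun x => f x + g x).
Proof.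
move=> [a Ha] [b Hb]; exists (fun i j => a i j + b i j) => x; rewrite Ha Hb.
rewrite -big_split; apply: eq_bigr => i _; rewrite -big_split; apply: eq_bigr => j _ /=.
by rewrite !mulrDl.
Qed.

Lemma polyZ (m : int) (s : R) f : poly_le m f -> poly_le m (fun x => s * f x).
Proof.
move=> [a Ha]; exists (fun i j => s * a i j) => x; rewrite Ha mulr_sumr.
apply: eq_bigr => i _; rewrite mulr_sumr; apply: eq_bigr => j _.
by rewrite !mulrA.
Qed.

Lemma poly_sum (m : int) (I : Type) (r : seq I) (P : pred I) (F : I -> R * R -> R) :
  (forall k, P k -> poly_le m (F k)) -> poly_le m (fun x => \sum_(i <- r | P i) F i x).
Proof.
move=> PF; elim: r => [|i r IH].
  by under eq_fun do rewrite big_nil; exact: poly_zero.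
under eq_fun do rewrite big_cons.
by case: (boolP (P i)) => // /PF h; exact: polyD.
Qed.

Lemma poly_mono n i j : (i + j <= n)%N -> poly_le n%:Z (mono i j).
Proof.
move=> ijn; apply/poly_leE; exists (fun a b => ((a == i) && (b == j))%:R) => x.
have iN : (i < n.+1)%N by rewrite ltnS (leq_trans (leq_addr _ _) ijn).
have jN : (j < n.+1)%N by rewrite ltnS (leq_trans (leq_addl _ _) ijn).
rewrite (bigD1 (Ordinal iN))//= (bigD1 (Ordinal jN))//= !eqxx mul1r.
rewrite big1 ?addr0 => [|b /andP[_ bj]]; last first.
  by rewrite (negbTE (_ : (b : nat) != j)) ?mul0r.
rewrite big1 ?addr0// => a ai; rewrite big1// => b _.
by rewrite (negbTE (_ : (a : nat) != i)) ?mul0r.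
Qed.

(** Reduces a property that is stable under linear combinations to the monomials, so that later
    arguments never handle the double sum. *)
Lemma poly_ind n (Q : (R * R -> R) -> Prop) f :
  Q (fun=> 0) -> (forall f g, Q f -> Q g -> Q (fun x => f x + g x)) ->
  (forall s f, Q f -> Q (fun x => s * f x)) ->
  (forall i j, (i + j <= n)%N -> Q (mono i j)) -> poly_le n%:Z f -> Q f.
Proof.
move=> Q0 QD QZ QM /poly_leE [c H].
have -> : f = (fun x => \sum_(i < n.+1) \sum_(j < n.+1 | (i + j <= n)%N) c i j * mono i j x).
  exact/funext.
have Qs (I : Type) (r : seq I) (P : pred I) (F : I -> R * R -> R) :
    (forall k, P k -> Q (F k)) -> Q (fun x => \sum_(i <- r | P i) F i x).
  move=> QF; elim: r => [|i r IH]; first by under eq_fun do rewrite big_nil.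
  by under eq_fun do rewrite big_cons; case: (boolP (P i)) => // /QF h; exact: QD.
by apply: (Qs) => i _; apply: (Qs) => j ij; apply: QZ; exact: QM.
Qed.

Lemma poly_leW m n f : (m <= n)%N -> poly_le m%:Z f -> poly_le n%:Z f.
Proof.
move=> mn; apply: poly_ind; [exact: poly_zero|exact: polyD|exact: polyZ|].
by move=> i j ij; apply: poly_mono; exact: leq_trans mn.
Qed.

Lemma poly_cst n (a : R) : poly_le n%:Z (fun=> a).
Proof.
have := polyZ a (@poly_mono n 0 0 isT).
by congr (poly_le n%:Z _); apply/funext => x; rewrite /mono !expr0 !mulr1.
Qed.

Lemma poly_mulX1 n f (a b : R) : poly_le n%:Z f ->
  poly_le n.+1%:Z (fun x => (a * x.1 + b) * f x).
Proof.
apply: (@poly_ind n (fun f => poly_le n.+1%:Z (fun x => (a * x.1 + b) * f x))).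
- have := poly_zero n.+1; congr (poly_le _ _); by apply/funext => x; rewrite mulr0.
- move=> f1 f2 h1 h2; have := polyD h1 h2; congr (poly_le _ _).
  by apply/funext => x; rewrite mulrDr.
- move=> s f1 h1; have := polyZ s h1; congr (poly_le _ _).
  by apply/funext => x; ring.
- move=> i j ij; have h1 := @poly_mono n.+1 i.+1 j ij.
  have h2 := @poly_mono n.+1 i j (leqW ij).
  have := polyD (polyZ a h1) (polyZ b h2); congr (poly_le _ _).
  by apply/funext => x; rewrite /mono exprS; ring.
Qed.

Lemma poly_mulX2 n f (a b : R) : poly_le n%:Z f ->
  poly_le n.+1%:Z (fun x => (a * x.2 + b) * f x).
Proof.
apply: (@poly_ind n (fun f => poly_le n.+1%:Z (fun x => (a * x.2 + b) * f x))).
- have := poly_zero n.+1; congr (poly_le _ _); by apply/funext => x; rewrite mulr0.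
- move=> f1 f2 h1 h2; have := polyD h1 h2; congr (poly_le _ _).
  by apply/funext => x; rewrite mulrDr.
- move=> s f1 h1; have := polyZ s h1; congr (poly_le _ _).
  by apply/funext => x; ring.
- move=> i j ij; have h1 := @poly_mono n.+1 i j.+1 _.
  have h2 := @poly_mono n.+1 i j (leqW ij).
  have := polyD (polyZ a (h1 _)) (polyZ b h2); rewrite addnS ltnS => /(_ ij).
  congr (poly_le _ _); by apply/funext => x; rewrite /mono exprS; ring.
Qed.

Lemma poly_affine_mono n i j (a b a' b' : R) : (i + j <= n)%N ->
  poly_le n%:Z (fun x => (a * x.1 + b) ^+ i * (a' * x.2 + b') ^+ j).
Proof.
move=> ijn; apply: (poly_leW ijn) => {ijn}; elim: i => [|i IH].
  elim: j => [|j IH].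
    by have := @poly_cst 0 1; congr (poly_le _ _); apply/funext => x; rewrite !expr0 mulr1.
  have := poly_mulX2 a' b' IH; congr (poly_le _ _).
  by apply/funext => x; rewrite !expr0 !mul1r exprS.
by have := poly_mulX1 a b IH; congr (poly_le _ _); apply/funext => x; rewrite exprS mulrA.
Qed.

Lemma poly_affine n f (c : R * R) (r : R) : poly_le n%:Z f ->
  poly_le n%:Z (fun x => f (c + r *: x)).
Proof.
apply: (@poly_ind n (fun f => poly_le n%:Z (fun x => f (c + r *: x)))).
- exact: poly_zero.
- by move=> f1 f2; exact: polyD.
- by move=> s f1; exact: polyZ.
- move=> i j ij; have := poly_affine_mono r c.1 r c.2 ij; congr (poly_le _ _).
  by apply/funext => x; rewrite /mono /= ![_ *: _]/(_ * _) ![_ + r * _]addrC.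
Qed.

Lemma smooth_poly n f : poly_le n%:Z f -> smooth f.
Proof.
apply: poly_ind.
- exact: smooth_cst.
- by move=> f1 f2; exact: smoothD.
- by move=> s f1; exact: smoothZ.
- move=> i j _; have := @smooth_tensor R (horner ('X^i)) (horner ('X^j))
    (fun n => Cline_poly n _) (fun n => Cline_poly n _).
  by congr smooth; apply/funext => x; rewrite !hornerXn.
Qed.

Lemma d1_mono i j : d1 (mono i j) = fun x => i%:R * mono i.-1 j x.
Proof.
apply/funext => x.
have -> : mono i j = (fun x => ('X^i).[x.1] * ('X^j).[x.2]).
  by apply/funext => y; rewrite !hornerXn.
rewrite (d1_tensor _ (is_derive_poly _ _)) derivXn hornerMn !hornerXn /mono.
by rewrite -mulr_natl mulrA.
Qed.

Lemma d2_mono i j : d2 (mono i j) = fun x => j%:R * mono i j.-1 x.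
Proof.
apply/funext => x.
have -> : mono i j = (fun x => ('X^i).[x.1] * ('X^j).[x.2]).
  by apply/funext => y; rewrite !hornerXn.
rewrite (d2_tensor _ (is_derive_poly _ _)) derivXn hornerMn !hornerXn /mono.
by rewrite -mulr_natl; ring.
Qed.

Lemma poly_d1 n f : poly_le n%:Z f -> poly_le (n%:Z - 1) (d1 f).
Proof.
(* Smoothness is carried through the induction because the sum rule for [d1] needs both terms
   differentiable. *)
move=> pf; have [] // : smooth f /\ poly_le (n%:Z - 1) (d1 f).
move: pf; apply: (@poly_ind n (fun f => smooth f /\ poly_le (n%:Z - 1) (d1 f))).
- by rewrite d1_cst; split; [exact: smooth_cst|exact: poly_zero].
- by move=> f1 f2 [s1 h1] [s2 h2]; rewrite d1D//; split; [exact: smoothD|exact: polyD].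
- by move=> s f1 [s1 h1]; rewrite d1Z//; split; [exact: smoothZ|exact: polyZ].
- move=> i j ij; split; first exact: smooth_poly (poly_mono ij).
  rewrite d1_mono; case: i ij => [|i] ij.
    have := poly_zero (n%:Z - 1); congr (poly_le _ _).
    by apply/funext => x; rewrite mul0r.
  apply: polyZ; case: n ij => // n ij.
  by rewrite -addn1 PoszD addrK; exact: poly_mono.
Qed.

Lemma poly_d2 n f : poly_le n%:Z f -> poly_le (n%:Z - 1) (d2 f).
Proof.
move=> pf; have [] // : smooth f /\ poly_le (n%:Z - 1) (d2 f).
move: pf; apply: (@poly_ind n (fun f => smooth f /\ poly_le (n%:Z - 1) (d2 f))).
- by rewrite d2_cst; split; [exact: smooth_cst|exact: poly_zero].
- by move=> f1 f2 [s1 h1] [s2 h2]; rewrite d2D//; split; [exact: smoothD|exact: polyD].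
- by move=> s f1 [s1 h1]; rewrite d2Z//; split; [exact: smoothZ|exact: polyZ].
- move=> i j ij; split; first exact: smooth_poly (poly_mono ij).
  rewrite d2_mono; case: j ij => [|j] ij.
    have := poly_zero (n%:Z - 1); congr (poly_le _ _).
    by apply/funext => x; rewrite mul0r.
  apply: polyZ; case: n ij => [|n] ij; first by rewrite addnS in ij.
  by rewrite -addn1 PoszD addrK; apply: poly_mono; move: ij; rewrite addnS.
Qed.

Lemma poly_pred (n : nat) f : poly_le (n%:Z - 1) f -> poly_le n%:Z f.
Proof.
case: n => [/poly_neg ->//|n]; first exact: poly_zero.
by rewrite -addn1 PoszD addrK; apply: poly_leW; rewrite addn1.
Qed.

Lemma poly_laplacian n f : poly_le n%:Z f ->
  poly_le (n%:Z - 2) (fun x => d1 (d1 f) x + d2 (d2 f) x).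
Proof.
move=> pf; have h1 := poly_d1 pf; have h2 := poly_d2 pf.
case: n pf h1 h2 => [|n] pf h1 h2.
  rewrite (poly_neg _ h1)// (poly_neg _ h2)// d1_cst d2_cst.
  have := poly_zero (0%:Z - 2); congr (poly_le _ _).
  by apply/funext => x; rewrite addr0.
have E : n.+1%:Z - 1 = n%:Z by rewrite -addn1 PoszD addrK.
have E2 : n.+1%:Z - 2 = n%:Z - 1 by rewrite -addn1 PoszD; lia.
rewrite E in h1 h2; rewrite E2.
by apply: polyD; [exact: poly_d1|exact: poly_d2].
Qed.

Lemma poly_mul_affine2 n f (u : R * R -> R) : poly_le 1 u -> poly_le n%:Z f ->
  poly_le n.+1%:Z (fun x => u x * f x).
Proof.
move=> pu pf; move: pu; apply: (@poly_ind 1 (fun u => poly_le n.+1%:Z (fun x => u x * f x))).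
- by have := poly_zero n.+1; congr (poly_le _ _); apply/funext => x; rewrite mul0r.
- move=> u1 u2 h1 h2; have := polyD h1 h2; congr (poly_le _ _).
  by apply/funext => x; rewrite mulrDl.
- move=> s f1 h1; have := polyZ s h1; congr (poly_le _ _).
  by apply/funext => x; ring.
- case=> [|[|i]] [|[|j]]//= _.
  + have := poly_mulX1 0 1 pf; congr (poly_le _ _).
    by apply/funext => x; rewrite /mono !expr0 mul0r add0r mulr1.
  + have := poly_mulX2 1 0 pf; congr (poly_le _ _).
    by apply/funext => x; rewrite /mono expr0 expr1 !mul1r addr0.
  + have := poly_mulX1 1 0 pf; congr (poly_le _ _).
    by apply/funext => x; rewrite /mono expr0 expr1 mulr1 mul1r addr0.
Qed.

End Plane_polynomials.

(** * Smooth functions biorthogonal to the monomials *)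

Section Dual_basis.
Context {R : realType}.
Notation mu := (@lebesgue_measure R).

Lemma Rintegral_lsum d (T : measurableType d) (nu : {measure set T -> \bar R})
    (D : set T) (I : Type) (r : seq I) (F : I -> T -> R) : measurable D ->
  (forall k, nu.-integrable D (EFin \o F k)) ->
  \int[nu]_(x in D) (\sum_(k <- r) F k x) = \sum_(k <- r) \int[nu]_(x in D) F k x.
Proof.
move=> mD iF; elim: r => [|k r IH].
  under eq_Rintegral do rewrite big_nil.
  by rewrite big_nil Rintegral_cst// mul0r.
under eq_Rintegral do rewrite big_cons.
rewrite big_cons -IH RintegralD//.
have -> : EFin \o (fun x => \sum_(j <- r) F j x) = (fun x => (\sum_(j <- r) (F j x)%:E)%E).
  by apply/funext => x; rewrite /= sumEFin.
by apply: (@integrable_sum _ _ _ nu D mD _ r xpredT (fun j x => (F j x)%:E)) => j _; exact: iF.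
Qed.

Lemma continuous_ge0_integral_eq0 (f : R -> R) : continuous f -> (forall s, 0 <= f s) ->
  mu.-integrable setT (EFin \o f) -> \int[mu]_s f s = 0 -> forall s, f s = 0.
Proof.
move=> cf f0 If int0 s; apply/eqP; rewrite eq_le f0 andbT leNgt; apply/negP => fs.
have /cvgrPdist_lt /(_ (f s / 2)) := cf s; rewrite divr_gt0// => /(_ isT).
move=> /nbhs_ballP[d /= d0 hd].
have fd t : t \in `[s - d / 2, s + d / 2] -> f s / 2 <= f t.
  rewrite in_itv/= => /andP[t1 t2].
  have : ball s d t by rewrite /ball/= ltr_norml; lra.
  by move=> /hd /=; rewrite ltr_norml; lra.
have mI : measurable `[s - d / 2, s + d / 2] by [].
have Em : mu `[s - d / 2, s + d / 2]%classic = d%:E.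
  rewrite lebesgue_measure_itv/= lte_fin ifT; last lra.
  by rewrite -EFinD; congr EFin; lra.
have : 0 < \int[mu]_(t in `[s - d / 2, s + d / 2]) (f s / 2).
  rewrite Rintegral_cst//; apply: mulr_gt0; first lra.
  have E : fine (mu `[s - d / 2, s + d / 2]%classic) = d by rewrite Em.
  by apply: lt_le_trans d0 _; rewrite -{1}E; exact: lexx.
have h1 : \int[mu]_(t in `[s - d / 2, s + d / 2]) (f s / 2) <=
    \int[mu]_(t in `[s - d / 2, s + d / 2]) f t.
  apply: le_Rintegral => //.
  - apply: integrable_const => //.
    exact: (eq_ind_r (fun z => (z < +oo)%E) (ltry d) Em).
  - exact: integrableS If.
have h2 : \int[mu]_(t in `[s - d / 2, s + d / 2]) f t <= \int[mu]_t f t.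
  rewrite -lee_fin /Rintegral !fineK ?integrable_fin_num//; last exact: integrableS If.
  apply: ge0_subset_integral => //; first by case/integrableP: If.
  by move=> x _; rewrite lee_fin.
by rewrite int0 in h2 => h3; have := lt_le_trans h3 (le_trans h1 h2); rewrite ltxx.
Qed.

(** Supported in [-1/2, 1/2], so that the product of two copies scaled by r lives on a square of
    half-side r/2, which fits in a Euclidean disc of radius r. *)
Definition bump (s : R) : R := hat (2 * s).

Lemma Cline_bump n : Cline n bump.
Proof.
have := @Cline_affine R n hat 2 0 (Cline_hat n).
by congr Cline; apply/funext => s; rewrite /bump addr0.
Qed.

Lemma bump_eq0 (s : R) : 2^-1 <= `|s| -> bump s = 0.
Proof. by move=> hs; apply: hat_eq0; rewrite normrM ger0_norm//; lra. Qed.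

Lemma bump_gt0 (s : R) : - 2^-1 < s -> s <= 0 -> 0 < bump s.
Proof.
by move=> s1 s2; rewrite /bump /hat (@step_eq0 _ (2 * s)) ?subr0 ?step_gt0//; lra.
Qed.

Lemma bump_mul_supp (u : R -> R) (s : R) : 2^-1 <= `|s| -> bump s * u s = 0.
Proof. by move=> /bump_eq0 ->; rewrite mul0r. Qed.

Lemma bump_mul_integrable (u : R -> R) : continuous u ->
  mu.-integrable setT (EFin \o (fun s => bump s * u s)).
Proof.
move=> cu; apply: (line_integrable _ (@bump_mul_supp u)).
by move=> s; apply: continuousM; [exact: Cline_cont (Cline_bump 0) _|exact: cu].
Qed.

Lemma continuous_poly1 (p : {poly R}) : continuous (horner p).
Proof. exact: Cline_cont (Cline_poly 0 p). Qed.
Arguments continuous_poly1 : clear implicits.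

Lemma poly_null_left (p : {poly R}) :
  (forall s : R, - 2^-1 < s -> s <= 0 -> p.[s] = 0) -> p = 0.
Proof.
move=> p0; apply/eqP; apply: contraT => pn0.
(* As many distinct roots as the size of [p], one more than its degree allows; the shift by 3 keeps
   them to the right of -1/2. *)
pose rs := [seq - (k.+3%:R^-1 : R) | k <- iota 0 (size p)].
have h1 : all (root p) rs.
  apply/allP => _ /mapP[k _ ->]; apply/rootP; apply: p0.
    by rewrite ltrN2 ltf_pV2 ?posrE ?ltr0n// ltr_nat.
  by rewrite oppr_le0 invr_ge0 ler0n.
have h2 : uniq rs.
  rewrite map_inj_uniq ?iota_uniq// => a b /eqP; rewrite eqr_opp => /eqP/invr_inj/eqP.
  by rewrite eqr_nat => /eqP[].
by have := max_poly_roots pn0 h1 h2; rewrite size_map size_iota ltnn.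
Qed.

Variable n : nat.
Notation N := n.+1.

Definition gram : 'M[R]_N :=
  \matrix_(i, j) \int[mu]_s (bump s * s ^+ (i + j)).

(** A vector in the kernel is the coefficient vector of a polynomial p with integral of [bump] p^2
    equal to 0. Hence p vanishes where [bump] is positive, and has too many roots. *)
Lemma gram_unit : gram \in unitmx.
Proof.
rewrite -row_free_unit; apply: inj_row_free => v vG.
pose p : {poly R} := \poly_(i < N) (if insub i is Some k then v 0 k else 0).
have pE s : p.[s] = \sum_(i < N) v 0 i * s ^+ i.
  rewrite horner_poly; apply: eq_bigr => i _.
  by rewrite insubT /= ?ltn_ord// => lt; congr (v 0 _ * _); apply: val_inj.
have int0 : \int[mu]_s (bump s * p.[s] ^+ 2) = 0.
  have -> : (fun s => bump s * p.[s] ^+ 2) =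
     (fun s => \sum_(i < N) \sum_(j < N) (v 0 i * v 0 j) * (bump s * s ^+ (i + j))).
    apply/funext => s; rewrite pE expr2 mulr_suml mulr_sumr; apply: eq_bigr => i _.
    by rewrite !mulr_sumr; apply: eq_bigr => j _; rewrite exprD; ring.
  have Ib (i j : 'I_N) : mu.-integrable setT
      (EFin \o (fun s => (v 0 i * v 0 j) * (bump s * s ^+ (i + j)))).
    have -> : (fun s => (v 0 i * v 0 j) * (bump s * s ^+ (i + j))) =
              (fun s => bump s * ((v 0 i * v 0 j)%:P * 'X^(i + j)).[s]).
      by apply/funext => s; rewrite hornerM hornerC hornerXn; ring.
    by apply: bump_mul_integrable; exact: continuous_poly1.
  rewrite Rintegral_lsum//; last first.
    move=> i; have -> : EFin \o (fun s => \sum_(j < N) (v 0 i * v 0 j) * (bump s * s ^+ (i + j))) =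
      (fun s => (\sum_(j < N) ((v 0 i * v 0 j) * (bump s * s ^+ (i + j)))%:E)%E).
      by apply/funext => s; rewrite /= sumEFin.
    by apply: (@integrable_sum _ _ _ mu setT measurableT _ _ xpredT (fun (j : 'I_N) s => ((v 0 i * v 0 j) * (bump s * s ^+ (i + j)))%:E)) => j _; exact: Ib.
  have -> : \sum_(i < N) \int[mu]_s (\sum_(j < N) (v 0 i * v 0 j) * (bump s * s ^+ (i + j))) =
      \sum_(i < N) v 0 i * \sum_(j < N) gram i j * v 0 j.
    apply: eq_bigr => i _; rewrite Rintegral_lsum//.
    rewrite mulr_sumr; apply: eq_bigr => j _; rewrite mxE RintegralZl//; first by ring.
    have := @bump_mul_integrable (fun s => ('X^(i + j) : {poly R}).[s]) (continuous_poly1 _).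
    by congr (_.-integrable _ _); apply/funext => s /=; rewrite hornerXn.
  under eq_bigr do rewrite mulr_sumr.
  rewrite exchange_big/= big1// => j _.
  have /rowP/(_ j) := vG; rewrite mxE mxE => E.
  transitivity ((\sum_k v 0 k * gram k j) * v 0 j); last by rewrite E mul0r.
  by rewrite mulr_suml; apply: eq_bigr => i _; rewrite mulrA.
have cp : continuous (fun s => bump s * p.[s] ^+ 2).
  move=> s; apply: continuousM; first exact: Cline_cont (Cline_bump 0) _.
  by apply: continuousM; exact: continuous_poly1.
have b0 s : bump s * p.[s] ^+ 2 = 0.
  apply: (continuous_ge0_integral_eq0 cp _ _ int0 s).
    by move=> t; rewrite mulr_ge0 ?sqr_ge0// hat_ge0.
  by apply: bump_mul_integrable => t; apply: continuousM; exact: continuous_poly1.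
have p0 : p = 0.
  apply: poly_null_left => s s1 s2; apply/eqP; rewrite -sqrf_eq0.
  by move: (b0 s) => /eqP; rewrite mulf_eq0 gt_eqF// bump_gt0.
apply/rowP => i; rewrite mxE.
have := coef_poly N (fun i => if insub i is Some k then v 0 k else 0) i.
rewrite -/p p0 coef0 ltn_ord insubT ?ltn_ord// => lt ->.
by congr (v 0 _); apply: val_inj.
Qed.

(** Biorthogonal to the monomials of degree at most [n]: integrating a polynomial against [dual i]
    reads off its i-th coefficient. Being smooth and compactly supported, products of these
    functions are test functions, onto which weak derivatives can be moved. *)
Definition dual (i : 'I_N) (s : R) : R :=
  bump s * (\sum_(k < N) (invmx gram i k)%:P * 'X^k : {poly R}).[s].

Lemma Cline_dual i m : Cline m (dual i).
Proof. by apply: ClineM; [exact: Cline_bump|exact: Cline_poly]. Qed.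

Lemma dual_eq0 (i : 'I_N) (s : R) : 2^-1 <= `|s| -> dual i s = 0.
Proof. exact: (@bump_mul_supp (horner _)). Qed.

Lemma dual_integral (i j : 'I_N) : \int[mu]_s (s ^+ j * dual i s) = (i == j)%:R.
Proof.
have Ib (k : 'I_N) : mu.-integrable setT
      (EFin \o (fun s => invmx gram i k * (bump s * s ^+ (k + j)))).
  have -> : (fun s => invmx gram i k * (bump s * s ^+ (k + j))) =
            (fun s => bump s * ((invmx gram i k)%:P * 'X^(k + j)).[s]).
    by apply/funext => s; rewrite hornerM hornerC hornerXn; ring.
  by apply: bump_mul_integrable; exact: continuous_poly1.
have -> : (fun s => s ^+ j * dual i s) =
    (fun s => \sum_(k < N) invmx gram i k * (bump s * s ^+ (k + j))).
  apply/funext => s; rewrite /dual horner_sum !mulr_sumr; apply: eq_bigr => k _.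
  by rewrite hornerM hornerC hornerXn exprD; ring.
rewrite Rintegral_lsum//.
have -> : \sum_(k < N) \int[mu]_s (invmx gram i k * (bump s * s ^+ (k + j))) =
    \sum_(k < N) invmx gram i k * gram k j.
  apply: eq_bigr => k _; rewrite mxE RintegralZl//.
  have := @bump_mul_integrable (fun s => ('X^(k + j) : {poly R}).[s]) (continuous_poly1 _).
  by congr (_.-integrable _ _); apply/funext => s /=; rewrite hornerXn.
have := mulVmx gram_unit; move/matrixP/(_ i j); rewrite !mxE => ->.
by [].
Qed.

Lemma dual_bound : exists2 B, 1 <= B & forall i s,
  `|dual i s| <= B /\ `|(dual i)^`()%classic s| <= B.
Proof.
have H (u : R -> R) : continuous u -> (forall s, 1 <= `|s| -> u s = 0) ->
    exists2 B, 0 <= B & forall s, `|u s| <= B.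
  move=> cu u0; have [B B0 HB] := @bounded_on_box R (fun x => u x.1) 1 (continuous_fst2 cu).
  exists B => // s; have [s1|s1] := leP `|s| 1.
    by apply: (HB (s, 0)); rewrite norm2_le /= s1 normr0 ler01.
  by rewrite u0 ?normr0// ltW.
have H2 i : exists B : R, 0 <= B /\ forall s, `|dual i s| <= B /\ `|(dual i)^`()%classic s| <= B.
  have [B1 B10 h1] : exists2 B, 0 <= B & forall s, `|dual i s| <= B.
    apply: H; first exact: Cline_cont (Cline_dual i 0).
    by move=> s s1; apply: dual_eq0; lra.
  have [df C] := Cline_derive (Cline_dual i 1).
  have [B2 B20 h2] : exists2 B, 0 <= B & forall s, `|(dual i)^`()%classic s| <= B.
    apply: H; first exact: Cline_cont C.
    move=> s s1; rewrite derive1E -[RHS](@derive_cst R R R 0 1 s).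
    apply: near_eq_derive.
    have : \forall t \near s, 2^-1 < `|t|.
      have := @norm_continuous R R s; move/cvgrPdist_lt => /(_ 2^-1).
      rewrite invr_gt0 ltr0n => /(_ isT); apply: filterS => t.
      by rewrite ltr_norml; lra.
    by apply: filterS => t t1; apply: dual_eq0; exact: ltW.
  exists (B1 + B2); split=> [|s]; first exact: addr_ge0.
  by split; [have := h1 s|have := h2 s]; lra.
have [Bf HB] := choice H2.
exists (1 + \sum_i Bf i) => [|i s].
  by rewrite lerDl sumr_ge0// => i _; case: (HB i).
have [_ /(_ s)[h1 h2]] := HB i.
have : Bf i <= \sum_i Bf i.
  by rewrite (bigD1 i)//= lerDl sumr_ge0// => k _; case: (HB k).
by split; lra.
Qed.

(** The tensor duals transported to the square of half-side r/2 about [c], which lies inside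
    [disc c r]. *)
Definition dual2 (c : R * R) (r : R) (i j : 'I_N) (x : R * R) : R :=
  dual i ((x.1 - c.1) / r) * dual j ((x.2 - c.2) / r).

Lemma dual_affE (i : 'I_N) (a r : R) :
  (fun s => dual i ((s - a) / r)) = (fun s => dual i (r^-1 * s + (- a / r))).
Proof. by apply/funext => s; congr dual; ring. Qed.

Lemma smooth_dual2 c r i j : smooth (dual2 c r i j).
Proof.
have H k a m : Cline m (fun s => dual k ((s - a) / r)).
  by rewrite dual_affE; apply: Cline_affine; exact: Cline_dual.
exact: (smooth_tensor (H i c.1) (H j c.2)).
Qed.

Lemma dual2_integral c r (i j k l : 'I_N) : 0 < r ->
  \int[leb2]_x (((x.1 - c.1) / r) ^+ k * ((x.2 - c.2) / r) ^+ l * dual2 c r i j x) =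
  r ^+ 2 * ((i == k)%:R * (j == l)%:R).
Proof.
move=> r0; pose w (i k : 'I_N) (s : R) := s ^+ k * dual i s.
have cw a b : continuous (w a b).
  move=> s; apply: (@continuousM R R (fun s => s ^+ b)); last exact: Cline_cont (Cline_dual a 0) _.
  have -> : (fun s : R => s ^+ b) = horner ('X^b) by apply/funext => t; rewrite hornerXn.
  exact: continuous_poly1.
have ca a b (e : R) : continuous (fun s => w a b ((s - e) / r)).
  move=> s; apply: (@continuous_comp _ _ _ (fun s => (s - e) / r)); last exact: cw.
  by apply: continuousM; [apply: continuousD|]; try exact: cst_continuous.
have w0 a b s : 1 <= `|s| -> w a b s = 0.
  by move=> s1; rewrite /w dual_eq0 ?mulr0//; lra.
have wa a b e s : `|e| + r <= `|s| -> w a b ((s - e) / r) = 0.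
  move=> s1; apply: w0; rewrite normrM normfV (gtr0_norm r0) ler_pdivlMr// mul1r.
  by have := lerB_normD s (- e); rewrite normrN; lra.
pose M := `|c.1| + `|c.2| + r.
rewrite (_ : (fun x => _) = (fun x : R * R => w i k ((x.1 - c.1) / r) * w j l ((x.2 - c.2) / r))).
  rewrite (@tensor_integral R (fun s => w i k ((s - c.1) / r)) (fun s => w j l ((s - c.2) / r)) M)//.
  - have E1 := @integral_affine R r c.1 (w i k) 1 r0 (cw i k) (w0 i k).
    have E2 := @integral_affine R r c.2 (w j l) 1 r0 (cw j l) (w0 j l).
    by rewrite E1 E2 /w !dual_integral; ring.
  - by move=> s sM; apply: wa; rewrite (le_trans _ sM)// /M; have := normr_ge0 c.2; lra.
  - by move=> s sM; apply: wa; rewrite (le_trans _ sM)// /M; have := normr_ge0 c.1; lra.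
by apply/funext => x; rewrite /w /dual2; ring.
Qed.

Lemma dual2_eq0 c r i j x : 0 < r -> r / 2 <= `|x - c| -> dual2 c r i j x = 0.
Proof.
move=> r0; have H (s : R) : (2^-1 <= `|s / r|) = (r / 2 <= `|s|).
  by rewrite normrM normfV (gtr0_norm r0) ler_pdivlMr// mulrC.
rewrite prod_normE /= le_max -!H /dual2 => /orP[h|h]; rewrite (dual_eq0 _ h) ?mul0r//.
by rewrite mulr0.
Qed.

Lemma is_derive_dual (i : 'I_N) (a r s : R) :
  is_derive s (1 : R) (fun s => dual i ((s - a) / r))
    (r^-1 * (dual i)^`()%classic ((s - a) / r)).
Proof.
have [df _] := Cline_derive (Cline_dual i 1).
have d1 : is_derive s (1 : R) (fun s => (s - a) / r) r^-1.
  have := is_derive_poly ((r^-1)%:P * 'X + (- a / r)%:P) s.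
  rewrite derivD derivM !derivC derivX mul0r add0r mulr1 addr0 hornerC.
  by congr is_derive; apply/funext => y; rewrite !hornerD hornerM !hornerC hornerX; ring.
have := @is_derive1_comp _ (dual i) (fun s => (s - a) / r) s _ _ (df _) d1.
by rewrite mulrC.
Qed.

Lemma disc_box (c x : R * R) (r : R) : 0 < r -> `|x - c| <= r / 2 -> disc c r x.
Proof.
rewrite norm2_le /disc /= => r0 /andP[h1 h2]; rewrite /enorm /dot.
rewrite -(ltr_pXn2r (n := 2)) ?nnegrE ?sqrtr_ge0 ?ltW// sqr_sqrtr; last first.
  by rewrite addr_ge0// -expr2 sqr_ge0.
rewrite /= -!expr2 -(real_normK (num_real (x.1 - c.1))) -(real_normK (num_real (x.2 - c.2))).
have := normr_ge0 (x.1 - c.1); have := normr_ge0 (x.2 - c.2); rewrite /= in h1 h2 *; nra.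
Qed.

Lemma test_dual2 K c r i j : 0 < r -> disc c r `<=` K -> test_fun K (dual2 c r i j).
Proof.
move=> r0 dK; split; first exact: smooth_dual2.
pose Q : set (R * R) := `[c.1 - r / 2, c.1 + r / 2]%classic `*` `[c.2 - r / 2, c.2 + r / 2]%classic.
have QP x : Q x <-> `|x - c| <= r / 2.
  rewrite norm2_le/= !ler_norml /Q /= !in_itv/=; split.
    by move=> [/andP[? ?] /andP[? ?]]; apply/andP; split; apply/andP; split; lra.
  by move=> /andP[/andP[? ?] /andP[? ?]]; split; apply/andP; split; lra.
exists Q; split.
- by apply: compact_setX; exact: segment_compact.
- by move=> x /QP /(disc_box r0) /dK.
- move=> x nQ; apply: dual2_eq0 => //; rewrite leNgt; apply/negP => h; apply: nQ.
  by apply/QP; exact: ltW.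
Qed.

End Dual_basis.

Lemma test_integrable (R : realType) (K : set (R * R)) psi : measurable K ->
  test_fun K psi -> leb2.-integrable K (EFin \o psi).
Proof.
move=> mK tp; have [M M0 HM] := test_bounded tp.
by apply: integrableS (integrable_plane (smooth_cont tp.1) HM).
Qed.

(** The inverse estimate behind all others: test functions supported in one disc control a
    polynomial on a whole dilated square. In the scaled coordinates (x - c)/r the coefficients of
    [F] are its pairings with [dual2], divided by r^2. Each is at most [B ^+ 2 * L], there are at
    most (n + 1)^2 of them, and [P] bounds every power of a scaled coordinate. *)
Lemma poly_sup_test (R : realType) (n : nat) (M : R) : 0 <= M ->
  exists2 C : R, 0 < C & forall (K : set (R * R)) (c : R * R) (r : R) (F : R * R -> R) (L : R), measurable K -> 0 < r ->
    disc c r `<=` K -> poly_le n%:Z F ->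
    (forall psi, test_fun K psi -> (forall x, `|psi x| <= 1) ->
       (forall x, `|d1 psi x| <= r^-1) -> (forall x, `|d2 psi x| <= r^-1) ->
       `|inner K F psi| <= L * r ^+ 2) ->
    forall x : R * R, `|x - c| <= M * r -> `|F x| <= C * L.
Proof.
move=> M0; have [B B1 HB] := @dual_bound R n.
pose P := (1 + M) ^+ n; have P1 : 1 <= P by rewrite exprn_ege1// lerDl.
exists (n.+1%:R ^+ 2 * (B ^+ 2 * P ^+ 2)).
  by rewrite !mulr_gt0 ?exprn_gt0 ?ltr0n//; lra.
move=> K c r F L mK r0 dK pF hF x xM.
have [a Ha] := (poly_leE _ _).1 (poly_affine c r pF).
have FE y : F y = \sum_(k < n.+1) \sum_(l < n.+1 | (k + l <= n)%N)
    a k l * (((y.1 - c.1) / r) ^+ k * ((y.2 - c.2) / r) ^+ l).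
  have := Ha (r^-1 *: (y - c)); rewrite scalerA divff ?gt_eqF// scale1r addrC subrK => ->.
  apply: eq_bigr => k _; apply: eq_bigr => l _; rewrite /mono /=.
  by congr (_ * (_ ^+ _ * _ ^+ _)); exact: mulrC.
have sp (i j : 'I_n.+1) : smooth (dual2 c r i j) by exact: smooth_dual2.
have aE (i j : 'I_n.+1) : (i + j <= n)%N -> inner K F (dual2 c r i j) = r ^+ 2 * a i j.
  move=> ij; have td : test_fun K (dual2 c r i j) by exact: test_dual2.
  rewrite /inner (inner_plane mK); last by move=> y ny; rewrite (test_off td ny) mulr0.
  pose G (k l : 'I_n.+1) (y : R * R) := (if (k + l <= n)%N then a k l else 0) *
     (((y.1 - c.1) / r) ^+ k * ((y.2 - c.2) / r) ^+ l * dual2 c r i j y).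
  have iG k l : leb2.-integrable setT
      (EFin \o (fun y => ((y.1 - c.1) / r) ^+ k * ((y.2 - c.2) / r) ^+ l * dual2 c r i j y)).
    have [M' M'0 HM'] := test_bounded td; apply: (@integrable_plane _ _ M').
      move=> y; apply: (@continuousM R (R * R)%type (fun y => ((y.1 - c.1) / r) ^+ k * ((y.2 - c.2) / r) ^+ l)).
        have := @poly_affine_mono R _ k l r^-1 (- c.1 / r) r^-1 (- c.2 / r) (leqnn _).
        move=> /smooth_poly/smooth_cont/(_ y).
        by congr (continuous_at _ _); apply/funext => z; congr (_ ^+ _ * _ ^+ _); ring.
      exact: smooth_cont.
    by move=> y /HM' ->; rewrite mulr0.
  have iGG k l : leb2.-integrable setT (EFin \o G k l).
    have := integrableZl measurableT (if (k + l <= n)%N then a k l else 0) (iG k l).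
    by congr (_.-integrable _ _); apply/funext => y; rewrite /= EFinM.
  have -> : (fun y => F y * dual2 c r i j y) = (fun y => \sum_k \sum_l G k l y).
    apply/funext => y; rewrite FE mulr_suml; apply: eq_bigr => k _.
    rewrite mulr_suml big_mkcond; apply: eq_bigr => l _; rewrite /G.
    by case: ifP => _; ring.
  rewrite Rintegral_lsum//; last first.
    move=> k; have := @integrable_sum _ _ _ leb2 setT measurableT _
      (index_enum 'I_n.+1) xpredT (fun l y => (G k l y)%:E) (fun l _ => iGG k l).
    by congr (_.-integrable _ _); apply/funext => y; rewrite /= sumEFin.
  have -> : \sum_(k < n.+1) \int[leb2]_y (\sum_l G k l y) =
     \sum_(k < n.+1) \sum_(l < n.+1) (if (k + l <= n)%N then a k l else 0) * (r ^+ 2 * ((i == k)%:R * (j == l)%:R)).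
    apply: eq_bigr => k _; rewrite Rintegral_lsum//; apply: eq_bigr => l _.
    by rewrite RintegralZl// dual2_integral.
  rewrite (bigD1 i)//= [X in _ + X]big1 ?addr0; last first.
    by move=> k ki; rewrite big1// => l _; rewrite [i == k]eq_sym (negbTE ki) mul0r !mulr0.
  rewrite (bigD1 j)//= [X in _ + X]big1 ?addr0; last first.
    by move=> l lj; rewrite [j == l]eq_sym (negbTE lj) !mulr0.
  by rewrite !eqxx ij !mulr1 mulrC.
have BB : 0 < B ^+ 2 by rewrite exprn_gt0//; lra.
have ab (i j : 'I_n.+1) : (i + j <= n)%N -> `|a i j| <= B ^+ 2 * L.
  move=> ij; have td : test_fun K (dual2 c r i j) by exact: test_dual2.
  (* Division by [B ^+ 2] normalizes the product of two duals, and also its partial derivatives up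
     to the factor 1/r, so that the hypothesis applies. *)
  have t1 : test_fun K (fun y => B ^- 2 * dual2 c r i j y).
    by apply: testM => //; exact: smooth_cst.
  have b1 (u v : R) : `|u| <= B -> `|v| <= B -> `|B ^- 2 * (u * v)| <= 1.
    move=> hu hv; rewrite !normrM [`|_^-1|]gtr0_norm ?invr_gt0//.
    by rewrite ler_pdivrMl// mulr1 expr2 ler_pM.
  have b2 (u v : R) : `|u| <= B -> `|v| <= B -> `|B ^- 2 * (r^-1 * u * v)| <= r^-1.
    move=> hu hv; have -> : B ^- 2 * (r^-1 * u * v) = r^-1 * (B ^- 2 * (u * v)) by ring.
    by rewrite normrM gtr0_norm ?invr_gt0// ger_pMr ?invr_gt0// b1.
  have dd1 y : d1 (dual2 c r i j) y = r^-1 * (dual i)^`()%classic ((y.1 - c.1) / r) * dual j ((y.2 - c.2) / r).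
    exact: (@d1_tensor R (fun s => dual i ((s - c.1) / r)) (fun s => dual j ((s - c.2) / r)) y _ (is_derive_dual i c.1 r y.1)).
  have dd2 y : d2 (dual2 c r i j) y = r^-1 * (dual j)^`()%classic ((y.2 - c.2) / r) * dual i ((y.1 - c.1) / r).
    by rewrite mulrC; exact: (@d2_tensor R (fun s => dual i ((s - c.1) / r)) (fun s => dual j ((s - c.2) / r)) y _ (is_derive_dual j c.2 r y.2)).
  have HH : `|inner K F (fun y => B ^- 2 * dual2 c r i j y)| <= L * r ^+ 2.
    apply: (hF _ t1) => y.
    - by apply: b1; [case: (HB i ((y.1 - c.1) / r))|case: (HB j ((y.2 - c.2) / r))].
    - by rewrite (d1Z _ (sp i j)) dd1; apply: b2; [case: (HB i ((y.1 - c.1) / r))|case: (HB j ((y.2 - c.2) / r))].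
    - by rewrite (d2Z _ (sp i j)) dd2; apply: b2; [case: (HB j ((y.2 - c.2) / r))|case: (HB i ((y.1 - c.1) / r))].
  move: HH; have -> : inner K F (fun y => B ^- 2 * dual2 c r i j y) =
      B ^- 2 * inner K F (dual2 c r i j).
    rewrite /inner -RintegralZl//.
      by apply: eq_Rintegral => y _; ring.
    exact: (test_integrable mK (testM (smooth_poly pF) td)).
  rewrite aE// normrM gtr0_norm ?invr_gt0// ler_pdivrMl// normrM.
  rewrite [`|r ^+ 2|]gtr0_norm ?exprn_gt0// => h.
  by rewrite -(ler_pM2l (exprn_gt0 2 r0)) (le_trans h)//; lra.
(* Nonnegativity of [L] is read off a coefficient bound; the last comparison needs it for the index
   pairs without a term. *)
have L0 : 0 <= L.
  have := le_trans (normr_ge0 _) (ab ord0 ord0 isT).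
  by rewrite pmulr_rge0.
rewrite FE; apply: le_trans (ler_norm_sum _ _ _) _.
apply: (@le_trans _ _ (\sum_(k < n.+1) \sum_(l < n.+1) (B ^+ 2 * L) * P ^+ 2)).
  apply: ler_sum => k _; rewrite big_mkcond; apply: le_trans (ler_norm_sum _ _ _) _.
  apply: ler_sum => l _; case: ifP => kl; last first.
    by rewrite normr0; apply: mulr_ge0; [apply: mulr_ge0 => //; exact: ltW|exact: sqr_ge0].
  have H (s : R) (m : 'I_n.+1) : `|s| <= M * r -> `|s / r| ^+ m <= P.
    move=> hs; have h0 : `|s / r| <= 1 + M.
      rewrite normrM normfV (gtr0_norm r0) ler_pdivrMr// (le_trans hs)//.
      by rewrite mulrDl; have := ltW r0; lra.
    apply: (@le_trans _ _ ((1 + M) ^+ m)); first by apply: lerXn2r; rewrite ?nnegrE// addr_ge0.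
    by rewrite ler_weXn2l ?lerDl// -ltnS.
  move: xM; rewrite norm2_le => /andP[x1 x2].
  rewrite !normrM !normrX [P ^+ 2]expr2.
  apply: ler_pM; [exact: normr_ge0|by rewrite mulr_ge0 ?exprn_ge0|exact: ab|].
  by apply: ler_pM; rewrite ?exprn_ge0//; apply: H.
have S (z : R) : \sum_(l < n.+1) z = n.+1%:R * z.
  by rewrite sumr_const card_ord mulr_natl.
rewrite !S.
have -> : n.+1%:R * (n.+1%:R * (B ^+ 2 * L * P ^+ 2)) =
   n.+1%:R ^+ 2 * (B ^+ 2 * P ^+ 2) * L by ring.
exact: lexx.
Qed.

(** * Partition of unity on a square grid *)

Section Grid.
Context {R : realType}.
Variables (e : R) (N : nat).
Hypothesis e0 : 0 < e.
Notation M := (N.*2.+1).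
Implicit Types (a b : 'I_M) (w : 'I_M -> 'I_M -> R).

Definition tick (a : nat) : R := a%:R - N%:R.
Definition node a b : R * R := (e * tick a, e * tick b).
Definition tooth a (s : R) : R := hat (e^-1 * s + - tick a).
(** A smooth quasi-interpolant of the nodal values [w a b]: the products of teeth sum to 1 on the
    square of half-side [e * N], covered by 2 N + 1 nodes in each direction. *)
Definition grid w (x : R * R) : R :=
  \sum_(a < M) \sum_(b < M) w a b * (tooth a x.1 * tooth b x.2).

Lemma Cline_tooth n a : Cline n (tooth a).
Proof. exact: Cline_affine (Cline_hat n). Qed.

(** The sum telescopes because [hat] is a difference of consecutive values of [step]. *)
Lemma hat_sum (v : R) : \sum_(a < M) hat (v - tick a) = step (v + N%:R + 1) - step (v - N%:R).
Proof.
pose g (a : nat) : R := step (v + N%:R + 1 - a%:R).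
rewrite (eq_bigr (fun a : 'I_M => g a - g a.+1)); last first.
  by move=> a _; rewrite /hat /g /tick; congr (step _ - step _); rewrite -?natr1; ring.
rewrite -(big_mkord xpredT (fun a : nat => g a - g a.+1)).
transitivity (- \sum_(0 <= a < M) (g a.+1 - g a)).
  by rewrite -sumrN; apply: eq_bigr => a _; rewrite opprB.
rewrite telescope_sumr// opprB /g subr0; congr (step _ - step _).
by rewrite -addnn -natr1 natrD; ring.
Qed.

Lemma hat_sum_le1 (v : R) : \sum_(a < M) hat (v - tick a) <= 1.
Proof. by rewrite hat_sum; have := step_le1 (v + N%:R + 1); have := step_ge0 (v - N%:R); lra. Qed.

Lemma tooth_sum (s : R) : `|s| <= e * N%:R -> \sum_(a < M) tooth a s = 1.
Proof.
move=> sN; rewrite hat_sum.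
have : `|e^-1 * s| <= N%:R by rewrite normrM gtr0_norm ?invr_gt0// ler_pdivrMl.
by rewrite ler_norml => /andP[? ?]; rewrite step_eq1 ?step_eq0 ?subr0//; lra.
Qed.

Lemma tooth_ge0 a s : 0 <= tooth a s. Proof. exact: hat_ge0. Qed.

Lemma tooth_eq0 a s : e <= `|s - e * tick a| -> tooth a s = 0.
Proof.
move=> h; apply: hat_eq0; have -> : e^-1 * s - tick a = e^-1 * (s - e * tick a) by field; rewrite gt_eqF.
by rewrite normrM gtr0_norm ?invr_gt0// ler_pdivlMl ?mulr1.
Qed.

Lemma hat_derive_bound : exists2 B : R, 0 < B & forall s : R, `|hat^`()%classic s| <= B.
Proof.
have [_ C] := Cline_derive (@Cline_hat R 1).
have [B B0 HB] := @bounded_on_box R (fun x => hat^`()%classic x.1) 2 (continuous_fst2 (Cline_cont C)).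
exists (B + 1) => [|s]; first lra.
have [s1|s1] := leP `|s| 2.
  by have := HB (s, 0); rewrite norm2_le /= s1 normr0 ler0n => /(_ isT); lra.
have -> : hat^`()%classic s = 0.
  rewrite derive1E -[RHS](@derive_cst R R R 0 1 s); apply: near_eq_derive.
  have : \forall t \near s, 1 < `|t|.
    have := @norm_continuous R R s; move/cvgrPdist_lt => /(_ 1 ltr01).
    by apply: filterS => t; rewrite ltr_norml; lra.
  by apply: filterS => t t1; apply: hat_eq0; exact: ltW.
by rewrite normr0; lra.
Qed.

Lemma hat_derive_eq0 (s : R) : 1 < `|s| -> hat^`()%classic s = 0.
Proof.
move=> s1; rewrite derive1E -[RHS](@derive_cst R R R 0 1 s); apply: near_eq_derive.
have : \forall t \near s, 1 < `|t|.
  have := @norm_continuous R R s; move/cvgrPdist_lt => /(_ (`|s| - 1)).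
  by rewrite subr_gt0 => /(_ s1); apply: filterS => t; rewrite ltr_norml; lra.
by apply: filterS => t t1; apply: hat_eq0; exact: ltW.
Qed.

Definition dtooth a (s : R) : R := e^-1 * hat^`()%classic (e^-1 * s + - tick a).

Lemma is_derive_tooth a (s : R) : is_derive s (1 : R) (tooth a) (dtooth a s).
Proof.
have [df _] := Cline_derive (@Cline_hat R 1).
have d1 : is_derive s (1 : R) (fun s => e^-1 * s + - tick a) e^-1.
  have := is_derive_poly ((e^-1)%:P * 'X + (- tick a)%:P) s.
  rewrite derivD derivM !derivC derivX mul0r add0r mulr1 addr0 hornerC.
  by congr is_derive; apply/funext => y; rewrite hornerD hornerM !hornerC hornerX.
have := @is_derive1_comp _ hat (fun s => e^-1 * s + - tick a) s _ _ (df _) d1.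
by rewrite mulrC.
Qed.

Lemma dtooth_eq0 a s : e < `|s - e * tick a| -> dtooth a s = 0.
Proof.
move=> h; rewrite /dtooth hat_derive_eq0 ?mulr0//.
have -> : e^-1 * s - tick a = e^-1 * (s - e * tick a) by field; rewrite gt_eqF.
by rewrite normrM gtr0_norm ?invr_gt0// ltr_pdivlMl ?mulr1.
Qed.

Lemma smooth_teeth a b : smooth (fun x : R * R => tooth a x.1 * tooth b x.2).
Proof. by apply: smooth_tensor => n; exact: Cline_tooth. Qed.

Lemma smooth_grid w : smooth (grid w).
Proof.
by apply: smooth_sum => a; apply: smooth_sum => b; apply: smoothZ; exact: smooth_teeth.
Qed.

Lemma d1_grid w x : d1 (grid w) x = \sum_(a < M) \sum_(b < M) w a b * (dtooth a x.1 * tooth b x.2).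
Proof.
rewrite /grid d1_sum; last first.
  by move=> a; apply: smooth_sum => b; apply: smoothZ; exact: smooth_teeth.
apply: eq_bigr => a _; rewrite d1_sum; last by move=> b; apply: smoothZ; exact: smooth_teeth.
apply: eq_bigr => b _; rewrite (d1Z _ (smooth_teeth a b)).
by rewrite (@d1_tensor R (tooth a) (tooth b) x _ (is_derive_tooth a x.1)).
Qed.

Lemma d2_grid w x : d2 (grid w) x = \sum_(a < M) \sum_(b < M) w a b * (tooth a x.1 * dtooth b x.2).
Proof.
rewrite /grid d2_sum; last first.
  by move=> a; apply: smooth_sum => b; apply: smoothZ; exact: smooth_teeth.
apply: eq_bigr => a _; rewrite d2_sum; last by move=> b; apply: smoothZ; exact: smooth_teeth.
apply: eq_bigr => b _; rewrite (d2Z _ (smooth_teeth a b)).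
by rewrite (@d2_tensor R (tooth a) (tooth b) x _ (is_derive_tooth b x.2)).
Qed.

Lemma dtooth_sum (s : R) : `|s| < e * N%:R -> \sum_(a < M) dtooth a s = 0.
Proof.
move=> sN; have H : is_derive s (1 : R) (fun s => \sum_(a < M) tooth a s) (\sum_(a < M) dtooth a s).
  have := @is_derive_sum R R R M (fun a => tooth a) s 1 (fun a => dtooth a s) (fun a => is_derive_tooth a s).
  by congr is_derive; apply/funext => t; rewrite fct_sumE.
case: H => _ <-; rewrite -[RHS](@derive_cst R R R 1 1 s); apply: near_eq_derive.
have : \forall t \near s, `|t| < e * N%:R.
  have := @norm_continuous R R s; move/cvgrPdist_lt => /(_ (e * N%:R - `|s|)).
  by rewrite subr_gt0 => /(_ sN); apply: filterS => t; rewrite ltr_norml; lra.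
by apply: filterS => t t1; apply: tooth_sum; exact: ltW.
Qed.

(* [hat (v - 1) + hat v + hat (v + 1) = 1] on the support of [hat], so each
   family of translates of the support is counted at most three times. *)
Lemma dtooth_abs_sum (B s : R) : (forall t, `|hat^`()%classic t| <= B) ->
  \sum_(a < M) `|dtooth a s| <= 3 * B / e.
Proof.
move=> HB; set u := e^-1 * s.
have B0 : 0 <= B by apply: le_trans (HB 0).
apply: (@le_trans _ _ (\sum_(a < M) (B / e) * (hat (u - 1 - tick a) + hat (u - tick a) + hat (u + 1 - tick a)))).
  apply: ler_sum => a _; rewrite /dtooth -/u normrM (gtr0_norm (x := e^-1)) ?invr_gt0//.
  have k1 := hat_ge0 (u - 1 - tick a); have k2 := hat_ge0 (u - tick a).
  have k3 := hat_ge0 (u + 1 - tick a).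
  have [h|h] := ltP 1 `|u - tick a|.
    rewrite hat_derive_eq0// normr0 mulr0; apply: mulr_ge0; last exact: addr_ge0 (addr_ge0 k1 k2) k3.
    by rewrite mulr_ge0// invr_ge0 ltW.
  have -> : hat (u - 1 - tick a) + hat (u - tick a) + hat (u + 1 - tick a) = 1.
    move: h; rewrite ler_norml => /andP[h1 h2]; rewrite /hat.
    have -> : u - 1 - tick a + 1 = u - tick a by ring.
    have -> : u + 1 - tick a = u - tick a + 1 by ring.
    by rewrite (@step_eq1 _ (_ + 1 + 1)) ?(@step_eq0 _ (u - 1 - tick a)); lra.
  by rewrite mulr1 mulrC ler_wpM2r// invr_ge0 ltW.
rewrite -mulr_sumr big_split /= big_split /=.
have := hat_sum_le1 (u - 1); have := hat_sum_le1 u; have := hat_sum_le1 (u + 1).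
set X := \sum_(a < M) hat (u + 1 - _); set Y := \sum_(a < M) hat (u - _); set Z := \sum_(a < M) hat _.
move=> h1 h2 h3; have Be : 0 <= B / e by rewrite mulr_ge0// invr_ge0 ltW.
have -> : 3 * B / e = (B / e) * 3 by ring.
by rewrite ler_wpM2l//; lra.
Qed.

Lemma sum_prod_abs_le (F G : 'I_M -> R) (A B : R) : 0 <= B ->
  \sum_(a < M) `|F a| <= A -> \sum_(b < M) `|G b| <= B ->
  \sum_(a < M) \sum_(b < M) `|F a| * `|G b| <= A * B.
Proof.
move=> B0 hA hB; under eq_bigr do rewrite -mulr_sumr.
rewrite -mulr_suml; apply: ler_pM => //; by apply: sumr_ge0.
Qed.

Lemma weighted_sum_le w (F G : 'I_M -> R) (A B S T : R) : 0 <= B -> 0 <= T ->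
  \sum_(a < M) `|F a| <= S -> \sum_(b < M) `|G b| <= T ->
  (forall a b, F a * G b != 0 -> `|w a b - A| <= B) ->
  `|\sum_(a < M) \sum_(b < M) (w a b - A) * (F a * G b)| <= B * (S * T).
Proof.
move=> B0 T0 hS hT hw; apply: le_trans (ler_norm_sum _ _ _) _.
apply: (@le_trans _ _ (B * \sum_(a < M) \sum_(b < M) `|F a| * `|G b|)); last first.
  by rewrite ler_wpM2l// sum_prod_abs_le.
rewrite mulr_sumr; apply: ler_sum => a _; apply: le_trans (ler_norm_sum _ _ _) _.
rewrite mulr_sumr; apply: ler_sum => b _; rewrite !normrM.
have [/eqP|/hw h] := eqVneq (F a * G b) 0.
  by rewrite mulf_eq0 => /orP[/eqP->|/eqP->]; rewrite normr0 ?mul0r !mulr0 ?mul0r.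
by rewrite ler_wpM2r// mulr_ge0.
Qed.

(** Inside the grid the teeth sum to 1 and their derivatives to 0, so [w] may be replaced by
    [w - A]; only nodes within [e] of [x] carry weight. An oscillation [B] over one mesh width thus
    gives a gradient of order [B / e]. *)
Lemma grid_bound (B0 : R) w x (A B : R) : (forall t : R, `|hat^`()%classic t| <= B0) ->
  0 <= B -> `|x| < e * N%:R -> (forall a b, `|x - node a b| <= e -> `|w a b - A| <= B) ->
  [/\ `|grid w x - A| <= B, `|d1 (grid w) x| <= B * (3 * B0 / e)
    & `|d2 (grid w) x| <= B * (3 * B0 / e)].
Proof.
move=> HB Bp; rewrite norm2_lt => /andP[x1 x2] hw.
have B00 : 0 <= B0 by apply: le_trans (HB 0).
have T0 a s : tooth a s != 0 -> `|s - e * tick a| <= e.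
  by apply: contraNT; rewrite -ltNge => /ltW /tooth_eq0 ->.
have D0 a s : dtooth a s != 0 -> `|s - e * tick a| <= e.
  by apply: contraNT; rewrite -ltNge => /dtooth_eq0 ->.
have S1 s : `|s| < e * N%:R -> \sum_(a < M) `|tooth a s| = 1.
  move=> sN; rewrite -[RHS](tooth_sum (ltW sN)); apply: eq_bigr => a _.
  by rewrite ger0_norm// tooth_ge0.
have split2 (F G : 'I_M -> R) : \sum_(a < M) \sum_(b < M) w a b * (F a * G b) =
    \sum_(a < M) \sum_(b < M) (w a b - A) * (F a * G b) + A * ((\sum_(a < M) F a) * (\sum_(b < M) G b)).
  rewrite [X in A * X]mulr_suml mulr_sumr -big_split; apply: eq_bigr => a _ /=.
  rewrite mulr_sumr mulr_sumr -big_split; apply: eq_bigr => b _ /=; ring.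
have E0 : 0 <= 3 * B0 / e by rewrite divr_ge0 ?mulr_ge0// ltW.
split.
- rewrite /grid split2 (tooth_sum (ltW x1)) (tooth_sum (ltW x2)) !mulr1 addrK.
  apply: (@le_trans _ _ (B * (1 * 1))); last by rewrite !mulr1.
  apply: weighted_sum_le; rewrite ?S1//.
  move=> a b; rewrite mulf_eq0 negb_or => /andP[/T0 h1 /T0 h2].
  by apply: hw; rewrite norm2_le/= h1 h2.
- rewrite d1_grid split2 dtooth_sum// mul0r mulr0 addr0.
  rewrite -[3 * B0 / e]mulr1.
  apply: weighted_sum_le; rewrite ?S1//; first exact: dtooth_abs_sum.
  move=> a b; rewrite mulf_eq0 negb_or => /andP[/D0 h1 /T0 h2].
  by apply: hw; rewrite norm2_le/= h1 h2.
- rewrite d2_grid split2 (dtooth_sum x2) mulr0 mulr0 addr0.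
  rewrite -[3 * B0 / e]mul1r.
  apply: weighted_sum_le; rewrite ?S1//; first exact: dtooth_abs_sum.
  move=> a b; rewrite mulf_eq0 negb_or => /andP[/T0 h1 /D0 h2].
  by apply: hw; rewrite norm2_le/= h1 h2.
Qed.

End Grid.

(** * Star-shaped polygons *)

Section Star_shaped.
Context {R : realType}.
Implicit Types (x y b u : R * R) (s t l : R).

Lemma enorm_ge0 x : 0 <= enorm x. Proof. exact: sqrtr_ge0. Qed.

Lemma norm_le_enorm x : `|x| <= enorm x.
Proof.
rewrite norm2_le; apply/andP; split; rewrite -sqrtr_sqr ler_sqrt /dot -!expr2.
- by rewrite lerDl sqr_ge0.
- by rewrite addr_ge0 ?sqr_ge0.
- by rewrite lerDr sqr_ge0.
- by rewrite addr_ge0 ?sqr_ge0.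
Qed.

Lemma enorm_le_norm x : enorm x <= 2 * `|x|.
Proof.
have n0 := normr_ge0 x; rewrite /enorm -[leRHS]ger0_norm ?mulr_ge0// -sqrtr_sqr.
rewrite ler_sqrt ?sqr_ge0// /dot -!expr2 -(real_normK (num_real x.1)) -(real_normK (num_real x.2)).
have := norm2_fst x; have := norm2_snd x.
have := normr_ge0 x.1; have := normr_ge0 x.2; nra.
Qed.

Lemma enorm_gt0 x : x != 0 -> 0 < enorm x.
Proof. by move=> x0; apply: lt_le_trans (norm_le_enorm x); rewrite normr_gt0. Qed.

Definition homot (c : R * R) s x : R * R := c + s *: (x - c).

Lemma homotM c s t x : homot c s (homot c t x) = homot c (s * t) x.
Proof. by rewrite /homot addrAC subrr add0r scalerA. Qed.

Lemma homot1 c x : homot c 1 x = x.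
Proof. by rewrite /homot scale1r addrC subrK. Qed.

Lemma homotK c s x : s != 0 -> homot c s^-1 (homot c s x) = x.
Proof. by move=> s0; rewrite homotM mulVf// homot1. Qed.

Lemma homotVK c s x : s != 0 -> homot c s (homot c s^-1 x) = x.
Proof. by move=> s0; rewrite homotM divff// homot1. Qed.

Lemma homotB c s x y : homot c s x - homot c s y = s *: (x - y).
Proof. by rewrite /homot opprD addrACA subrr add0r -scalerBr opprB addrA subrK. Qed.

Variables (K : set (R * R)) (c : R * R) (r : R).
Hypothesis oK : open K.
Hypothesis r0 : 0 < r.
Hypothesis dK : disc c r `<=` K.
Hypothesis sK : star_shaped_disc K c r.

Lemma star_center : K c.
Proof.
apply: dK; rewrite /disc /= subrr /enorm /dot /= !mulr0 addr0 sqrtr0//.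
Qed.

Lemma closure_approx x (e : R) : closure K x -> 0 < e -> exists2 y, K y & `|x - y| < e.
Proof.
move=> /(_ (ball x e)) H e0; have [|y [Ky]] := H; first exact: nbhsx_ballx.
by rewrite ball2E => xy; exists y.
Qed.

(** The point is the convex combination, with weights s and 1 - s, of [b] and of c + u / (1 - s).
    The latter lies in the disc, because the square of half-side r/2 does. Contracted points
    therefore keep a margin proportional to 1 - s. *)
Lemma star_ball_open b s u : K b -> 0 <= s -> s < 1 -> `|u| <= (1 - s) * (r / 2) ->
  K (homot c s b + u).
Proof.
move=> Kb s0 s1 hu; have s1' : 0 < 1 - s by lra.
have dy : disc c r (c + (1 - s)^-1 *: u).
  apply: disc_box => //; rewrite addrAC subrr add0r normrZ gtr0_norm ?invr_gt0//.
  by rewrite ler_pdivrMl.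
apply: (sK Kb dy); exists (1 - s) => /=; first by rewrite in_itv/=; lra.
rewrite /seg_pt /homot scalerBr scalerDr scalerA divff ?gt_eqF// scale1r.
rewrite !scalerBl !scale1r !scalerBr.
by rewrite [LHS]surjective_pairing [RHS]surjective_pairing; congr pair => /=; ring.
Qed.

Lemma star_ball b s u : closure K b -> 0 <= s -> s < 1 -> `|u| < (1 - s) * (r / 2) ->
  K (homot c s b + u).
Proof.
move=> Kb s0 s1 hu.
have [b' Kb' bb] := closure_approx Kb (e := (1 - s) * (r / 2) - `|u|) ltac:(lra).
have -> : homot c s b + u = homot c s b' + (u + s *: (b - b')).
  by rewrite -(homotB c) addrCA [homot c s b' + _]addrC subrK addrC.
apply: star_ball_open => //; apply: le_trans (ler_normD _ _) _.
rewrite normrZ ger0_norm//; have := normr_ge0 (b - b'); nra.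
Qed.

Lemma star_homot b s : closure K b -> 0 <= s -> s < 1 -> K (homot c s b).
Proof.
move=> Kb s0 s1; rewrite -[homot c s b]addr0; apply: star_ball => //.
by rewrite normr0 mulr_gt0 ?divr_gt0//; lra.
Qed.

Lemma star_homot_closure b s : closure K b -> 0 <= s -> s <= 1 -> closure K (homot c s b).
Proof.
rewrite [s <= 1]le_eqVlt => Kb s0 /orP[/eqP->|s1]; first by rewrite homot1.
by apply: subset_closure; exact: star_homot.
Qed.

(** A point of [U] is a proper contraction towards [c] of a nearby point of [U], and proper
    contractions of closure points lie in [K]. Later this places the inscribed discs of the
    triangles inside [K] and not merely in its closure. *)
Lemma open_sub_closure (U : set (R * R)) : open U -> U `<=` closure K -> U `<=` K.
Proof.
move=> /open2P oU UK x Ux; have [e e0 hU] := oU x Ux.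
have n0 := normr_ge0 (x - c); pose t := e / (2 * (`|x - c| + 1)).
have t0 : 0 < t by rewrite divr_gt0// mulr_gt0//; lra.
have : U (homot c (1 + t) x).
  apply: hU; rewrite -[X in X - _](homot1 c) /homot opprD addrACA subrr add0r -scalerBl.
  rewrite normrZ opprD addrA subrr add0r normrN gtr0_norm// /t.
  by rewrite mulrC mulrA ltr_pdivrMr; last lra; nra.
move=> /UK cK; rewrite -[x](@homotK c (1 + t)); last lra.
apply: star_homot => //; first by rewrite invr_ge0; lra.
by rewrite invf_lt1; lra.
Qed.

(** The boundary layer left by the contraction of [K] with ratio [l]. Cut-off functions vary only
    there. *)
Definition strip l : set (R * R) := K `\` [set homot c l x | x in K].

Lemma strip_sub l : strip l `<=` K. Proof. by move=> x []. Qed.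

Lemma boundary_not_in_homot b s l : ~ K b -> closure K b -> 0 < l -> l <= s ->
  ~ [set homot c l x | x in K] (homot c s b).
Proof.
move=> nKb cb l0 ls [y Ky E]; apply: nKb.
have s0 : s != 0 by rewrite gt_eqF// (lt_le_trans l0).
rewrite -(homotK c b s0) -E homotM.
have [->|sl] := eqVneq s l; first by rewrite mulVf ?gt_eqF// homot1.
apply: star_homot; first exact: subset_closure.
  by rewrite mulr_ge0 ?invr_ge0; lra.
by rewrite mulrC ltr_pdivrMr ?mul1r ?(lt_le_trans l0)// lt_neqAle eq_sym sl.
Qed.

Lemma strip_param b s l : ~ K b -> closure K b -> 0 < l -> l <= s -> s < 1 ->
  strip l (homot c s b).
Proof.
move=> nKb cb l0 ls s1; split; first by apply: star_homot => //; lra.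
exact: boundary_not_in_homot.
Qed.

(** The ray from [c] through [x] leaves [K] at the parameter [S = sup T]. If it stayed in [K] beyond
    1/l, then the point at 1/l would be in [K] and [x] in the contracted copy; hence [S <= 1 / l],
    and [x] is the contraction of the exit point with ratio 1/S. *)
Lemma strip_exit x l : 0 < l -> l < 1 -> strip l x ->
  exists b s, [/\ closure K b, ~ K b, l <= s, s <= 1 & x = homot c s b].
Proof.
move=> l0 l1 [Kx nx].
have xc : x != c.
  apply/eqP => E; apply: nx; exists c; first exact: star_center.
  by rewrite E /homot subrr scaler0 addr0.
pose T := [set t : R | 0 <= t /\ K (homot c t x)].
have T1 : T 1 by split=> //; rewrite homot1.
have Tub t : T t -> t <= l^-1.
  move=> [t0 Kt]; rewrite leNgt; apply/negP => tl; apply: nx.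
  have tp : 0 < t by apply: lt_trans tl; rewrite invr_gt0.
  exists (homot c l^-1 x); last by rewrite homotVK ?gt_eqF.
  have -> : homot c l^-1 x = homot c (l^-1 / t) (homot c t x).
    by rewrite homotM divfK ?gt_eqF.
  apply: star_homot; first exact: subset_closure.
    by rewrite divr_ge0 ?invr_ge0 ?ltW.
  by rewrite ltr_pdivrMr ?mul1r.
have hT : has_sup T by split; [exists 1|exists l^-1 => t; exact: Tub].
pose S := sup T.
have S1 : 1 <= S by exact: (sup_upper_bound hT T1).
have Sl : S <= l^-1 by apply: ge_sup; [exists 1|move=> t; exact: Tub].
have nb : 0 < `|x - c| by rewrite normr_gt0 subr_eq0.
exists (homot c S x), S^-1; split.
- move=> B /nbhs_ballP[e /= e0 he].
  have [t [t0 Kt] tS] := sup_adherent (divr_gt0 e0 nb) hT.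
  have tS' : t <= S by apply: (sup_upper_bound hT); split.
  exists (homot c t x); split=> //; apply: he; rewrite ball2E.
  rewrite /homot opprD addrACA subrr add0r -scalerBl normrZ ger0_norm ?subr_ge0//.
  by rewrite -ltr_pdivlMr//; rewrite -/S in tS; lra.
- move=> KS; have [e e0 he] := (open2P K).1 oK _ KS.
  pose t := S + e / (2 * `|x - c|).
  have et : 0 < e / (2 * `|x - c|) by rewrite divr_gt0// mulr_gt0.
  have : T t.
    split; first by rewrite /t; lra.
    apply: he; rewrite /homot opprD addrACA subrr add0r -scalerBl normrZ.
    rewrite /t opprD addrA subrr add0r normrN gtr0_norm//.
    have -> : e / (2 * `|x - c|) * `|x - c| = e / 2 by field; rewrite gt_eqF.
    by lra.
  by move=> /(sup_upper_bound hT); rewrite -/S /t; lra.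
- by rewrite -[l]invrK lef_pV2// posrE ?invr_gt0//; lra.
- by rewrite invf_le1//; lra.
- by rewrite homotK// gt_eqF//; lra.
Qed.

Lemma homot_open l : 0 < l -> open [set homot c l x | x in K].
Proof.
move=> l0; apply/open2P => _ [x Kx <-]; have [e e0 he] := (open2P K).1 oK x Kx.
exists (l * e); first exact: mulr_gt0.
move=> y xy; exists (homot c l^-1 y); last by rewrite homotVK ?gt_eqF.
apply: he; rewrite -[x](@homotK c l) ?gt_eqF// homotB normrZ gtr0_norm ?invr_gt0//.
by rewrite ltr_pdivrMl.
Qed.

Lemma strip_measurable l : 0 < l -> measurable (strip l).
Proof.
move=> l0; apply: measurableD; apply: open2_measurable => //; exact: homot_open.
Qed.

End Star_shaped.

(** * Inequalities along a ray *)

Section Radial_inequalities.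
Context {R : realType}.
Notation mu := (@lebesgue_measure R).

Lemma continuous_integrable_itv (f : R -> R) (a b : R) : continuous f ->
  mu.-integrable `[a, b] (EFin \o f).
Proof.
move=> cf; apply: continuous_compact_integrable; first exact: segment_compact.
exact: continuous_subspaceT.
Qed.

Lemma continuous_integral_itv (f : R -> R) (a b : R) : continuous f ->
  (\int[mu]_(s in `[a, b]) (f s)%:E = (\int[mu]_(s in `[a, b]) f s)%:E)%E.
Proof.
by move=> cf; rewrite /Rintegral fineK// integrable_fin_num//; exact: continuous_integrable_itv.
Qed.

(** The fundamental theorem for (s - a) g(s)^2: the weight vanishes at [a], so only the value at the
    end point 1 survives. Both radial inequalities come from this identity. *)
Lemma weighted_ftc (g dg : R -> R) (a : R) : a < 1 ->
  (forall s, is_derive s (1 : R) g (dg s)) -> continuous dg ->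
  (1 - a) * g 1 ^+ 2 = \int[mu]_(s in `[a, 1]) (g s ^+ 2 + 2 * (s - a) * g s * dg s).
Proof.
move=> a1 hg cdg; pose F s := (s - a) * g s ^+ 2.
have cg : continuous g by apply: derivable_line_continuous => s; case: (hg s).
have hF s : is_derive s (1 : R) F (g s ^+ 2 + 2 * (s - a) * g s * dg s).
  have h1 : is_derive s (1 : R) (fun s => s - a) 1.
    have := is_derive_poly ('X - a%:P) s; rewrite derivB derivX derivC subr0 hornerC.
    by congr is_derive; apply/funext => t; rewrite hornerD hornerN hornerX hornerC.
  have h2 := is_deriveM (hg s) (hg s).
  have h3 := is_deriveM h1 h2.
  have -> : F = (fun s => s - a) * (g * g) by apply/funext => t; rewrite /F expr2.
  apply: (is_derive_eq h3).
  change ((s - a) * (g s * dg s + g s * dg s) + g s * g s * 1 = g s ^+ 2 + 2 * (s - a) * g s * dg s).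
  by ring.
have cF : continuous F by apply: derivable_line_continuous => s; case: (hF s).
have cf : continuous (fun s => g s ^+ 2 + 2 * (s - a) * g s * dg s).
  move=> s; apply: (@continuousD R R R (fun s => g s ^+ 2)).
    by have := continuousM (cg s) (cg s).
  apply: (@continuousM R R (fun s => 2 * (s - a) * g s)); last exact: cdg.
  apply: (@continuousM R R (fun s => 2 * (s - a))); last exact: cg.
  by apply: continuousM; [exact: cst_continuous|apply: continuousB => //; exact: cst_continuous].
apply: EFin_inj; rewrite -continuous_integral_itv//.
rewrite (@continuous_FTC2 _ _ F)//.
- by rewrite /F subrr mul0r sube0.
- exact: continuous_subspaceT.
- split; [by move=> s _; case: (hF s)|exact: cvg_at_right_filter (cF _)|
    exact: cvg_at_left_filter (cF _)].
- by move=> s _; rewrite derive1E; case: (hF s).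
Qed.

Lemma sqr_continuous (g : R -> R) : continuous g -> continuous (fun s => g s ^+ 2).
Proof. by move=> cg s; have := continuousM (cg s) (cg s). Qed.

(** From (g + 2 (s - a) g')^2 >= 0, the integrand of the identity is at least g^2 / 2 - 2 (1 - a)^2
    g'^2. This bounds the strip by the boundary value with one power of 1 - a and by the derivative
    with two. *)
Lemma radial_strip (g dg : R -> R) (a : R) : a < 1 ->
  (forall s, is_derive s (1 : R) g (dg s)) -> continuous dg ->
  \int[mu]_(s in `[a, 1]) g s ^+ 2 <=
  2 * (1 - a) * g 1 ^+ 2 + 4 * (1 - a) ^+ 2 * \int[mu]_(s in `[a, 1]) dg s ^+ 2.
Proof.
move=> a1 hg cdg; have E := weighted_ftc a1 hg cdg.
have cg : continuous g by apply: derivable_line_continuous => s; case: (hg s).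
have i1 := continuous_integrable_itv a 1 (sqr_continuous cg).
have i2 := continuous_integrable_itv a 1 (sqr_continuous cdg).
have cf : continuous (fun s => g s ^+ 2 + 2 * (s - a) * g s * dg s).
  move=> s; apply: (@continuousD R R R (fun s => g s ^+ 2)); first exact: sqr_continuous.
  apply: (@continuousM R R (fun s => 2 * (s - a) * g s)); last exact: cdg.
  apply: (@continuousM R R (fun s => 2 * (s - a))); last exact: cg.
  by apply: continuousM; [exact: cst_continuous|apply: continuousB => //; exact: cst_continuous].
have c1 : continuous (fun s => 2^-1 * g s ^+ 2).
  by move=> s; apply: (@continuousM R R (fun=> 2^-1) (fun s => g s ^+ 2)); [exact: cst_continuous|exact: sqr_continuous].
have c2 : continuous (fun s => 2 * (1 - a) ^+ 2 * dg s ^+ 2).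
  by move=> s; apply: (@continuousM R R (fun=> 2 * (1 - a) ^+ 2) (fun s => dg s ^+ 2)); [exact: cst_continuous|exact: sqr_continuous].
have : \int[mu]_(s in `[a, 1]) (2^-1 * g s ^+ 2 - 2 * (1 - a) ^+ 2 * dg s ^+ 2) <= (1 - a) * g 1 ^+ 2.
  rewrite E; apply: le_Rintegral => //.
  - apply: continuous_integrable_itv => s; apply: (@continuousB R R R (fun s => 2^-1 * g s ^+ 2)); [exact: c1|exact: c2].
  - exact: continuous_integrable_itv.
  - move=> s; rewrite /= in_itv/= => /andP[s1 s2].
    have : 0 <= (g s + 2 * (s - a) * dg s) ^+ 2 by exact: sqr_ge0.
    have : (s - a) ^+ 2 * dg s ^+ 2 <= (1 - a) ^+ 2 * dg s ^+ 2.
      by rewrite ler_wpM2r ?sqr_ge0// lerXn2r ?nnegrE; lra.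
    by have := sqr_ge0 (g s); nra.
rewrite RintegralB//; [|exact: continuous_integrable_itv..].
rewrite !RintegralZl//; lra.
Qed.

(** The same identity read in the other direction, with 2 (s - a) g g' <= g^2 + (s - a)^2 g'^2. *)
Lemma radial_trace (g dg : R -> R) (a : R) : a < 1 ->
  (forall s, is_derive s (1 : R) g (dg s)) -> continuous dg ->
  (1 - a) * g 1 ^+ 2 <= \int[mu]_(s in `[a, 1]) (2 * g s ^+ 2 + (1 - a) ^+ 2 * dg s ^+ 2).
Proof.
move=> a1 hg cdg; rewrite (weighted_ftc a1 hg cdg).
have cg : continuous g by apply: derivable_line_continuous => s; case: (hg s).
apply: le_Rintegral => //.
- apply: continuous_integrable_itv => s.
  apply: (@continuousD R R R (fun s => g s ^+ 2)); first exact: sqr_continuous.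
  apply: (@continuousM R R (fun s => 2 * (s - a) * g s)); last exact: cdg.
  apply: (@continuousM R R (fun s => 2 * (s - a))); last exact: cg.
  by apply: continuousM; [exact: cst_continuous|apply: continuousB => //; exact: cst_continuous].
- apply: continuous_integrable_itv => s.
  apply: (@continuousD R R R (fun s => 2 * g s ^+ 2)).
    by apply: (@continuousM R R (fun=> 2) (fun s => g s ^+ 2)); [exact: cst_continuous|exact: sqr_continuous].
  by apply: (@continuousM R R (fun=> (1 - a) ^+ 2) (fun s => dg s ^+ 2)); [exact: cst_continuous|exact: sqr_continuous].
- move=> s; rewrite /= in_itv/= => /andP[s1 s2].
  have : 0 <= (g s - (s - a) * dg s) ^+ 2 by exact: sqr_ge0.
  have : (s - a) ^+ 2 * dg s ^+ 2 <= (1 - a) ^+ 2 * dg s ^+ 2.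
    by rewrite ler_wpM2r ?sqr_ge0// lerXn2r ?nnegrE; lra.
  by nra.
Qed.

End Radial_inequalities.

(** * Coordinates of polar type over an edge *)

Section Fan.
Context {R : realType}.
Notation mu := (@lebesgue_measure R).
Variables (c p q : R * R).
Hypothesis D0 : det2 (p - c) (q - p) != 0.
Notation D := (det2 (p - c) (q - p)).
Implicit Types (H : R * R -> \bar R) (l s t : R).

Definition fan_pt s t : R * R := homot c s (seg_pt p q t).

Lemma fan_ptE s t : fan_pt s t = c + s *: ((p - c) + t *: (q - p)).
Proof. by rewrite /fan_pt /homot /seg_pt addrAC. Qed.

Definition sector l : set (R * R) :=
  [set x | exists s t, [/\ l <= s <= 1, 0 <= t <= 1 & x = fan_pt s t]].

(** Cramer's rule recovers [s] and the product [s * t]. Both are affine in the point, whereas [t]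
    alone is not; this makes the sectors visibly measurable. *)
Definition fan_s (x : R * R) : R := det2 (x - c) (q - p) / D.
Definition fan_st (x : R * R) : R := det2 (p - c) (x - c) / D.

Lemma fan_s_pt s t : fan_s (fan_pt s t) = s.
Proof.
rewrite /fan_s fan_ptE; have -> : det2 (c + s *: (p - c + t *: (q - p)) - c) (q - p) = s * D.
  by rewrite /det2/= /GRing.scale/=; ring.
by rewrite mulfK.
Qed.

Lemma fan_st_pt s t : fan_st (fan_pt s t) = s * t.
Proof.
rewrite /fan_st fan_ptE.
have -> : det2 (p - c) (c + s *: (p - c + t *: (q - p)) - c) = s * t * D.
  by rewrite /det2/= /GRing.scale/=; ring.
by rewrite mulfK.
Qed.

Lemma fan_pt_coord x : fan_s x != 0 -> x = fan_pt (fan_s x) (fan_st x / fan_s x).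
Proof.
move=> s0; rewrite fan_ptE scalerDr scalerA mulrC divfK//.
rewrite /fan_s /fan_st; apply/eqP; rewrite -subr_eq0; apply/eqP.
have D1 := D0; rewrite /det2/= in D1.
rewrite [LHS]surjective_pairing /det2 /= /GRing.scale/=; congr pair; field; exact: D1.
Qed.

Lemma sectorE l : 0 < l -> sector l = [set x | l <= fan_s x <= 1 /\ 0 <= fan_st x <= fan_s x].
Proof.
move=> l0; apply/seteqP; split=> [_ [s [t [/andP[s1 s2] /andP[t1 t2] ->]]]|x [/andP[s1 s2] /andP[t1 t2]]].
  rewrite /= fan_s_pt fan_st_pt s1 s2; split=> //; apply/andP; split.
    by rewrite mulr_ge0//; lra.
  by rewrite ger_pMr//; lra.
have sp : 0 < fan_s x by lra.
exists (fan_s x), (fan_st x / fan_s x); split; [by apply/andP| |].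
  by apply/andP; split; [rewrite divr_ge0 // ltW | rewrite ler_pdivrMr// mul1r].
by apply: fan_pt_coord; rewrite gt_eqF.
Qed.

Lemma measurable_fan_s : measurable_fun setT fan_s.
Proof.
apply: measurable_funM => //; rewrite /det2; apply: measurable_funB;
  by apply: measurable_funM => //=; apply: measurable_funB.
Qed.

Lemma measurable_fan_st : measurable_fun setT fan_st.
Proof.
apply: measurable_funM => //; rewrite /det2; apply: measurable_funB;
  by apply: measurable_funM => //=; apply: measurable_funB.
Qed.

Lemma sector_measurable l : 0 < l -> measurable (sector l).
Proof.
move=> l0; rewrite sectorE//.
have -> : [set x | l <= fan_s x <= 1 /\ 0 <= fan_st x <= fan_s x] =
   (fan_s @^-1` `[l, 1]) `&` ((fan_st @^-1` `[0, +oo[) `&` ((fan_s \- fan_st) @^-1` `[0, +oo[)).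
  apply/seteqP; split=> x /=; rewrite !in_itv/= !andbT subr_ge0.
    by move=> [-> /andP[-> ->]].
  by move=> [-> [-> ->]].
have mp (f : R * R -> R) (A : set R) : measurable_fun setT f -> measurable A -> measurable (f @^-1` A).
  by move=> mf mA; rewrite -[X in measurable X]setTI; exact: mf.
apply: measurableI; first exact: mp measurable_fan_s _.
apply: measurableI; first exact: mp measurable_fan_st _.
by apply: mp => //; apply: measurable_funB; [exact: measurable_fan_s|exact: measurable_fan_st].
Qed.

Lemma measurable_fan_pt : measurable_fun setT (fun z : R * R => fan_pt z.1 z.2).
Proof.
under eq_fun do rewrite fan_ptE.
apply: measurable_fun_pair => /=.
  by apply: measurable_funD => //; apply: measurable_funM => //;
    apply: measurable_funD => //; apply: measurable_funM.
by apply: measurable_funD => //; apply: measurable_funM => //;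
    apply: measurable_funD => //; apply: measurable_funM.
Qed.

(** The radial variable is put innermost, so that the one-dimensional inequalities can be applied on
    each ray before integrating along the edge. *)
Lemma sector_integral l H : 0 < l -> measurable_fun setT H -> (forall x, (0 <= H x)%E) ->
  (\int[leb2]_(x in sector l) H x = `|D|%:E *
     \int[mu]_(t in `[0%R, 1%R]) \int[mu]_(s in `[l, 1%R]) (`|s|%:E * H (fan_pt s t)))%E.
Proof.
move=> l0 mH H0; have mS := sector_measurable l0.
rewrite integral_mkcond (ge0_integral_fan c (a := p - c) (d := q - p))//; last 2 first.
- exact/(measurable_restrictT _ mS)/measurable_funTS.
- by move=> x; rewrite patchE; case: ifP.
congr (_ * _)%E.
pose F (z : R * R) : \bar R := (`|z.1|%:E * H (fan_pt z.1 z.2))%E.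
pose Q : set (R * R) := `[l, 1]%classic `*` `[0, 1]%classic.
have mQ : measurable Q by exact: measurableX.
have mF : measurable_fun setT F.
  apply: emeasurable_funM; first by apply/measurable_EFinP; apply: measurableT_comp.
  exact: (measurableT_comp mH measurable_fan_pt).
have F0 z : (0 <= F z)%E by rewrite mule_ge0.
have mFQ : measurable_fun setT (F \_ Q) by apply/(measurable_restrictT _ mQ)/measurable_funTS.
have FQ0 z : (0 <= (F \_ Q) z)%E by rewrite patchE; case: ifP.
transitivity (\int[mu]_s \int[mu]_t (F \_ Q) (s, t))%E.
  apply: eq_integral => s _; apply: eq_integral => t _.
  rewrite -fan_ptE !patchE /F/=; case: ifPn => h1; case: ifPn => h2 //.
    exfalso; move/negP: h2; apply; move: h1; rewrite !inE => h1.
    have := h1; rewrite sectorE//= fan_s_pt fan_st_pt => -[/andP[a1 a2] /andP[b1 b2]].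
    have sp : 0 < s by lra.
    split; rewrite /= in_itv/=; first by apply/andP.
    by rewrite -(pmulr_rge0 _ sp) b1 -(ler_pM2l sp) mulr1.
    exfalso; move/negP: h1; apply; move: h2; rewrite !inE => -[/=].
    by rewrite !in_itv/= => h1 h2; exists s, t.
  exact: mule0.
rewrite -(fubini_tonelli1 (m1 := mu) (m2 := mu) (F \_ Q) mFQ FQ0).
rewrite (fubini_tonelli2 (m1 := mu) (m2 := mu) (F \_ Q) mFQ FQ0) /fubini_G.
rewrite [RHS]integral_mkcond; apply: eq_integral => t _; rewrite [RHS]patchE.
case: ifPn => ht.
  rewrite [RHS]integral_mkcond; apply: eq_integral => s _; rewrite !patchE /F /=.
  have -> : ((s, t) \in Q) = (s \in `[l, 1]%classic) => //.
  apply/idP/idP; rewrite !inE; first by case.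
  by move: ht; rewrite inE => ht hs; split.
apply: integral0_eq => s _; rewrite patchE ifF//; apply/negbTE; apply: contra ht.
by rewrite !inE => -[].
Qed.

End Fan.

Section Fan_inequalities.
Context {R : realType}.
Notation mu := (@lebesgue_measure R).
Variables (c p q : R * R).
Hypothesis D0 : det2 (p - c) (q - p) != 0.
Notation D := (det2 (p - c) (q - p)).

Lemma fan_inner_measurable l (H : R * R -> R) : measurable_fun setT H -> (forall x, 0 <= H x) ->
  measurable_fun setT (fun t => \int[mu]_(s in `[l, 1%R]) (`|s|%:E * (H (fan_pt c p q s t))%:E))%E.
Proof.
move=> mH H0.
pose F (z : R * R) : \bar R := (`|z.1|%:E * (H (fan_pt c p q z.1 z.2))%:E)%E.
pose Q : set (R * R) := `[l, 1]%classic `*` setT.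
have mQ : measurable Q by exact: measurableX.
have mF : measurable_fun setT F.
  apply: emeasurable_funM; first by apply/measurable_EFinP; apply: measurableT_comp.
  apply/measurable_EFinP; exact: (measurableT_comp mH (measurable_fan_pt c p q)).
have F0 z : (0 <= F z)%E by rewrite mule_ge0// lee_fin.
have mFQ : measurable_fun setT (F \_ Q) by apply/(measurable_restrictT _ mQ)/measurable_funTS.
have FQ0 z : (0 <= (F \_ Q) z)%E by rewrite patchE; case: ifP.
have := @measurable_fun_fubini_tonelli_G _ _ _ _ R mu (F \_ Q) mFQ FQ0.
congr measurable_fun; apply/funext => t; rewrite [RHS]integral_mkcond.
apply: eq_integral => s _; rewrite !patchE /F /=.
have -> : ((s, t) \in Q) = (s \in `[l, 1]%classic) => //.
by apply/idP/idP; rewrite !inE; [case|split].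
Qed.

(** Integrates an inequality valid on every ray over the edge parameter. [A] and [B] carry the edge
    terms, and working with extended reals avoids any integrability condition. *)
Lemma fan_le l (H1 H2 : R * R -> R) (A B : R -> R) : 0 < l ->
  measurable_fun setT H1 -> measurable_fun setT H2 ->
  measurable_fun setT A -> measurable_fun setT B ->
  (forall x, 0 <= H1 x) -> (forall x, 0 <= H2 x) -> (forall t, 0 <= A t) -> (forall t, 0 <= B t) ->
  (forall t, (0 <= t <= 1)%R -> (B t)%:E + \int[mu]_(s in `[l, 1%R]) (`|s| * H1 (fan_pt c p q s t))%:E <=
             (A t)%:E + \int[mu]_(s in `[l, 1%R]) (`|s| * H2 (fan_pt c p q s t))%:E)%E ->
  (`|D|%:E * \int[mu]_(t in `[0%R, 1%R]) (B t)%:E + \int[leb2]_(x in sector c p q l) (H1 x)%:E <=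
   `|D|%:E * \int[mu]_(t in `[0%R, 1%R]) (A t)%:E + \int[leb2]_(x in sector c p q l) (H2 x)%:E)%E.
Proof.
move=> l0 m1 m2 mA mB h1 h2 hA hB hle.
have I0 (H : R * R -> R) t : (forall x, 0 <= H x) ->
  (0 <= \int[mu]_(s in `[l, 1%R]) (`|s|%:E * (H (fan_pt c p q s t))%:E))%E.
  by move=> H0; apply: integral_ge0 => s _; rewrite mule_ge0// lee_fin.
have mI (H : R * R -> R) := fan_inner_measurable l (H := H).
have mE (f : R -> R) : measurable_fun setT f -> measurable_fun (`[0, 1] : set R) (EFin \o f).
  by move=> mf; apply/measurable_EFinP; exact: measurable_funTS.
rewrite (sector_integral D0 l0 (H := EFin \o H1)); [|exact/measurable_EFinP|by move=> x; rewrite /= lee_fin].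
rewrite (sector_integral D0 l0 (H := EFin \o H2)); [|exact/measurable_EFinP|by move=> x; rewrite /= lee_fin].
have E (f : R -> R) (H : R * R -> R) : measurable_fun setT f -> measurable_fun setT H ->
  (forall t, 0 <= f t) -> (forall x, 0 <= H x) ->
  (`|D|%:E * \int[mu]_(t in `[0%R, 1%R]) (f t)%:E + `|D|%:E *
     \int[mu]_(t in `[0%R, 1%R]) \int[mu]_(s in `[l, 1%R]) (`|s|%:E * (H (fan_pt c p q s t))%:E) =
   `|D|%:E * \int[mu]_(t in `[0%R, 1%R]) ((f t)%:E + \int[mu]_(s in `[l, 1%R]) (`|s|%:E * (H (fan_pt c p q s t))%:E)))%E.
  move=> mf mH f0 H0; rewrite -ge0_muleDr; last 2 first.
  - by apply: integral_ge0 => t _; rewrite lee_fin.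
  - by apply: integral_ge0 => t _; exact: I0.
  congr (_ * _)%E; symmetry; apply: ge0_integralD.
  - exact: measurable_itv.
  - by move=> t _; rewrite lee_fin.
  - exact: mE.
  - by move=> t _; exact: I0.
  - by apply: measurable_funTS; exact: mI.
rewrite !E//; apply: lee_wpmul2l; first by rewrite lee_fin.
apply: ge0_le_integral => //.
- by move=> t _; apply: adde_ge0; [rewrite lee_fin|exact: I0].
- by apply: emeasurable_funD; [exact: mE|apply: measurable_funTS; exact: mI].
- by apply: emeasurable_funD; [exact: mE|apply: measurable_funTS; exact: mI].
Qed.

Variables (M : R) (y : R * R -> R).
Hypothesis M0 : 0 <= M.
Hypothesis pM : `|p - c| <= M.
Hypothesis qM : `|q - c| <= M.
Hypothesis sy : smooth y.

Definition grad_sqr (f : R * R -> R) (x : R * R) : R := d1 f x ^+ 2 + d2 f x ^+ 2.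

Lemma sqr_cont2 (f : R * R -> R) : continuous f -> continuous (fun x => f x ^+ 2).
Proof. by move=> cf s; have := continuousM (cf s) (cf s). Qed.

Lemma grad_sqr_ge0 f x : 0 <= grad_sqr f x.
Proof. by rewrite addr_ge0 ?sqr_ge0. Qed.

Lemma grad_sqr_cont f : smooth f -> continuous (grad_sqr f).
Proof.
move=> sf x; apply: (@continuousD R _ _ (fun x => d1 f x ^+ 2) (fun x => d2 f x ^+ 2)).
- by apply: sqr_cont2; apply: smooth_cont; exact: smooth_d1.
- by apply: sqr_cont2; apply: smooth_cont; exact: smooth_d2.
Qed.

Lemma fan_pt1 t : fan_pt c p q 1 t = seg_pt p q t.
Proof. by rewrite /fan_pt homot1. Qed.

Let ray t s : R := y (c + s *: (seg_pt p q t - c)).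
Let dray t s : R := d1 y (c + s *: (seg_pt p q t - c)) * (seg_pt p q t - c).1 +
  d2 y (c + s *: (seg_pt p q t - c)) * (seg_pt p q t - c).2.

Let ray_is t s : is_derive s (1 : R) (ray t) (dray t s).
Proof. exact: smooth_line. Qed.

Lemma line_cont (x v : R * R) (f : R * R -> R) : continuous f -> continuous (fun s : R => f (x + s *: v)).
Proof.
move=> cf s; apply: continuous_comp; last exact: cf.
apply: (@continuousD _ (R * R)%type R (fun=> x) (fun s => s *: v)); first exact: cst_continuous.
exact: scalel_continuous.
Qed.

Let dray_cont t : continuous (dray t).
Proof.
move=> s; apply: (@continuousD R R R (fun s => d1 y (c + s *: (seg_pt p q t - c)) * (seg_pt p q t - c).1)).
  apply: (@continuousM R R _ (fun=> (seg_pt p q t - c).1)); last exact: cst_continuous.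
  by apply: line_cont; apply: smooth_cont; exact: smooth_d1.
apply: (@continuousM R R _ (fun=> (seg_pt p q t - c).2)); last exact: cst_continuous.
by apply: line_cont; apply: smooth_cont; exact: smooth_d2.
Qed.

Let dray_le t s : 0 <= t <= 1 -> dray t s ^+ 2 <= 2 * M ^+ 2 * grad_sqr y (fan_pt c p q s t).
Proof.
move=> /andP[t0 t1].
have gM : `|seg_pt p q t - c| <= M.
  have -> : seg_pt p q t - c = (1 - t) *: (p - c) + t *: (q - c).
    rewrite /seg_pt [LHS]surjective_pairing [RHS]surjective_pairing.
    by congr pair; rewrite /= /GRing.scale/=; ring.
  apply: le_trans (ler_normD _ _) _; rewrite !normrZ !ger0_norm ?subr_ge0//.
  have : (1 - t) * `|p - c| <= (1 - t) * M by rewrite ler_wpM2l// subr_ge0.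
  have : t * `|q - c| <= t * M by rewrite ler_wpM2l.
  lra.
rewrite /dray /grad_sqr /fan_pt /homot.
move: (d1 _ _) (d2 _ _) => a b; move: gM; rewrite norm2_le; move: (_ - c) => [u v] /= /andP[].
rewrite !ler_norml => /andP[u1 u2] /andP[v1 v2].
have uu : u ^+ 2 <= M ^+ 2 by nra.
have vv : v ^+ 2 <= M ^+ 2 by nra.
have : (a * u + b * v) ^+ 2 <= 2 * ((a ^+ 2) * u ^+ 2 + b ^+ 2 * v ^+ 2).
  by have := sqr_ge0 (a * u - b * v); rewrite !expr2; nra.
have := sqr_ge0 a; have := sqr_ge0 b; nra.
Qed.

Let fan_cont (f : R * R -> R) t : continuous f -> continuous (fun s => f (fan_pt c p q s t)).
Proof. exact: line_cont. Qed.

Let weighted_cont (f : R * R -> R) t : continuous f -> continuous (fun s : R => `|s| * f (fan_pt c p q s t)).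
Proof.
move=> cf s; apply: (@continuousM R R (fun s => `|s|) (fun s => f (fan_pt c p q s t))).
  exact: norm_continuous.
exact: fan_cont.
Qed.

Arguments fan_cont : clear implicits.
Arguments weighted_cont : clear implicits.

Let weighted_fin (f : R * R -> R) t (l : R) : continuous f ->
  (\int[mu]_(s in `[l, 1%R]) (`|s| * f (fan_pt c p q s t))%:E =
   (\int[mu]_(s in `[l, 1%R]) (`|s| * f (fan_pt c p q s t)))%:E)%E.
Proof. by move=> cf; apply: continuous_integral_itv; exact: weighted_cont. Qed.

Lemma seg_pt_cont (a b : R * R) (f : R * R -> R) : continuous f -> continuous (fun t => f (seg_pt a b t)).
Proof. exact: line_cont. Qed.

Lemma continuousZr (T : topologicalType) (k : R) (f : T -> R) : continuous f -> continuous (fun x => k * f x).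
Proof. by move=> cf x; apply: (@continuousM R T (fun=> k) f); [exact: cst_continuous|exact: cf]. Qed.

Lemma fan_strip l : 2^-1 <= l -> l < 1 ->
  (\int[leb2]_(x in sector c p q l) (y x ^+ 2)%:E <=
   `|D|%:E * \int[mu]_(t in `[0%R, 1%R]) (2 * (1 - l) * y (seg_pt p q t) ^+ 2)%:E +
   \int[leb2]_(x in sector c p q l) (16 * (1 - l) ^+ 2 * M ^+ 2 * grad_sqr y x)%:E)%E.
Proof.
move=> l2 l1; have l0 : 0 < l by apply: lt_le_trans l2; rewrite invr_gt0.
have cy := sqr_cont2 (smooth_cont sy).
have cA : continuous (fun t => 2 * (1 - l) * y (seg_pt p q t) ^+ 2).
  by apply: continuousZr; exact: (seg_pt_cont cy).
have cG := continuousZr (k := 16 * (1 - l) ^+ 2 * M ^+ 2) (grad_sqr_cont sy).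
have hl : 0 <= 1 - l by rewrite subr_ge0 ltW.
have := @fan_le l (fun x => y x ^+ 2) (fun x => 16 * (1 - l) ^+ 2 * M ^+ 2 * grad_sqr y x)
  (fun t => 2 * (1 - l) * y (seg_pt p q t) ^+ 2) (fun=> 0) l0.
rewrite integral0 mule0 add0e; apply.
- exact: continuous2_measurable.
- exact: continuous2_measurable.
- exact: continuous_measurable_fun.
- exact: measurable_cst.
- by move=> x; exact: sqr_ge0.
- by move=> x; rewrite !mulr_ge0 ?sqr_ge0 ?grad_sqr_ge0.
- by move=> t; apply: mulr_ge0 (sqr_ge0 _); rewrite ?mulr_ge0 ?invr_ge0.
- by [].
move=> t ht; rewrite add0e.
rewrite (weighted_fin t l cy) (weighted_fin t l cG).
rewrite -EFinD lee_fin.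
have := @radial_strip R (ray t) (dray t) _ l1 (ray_is t) (@dray_cont t).
rewrite [ray t 1](_ : _ = y (seg_pt p q t)); last by rewrite /ray scale1r addrC subrK.
have i1 := continuous_integrable_itv l 1 (sqr_continuous (@dray_cont t)).
rewrite -RintegralZl//.
move=> h; apply: le_trans (le_trans h _).
  apply: le_Rintegral; first exact: measurable_itv.
  - by apply: continuous_integrable_itv; exact (weighted_cont _ t cy).
  - by apply: continuous_integrable_itv; exact (fan_cont _ t cy).
  - move=> s; rewrite /= in_itv/= => /andP[s1 s2].
    by rewrite ger0_norm ?(le_trans (ltW l0))// ler_piMl ?sqr_ge0.
rewrite lerD2l; apply: le_Rintegral; first exact: measurable_itv.
- by apply: continuous_integrable_itv; apply: (continuousZr (f := fun s => dray t s ^+ 2)); exact: sqr_continuous (@dray_cont t).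
- by apply: continuous_integrable_itv; exact (weighted_cont _ t cG).
- move=> s; rewrite /= in_itv/= => /andP[s1 s2].
  have s0 : 2^-1 <= s by apply: le_trans s1.
  rewrite ger0_norm; last by apply: le_trans s0; rewrite invr_ge0.
  apply: (@le_trans _ _ (4 * (1 - l) ^+ 2 * (2 * M ^+ 2 * grad_sqr y (fan_pt c p q s t)))).
    by rewrite ler_wpM2l ?dray_le// mulr_ge0 ?sqr_ge0.
  have : 0 <= (1 - l) ^+ 2 * M ^+ 2 * grad_sqr y (fan_pt c p q s t).
    by rewrite !mulr_ge0 ?sqr_ge0 ?grad_sqr_ge0.
  nra.
Qed.

(** The ray inequality at a = 1/2. The Jacobian, at least 1/2 there, again costs a factor 2. *)
Lemma fan_trace :
  (`|D|%:E * \int[mu]_(t in `[0%R, 1%R]) (2^-1 * y (seg_pt p q t) ^+ 2)%:E <=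
   \int[leb2]_(x in sector c p q 2^-1) (4 * y x ^+ 2 + M ^+ 2 * grad_sqr y x)%:E)%E.
Proof.
have l0 : 0 < 2^-1 :> R by rewrite invr_gt0.
have l1 : 2^-1 < 1 :> R by rewrite invf_lt1// ltr1n.
have cy := sqr_cont2 (smooth_cont sy).
have cA : continuous (fun t => 2^-1 * y (seg_pt p q t) ^+ 2).
  by apply: continuousZr; exact: (seg_pt_cont cy).
have cG : continuous (fun x => 4 * y x ^+ 2 + M ^+ 2 * grad_sqr y x).
  move=> x; apply: (@continuousD R R _ (fun x => 4 * y x ^+ 2) (fun x => M ^+ 2 * grad_sqr y x)).
    exact: continuousZr.
  by apply: continuousZr; exact: grad_sqr_cont.
have := @fan_le 2^-1 (fun=> 0) (fun x => 4 * y x ^+ 2 + M ^+ 2 * grad_sqr y x)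
  (fun=> 0) (fun t => 2^-1 * y (seg_pt p q t) ^+ 2) l0.
rewrite !integral0 mule0 add0e adde0; apply.
- exact: measurable_cst.
- exact: continuous2_measurable.
- exact: measurable_cst.
- exact: continuous_measurable_fun.
- by [].
- by move=> x; apply: addr_ge0; apply: mulr_ge0; rewrite ?sqr_ge0 ?grad_sqr_ge0.
- by [].
- by move=> t; apply: mulr_ge0 (sqr_ge0 _); rewrite ?mulr_ge0 ?invr_ge0.
move=> t ht; rewrite add0e.
rewrite [X in (_ + X)%E]integral0_eq; last by move=> s _; rewrite mulr0.
rewrite adde0 (weighted_fin t 2^-1 cG).
rewrite lee_fin.
have := @radial_trace R (ray t) (dray t) _ l1 (ray_is t) (@dray_cont t).
have -> : 1 - 2^-1 = 2^-1 :> R by field.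
rewrite [ray t 1](_ : _ = y (seg_pt p q t)); last by rewrite /ray scale1r addrC subrK.
move=> h; apply: le_trans h _; apply: le_Rintegral; first exact: measurable_itv.
- have k1 : continuous (fun s => 2 * ray t s ^+ 2).
    by apply: (continuousZr (f := fun s => ray t s ^+ 2)); exact (fan_cont _ t cy).
  have k2 : continuous (fun s => 2^-1 ^+ 2 * dray t s ^+ 2).
    by apply: (continuousZr (f := fun s => dray t s ^+ 2)); exact: sqr_continuous (@dray_cont t).
  apply: continuous_integrable_itv => s.
  apply: (@continuousD R R R (fun s => 2 * ray t s ^+ 2) (fun s => 2^-1 ^+ 2 * dray t s ^+ 2)).
    exact: k1.
  exact: k2.
- by apply: continuous_integrable_itv; exact (weighted_cont _ t cG).
- move=> s; rewrite /= in_itv/= => /andP[s0 s2].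
  rewrite ger0_norm; last by apply: le_trans s0; rewrite invr_ge0.
  have := dray_le s ht; rewrite -/(ray t s).
  have := grad_sqr_ge0 y (fan_pt c p q s t); have := sqr_ge0 M.
  have : ray t s = y (fan_pt c p q s t) by [].
  move=> ->; move: (grad_sqr _ _) (dray t s ^+ 2) => g dd.
  have := sqr_ge0 (y (fan_pt c p q s t)); move: (y _ ^+ 2) (M ^+ 2) => yy mm y0 m0 g0 hd.
  have mg : 0 <= mm * g by rewrite mulr_ge0.
  rewrite expr2 mulrDr; nra.
Qed.

End Fan_inequalities.

Section Subadditivity.
Context d (T : measurableType d) (R : realType) (mu : {measure set T -> \bar R}).

Lemma ge0_integral_cover (n : nat) (A : set T) (S : 'I_n -> set T) (f : T -> \bar R) :
  measurable A -> (forall i, measurable (S i)) -> A `<=` \bigcup_i S i ->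
  measurable_fun setT f -> (forall x, (0 <= f x)%E) ->
  (\int[mu]_(x in A) f x <= \sum_(i < n) \int[mu]_(x in S i) f x)%E.
Proof.
move=> mA mS AS mf f0.
rewrite [leLHS]integral_mkcond.
under eq_bigr do rewrite integral_mkcond.
have mr B : measurable B -> measurable_fun setT (f \_ B).
  by move=> mB; apply/(measurable_restrictT _ mB)/measurable_funTS.
have r0 B x : (0 <= (f \_ B) x)%E by rewrite patchE; case: ifP.
rewrite -ge0_integral_sum//; last by move=> i; exact: mr.
apply: ge0_le_integral => //.
- exact: mr.
- by apply: emeasurable_sum => i; exact: mr.
- move=> x _; rewrite [leLHS]patchE; case: ifPn => [|_]; last exact: sume_ge0.
  rewrite inE => /AS[i _ Sx]; rewrite (bigD1 i)//= [X in (X + _)%E]patchE mem_set//.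
  by rewrite leeDl//; apply: sume_ge0.
Qed.

Lemma ge0_integral_subset_null (A B N : set T) (f : T -> \bar R) :
  measurable A -> measurable B -> measurable N -> mu N = 0%E -> A `<=` B `|` N ->
  measurable_fun setT f -> (forall x, (0 <= f x)%E) ->
  (\int[mu]_(x in A) f x <= \int[mu]_(x in B) f x)%E.
Proof.
move=> mA mB mN N0 AB mf f0.
rewrite (ge0_negligible_integral _ _ _ _ N0)//; last exact: measurable_funTS.
apply: ge0_subset_integral => //; first exact: measurableD.
- exact: measurable_funTS.
- by move=> x [/AB[]].
Qed.

End Subadditivity.


(** * Strip and trace inequalities on a polygon *)

Section Star_polygon.
Context {R : realType}.
Notation mu := (@lebesgue_measure R).
Variables (K : @polygon R) (c : R * R) (r : R).
Hypothesis r0 : 0 < r.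
Hypothesis dK : disc c r `<=` K.
Hypothesis sK : star_shaped_disc K c r.
Notation P := (@pol_vtx R K).
Notation Q i := (@pol_vtx R K (ordS i)).
Notation D i := (det2 (P i - c) (Q i - P i)).

(** The centre is not on the line of an edge. If it were beyond one end point, that end point would
    be a proper contraction of the other one and hence interior; if it were on the edge itself, the
    centre would be a boundary point. *)
Lemma edge_det (p q : R * R) : p != q -> segment p q `<=` closure K `\` K ->
  det2 (p - c) (q - p) != 0.
Proof.
move=> pq sb; apply/eqP => E; have Kc := star_center r0 dK.
have hseg t : 0 <= t <= 1 -> closure K (seg_pt p q t) /\ ~ pol_dom K (seg_pt p q t).
  by move=> ht; apply: sb; exists t => //=; rewrite in_itv.
pose dd := dot (q - p) (q - p); pose t := dot (c - p) (q - p) / dd.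
have d0 : dd != 0.
  rewrite /dd /dot; apply/eqP => /eqP; rewrite -!expr2 paddr_eq0 ?sqr_ge0// !sqrf_eq0.
  move=> /andP[/eqP a /eqP b]; move/negP: pq; apply; rewrite -subr_eq0 -oppr_eq0 opprB.
  by apply/eqP; rewrite [LHS]surjective_pairing a b.
have cE : c = seg_pt p q t.
  have E' : (p.1 - c.1) * (q.2 - p.2) = (p.2 - c.2) * (q.1 - p.1).
    by apply/eqP; rewrite -subr_eq0; apply/eqP.
  rewrite /seg_pt [LHS]surjective_pairing [RHS]surjective_pairing /t /dd /dot.
  have d1 : (q.1 - p.1) * (q.1 - p.1) + (q.2 - p.2) * (q.2 - p.2) != 0 by exact: d0.
  rewrite /= /GRing.scale/=; congr pair; apply: (mulIf d1); apply/eqP; rewrite -subr_eq0; apply/eqP.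
    transitivity ((q.2 - p.2) * ((p.2 - c.2) * (q.1 - p.1) - (p.1 - c.1) * (q.2 - p.2))).
      by field.
    by rewrite E' subrr mulr0.
  transitivity ((q.1 - p.1) * ((p.1 - c.1) * (q.2 - p.2) - (p.2 - c.2) * (q.1 - p.1))).
    by field.
  by rewrite E' subrr mulr0.
have hom (s a b : R) : s * (b - t) = a - t -> homot c s (seg_pt p q b) = seg_pt p q a.
  move=> h; rewrite /homot [in LHS]cE /seg_pt opprD addrACA subrr add0r -scalerBl scalerA.
  by rewrite h -addrA -scalerDl [t + _]addrC subrK.
have [t0|t0] := ltrP t 0.
  have [_ nK] := hseg 0 ltac:(by rewrite lexx ler01).
  have [cl _] := hseg 1 ltac:(by rewrite ler01 lexx).
  have t1 : 1 - t != 0 by rewrite gt_eqF//; lra.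
  apply: nK; rewrite -(hom (- t / (1 - t)) 0 1); last by rewrite divfK// sub0r.
  apply: (star_homot r0 sK cl); first by rewrite divr_ge0//; lra.
  by rewrite ltr_pdivrMr; lra.
have [t1|t1] := ltrP 1 t.
  have [_ nK] := hseg 1 ltac:(by rewrite ler01 lexx).
  have [cl _] := hseg 0 ltac:(by rewrite lexx ler01).
  have t1' : 0 - t != 0 by rewrite lt_eqF//; lra.
  apply: nK; rewrite -(hom ((t - 1) / t) 1 0); last by field; rewrite gt_eqF//; lra.
  apply: (star_homot r0 sK cl); first by rewrite divr_ge0//; lra.
  by rewrite ltr_pdivrMr; lra.
by have [_] := hseg t ltac:(by rewrite t0 t1); rewrite -cE.
Qed.

Lemma vertex_neq i : P i != Q i.
Proof.
clear r0 dK sK.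
apply/eqP => /(@pol_inj R K) /(congr1 val) /=.
have n3 := pol_n_ge3 K; have := ltn_ord i.
move: (nat_of_ord i) => a; move: (pol_n K) n3 => n n3 an E; have [h|h] := ltnP a.+1 n.
  by rewrite modn_small in E => //; lia.
have {}h : n = a.+1 by apply/eqP; rewrite eqn_leq h an.
by move: E; rewrite h modnn; lia.
Qed.

Lemma edge_boundary i : segment (P i) (Q i) `<=` closure K `\` K.
Proof. by rewrite pol_boundary => x hx; exists i. Qed.

Lemma polygon_det i : D i != 0.
Proof. exact: edge_det (vertex_neq i) (@edge_boundary i). Qed.

Lemma polygon_bounded : exists M : R, 0 <= M /\ (forall x, closure K x -> `|x| <= M) /\
  (forall x, closure K x -> `|x - c| <= M).
Proof.
have [M hM] := @pol_bounded R K.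
have h x : pol_dom K x -> `|x| < M.
  by move=> /hM; rewrite /disc/= subr0; exact: le_lt_trans (norm_le_enorm x).
have h' x : closure K x -> `|x| <= M.
  move=> cx; apply/ler_addgt0Pr => e e0.
  have [y Ky xy] := closure_approx cx e0.
  have := ler_normD (x - y) y; rewrite subrK => /le_trans; apply.
  by rewrite addrC lerD// ltW// h.
have M0 : 0 <= M by apply: le_trans (h' c _); [exact: normr_ge0|exact/subset_closure/(star_center r0 dK)].
exists (M + `|c|); split; first by rewrite addr_ge0.
split=> x /h' xM; first by rewrite (le_trans xM)// lerDl.
by apply: le_trans (ler_normB _ _) _; rewrite lerD2r.
Qed.

Lemma polygon_measurable : measurable (K : set (R * R)).
Proof. exact: open2_measurable (@pol_open R K). Qed.

Lemma sector_sub_strip i l : 0 < l ->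
  sector c (P i) (Q i) l `<=` strip K c l `|` [set x | det2 (Q i - P i) (x - P i) = 0].
Proof.
move=> l0 _ [s [t [/andP[s0 s1] ht ->]]].
have [cb nb] : (closure K `\` K) (seg_pt (P i) (Q i) t).
  by apply: (@edge_boundary i); exists t => //=; rewrite in_itv.
move: s1; rewrite le_eqVlt => /orP[/eqP->|s1]; last by left; apply: (strip_param r0 sK) => //.
by right; rewrite /= fan_pt1 /seg_pt /det2/= /GRing.scale/=; ring.
Qed.

Lemma strip_sub_sectors l : 0 < l -> l < 1 ->
  strip K c l `<=` \bigcup_i sector c (P i) (Q i) l.
Proof.
move=> l0 l1 x sx.
have [b [s [cb nb ls s1 ->]]] := strip_exit (@pol_open R K) r0 dK sK l0 l1 sx.
have : (closure K `\` K) b by [].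
rewrite pol_boundary => -[i _ [t]]; rewrite /= in_itv/= => ht <-.
by exists i => //; exists s, t; split=> //; rewrite ls s1.
Qed.


Lemma continuous_integrable2 (A : set (R * R)) (f : R * R -> R) (M : R) :
  measurable A -> (forall x, A x -> `|x| <= M) -> continuous f ->
  leb2.-integrable A (EFin \o f).
Proof.
move=> mA AM cf.
have s1 := sqint_continuous mA AM cf.
have s2 := sqint_continuous mA AM (@cst_continuous _ R 1).
have := @sqint_mul _ _ _ leb2 A mA _ _ s1 s2.
by congr (_.-integrable _ _); apply/funext => x; rewrite /= mulr1.
Qed.

Lemma Rintegral_continuous (A : set (R * R)) (f : R * R -> R) (M : R) :
  measurable A -> (forall x, A x -> `|x| <= M) -> continuous f ->
  (\int[leb2]_(x in A) (f x)%:E = (\int[leb2]_(x in A) f x)%:E)%E.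
Proof.
move=> mA AM cf; have := continuous_integrable2 mA AM cf.
by move=> h; rewrite /Rintegral fineK// integrable_fin_num.
Qed.

Lemma line_measurable (x d : R * R) : measurable [set y | det2 d (y - x) = 0].
Proof.
have mf : measurable_fun setT (fun y : R * R => det2 d (y - x)).
  rewrite /det2; apply: measurable_funB; apply: measurable_funM => //=; exact: measurable_funB.
rewrite (_ : [set _ | _] = (fun y : R * R => det2 d (y - x)) @^-1` [set 0]); last first.
  by apply/seteqP; split=> y.
by rewrite -[X in measurable X]setTI; apply: mf => //; exact: measurable_set1.
Qed.

Lemma vertex_closure i : closure K (P i) /\ ~ pol_dom K (P i).
Proof.
have : segment (P i) (Q i) (P i).
  by exists 0; rewrite /= ?in_itv/= ?lexx ?ler01// /seg_pt scale0r addr0.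
by move/edge_boundary.
Qed.

Lemma edge_len_gt0 i : 0 < enorm (Q i - P i).
Proof. by apply: enorm_gt0; rewrite subr_eq0 eq_sym; exact: vertex_neq. Qed.

Lemma edge_int_continuous i (a : R) (f : R * R -> R) : continuous f ->
  (`|D i|%:E * \int[mu]_(t in `[0%R, 1%R]) (a * f (seg_pt (P i) (Q i) t))%:E =
   (a * (`|D i| / enorm (Q i - P i)) * edge_int (P i) (Q i) f)%:E)%E.
Proof.
move=> cf; have cf' := line_cont (x := P i) (v := Q i - P i) cf.
have cf2 : continuous (fun t => a * f (seg_pt (P i) (Q i) t)).
  by move=> s; apply: (@continuousM R R (fun=> a) (fun t => f (seg_pt (P i) (Q i) t)));
    [exact: cst_continuous|exact: cf'].
rewrite continuous_integral_itv// -EFinM RintegralZl//; last first.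
  exact: continuous_integrable_itv cf'.
congr EFin; rewrite /edge_int; move: (\int[_]_(t in _) _) => I.
by field; rewrite gt_eqF// edge_len_gt0.
Qed.

Lemma edge_int_ge0 (p q : R * R) (f : R * R -> R) : (forall x, 0 <= f x) -> 0 <= edge_int p q f.
Proof. by move=> f0; rewrite mulr_ge0 ?enorm_ge0// Rintegral_ge0. Qed.

Lemma boundary_int_ge0 (f : R * R -> R) : (forall x, 0 <= f x) -> 0 <= boundary_int K f.
Proof. by move=> f0; apply: sumr_ge0 => i _; exact: edge_int_ge0. Qed.

Lemma edge_int_le_boundary i (f : R * R -> R) : (forall x, 0 <= f x) ->
  edge_int (P i) (Q i) f <= boundary_int K f.
Proof.
move=> f0; rewrite /boundary_int (bigD1 i)//= lerDl.
by apply: sumr_ge0 => j _; exact: edge_int_ge0.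
Qed.

(** The fan inequalities are summed over the edges; the sectors cover the strip, and each is
    contained in it up to a line. Only the powers of 1 - l matter: the constant depends on [K] and
    serves only in a limit. *)
Lemma strip_ineq : exists C : R, 0 < C /\ forall (y : R * R -> R) (l : R),
  smooth y -> 2^-1 <= l -> l < 1 ->
  \int[leb2]_(x in strip K c l) (y x ^+ 2) <=
  C * ((1 - l) * boundary_int K (fun x => y x ^+ 2) +
       (1 - l) ^+ 2 * \int[leb2]_(x in strip K c l) grad_sqr y x).
Proof.
have [M [M0 [hM hMc]]] := polygon_bounded.
pose C1 : R := \sum_i 2 * (`|D i| / enorm (Q i - P i)).
pose C2 : R := \sum_(i < pol_n K) 16 * M ^+ 2.
have C1i i : 0 <= 2 * (`|D i| / enorm (Q i - P i)).
  by rewrite mulr_ge0// divr_ge0// enorm_ge0.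
have C10 : 0 <= C1 by apply: sumr_ge0.
have C20 : 0 <= C2 by apply: sumr_ge0 => i _; rewrite mulr_ge0 ?sqr_ge0.
exists (C1 + C2 + 1); split; first lra.
move=> y l sy l2 l1; have l0 : 0 < l by apply: lt_le_trans l2; rewrite invr_gt0.
have mst := strip_measurable c (@pol_open R K) l0.
have cy := sqr_cont2 (smooth_cont sy).
have cG := grad_sqr_cont sy.
have stM x : strip K c l x -> `|x| <= M by move=> [Kx _]; apply: hM; exact: subset_closure.
have l1' : 0 <= 1 - l by rewrite subr_ge0 ltW.
have dM i : `|P i - c| <= M /\ `|Q i - c| <= M.
  by split; apply: hMc; [have [] := vertex_closure i|have [] := vertex_closure (ordS i)].
have k0 : 0 <= 16 * (1 - l) ^+ 2 * M ^+ 2 by rewrite !mulr_ge0 ?sqr_ge0.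
have cK : continuous (fun x => 16 * (1 - l) ^+ 2 * M ^+ 2 * grad_sqr y x).
  by move=> x; apply: (@continuousM R _ (fun=> 16 * (1 - l) ^+ 2 * M ^+ 2) (grad_sqr y));
    [exact: cst_continuous|exact: cG].
have [bi0 G0] : 0 <= boundary_int K (fun x => y x ^+ 2) /\
    0 <= \int[leb2]_(x in strip K c l) grad_sqr y x.
  split; first by apply: boundary_int_ge0 => x; exact: sqr_ge0.
  by apply: Rintegral_ge0 => x _; exact: grad_sqr_ge0.
have main : (\int[leb2]_(x in strip K c l) (y x ^+ 2)%:E <=
   \sum_(i < pol_n K) ((2 * (`|D i| / enorm (Q i - P i))) *
     ((1 - l) * boundary_int K (fun x => y x ^+ 2)) +
     16 * M ^+ 2 * ((1 - l) ^+ 2 * \int[leb2]_(x in strip K c l) grad_sqr y x))%:E)%E.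
  have cov := @ge0_integral_cover _ _ _ leb2 _ _ _ (fun x => (y x ^+ 2)%:E) mst _ (strip_sub_sectors l0 l1).
  apply: le_trans (cov _ _ _) _; clear cov.
  - by move=> i; apply: sector_measurable => //; exact: polygon_det.
  - by apply/measurable_EFinP; exact: continuous2_measurable.
  - by move=> x; rewrite lee_fin sqr_ge0.
  apply: lee_sum => i _; have [pM qM] := dM i.
  apply: le_trans (fan_strip (polygon_det i) M0 pM qM sy l2 l1) _.
  rewrite (edge_int_continuous i (2 * (1 - l)) cy) EFinD; apply: leeD.
    rewrite lee_fin; have := edge_int_le_boundary i (f := fun x => y x ^+ 2) (fun x => sqr_ge0 _).
    move=> h; have := C1i i => h2.
    rewrite [leLHS](_ : _ = (2 * (`|D i| / enorm (Q i - P i))) * ((1 - l) * edge_int (P i) (Q i) (fun x => y x ^+ 2))); last by ring.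
    by rewrite ler_wpM2l// ler_wpM2l.
  rewrite [in leRHS](_ : 16 * M ^+ 2 * ((1 - l) ^+ 2 * _) = 16 * (1 - l) ^+ 2 * M ^+ 2 * \int[leb2]_(x in strip K c l) grad_sqr y x); last by ring.
  have iG : leb2.-integrable (strip K c l) (EFin \o grad_sqr y).
    exact: continuous_integrable2 mst stM cG.
  rewrite -RintegralZl// -(Rintegral_continuous mst stM cK).
  apply: (@ge0_integral_subset_null _ _ _ leb2 _ _ [set x | det2 (Q i - P i) (x - P i) = 0]) => //.
  - by apply: sector_measurable => //; exact: polygon_det.
  - exact: line_measurable.
  - by apply: line_null; rewrite subr_eq0 eq_sym; exact: vertex_neq.
  - exact: sector_sub_strip.
  - by apply/measurable_EFinP; exact: continuous2_measurable.
  - by move=> x; rewrite lee_fin mulr_ge0 ?grad_sqr_ge0.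
move: main; rewrite (Rintegral_continuous mst stM cy) sumEFin lee_fin big_split/= -!mulr_suml -/C1 [(\sum_(i < pol_n K) 16) * M ^+ 2](_ : _ = C2); last by rewrite /C2 mulr_suml.
move=> h; apply: le_trans h _.
move: (boundary_int _ _) bi0 => b b0; move: (\int[_]_(x in _) _) G0 => g g0.
have : 0 <= (1 - l) * b by rewrite mulr_ge0.
have : 0 <= (1 - l) ^+ 2 * g by rewrite mulr_ge0 ?sqr_ge0.
move: (_ * b) (_ * g) => u v u0 v0.
nra.
Qed.

(** Its constant depends on [K] as well, which is harmless because it only serves to show that
    traces are unique. *)
Lemma trace_ineq : exists C : R, 0 < C /\ forall (y : R * R -> R), smooth y ->
  boundary_int K (fun x => y x ^+ 2) <=
  C * (\int[leb2]_(x in K) (y x ^+ 2) + \int[leb2]_(x in K) grad_sqr y x).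
Proof.
have [M [M0 [hM hMc]]] := polygon_bounded.
pose W i : R := enorm (Q i - P i) / `|D i|.
have W0 i : 0 < W i by rewrite divr_gt0 ?edge_len_gt0// normr_gt0 polygon_det.
pose C1 : R := \sum_i W i.
have C10 : 0 <= C1 by apply: sumr_ge0 => i _; exact: ltW.
exists (C1 * (8 + 2 * M ^+ 2) + 1).
have M2 : 0 <= M ^+ 2 by exact: sqr_ge0.
split; first by rewrite ltr_wpDl// mulr_ge0//; lra.
move=> y sy.
have mK := polygon_measurable.
have KM x : pol_dom K x -> `|x| <= M by move=> Kx; apply: hM; exact: subset_closure.
have cy := sqr_cont2 (smooth_cont sy).
have cG := grad_sqr_cont sy.
have dM i : `|P i - c| <= M /\ `|Q i - c| <= M.
  by split; apply: hMc; [have [] := vertex_closure i|have [] := vertex_closure (ordS i)].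
pose F x := 4 * y x ^+ 2 + M ^+ 2 * grad_sqr y x.
have c4 : continuous (fun x => 4 * y x ^+ 2).
  by move=> x; apply: (@continuousM R _ (fun=> 4) (fun x => y x ^+ 2)); [exact: cst_continuous|exact: cy].
have cM : continuous (fun x => M ^+ 2 * grad_sqr y x).
  by move=> x; apply: (@continuousM R _ (fun=> M ^+ 2) (grad_sqr y)); [exact: cst_continuous|exact: cG].
have cF : continuous F.
  by move=> x; apply: (@continuousD R R _ (fun x => 4 * y x ^+ 2)); [exact: c4|exact: cM].
have F0 x : 0 <= F x by rewrite addr_ge0// mulr_ge0 ?sqr_ge0 ?grad_sqr_ge0.
have l0 : 0 < 2^-1 :> R by rewrite invr_gt0.
have l1 : 2^-1 < 1 :> R by rewrite invf_lt1// ltr1n.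
have edge i : edge_int (P i) (Q i) (fun x => y x ^+ 2) <= W i * (2 * \int[leb2]_(x in K) F x).
  have [pM qM] := dM i.
  have := fan_trace (polygon_det i) pM qM sy.
  rewrite (edge_int_continuous i 2^-1 cy) => h.
  have : (\int[leb2]_(x in sector c (P i) (Q i) 2^-1) (F x)%:E <= (\int[leb2]_(x in K) F x)%:E)%E.
    rewrite -(Rintegral_continuous mK KM cF).
    apply: (@ge0_integral_subset_null _ _ _ leb2 _ _ [set x | det2 (Q i - P i) (x - P i) = 0]) => //.
    - by apply: sector_measurable => //; exact: polygon_det.
    - exact: line_measurable.
    - by apply: line_null; rewrite subr_eq0 eq_sym; exact: vertex_neq.
    - by move=> x /(sector_sub_strip l0)[[]|]; [left|right].
    - by apply/measurable_EFinP; exact: continuous2_measurable.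
  move=> /(le_trans h); rewrite lee_fin /W.
  have D0 : 0 < `|D i| by rewrite normr_gt0 polygon_det.
  have := edge_len_gt0 i.
  move: (\int[_]_(x in _) _) (edge_int _ _ _) (`|D i|) D0 (enorm _) => I J d d0 e e0.
  move=> {}h; rewrite [J](_ : _ = e / d * (2 * (2^-1 * (d / e) * J))); last first.
    by field; rewrite !gt_eqF.
  by rewrite ler_wpM2l ?divr_ge0 ?(ltW e0) ?(ltW d0)// ler_wpM2l.
have EF : \int[leb2]_(x in K) F x = 4 * \int[leb2]_(x in K) (y x ^+ 2) + M ^+ 2 * \int[leb2]_(x in K) grad_sqr y x.
  have i1 := continuous_integrable2 mK KM cy.
  have i2 := continuous_integrable2 mK KM cG.
  rewrite -RintegralZl// -RintegralZl//; apply: RintegralD => //.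
  - exact: continuous_integrable2 mK KM c4.
  - exact: continuous_integrable2 mK KM cM.
apply: (@le_trans _ _ (\sum_i W i * (2 * \int[leb2]_(x in K) F x))); first by apply: ler_sum.
rewrite -mulr_suml -/C1 EF.
have arith (a b m : R) : 0 <= a -> 0 <= b -> 0 <= m ->
    C1 * (2 * (4 * a + m * b)) <= (C1 * (8 + 2 * m) + 1) * (a + b).
  move=> a0 b0 m0; have mb : 0 <= m * b by rewrite mulr_ge0.
  have ma : 0 <= m * a by rewrite mulr_ge0.
  apply: (@le_trans _ _ (C1 * ((8 + 2 * m) * (a + b)))); last first.
    by rewrite mulrA [leRHS]mulrDl mul1r lerDl addr_ge0.
  by rewrite ler_wpM2l//; nra.
apply: arith => //; apply: Rintegral_ge0 => x _; [exact: sqr_ge0|exact: grad_sqr_ge0].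
Qed.

End Star_polygon.

(** * Functions with zero trace *)

Section Approximation.
Context {R : realType}.
Implicit Types (x y : R * R).

Lemma bounded_closed2_compact (A : set (R * R)) (M : R) : closed A ->
  (forall x, A x -> `|x| <= M) -> compact A.
Proof.
move=> cA AM; pose Q : set (R * R) := `[- M, M]%classic `*` `[- M, M]%classic.
have cQ : compact Q by apply: compact_setX; exact: segment_compact.
apply: (subclosed_compact cA cQ) => x /AM; rewrite norm2_le !ler_norml => /andP[h1 h2].
by split; rewrite /= in_itv.
Qed.

Lemma grid_size (M e : R) : 0 < e -> exists N : nat, M < e * N%:R.
Proof.
move=> e0; exists (Num.truncn (`|M| / e)).+1.
rewrite -ltr_pdivrMl// mulrC; apply: le_lt_trans (truncnS_gt _).
by rewrite ler_pM2r ?invr_gt0// ler_norm.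
Qed.

(** Restricted to segments inside [A]: [K] need not be convex, and [w] is controlled one triangle
    after another along a segment. *)
Definition lipschitz_along (A : set (R * R)) (G : R) (w : R * R -> R) : Prop :=
  forall x y, segment x y `<=` A -> `|w x - w y| <= G * `|x - y|.

Lemma segment_in_ball (A : set (R * R)) x u (d : R) :
  (forall v, `|v| < d -> A (x + v)) -> `|u| < d -> segment x (x + u) `<=` A.
Proof.
move=> Ad ud _ [t /= + <-]; rewrite in_itv/= => /andP[t0 t1].
rewrite /seg_pt addrAC subrr add0r; apply: Ad; rewrite normrZ ger0_norm//.
by apply: le_lt_trans ud; rewrite ler_piMl.
Qed.

(** Nodes close to the closure may fall outside [K], so [w] is sampled at their contractions, which
    have a margin of order (1 - l) r. With a mesh width [e] below this margin, [w] oscillates by at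
    most [G * e] around a sample, and the derivatives of the teeth, of order 1/e, give a gradient
    bound free of [e], [l] and [K]. *)
Lemma quasi_interpolation : exists2 B : R, 0 < B & forall (K : set (R * R)) c (r M G l : R) w,
  0 < r -> star_shaped_disc K c r -> 0 <= G ->
  (forall x, closure K x -> `|x| <= M) -> (forall x, closure K x -> `|x - c| <= M) ->
  lipschitz_along (closure K) G w -> 0 < l -> l < 1 ->
  exists W, [/\ smooth W, forall x, closure K x -> `|W x - w x| <= G * ((1 - l) * (r + M)) &
     forall x, closure K x -> `|d1 W x| <= B * G /\ `|d2 W x| <= B * G].
Proof.
have [B0 B00 HB0] := @hat_derive_bound R.
exists (3 * B0); first by rewrite mulr_gt0.
move=> K c r M G l w r0 sK G0 KM KMc Lw l0 l1.
(* One quarter of the margin (1 - l) r/2 that contraction provides. *)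
pose e := (1 - l) * (r / 8).
have e0 : 0 < e by rewrite mulr_gt0 ?divr_gt0//; lra.
have [N hN] := grid_size M e0.
pose W := @grid R e N (fun a b => w (homot c l (node e a b))).
have near x (a b : 'I_N.*2.+1) : closure K x -> `|x - node e a b| <= e ->
    `|w (homot c l (node e a b)) - w (homot c l x)| <= G * e.
  move=> cx xe; have ue : `|l *: (node e a b - x)| <= e.
    by rewrite normrZ gtr0_norm// distrC; apply: le_trans xe; rewrite ler_piMl// ltW.
  have -> : homot c l (node e a b) = homot c l x + l *: (node e a b - x).
    by rewrite -(homotB c) addrCA subrr addr0.
  rewrite distrC; apply: le_trans (Lw _ _ _) _; last first.
    by rewrite opprD addrA subrr add0r normrN ler_wpM2l.
  apply: (segment_in_ball (d := (1 - l) * (r / 2))).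
    by move=> v hv; apply: subset_closure; apply: (star_ball r0 sK) => //; lra.
  by apply: le_lt_trans ue _; rewrite /e ltr_pM2l; lra.
have main x : closure K x -> [/\ `|W x - w (homot c l x)| <= G * e,
    `|d1 W x| <= G * e * (3 * B0 / e) & `|d2 W x| <= G * e * (3 * B0 / e)].
  move=> cx.
  have xN : `|x| < e * N%:R by apply: le_lt_trans hN; exact: KM.
  by apply: (grid_bound e0 HB0) => //; [rewrite mulr_ge0// ltW|move=> a b; exact: near].
exists W; split; first exact: smooth_grid.
- move=> x cx; have [h _ _] := main x cx.
  have -> : W x - w x = (W x - w (homot c l x)) + (w (homot c l x) - w x) by rewrite addrA subrK.
  apply: le_trans (ler_normD _ _) _.
  have : `|w (homot c l x) - w x| <= G * ((1 - l) * M).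
    apply: le_trans (Lw _ _ _) _.
      move=> _ [t /= + <-]; rewrite in_itv/= => /andP[t0 t1].
      have -> : seg_pt (homot c l x) x t = homot c (l + t * (1 - l)) x.
        rewrite /seg_pt /homot [LHS]surjective_pairing [RHS]surjective_pairing.
        by congr pair => /=; rewrite /GRing.scale/=; ring.
      apply: (star_homot_closure r0 sK) => //; nra.
    have -> : homot c l x - x = (l - 1) *: (x - c).
      rewrite /homot [LHS]surjective_pairing [RHS]surjective_pairing.
      by congr pair => /=; rewrite /GRing.scale/=; ring.
    rewrite normrZ ltr0_norm ?opprB; last lra.
    by rewrite ler_wpM2l// ler_wpM2l ?KMc//; lra.
  have : G * e <= G * ((1 - l) * r) by rewrite ler_wpM2l// ler_wpM2l//; lra.
  rewrite mulrDr mulrDr; lra.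
- move=> x cx; have [_ h1 h2] := main x cx.
  have E : G * e * (3 * B0 / e) = 3 * B0 * G by field; rewrite gt_eqF.
  by rewrite -E.
Qed.

Lemma tooth_node (e : R) (N : nat) (a b : 'I_N.*2.+1) x : 0 < e ->
  tooth e a x.1 * tooth e b x.2 != 0 -> `|x - node e a b| <= e.
Proof.
move=> e0; rewrite mulf_eq0 negb_or => /andP[h1 h2]; rewrite norm2_le /=; apply/andP; split.
  by move: h1; apply: contraNT; rewrite -ltNge => /ltW /(tooth_eq0 e0) ->.
by move: h2; apply: contraNT; rewrite -ltNge => /ltW /(tooth_eq0 e0) ->.
Qed.

Lemma grid_unit (e : R) (N : nat) (g : R * R -> bool) x : 0 < e ->
  0 <= @grid R e N (fun a b => (g (node e a b))%:R) x <= 1.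
Proof.
move=> e0; have T0 (a : 'I_N.*2.+1) s : 0 <= tooth e a s by exact: tooth_ge0.
have T1 s : \sum_(a < N.*2.+1) tooth e a s <= 1 by exact: (hat_sum_le1 N (e^-1 * s)).
apply/andP; split.
  by apply: sumr_ge0 => a _; apply: sumr_ge0 => b _; rewrite mulr_ge0 ?mulr_ge0.
apply: (@le_trans _ _ ((\sum_(a < N.*2.+1) tooth e a x.1) * (\sum_(b < N.*2.+1) tooth e b x.2))).
  rewrite mulr_suml; apply: ler_sum => a _; rewrite mulr_sumr; apply: ler_sum => b _.
  by case: (g _); rewrite ?mul1r ?mul0r// mulr_ge0.
rewrite -[leRHS]mulr1; apply: ler_pM => //; exact: sumr_ge0.
Qed.

(** The indicator of the nodes within [e] of the contracted copy, smoothed on the grid. Points of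
    its support are within 2 e of that copy, within 3 e after taking the closure, and 3/8 of (1 - l)
    r is still below the margin (1 - l) r/2. *)
Lemma cutoff : exists2 B : R, 0 < B & forall (K : set (R * R)) c (r M l : R),
  0 < r -> star_shaped_disc K c r -> (forall x, closure K x -> `|x| <= M) -> 0 < l -> l < 1 ->
  exists chi, [/\ test_fun K chi, forall x, `|chi x| <= 1,
     forall x, [set homot c l x | x in K] x -> chi x = 1,
     forall x, `|chi x - 1| <= 1 &
     forall x, K x -> `|d1 chi x| <= B / ((1 - l) * r) /\ `|d2 chi x| <= B / ((1 - l) * r)].
Proof.
have [B0 B00 HB0] := @hat_derive_bound R.
(* The nodal values 0 and 1 are both at distance 1/2 from 1/2, so the gradient is at most half of
   [3 * B0 / e]; with e = (1 - l) r/8 this gives 12. *)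
exists (12 * B0); first by rewrite mulr_gt0.
move=> K c r M l r0 sK KM l0 l1.
pose e := (1 - l) * (r / 8).
have e0 : 0 < e by rewrite mulr_gt0 ?divr_gt0//; lra.
have [N hN] := grid_size (M + 2 * e) e0.
pose near_core (z : R * R) := `[< exists2 y, K y & `|homot c l y - z| <= e >].
pose chi := @grid R e N (fun a b => (near_core (node e a b))%:R).
have rng x : 0 <= chi x /\ chi x <= 1.
  by apply/andP; exact: grid_unit.
have half x : K x -> [/\ `|chi x - 2^-1| <= 2^-1,
    `|d1 chi x| <= 2^-1 * (3 * B0 / e) & `|d2 chi x| <= 2^-1 * (3 * B0 / e)].
  move=> Kx; have xN : `|x| < e * N%:R.
    by have := KM x (subset_closure Kx); lra.
  apply: (grid_bound e0 HB0) => // a b _; case: (near_core _) => /=; rewrite ler_norml; lra.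
have core x : [set homot c l x | x in K] x -> chi x = 1.
  move=> [y Ky <-]; apply/eqP; rewrite -subr_eq0 -normr_le0.
  have xN : `|homot c l y| < e * N%:R.
    have := KM _ (subset_closure (star_homot r0 sK (subset_closure Ky) (ltW l0) l1)); lra.
  have [|h _ _] := grid_bound (A := 1) (B := 0) (w := fun a b => (near_core (node e a b))%:R) e0 HB0 (lexx 0) xN.
    move=> a b hx; have -> : near_core (node e a b) by apply/asboolP; exists y.
    by rewrite subrr normr0.
  exact: h.
pose A := closure [set x | exists2 y, K y & `|x - homot c l y| <= 2 * e].
have Aball x : A x -> exists2 y, K y & `|x - homot c l y| <= 3 * e.
  move=> Ax; have [z [y Ky hz] xz] := closure_approx Ax e0; exists y => //.
  have -> : x - homot c l y = (x - z) + (z - homot c l y) by rewrite addrA subrK.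
  by apply: le_trans (ler_normD _ _) _; lra.
have AK : A `<=` K.
  move=> x /Aball[y Ky hy].
  have -> : x = homot c l y + (x - homot c l y) by rewrite addrC subrK.
  apply: (star_ball r0 sK) => //; [exact: subset_closure|exact: ltW|].
  by apply: le_lt_trans hy _; rewrite /e mulrCA ltr_pM2l; lra.
exists chi; split.
- split; first exact: smooth_grid.
  exists A; split=> //.
    apply: (bounded_closed2_compact (M := M)); first exact: closed_closure.
    by move=> x /AK /subset_closure; exact: KM.
  move=> x nA; rewrite /chi /grid big1// => a _; rewrite big1// => b _.
  have [t0|t0] := eqVneq (tooth e a x.1 * tooth e b x.2) 0; first by rewrite t0 mulr0.
  have [h|] := boolP (near_core _); last by rewrite mul0r.
  exfalso; apply: nA; apply: subset_closure; move/asboolP: h => [y Ky hy]; exists y => //.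
  have -> : x - homot c l y = (x - node e a b) - (homot c l y - node e a b).
    by rewrite opprB addrA subrK.
  apply: le_trans (ler_normB _ _) _.
  have := tooth_node e0 t0; lra.
- by move=> x; have [? ?] := rng x; rewrite ger0_norm.
- exact: core.
- by move=> x; have [? ?] := rng x; rewrite ler_norml; lra.
- move=> x Kx; have [_ h1 h2] := half x Kx.
  have E : 2^-1 * (3 * B0 / e) = 12 * B0 / ((1 - l) * r).
    have l1' : 1 - l != 0 by rewrite gt_eqF// subr_gt0.
    by rewrite /e; field; rewrite l1' gt_eqF.
  by rewrite -E.
Qed.

End Approximation.

(** * Norms over thin strips *)

Section Strip_small.
Context {R : realType}.
Variables (K : set (R * R)) (c : R * R) (r : R).
Hypothesis oK : open K.
Hypothesis r0 : 0 < r.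
Hypothesis sK : star_shaped_disc K c r.

Lemma strip_anti (l l' : R) : 0 < l -> l <= l' -> strip K c l' `<=` strip K c l.
Proof.
move=> l0 ll x [Kx nx]; split=> // -[y Ky E]; apply: nx.
have l'0 : 0 < l' by apply: lt_le_trans ll.
move: ll; rewrite le_eqVlt => /orP[/eqP <-|ll]; first by exists y.
exists (homot c (l / l') y).
  apply: (star_homot r0 sK (subset_closure Ky)); first by rewrite divr_ge0 ?ltW.
  by rewrite ltr_pdivrMr ?mul1r.
by rewrite homotM mulrC divfK ?gt_eqF.
Qed.

(** Contraction ratios tending to 1; the offset 2 keeps them at least 1/2, as the strip inequality
    requires. *)
Let lam (n : nat) : R := 1 - (n.+2%:R)^-1.

Let lam2 n : 2^-1 <= lam n.
Proof.
rewrite /lam lerBrDr -lerBrDl; have -> : 1 - 2^-1 = 2^-1 :> R by field.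
by rewrite lef_pV2 ?posrE// ler_nat.
Qed.

Let lam0 n : 0 < lam n.
Proof. by apply: lt_le_trans (lam2 n); rewrite invr_gt0. Qed.

Lemma strip_vanish x : K x -> \forall n \near \oo, ~ strip K c (lam n) x.
Proof.
move=> Kx; have [e e0 he] := (open2P K).1 oK x Kx.
have n0 := normr_ge0 (x - c).
have [N hN] := grid_size (2 * `|x - c|) e0.
exists N => // n /= Nn [_]; apply; exists (homot c (lam n)^-1 x); last by rewrite homotVK ?gt_eqF.
apply: he; rewrite -[X in X - _](homot1 c) /homot opprD addrACA subrr add0r -scalerBl normrZ.
have -> : 1 - (lam n)^-1 = - ((n.+2%:R)^-1 / lam n).
  by rewrite /lam; field; rewrite !gt_eqF//= ?subr_gt0 ?invf_lt1 ?ltr1n//.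
rewrite normrN gtr0_norm ?divr_gt0//.
rewrite mulrAC ltr_pdivrMr// mulrC ltr_pdivrMr//.
have h1 : N%:R <= n.+2%:R :> R by rewrite ler_nat; lia.
have := lam2 n; have : e * N%:R <= e * n.+2%:R by rewrite ler_pM2l.
have : 0 < e * n.+2%:R by rewrite mulr_gt0.
nra.
Qed.

(** Each point of [K] eventually leaves the strips, so dominated convergence applies with f^2 as
    majorant; strips shrink as the ratio grows, which passes from the sequence to all ratios near
    1. *)
Lemma strip_small (f : R * R -> R) (eps : R) : sqint leb2 K f -> 0 < eps ->
  exists l0, [/\ 2^-1 <= l0, l0 < 1 & forall l, l0 <= l -> l < 1 -> nrm leb2 (strip K c l) f <= eps].
Proof.
move=> hf eps0; have mK := open2_measurable oK.
have mS n : measurable (strip K c (lam n)) by apply: strip_measurable.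
pose F n (x : R * R) : \bar R := ((f x ^+ 2) * \1_(strip K c (lam n)) x)%:E.
have mf2 : measurable_fun K (fun x => f x ^+ 2) by apply: measurable_funX; case: hf.
have mF n : measurable_fun K (F n).
  by apply/measurable_EFinP; apply: measurable_funM => //; exact: measurable_funTS (measurable_indic (mS n)).
have [] := @dominated_convergence _ _ _ leb2 K mK F (fun=> 0%E) (fun x => (f x ^+ 2)%:E) mF.
- exact: measurable_cst.
- apply: aeW => x Kx; apply: cvg_near_cst; near=> n.
  have h : ~ strip K c (lam n) x by near: n; exact: strip_vanish.
  by rewrite /F indicE memNset// mulr0.
- by case: hf.
- apply: aeW => x n Kx; rewrite /F /= lee_fin ger0_norm; last exact: mulr_ge0 (sqr_ge0 _) _.
  by rewrite ler_piMr ?sqr_ge0// indicE; case: (_ \in _).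
move=> _ _; rewrite integral0 => /fine_cvgP[_ /cvgrPdist_le /(_ (eps ^+ 2))].
rewrite exprn_gt0// => /(_ isT) [n _ /(_ n (leqnn n))] /=.
rewrite sub0r normrN => hn.
exists (lam n); split=> [//||l ll l1].
  by rewrite /lam ltrBlDr ltrDl invr_gt0.
have l0 : 0 < l by apply: lt_le_trans ll.
have ms : measurable (strip K c l) by apply: strip_measurable.
have hS := @sqintS _ _ _ leb2 _ _ f (mS n) mK (@strip_sub _ _ _ _) hf.
apply: le_trans (@nrmS _ _ _ leb2 _ _ f ms (mS n) (strip_anti (lam0 n) ll) hS) _.
rewrite -(ler_pXn2r (n := 2)) ?nnegrE ?nrm_ge0 ?(ltW eps0)// nrm_sqr.
apply: le_trans hn; rewrite -[leLHS]ger0_norm; last by rewrite ip_ge0.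
rewrite /ip /Rintegral integral_mkcond [in leRHS]integral_mkcond.
rewrite le_eqVlt; apply/orP; left; apply/eqP; congr `|fine _|; apply: eq_integral => x _.
rewrite !patchE /F; case: ifPn => h.
  by rewrite indicE h mulr1 mem_set ?expr2//; apply: strip_sub; exact: set_mem h.
by case: ifPn => // _; rewrite indicE (negbTE h) mulr0.
Unshelve. all: by end_near. Qed.

End Strip_small.

Section Localized_norms.
Context d (T : measurableType d) (R : realType) (mu : {measure set T -> \bar R}).
Variables (A K : set T).
Hypothesis mA : measurable A.
Hypothesis mK : measurable K.
Hypothesis AK : A `<=` K.

Lemma nrm_off (f : T -> R) : (forall x, K x -> ~ A x -> f x = 0) -> nrm mu K f = nrm mu A f.
Proof.
move=> f0; rewrite /nrm /ip /Rintegral integral_mkcond [in RHS]integral_mkcond.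
congr (Num.sqrt (fine _)); apply: eq_integral => x _; rewrite !patchE.
have [xA|xA] := boolP (x \in A); first by rewrite ifT// mem_set//; exact/AK/set_mem.
case: ifPn => // xK; rewrite f0 ?mulr0//; first exact: set_mem.
by move=> Ax; move: xA; rewrite mem_set.
Qed.

Lemma nrm_mul_le (f h : T -> R) (B : R) : sqint mu K f -> measurable_fun K h -> 0 <= B ->
  (forall x, K x -> `|h x| <= B) -> (forall x, K x -> ~ A x -> h x = 0) ->
  nrm mu K (fun x => h x * f x) <= B * nrm mu A f.
Proof.
move=> hf mh B0 hB h0.
rewrite nrm_off; last by move=> x Kx nA; rewrite h0// mul0r.
have hfA := sqintS mA mK AK hf.
have hB' x : A x -> `|h x| <= B by move=> /AK; exact: hB.
have hhf : sqint mu A (fun x => h x * f x).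
  by apply: sqint_bounded_mul hB' => //; exact: measurable_funS mh.
rewrite -[B in leRHS]ger0_norm// -(nrmZ mA B hfA).
apply: (nrm_le mA hhf (sqintZ mA B hfA)) => x /hB' hx.
by rewrite !normrM (ger0_norm B0) ler_wpM2r.
Qed.

(** The shape of the error made when a function [y] is cut off: [a] is the approximation error, [b]
    the derivative lost where the cut-off is not 1, and [dchi * y] the Leibniz term. Only [a] is
    measured on all of [K], the other two on the strip. *)
Lemma nrm_cutoff (chi dchi a b y : T -> R) (B : R) :
  sqint mu K a -> sqint mu K b -> sqint mu K y ->
  measurable_fun K chi -> measurable_fun K dchi -> 0 <= B ->
  (forall x, `|chi x| <= 1) -> (forall x, `|chi x - 1| <= 1) ->
  (forall x, K x -> `|dchi x| <= B) ->
  (forall x, K x -> ~ A x -> chi x = 1) -> (forall x, K x -> ~ A x -> dchi x = 0) ->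
  nrm mu K (fun x => chi x * a x + ((chi x - 1) * b x + dchi x * y x)) <=
  nrm mu K a + (nrm mu A b + B * nrm mu A y).
Proof.
move=> ha hb hy mc md B0 c1 c2 dB c0 d0.
have mc1 : measurable_fun K (fun x => chi x - 1) by exact: measurable_funB.
have h1 : sqint mu K (fun x => chi x * a x).
  by apply: (sqint_bounded_mul mK (M := 1)) => // x _; exact: c1.
have h2 : sqint mu K (fun x => (chi x - 1) * b x).
  by apply: (sqint_bounded_mul mK (M := 1)) => // x _; exact: c2.
have h3 : sqint mu K (fun x => dchi x * y x) by apply: (sqint_bounded_mul mK (M := B)).
apply: le_trans (nrmD mK h1 (sqintD mK h2 h3)) _; apply: lerD.
  apply: (nrm_le mK) => // x _; rewrite normrM ler_piMl//; exact: c1.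
apply: le_trans (nrmD mK h2 h3) _; apply: lerD.
  rewrite -[leRHS]mul1r; apply: nrm_mul_le => // x Kx nA.
  by rewrite c0// subrr.
exact: nrm_mul_le.
Qed.

End Localized_norms.

Section Zero_trace_approximation.
Context {R : realType}.
Variables (K : @polygon R) (c : R * R) (r : R).
Hypothesis r0 : 0 < r.
Hypothesis dK : disc c r `<=` K.
Hypothesis sK : star_shaped_disc K c r.
Notation P := (@pol_vtx R K).
Notation Q i := (@pol_vtx R K (ordS i)).

Lemma edge_int_sqrB (p q : R * R) (phi g y : R * R -> R) (B : R) : continuous phi -> continuous y ->
  L2_edge p q g -> (forall t, 0 <= t <= 1 -> `|y (seg_pt p q t) - (phi (seg_pt p q t) - g (seg_pt p q t))| <= B) ->
  edge_int p q (fun x => y x ^+ 2) <=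
  2 * edge_int p q (fun x => (phi x - g x) ^+ 2) + 2 * B ^+ 2 * enorm (q - p).
Proof.
move=> cphi cy lg hB; rewrite /edge_int.
pose m : R -> R := fun t => (phi (seg_pt p q t) - g (seg_pt p q t)).
have cI (f : R * R -> R) : continuous f -> sqint (@lebesgue_measure R) `[0, 1] (f \o seg_pt p q).
  move=> cf; have c' : continuous (f \o seg_pt p q) by exact: (line_cont cf).
  split; first by apply: measurable_funTS; exact: continuous_measurable_fun.
  exact: continuous_integrable_itv (sqr_continuous c').
have mI : measurable (`[0, 1]%classic : set R) by [].
have sm : sqint (@lebesgue_measure R) `[0, 1] m.
  exact: (@sqintB _ _ _ (@lebesgue_measure R) _ mI (phi \o seg_pt p q) (g \o seg_pt p q) (cI _ cphi) lg).
have im := sqint_sqr sm.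
have iy := sqint_sqr (cI _ cy).
have mu1 : (@lebesgue_measure R `[0%R, 1%R] < +oo)%E by rewrite lebesgue_measure_itv/= lte_fin ltr01 sube0 ltry.
have iB := @integrable_const _ _ _ (@lebesgue_measure R) _ mI (2 * B ^+ 2) mu1.
have h : \int[@lebesgue_measure R]_(t in `[0, 1]) (y (seg_pt p q t) ^+ 2) <=
    2 * \int[@lebesgue_measure R]_(t in `[0, 1]) (m t ^+ 2) + 2 * B ^+ 2.
  have E : \int[@lebesgue_measure R]_(t in `[0, 1]) (2 * B ^+ 2) = 2 * B ^+ 2.
    transitivity (2 * B ^+ 2 * fine (@lebesgue_measure R `[0%R, 1%R])); first exact: Rintegral_cst.
    by rewrite lebesgue_measure_itv/= lte_fin ltr01 sube0 mulr1.
  rewrite -[in leRHS]E -RintegralZl// -RintegralD//; last first.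
    exact: (@integrableZl _ _ _ (@lebesgue_measure R) _ mI 2 _ im).
  apply: le_Rintegral => //.
    have i2m := @integrableZl _ _ _ (@lebesgue_measure R) _ mI 2 _ im.
    exact: (@integrableD _ _ _ (@lebesgue_measure R) _ mI _ _ i2m iB).
  move=> t; rewrite /= in_itv/= => ht; have := hB t ht; rewrite -/(m t).
  move: (y _) (m t) => a b; rewrite ler_norml => /andP[u1 u2].
  have : (a - b) ^+ 2 <= B ^+ 2 by nra.
  have := sqr_ge0 (a - 2 * b); nra.
apply: le_trans (ler_wpM2l (enorm_ge0 (q - p)) h) _.
by rewrite mulrDr mulrCA [_ * (2 * B ^+ 2)]mulrC.
Qed.

Lemma small_delta (a b e : R) : 0 <= a -> 0 <= b -> 0 < e ->
  exists delta, [/\ 0 < delta, delta <= 1, a * delta <= e & b * delta <= e].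
Proof.
move=> a0 b0 e0; have s0 : 0 < e + a + b by lra.
exists (e / (e + a + b)); split.
- exact: divr_gt0.
- by rewrite ler_pdivrMr//; lra.
- by rewrite mulrA ler_pdivrMr//; nra.
- by rewrite mulrA ler_pdivrMr//; nra.
Qed.


Lemma eventually_pick (u1 u2 u3 u4 : nat -> R) (e1 e2 : R) :
  u1 @ \oo --> (0 : R) -> u2 @ \oo --> (0 : R) -> u3 @ \oo --> (0 : R) -> u4 @ \oo --> (0 : R) ->
  0 < e1 -> 0 < e2 -> exists n, [/\ `|u1 n| <= e1, `|u2 n| <= e1, `|u3 n| <= e1 & `|u4 n| <= e2].
Proof.
have pick u e : u @ \oo --> (0 : R) -> 0 < e -> \forall n \near \oo, `|u n| <= e.
  by move=> /cvgrPdist_le h e0; have := h e e0; apply: filterS => n; rewrite sub0r normrN.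
move=> h1 h2 h3 h4 e10 e20.
have [N _ HN] := filterI (filterI (pick _ _ h1 e10) (pick _ _ h2 e10)) (filterI (pick _ _ h3 e10) (pick _ _ h4 e20)).
by exists N; have [[? ?] [? ?]] := HN N (leqnn N).
Qed.

Lemma grad_sqr_integral (A : set (R * R)) (M : R) y : measurable A -> (forall x, A x -> `|x| <= M) ->
  smooth y -> \int[leb2]_(x in A) grad_sqr y x = nrm leb2 A (d1 y) ^+ 2 + nrm leb2 A (d2 y) ^+ 2.
Proof.
move=> mA AM sy.
have E f : nrm leb2 A f ^+ 2 = \int[leb2]_(x in A) (f x ^+ 2).
  transitivity (ip leb2 A f f); first exact: nrm_sqr.
  by apply: eq_Rintegral => x _; rewrite expr2.
have i1 := continuous_integrable2 mA AM (sqr_cont2 (smooth_cont (smooth_d1 sy))).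
have i2 := continuous_integrable2 mA AM (sqr_cont2 (smooth_cont (smooth_d2 sy))).
transitivity (\int[leb2]_(x in A) (d1 y x ^+ 2) + \int[leb2]_(x in A) (d2 y x ^+ 2)).
  exact: RintegralD.
exact: (f_equal2 +%R (esym (E _)) (esym (E _))).
Qed.

Lemma cutoff_derive_strip (chi : R * R -> R) (l : R) (v x : R * R) : 0 < l -> pol_dom K x -> ~ strip K c l x ->
  (forall x, [set homot c l x | x in K] x -> chi x = 1) -> 'D_v chi x = 0.
Proof.
move=> l0 Kx ns hc; rewrite -[RHS](@derive_cst R (R * R)%type R 1 v x).
apply: near_eq_derive.
have hx : [set homot c l x | x in K] x by apply: contrapT => h; apply: ns.
have /open_nbhs_nbhs : open_nbhs x [set homot c l x | x in K].
  by split=> //; apply: homot_open => //; exact: pol_open.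
by apply: filterS => z; exact: hc.
Qed.

End Zero_trace_approximation.


(* The canonical instances under which [leb2] is a measure are only convertible to those
   found by unification, so the generic lemmas are restated for [leb2]. *)
Section Plane_norms.
Context {R : realType}.
Implicit Types (A K : set (R * R)) (f g h : R * R -> R).

Lemma le_of_eq (x y : R) : x = y -> x <= y. Proof. by move=> ->. Qed.

Lemma sqint2D A f g : measurable A -> sqint leb2 A f -> sqint leb2 A g ->
  sqint leb2 A (fun x => f x + g x).
Proof. by move=> mA; exact: sqintD. Qed.

Lemma sqint2B A f g : measurable A -> sqint leb2 A f -> sqint leb2 A g ->
  sqint leb2 A (fun x => f x - g x).
Proof. by move=> mA; exact: sqintB. Qed.

Lemma sqint2Z A a f : measurable A -> sqint leb2 A f -> sqint leb2 A (fun x => a * f x).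
Proof. by move=> mA; exact: sqintZ. Qed.

Lemma sqint2S A K f : measurable A -> measurable K -> A `<=` K -> sqint leb2 K f -> sqint leb2 A f.
Proof. exact: (@sqintS _ _ _ leb2). Qed.

Lemma nrm2D A f g : measurable A -> sqint leb2 A f -> sqint leb2 A g ->
  nrm leb2 A (fun x => f x + g x) <= nrm leb2 A f + nrm leb2 A g.
Proof. by move=> mA; exact: nrmD. Qed.

Lemma nrm2B A f g : measurable A -> sqint leb2 A f -> sqint leb2 A g ->
  nrm leb2 A (fun x => f x - g x) <= nrm leb2 A f + nrm leb2 A g.
Proof. by move=> mA; exact: nrmB. Qed.

Lemma nrm2Z A a f : measurable A -> sqint leb2 A f ->
  nrm leb2 A (fun x => a * f x) = `|a| * nrm leb2 A f.
Proof. by move=> mA; exact: nrmZ. Qed.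

Lemma nrm2_le A f g : measurable A -> sqint leb2 A f -> sqint leb2 A g ->
  (forall x, A x -> `|f x| <= `|g x|) -> nrm leb2 A f <= nrm leb2 A g.
Proof. by move=> mA; exact: nrm_le. Qed.

Lemma nrm2S A K f : measurable A -> measurable K -> A `<=` K -> sqint leb2 K f ->
  nrm leb2 A f <= nrm leb2 K f.
Proof. exact: (@nrmS _ _ _ leb2). Qed.

Lemma nrm2_sqr_int A f : nrm leb2 A f ^+ 2 = \int[leb2]_(x in A) (f x ^+ 2).
Proof.
transitivity (ip leb2 A f f); first exact: nrm_sqr.
by apply: eq_Rintegral => x _; rewrite expr2.
Qed.

Lemma nrm2_sqr A f : nrm leb2 A f ^+ 2 = ip leb2 A f f.
Proof. exact: nrm_sqr. Qed.

Lemma nrm2_const A f (B : R) : measurable A -> sqint leb2 A (fun=> 1) -> sqint leb2 A f -> 0 <= B ->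
  (forall x, A x -> `|f x| <= B) -> nrm leb2 A f <= B * nrm leb2 A (fun=> 1).
Proof.
move=> mA s1 sf B0 fB; have := nrm2Z B mA s1; rewrite ger0_norm// => <-.
by apply: nrm2_le => // [|x /fB]; [exact: sqint2Z|rewrite mulr1 (ger0_norm B0)].
Qed.

End Plane_norms.

(** * Approximation of a function with zero trace by test functions *)

Section Zero_trace_approximation_theorem.
Context {R : realType}.

Lemma small_delta_sum (q b d e : R) : 0 <= q -> 0 <= b -> 0 <= d -> 0 <= e ->
  (2 + q + b) * d <= e / 2 -> d + ((1 + b) * d + e / 2) <= e /\ (d + q * d) + d <= e.
Proof.
move=> q0 b0 d0 e0; have : 0 <= q * d by rewrite mulr_ge0.
by have : 0 <= b * d; [rewrite mulr_ge0|rewrite !mulrDl mul1r; split; lra].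
Qed.

(** The test function is [chi * (f - W)], with f a smooth approximation of v. The critical term is
    the gradient of [chi], of size 1/(1 - l), times f - W on the strip; the strip inequality and the
    small boundary values of f - W supply the compensating factor 1 - l. Weak derivatives of [w] do
    not occur: those of v are compared with the gradient of [W], for which [B] is chosen before the
    polygon. *)
Lemma zero_trace_approximation : exists2 B : R, 0 < B & forall (K : @polygon R) c r (v : H1 K) g w G,
  0 < r -> disc c r `<=` K -> star_shaped_disc K c r -> is_trace v g -> L2 K w ->
  0 <= G -> lipschitz_along (closure K) G w ->
  (forall i t, 0 <= t <= 1 -> w (seg_pt (pol_vtx i) (@pol_vtx R K (ordS i)) t) =
     g (seg_pt (pol_vtx i) (pol_vtx (ordS i)) t)) ->
  forall eps, 0 < eps -> exists psi W, [/\ test_fun K psi, smooth W,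
    L2norm K (fun x => psi x - (v x - w x)) <= eps,
    L2norm K (fun x => d1 psi x - (H1_d1 v x - d1 W x)) <= eps /\
    L2norm K (fun x => d2 psi x - (H1_d2 v x - d2 W x)) <= eps &
    forall x, pol_dom K x -> `|d1 W x| <= B * G /\ `|d2 W x| <= B * G].
Proof.
have [B B0 HB] := @quasi_interpolation R; have [Bc Bc0 HBc] := @cutoff R.
exists B => // K c r v g w G r0 dK sK [lg [phi [sphi ph0 ph1 ph2 phg]]] lw G0 Lw wg eps eps0.
have [M [M0 [KM KMc]]] := polygon_bounded r0 dK.
have [CK [CK0 strip_le]] := strip_ineq r0 dK sK.
have mK := @polygon_measurable R K.
have oK := @pol_open R K.
have KMo x : pol_dom K x -> `|x| <= M by move=> Kx; apply: KM; exact: subset_closure.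
pose q0 := G * (r + M); pose Pm : R := boundary_int K (fun=> 1).
have q00 : 0 <= q0 by rewrite mulr_ge0// addr_ge0// ltW.
have Pm0 : 0 <= Pm by apply: boundary_int_ge0.
pose A1 := nrm leb2 K (fun=> 1).
have A10 : 0 <= A1 by exact: nrm_ge0.
pose E1 := CK * (2 + 2 * q0 ^+ 2 * Pm + 2 * (2 + B * G) ^+ 2).
have BG0 : 0 <= B * G by rewrite mulr_ge0// ltW.
have E10 : 0 <= E1.
  apply: mulr_ge0 (ltW CK0) _; apply: addr_ge0; last exact: mulr_ge0 (sqr_ge0 _).
  by apply: addr_ge0 => //; apply: mulr_ge0 => //; exact: mulr_ge0 (sqr_ge0 _).
have e2 : 0 < eps / 2 by rewrite divr_gt0.
have sE0 : 0 <= (Bc / r) ^+ 2 * E1 by exact: mulr_ge0 (sqr_ge0 _) _.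
have e4 : 0 < (eps / 2) ^+ 2 by rewrite exprn_gt0.
have a0 : 0 <= 2 + q0 * A1 + B * G.
  by apply: addr_ge0 => //; apply: addr_ge0 => //; exact: mulr_ge0.
(* Two smallness conditions with different tolerances are obtained together: each is multiplied by
   the tolerance of the other, and the factors are cancelled in [delA'] and [delB]. *)
have [del [del0 del1 delA delB']] := small_delta (mulr_ge0 a0 (ltW e4)) (mulr_ge0 sE0 (ltW e2)) (mulr_gt0 e2 e4).
have delA' : (2 + q0 * A1 + B * G) * del <= eps / 2.
  by move: delA; rewrite mulrAC ler_pM2r.
have [sum1 sum2] := small_delta_sum (mulr_ge0 q00 A10) BG0 (ltW del0) (ltW eps0) delA'.
have delB : (Bc / r) ^+ 2 * E1 * del <= (eps / 2) ^+ 2.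
  by move: delB'; rewrite mulrAC mulrC ler_pM2l.
have s1 : sqint leb2 K (fun=> 1) by exact: sqint_continuous mK KMo (@cst_continuous _ R 1).
have sv : sqint leb2 K v := H1_L2 v.
have sv1 : sqint leb2 K (H1_d1 v) := H1_L2_d1 v.
have sv2 : sqint leb2 K (H1_d2 v) := H1_L2_d2 v.
have sw : sqint leb2 K w := lw.
have svw : sqint leb2 K (fun x => v x - w x) := sqint2B mK sv sw.
have [l [l2 l1 [ldel ln1 [lnv lnv1 lnv2]]]] : exists l, [/\ 2^-1 <= l, l < 1 & [/\ 1 - l <= del,
    nrm leb2 (strip K c l) (fun=> 1) <= del & [/\ nrm leb2 (strip K c l) (fun x => v x - w x) <= del,
    nrm leb2 (strip K c l) (H1_d1 v) <= del & nrm leb2 (strip K c l) (H1_d2 v) <= del]]].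
  have [la [a1 a2 a3]] := strip_small oK r0 sK s1 del0.
  have [lb [b1 b2 b3]] := strip_small oK r0 sK svw del0.
  have [lc [c1 c2 c3]] := strip_small oK r0 sK sv1 del0.
  have [ld [d1' d2' d3]] := strip_small oK r0 sK sv2 del0.
  exists (Num.max la (Num.max lb (Num.max lc (Num.max ld (1 - del))))).
  set m := Num.max _ _; have m1 : m < 1 by rewrite /m !gt_max a2 b2 c2 d2' /= ltrBlDr ltrDl.
  have ma : la <= m by rewrite /m le_max lexx.
  have mb : lb <= m by rewrite /m !le_max lexx orbT.
  have mc : lc <= m by rewrite /m !le_max lexx !orbT.
  have md : ld <= m by rewrite /m !le_max lexx !orbT.
  have me : 1 - del <= m by rewrite /m !le_max lexx !orbT.
  split=> //; first exact: le_trans ma.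
  by split; [rewrite lerBlDr -lerBlDl|exact: a3|split; [exact: b3|exact: c3|exact: d3]].
have l0 : 0 < l by apply: lt_le_trans l2; rewrite invr_gt0.
have l1' : 0 < 1 - l by rewrite subr_gt0.
have [chi [tchi chi1 chione chi2 dchi]] := HBc K c r M l r0 sK KM l0 l1.
have [W [sW Ww dW]] := HB K c r M G l w r0 sK G0 KM KMc Lw l0 l1.
(* The smooth approximation is chosen after [l]: its squared boundary error has to be small in
   comparison with 1 - l. *)
have [n [n0 n1 n2 ng]] := eventually_pick ph0 ph1 ph2 phg del0 (mulr_gt0 del0 l1').
move: n0 n1 n2 ng; rewrite !ger0_norm ?nrm_ge0//; last by apply: boundary_int_ge0 => x; exact: sqr_ge0.
move: (phi n) (sphi n) => f sf n0 n1 n2 ng {sphi ph0 ph1 ph2 phg phi}.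
pose y x := f x - W x; have sy : smooth y by exact: smoothB.
have schi : smooth chi by case: tchi.
have mS : measurable (strip K c l) by exact: strip_measurable.
have SK : strip K c l `<=` K by exact: strip_sub.
have SM x : strip K c l x -> `|x| <= M by move=> /SK; exact: KMo.
have sqc u : continuous u -> sqint leb2 K u by move=> cu; exact: sqint_continuous mK KMo cu.
have sS u : sqint leb2 K u -> sqint leb2 (strip K c l) u by exact: sqint2S.
have comp (F V U : R * R -> R) : sqint leb2 K F -> sqint leb2 K V -> sqint leb2 K U ->
    nrm leb2 K (fun x => F x - V x) <= del -> nrm leb2 (strip K c l) V <= del ->
    (forall x, pol_dom K x -> `|U x| <= B * G) ->
    nrm leb2 (strip K c l) (fun x => F x - U x) <= (2 + B * G) * del /\
    nrm leb2 (strip K c l) (fun x => V x - U x) <= (1 + B * G) * del.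
  move=> hF hV hU FV nV UB.
  have nU : nrm leb2 (strip K c l) U <= B * G * del.
    apply: le_trans (nrm2_const mS (sS _ s1) (sS _ hU) BG0 _) _; last by rewrite ler_wpM2l.
    by move=> x /SK /UB.
  have hVU := nrm2B mS (sS _ hV) (sS _ hU).
  have nVU : nrm leb2 (strip K c l) (fun x => V x - U x) <= (1 + B * G) * del.
    by apply: le_trans hVU _; rewrite mulrDl mul1r lerD.
  split=> //.
  have hFV := sqint2B mK hF hV.
  have FVS := le_trans (nrm2S mS mK SK hFV) FV.
  have E : (fun x => F x - U x) = (fun x => (F x - V x) + (V x - U x)).
    by apply/funext => x; rewrite addrA subrK.
  rewrite E; apply: le_trans (nrm2D mS (sS _ hFV) (sS _ (sqint2B mK hV hU))) _.
  have -> : (2 + B * G) * del = del + (1 + B * G) * del by ring.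
  exact: lerD.
have sc u : smooth u -> sqint leb2 K u by move=> /smooth_cont; exact: sqc.
have dW1 x : pol_dom K x -> `|d1 W x| <= B * G by move=> /subset_closure /dW[].
have dW2 x : pol_dom K x -> `|d2 W x| <= B * G by move=> /subset_closure /dW[].
have [F1 V1] := comp _ _ _ (sc _ (smooth_d1 sf)) sv1 (sc _ (smooth_d1 sW)) n1 lnv1 dW1.
have [F2 V2] := comp _ _ _ (sc _ (smooth_d2 sf)) sv2 (sc _ (smooth_d2 sW)) n2 lnv2 dW2.
have dy1 : d1 y = (fun x => d1 f x - d1 W x) by exact: d1B.
have dy2 : d2 y = (fun x => d2 f x - d2 W x) by exact: d2B.
(* On the boundary w = g, so y = (f - g) - (W - w). The first square carries the factor 1 - l by the
   choice of [n]; the second is of order (1 - l)^2, and one factor 1 - l is at most [del]. *)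
have bdy : boundary_int K (fun x => y x ^+ 2) <= (1 - l) * ((2 + 2 * q0 ^+ 2 * Pm) * del).
  have Bq0 : 0 <= q0 * (1 - l) by rewrite mulr_ge0// ltW.
  apply: (@le_trans _ _ (\sum_(i < pol_n K) (2 * edge_int (pol_vtx i) (pol_vtx (ordS i)) (fun x => (f x - g x) ^+ 2)
      + 2 * (q0 * (1 - l)) ^+ 2 * edge_int (pol_vtx i) (@pol_vtx R K (ordS i)) (fun=> 1)))).
    apply: ler_sum => i _.
    have -> : edge_int (pol_vtx i) (pol_vtx (ordS i)) (fun=> 1) = enorm (@pol_vtx R K (ordS i) - pol_vtx i).
      rewrite /edge_int; transitivity (enorm (@pol_vtx R K (ordS i) - pol_vtx i) * (1 * fine (@lebesgue_measure R `[0%R, 1%R]))).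
        by congr (_ * _); exact: Rintegral_cst.
      by rewrite lebesgue_measure_itv/= lte_fin ltr01 sube0 !mulr1.
    apply: edge_int_sqrB; [exact: smooth_cont|exact: smooth_cont|exact: lg|].
    move=> t ht; rewrite -wg// /y.
    have -> : f (seg_pt (pol_vtx i) (pol_vtx (ordS i)) t) - W (seg_pt (pol_vtx i) (pol_vtx (ordS i)) t) -
      (f (seg_pt (pol_vtx i) (pol_vtx (ordS i)) t) - w (seg_pt (pol_vtx i) (@pol_vtx R K (ordS i)) t)) =
      - (W (seg_pt (pol_vtx i) (pol_vtx (ordS i)) t) - w (seg_pt (pol_vtx i) (pol_vtx (ordS i)) t)) by ring.
    rewrite normrN /q0 -mulrA [(r + M) * _]mulrC; apply: Ww.
    by have [] : (closure K `\` K) (seg_pt (pol_vtx i) (@pol_vtx R K (ordS i)) t)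
      by apply: (@edge_boundary _ _ i); exists t => //=; rewrite in_itv.
  rewrite big_split/= -!mulr_sumr -/(boundary_int K (fun x => (f x - g x) ^+ 2)) -/(boundary_int K (fun=> 1)) -/Pm.
  apply: (@le_trans _ _ (2 * (del * (1 - l)) + 2 * (q0 ^+ 2 * ((1 - l) * del)) * Pm)).
    apply: lerD; first by rewrite ler_wpM2l.
    rewrite ler_wpM2r// ler_wpM2l// exprMn ler_wpM2l ?sqr_ge0// expr2 ler_wpM2l//.
    exact: ltW.
  by apply: le_of_eq; ring.
have nyS : nrm leb2 (strip K c l) y ^+ 2 <= (1 - l) ^+ 2 * (E1 * del).
  rewrite nrm2_sqr_int; apply: le_trans (strip_le y l sy l2 l1) _.
  rewrite (grad_sqr_integral mS SM sy).
  have q1 : nrm leb2 (strip K c l) (d1 y) <= (2 + B * G) * del.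
    by rewrite dy1; exact: F1.
  have q2 : nrm leb2 (strip K c l) (d2 y) <= (2 + B * G) * del.
    by rewrite dy2; exact: F2.
  have p1 := nrm_ge0 leb2 (strip K c l) (d1 y).
  have p2 := nrm_ge0 leb2 (strip K c l) (d2 y).
  have del2 : del ^+ 2 <= del by rewrite expr2 ler_piMl// ltW.
  have gr : nrm leb2 (strip K c l) (d1 y) ^+ 2 + nrm leb2 (strip K c l) (d2 y) ^+ 2 <= 2 * (2 + B * G) ^+ 2 * del.
    have sq x : 0 <= x -> x <= (2 + B * G) * del -> x ^+ 2 <= (2 + B * G) ^+ 2 * del.
      move=> x0 xle; apply: (@le_trans _ _ (((2 + B * G) * del) ^+ 2)).
        by rewrite lerXn2r ?nnegrE// (le_trans x0).
      by rewrite exprMn ler_wpM2l ?sqr_ge0.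
    have -> : 2 * (2 + B * G) ^+ 2 * del = (2 + B * G) ^+ 2 * del + (2 + B * G) ^+ 2 * del by ring.
    exact: lerD (sq _ p1 q1) (sq _ p2 q2).
  have -> : (1 - l) ^+ 2 * (E1 * del) =
    CK * ((1 - l) * ((1 - l) * ((2 + 2 * q0 ^+ 2 * Pm) * del)) + (1 - l) ^+ 2 * (2 * (2 + B * G) ^+ 2 * del)).
    by rewrite /E1; ring.
  exact: (ler_wpM2l (ltW CK0) (lerD (ler_wpM2l (ltW l1') bdy) (ler_wpM2l (sqr_ge0 _) gr))).
(* The factor 1 - l just gained cancels the denominator of the cut-off gradient. *)
have X0 : Bc / ((1 - l) * r) * nrm leb2 (strip K c l) y <= eps / 2.
  have Bn : 0 <= Bc / ((1 - l) * r) by rewrite divr_ge0 ?mulr_ge0// ltW.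
  rewrite -(ler_pXn2r (n := 2)) ?nnegrE ?(ltW e2) ?(mulr_ge0 Bn (nrm_ge0 _ _ _))//.
  rewrite exprMn; apply: le_trans (ler_wpM2l (sqr_ge0 _) nyS) _.
  apply: le_trans delB; apply: le_of_eq.
  by field; rewrite !gt_eqF.
have fin (F V U dchi0 : R * R -> R) : sqint leb2 K F -> sqint leb2 K V -> sqint leb2 K U ->
    nrm leb2 K (fun x => F x - V x) <= del -> nrm leb2 (strip K c l) (fun x => V x - U x) <= (1 + B * G) * del ->
    continuous dchi0 -> (forall x, pol_dom K x -> `|dchi0 x| <= Bc / ((1 - l) * r)) ->
    (forall x, pol_dom K x -> ~ strip K c l x -> dchi0 x = 0) ->
    nrm leb2 K (fun x => (y x * dchi0 x + chi x * (F x - U x)) - (V x - U x)) <= eps.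
  move=> hF hV hU FV VU cd dB d0.
  have -> : (fun x => (y x * dchi0 x + chi x * (F x - U x)) - (V x - U x)) =
      (fun x => chi x * (F x - V x) + ((chi x - 1) * (V x - U x) + dchi0 x * y x)).
    by apply/funext => x; ring.
  apply: le_trans (@nrm_cutoff _ _ _ leb2 _ _ mS mK SK chi dchi0 (fun x => F x - V x) (fun x => V x - U x) y _
    (sqint2B mK hF hV) (sqint2B mK hV hU) (sc _ sy) _ _ _ chi1 chi2 dB _ d0) _.
  - by apply: measurable_funTS; exact: continuous2_measurable (smooth_cont schi).
  - by apply: measurable_funTS; exact: continuous2_measurable.
  - by rewrite divr_ge0 ?mulr_ge0// ltW.
  - by move=> x Kx ns; apply: chione; apply: contrapT => h; apply: ns.
  by apply: le_trans sum1; apply: lerD FV (lerD VU X0).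
exists (fun x => y x * chi x), W; split=> //; first exact: testM.
- change (nrm leb2 K (fun x => y x * chi x - (v x - w x)) <= eps).
  have -> : (fun x => y x * chi x - (v x - w x)) =
      (fun x => chi x * ((f x - v x) + (w x - W x)) + ((chi x - 1) * (v x - w x) + 0 * y x)).
    by apply/funext => x; rewrite /y; ring.
  have sfv := sqint2B mK (sc _ sf) sv; have swW := sqint2B mK sw (sc _ sW).
  apply: le_trans (@nrm_cutoff _ _ _ leb2 _ _ mS mK SK chi (fun=> 0) (fun x => (f x - v x) + (w x - W x)) (fun x => v x - w x) y 0
    (sqint2D mK sfv swW) svw (sc _ sy) _ _ _ chi1 chi2 _ _ _) _ => //.
  - by apply: measurable_funTS; exact: continuous2_measurable (smooth_cont schi).
  - by move=> x _; rewrite normr0.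
  - by move=> x Kx ns; apply: chione; apply: contrapT => h; apply: ns.
  have nw : nrm leb2 K (fun x => w x - W x) <= q0 * A1 * del.
    have Bq0 : 0 <= q0 * (1 - l) by rewrite mulr_ge0// ltW.
    apply: le_trans (nrm2_const mK s1 swW Bq0 _) _.
      move=> x /subset_closure Kx; rewrite distrC; apply: le_trans (Ww x Kx) _.
      by rewrite /q0 -mulrA [(r + M) * _]mulrC.
    by rewrite -mulrA -mulrA ler_wpM2l// mulrC ler_wpM2l.
  apply: le_trans sum2; apply: lerD; last by rewrite mul0r addr0.
  by apply: le_trans (nrm2D mK sfv swW) _; apply: lerD.
- have off1 x : pol_dom K x -> ~ strip K c l x -> d1 chi x = 0.
    by move=> Kx ns; exact: cutoff_derive_strip l0 Kx ns chione.
  have off2 x : pol_dom K x -> ~ strip K c l x -> d2 chi x = 0.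
    by move=> Kx ns; exact: cutoff_derive_strip l0 Kx ns chione.
  have c1 := fin (d1 f) (H1_d1 v) (d1 W) (d1 chi) (sc _ (smooth_d1 sf)) sv1 (sc _ (smooth_d1 sW)) n1 V1
    (smooth_cont (smooth_d1 schi)) (fun x Kx => (dchi x Kx).1) off1.
  have c2 := fin (d2 f) (H1_d2 v) (d2 W) (d2 chi) (sc _ (smooth_d2 sf)) sv2 (sc _ (smooth_d2 sW)) n2 V2
    (smooth_cont (smooth_d2 schi)) (fun x Kx => (dchi x Kx).2) off2.
  split.
    by rewrite (d1M sy schi) dy1; exact: c1.
  by rewrite (d2M sy schi) dy2; exact: c2.
- by move=> x /subset_closure; exact: dW.
Qed.

End Zero_trace_approximation_theorem.

(** * Green's formula and Friedrichs' inequality up to the Lipschitz constant *)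

Section Zero_trace_consequences.
Context {R : realType}.

Lemma ip2Br (A : set (R * R)) f g h : measurable A -> sqint leb2 A f -> sqint leb2 A g -> sqint leb2 A h ->
  ip leb2 A f (fun x => g x - h x) = ip leb2 A f g - ip leb2 A f h.
Proof.
move=> mA sf sg sh; rewrite ipC; transitivity (ip leb2 A g f - ip leb2 A h f).
  exact: (@ipBl _ _ _ leb2 A mA g h f).
by congr (_ - _); exact: ipC.
Qed.

Lemma ip2_le (A : set (R * R)) f g : measurable A -> sqint leb2 A f -> sqint leb2 A g ->
  `|ip leb2 A f g| <= nrm leb2 A f * nrm leb2 A g.
Proof. by move=> mA; exact: ip_le. Qed.

Lemma ip2_le_bound (A : set (R * R)) f g B : measurable A -> sqint leb2 A f -> sqint leb2 A g ->
  nrm leb2 A g <= B -> `|ip leb2 A f g| <= B * nrm leb2 A f.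
Proof.
move=> mA sf sg gB; apply: le_trans (ip2_le mA sf sg) _.
by rewrite mulrC; apply: ler_wpM2r gB; exact: nrm_ge0.
Qed.

Lemma ip2Zl (A : set (R * R)) (a : R) f g : measurable A -> sqint leb2 A f -> sqint leb2 A g ->
  ip leb2 A (fun x => a * f x) g = a * ip leb2 A f g.
Proof. by move=> mA; exact: ipZl. Qed.

Lemma ip2Dl (A : set (R * R)) f g h : measurable A -> sqint leb2 A f -> sqint leb2 A g -> sqint leb2 A h ->
  ip leb2 A (fun x => f x + g x) h = ip leb2 A f h + ip leb2 A g h.
Proof. by move=> mA; exact: ipDl. Qed.

Lemma le_eps_scale (x y N : R) : 0 <= N -> (forall e, 0 < e -> x <= y + e * N) -> x <= y.
Proof.
move=> N0 h; apply/ler_addgt0Pr => e e0.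
have N1 : 0 < N + 1 by rewrite ltr_wpDl.
apply: le_trans (h _ (divr_gt0 e0 N1)) _.
by rewrite lerD2l mulrAC ler_pdivrMr// ler_wpM2l ?(ltW e0)// lerDl.
Qed.

Lemma green_arith (V1D V1p V1w e1 V2D V2p V2w e2 Fz Fp e0 X Y : R) :
  e1 = V1p - (V1D - V1w) -> e2 = V2p - (V2D - V2w) -> e0 = Fp - Fz -> Fp = - (V1p + V2p) ->
  `|V1w| + `|V2w| <= X -> `|e1| + `|e2| + `|e0| <= Y -> `|V1D + V2D + Fz| <= X + Y.
Proof.
move=> E1 E2 E0 Ep hX hY.
have -> : V1D + V2D + Fz = V1w + V2w - (e1 + e2 + e0) by rewrite E1 E2 E0 Ep; ring.
apply: le_trans (ler_normB _ _) _; apply: lerD.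
  by apply: le_trans (ler_normD _ _) _.
apply: le_trans hY; apply: le_trans (ler_normD _ _) _; rewrite lerD2r; exact: ler_normD.
Qed.

(** The integral of the first partial derivative of (x_1 - c_1) psi^2 vanishes, so ||psi||^2 equals
    -2 times the integral of (x_1 - c_1) psi times that derivative of psi. The Cauchy-Schwarz
    inequality gives the factor 2 M. *)
Lemma test_friedrichs (K : set (R * R)) c M' M psi : open K -> 0 <= M ->
  (forall x, K x -> `|x| <= M') -> (forall x, K x -> `|x - c| <= M) -> test_fun K psi ->
  nrm leb2 K psi <= 2 * M * nrm leb2 K (d1 psi).
Proof.
move=> oK M0 KM KMc tp; have mK := open2_measurable oK; have sp : smooth psi by case: tp.
pose X1 (x : R * R) := x.1 - c.1.
have EX : X1 = (fun x => mono 1 0 x - c.1) by apply/funext => x; rewrite /mono expr1 expr0 mulr1.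
have sm : smooth (mono 1 0 : R * R -> R) by exact: smooth_poly (@poly_mono R 1 1 0 isT).
have sX : smooth X1 by rewrite EX; apply: smoothB => //; exact: smooth_cst.
have dX x : d1 X1 x = 1.
  by rewrite EX (d1B sm (smooth_cst _)) d1_cst d1_mono /mono !expr0 !mulr1 subr0.
have sc u : smooth u -> sqint leb2 K u by move=> /smooth_cont cu; exact: sqint_continuous mK KM cu.
have := test_int_d1 mK (testM (smoothM sX sp) tp).
rewrite (d1M (smoothM sX sp) sp) (d1M sX sp) => I0.
have I1 : ip leb2 K psi psi = - (2 * ip leb2 K (fun x => X1 x * psi x) (d1 psi)).
  have sXp : sqint leb2 K (fun x => X1 x * psi x) by apply: sc; exact: smoothM.
  have sXd : sqint leb2 K (fun x => X1 x * d1 psi x).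
    by apply: sc; apply: smoothM sX _; exact: smooth_d1.
  have E : ip leb2 K (fun x => 2 * (X1 x * d1 psi x) + psi x) psi = 0.
    by rewrite -[RHS]I0; apply: eq_Rintegral => x _; rewrite dX; ring.
  rewrite (ip2Dl mK (sqint2Z 2 mK sXd) (sc _ sp) (sc _ sp)) (ip2Zl 2 mK sXd (sc _ sp)) in E.
  have -> : ip leb2 K (fun x => X1 x * psi x) (d1 psi) = ip leb2 K (fun x => X1 x * d1 psi x) psi.
    by apply: eq_Rintegral => x _; ring.
  by apply/eqP; rewrite -addr_eq0 addrC E.
have sXp : sqint leb2 K (fun x => X1 x * psi x) by apply: sc; exact: smoothM.
have nX : nrm leb2 K (fun x => X1 x * psi x) <= M * nrm leb2 K psi.
  have := nrm2Z M mK (sc _ sp); rewrite ger0_norm// => <-.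
  apply: nrm2_le => //; first exact: sqint2Z mK (sc _ sp).
  move=> x Kx; rewrite !normrM (ger0_norm M0) ler_wpM2r//.
  by apply: le_trans (KMc x Kx); exact: norm2_fst (x - c).
have n0 := nrm_ge0 leb2 K psi.
have [->|np] := eqVneq (nrm leb2 K psi) 0; first by rewrite !mulr_ge0// nrm_ge0.
have npos : 0 < nrm leb2 K psi by rewrite lt_def np.
rewrite -(ler_pM2r npos) -expr2 nrm2_sqr I1.
apply: le_trans (ler_norm _) _; rewrite normrN normrM ger0_norm//.
rewrite -mulrA -mulrA ler_wpM2l//.
apply: le_trans (ip2_le mK sXp (sc _ (smooth_d1 sp))) _.
rewrite mulrAC; exact: ler_wpM2r (nrm_ge0 _ _ _) _ _ nX.
Qed.

Section Fix_approximation.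
Variables (K : @polygon R) (B G M' M : R) (v : H1 K) (w : R * R -> R).
Hypotheses (B0 : 0 <= B) (G0 : 0 <= G) (M0 : 0 <= M).
Variable c : R * R.
Hypothesis KM : forall x, pol_dom K x -> `|x| <= M'.
Hypothesis KMc : forall x, pol_dom K x -> `|x - c| <= M.
Hypothesis lw : L2 K w.
Hypothesis approx : forall eps, 0 < eps -> exists psi W, [/\ test_fun K psi, smooth W,
    L2norm K (fun x => psi x - (v x - w x)) <= eps,
    L2norm K (fun x => d1 psi x - (H1_d1 v x - d1 W x)) <= eps /\
    L2norm K (fun x => d2 psi x - (H1_d2 v x - d2 W x)) <= eps &
    forall x, pol_dom K x -> `|d1 W x| <= B * G /\ `|d2 W x| <= B * G].

Let mK : measurable K := @polygon_measurable R K.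
Let A1 := nrm leb2 K (fun=> 1).
Let sc u : smooth u -> sqint leb2 K u.
Proof. by move=> /smooth_cont cu; exact: sqint_continuous mK KM cu. Qed.
Let s1 : sqint leb2 K (fun=> 1) := sqint_continuous mK KM (@cst_continuous _ R 1).
Let sv : sqint leb2 K v := H1_L2 v.
Let sv1 : sqint leb2 K (H1_d1 v) := H1_L2_d1 v.
Let sv2 : sqint leb2 K (H1_d2 v) := H1_L2_d2 v.
Let sw : sqint leb2 K w := lw.
Let svw : sqint leb2 K (fun x => v x - w x) := sqint2B mK sv sw.

(** The weak identity is tested with the approximations of v - w, and the error tends to 0. What
    remains on the right is the pairing of (V1, V2) with the gradient of [W], bounded by [B * G]. It
    is used both for the gradient of Pi v and for that of v. *)
Lemma zero_trace_green (V1 V2 F : R * R -> R) : L2 K V1 -> L2 K V2 -> L2 K F ->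
  (forall phi, test_fun K phi -> inner K F phi = - (inner K V1 (d1 phi) + inner K V2 (d2 phi))) ->
  `|inner K V1 (H1_d1 v) + inner K V2 (H1_d2 v) + inner K F (fun x => v x - w x)| <=
  B * G * L2norm K (fun=> 1) * (L2norm K V1 + L2norm K V2).
Proof.
move=> sV1 sV2 sF weak.
have BG0 : 0 <= B * G by rewrite mulr_ge0.
apply: (@le_eps_scale _ _ (L2norm K V1 + L2norm K V2 + L2norm K F)).
  by rewrite !addr_ge0 ?nrm_ge0.
move=> e e0; have [psi [W [tp sW h0 [h1 h2] hW]]] := approx e0.
have sp : smooth psi by case: tp.
have w1 := nrm2_const mK s1 (sc (smooth_d1 sW)) BG0 (fun x Kx => (hW x Kx).1).
have w2 := nrm2_const mK s1 (sc (smooth_d2 sW)) BG0 (fun x Kx => (hW x Kx).2).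
have t1 := sqint2B mK sv1 (sc (smooth_d1 sW)).
have t2 := sqint2B mK sv2 (sc (smooth_d2 sW)).
have u0 := sqint2B mK (sc sp) svw.
have u1 := sqint2B mK (sc (smooth_d1 sp)) t1.
have u2 := sqint2B mK (sc (smooth_d2 sp)) t2.
have E1 := ip2Br mK sV1 (sc (smooth_d1 sp)) t1; rewrite (ip2Br mK sV1 sv1 (sc (smooth_d1 sW))) in E1.
have E2 := ip2Br mK sV2 (sc (smooth_d2 sp)) t2; rewrite (ip2Br mK sV2 sv2 (sc (smooth_d2 sW))) in E2.
have E0 := ip2Br mK sF (sc sp) svw.
apply: (green_arith E1 E2 E0 (weak _ tp)).
  rewrite mulrDr.
  exact: lerD (ip2_le_bound mK sV1 (sc (smooth_d1 sW)) w1) (ip2_le_bound mK sV2 (sc (smooth_d2 sW)) w2).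
rewrite !mulrDr.
exact: lerD (lerD (ip2_le_bound mK sV1 u1 h1) (ip2_le_bound mK sV2 u2 h2)) (ip2_le_bound mK sF u0 h0).
Qed.

Lemma zero_trace_friedrichs :
  L2norm K (fun x => v x - w x) <= 2 * M * (L2norm K (H1_d1 v) + B * G * L2norm K (fun=> 1)).
Proof.
have BG0 : 0 <= B * G by rewrite mulr_ge0.
apply: (@le_eps_scale _ _ (1 + 2 * M)); first by rewrite addr_ge0// mulr_ge0.
move=> e e0; have [psi [W [tp sW h0 [h1 h2] hW]]] := approx e0.
have sp : smooth psi by case: tp.
have w1 := nrm2_const mK s1 (sc (smooth_d1 sW)) BG0 (fun x Kx => (hW x Kx).1).
have t1 := sqint2B mK sv1 (sc (smooth_d1 sW)).
have u0 := sqint2B mK (sc sp) svw.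
have u1 := sqint2B mK (sc (smooth_d1 sp)) t1.
have a1 : nrm leb2 K (fun x => v x - w x) <= nrm leb2 K psi + e.
  have -> : (fun x => v x - w x) = (fun x => psi x - (psi x - (v x - w x))).
    by apply/funext => x; ring.
  by apply: le_trans (nrm2B mK (sc sp) u0) _; rewrite lerD2l.
have a2 : nrm leb2 K (d1 psi) <= e + (nrm leb2 K (H1_d1 v) + B * G * nrm leb2 K (fun=> 1)).
  have -> : d1 psi = (fun x => (d1 psi x - (H1_d1 v x - d1 W x)) + (H1_d1 v x - d1 W x)).
    by apply/funext => x; ring.
  apply: le_trans (nrm2D mK u1 t1) _; apply: lerD; first exact: h1.
  by apply: le_trans (nrm2B mK sv1 (sc (smooth_d1 sW))) _; rewrite lerD2l.
have a3 := test_friedrichs (@pol_open R K) M0 KM KMc tp.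
apply: le_trans a1 _; apply: le_trans (lerD (le_trans a3 (ler_wpM2l _ a2)) (lexx e)) _.
  by rewrite mulr_ge0.
change (2 * M * (e + (nrm leb2 K (H1_d1 v) + B * G * nrm leb2 K (fun=> 1))) + e <=
  2 * M * (nrm leb2 K (H1_d1 v) + B * G * nrm leb2 K (fun=> 1)) + e * (1 + 2 * M)).
by apply: le_of_eq; ring.
Qed.

End Fix_approximation.
End Zero_trace_consequences.

(** * The macro finite element space *)

Section Piecewise_lipschitz.
Context {R : realType}.

(** Continuous induction on the parameters reached from 0 with the right bound. No continuity of [f]
    is assumed: closedness of the finitely many pieces makes neighbouring parameters share a piece
    with the supremum. *)
Lemma unit_interval_cover (n : nat) (A : 'I_n -> set R) (f : R -> R) (L : R) : 0 <= L ->
  (forall i, closed (A i)) -> (forall t, 0 <= t <= 1 -> exists i, A i t) ->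
  (forall i s t, A i s -> A i t -> `|f s - f t| <= L * `|s - t|) ->
  `|f 0 - f 1| <= L.
Proof.
move=> L0 cA cov Lf.
pose S := [set t : R | 0 <= t <= 1 /\ `|f 0 - f t| <= L * t].
have S0 : S 0 by split; rewrite ?lexx ?ler01// subrr normr0 mulr0.
have hS : has_sup S by split; [exists 0|exists 1 => t [/andP[]]].
pose m := sup S.
have m0 : 0 <= m by exact: sup_upper_bound hS _ S0.
have m1 : m <= 1 by apply: ge_sup; [exists 0|move=> t [/andP[]]].
(* Finitely many closed pieces miss [m], so all of them miss a neighbourhood of [m]. *)
have [e e0 he] : exists2 e : R, 0 < e & forall t i, `|m - t| < e -> A i t -> A i m.
  have : \forall t \near m, forall i, ~ A i m -> ~ A i t.
    apply: (@filter_forall R 'I_n (fun i => [set t | ~ A i m -> ~ A i t]) (nbhs m) (nbhs_filter m)) => i; have [Am|nA] := pselect (A i m); first by apply: filterE => t h; case: (h Am).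
    by have := open_nbhs_nbhs (conj (closed_openC (cA i)) nA); apply: filterS => t nt _.
  move=> /nbhs_ballP[e /= e0 he]; exists e => // t i mt At; apply: contrapT => nA.
  by apply: (he t _ i nA At).
have step s t : S s -> 0 <= t <= 1 -> s <= t -> (exists2 i, A i s & A i t) -> S t.
  move=> [_ hs] ht st [i As At]; split=> //.
  have -> : f 0 - f t = (f 0 - f s) + (f s - f t) by ring.
  apply: le_trans (ler_normD _ _) _.
  have := Lf i s t As At; rewrite (distrC s) [`|t - s|]ger0_norm ?subr_ge0//; lra.
have Sm : S m.
  have [s Ss ms] := sup_adherent e0 hS.
  have sm : s <= m by exact: sup_upper_bound.
  have [s0 s1] := andP Ss.1; have [i Ais] := cov s Ss.1.
  apply: (step s) => //; first by rewrite m0.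
  exists i => //; apply: he Ais; rewrite ger0_norm ?subr_ge0//; rewrite -/m in ms; lra.
have [m_eq|m_lt] : m = 1 \/ m < 1 by move: m1; rewrite le_eqVlt => /orP[/eqP|]; [left|right].
  by have [_] := Sm; rewrite m_eq mulr1.
exfalso; pose t := m + Num.min (e / 2) (1 - m).
have t1 : m < t by rewrite /t ltrDl lt_min divr_gt0//= subr_gt0.
have t2 : t <= 1 by rewrite /t -lerBrDl ge_min lexx orbT.
have tm : t - m <= e / 2 by rewrite /t addrAC subrr add0r ge_min lexx.
have ht : 0 <= t <= 1 by rewrite t2 andbT; lra.
have [i At] := cov t ht.
have Am : A i m by apply: (he t) At; rewrite distrC ger0_norm; lra.
have := sup_upper_bound hS (step m t Sm ht (ltW t1) (ex_intro2 _ _ i Am At)).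
by rewrite -/m leNgt t1.
Qed.

Lemma piecewise_lipschitz (n : nat) (T : 'I_n -> set (R * R)) (A : set (R * R)) (w : R * R -> R) (G : R) :
  0 <= G -> (forall i, closed (T i)) -> A `<=` \bigcup_i T i ->
  (forall i x y, T i x -> T i y -> `|w x - w y| <= G * `|x - y|) -> lipschitz_along A G w.
Proof.
move=> G0 cT AT Lw x y xyA.
pose g t := seg_pt x y t.
have cg : continuous g.
  move=> t; apply: (@continuousD _ (R * R)%type R (fun=> x) (fun s => s *: (y - x))); first exact: cst_continuous.
  exact: scalel_continuous.
have := @unit_interval_cover n (fun i => g @^-1` T i) (w \o g) (G * `|x - y|).
have -> : (w \o g) 0 = w x by rewrite /= /g /seg_pt scale0r addr0.
have -> : (w \o g) 1 = w y by rewrite /= /g /seg_pt scale1r addrC subrK.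
apply.
- by rewrite mulr_ge0.
- by move=> i; apply: preimage_closed => //; exact/continuousP.
- move=> t ht; have [i _ Ti] : (\bigcup_i T i) (g t).
    by apply/AT/xyA; exists t => //=; rewrite in_itv.
  by exists i.
- move=> i s t Ts Tt; apply: le_trans (Lw i _ _ Ts Tt) _.
  rewrite -mulrA ler_wpM2l// opprD addrACA subrr add0r -scalerBl normrZ mulrC.
  by rewrite (distrC y).
Qed.

Lemma convex_lipschitz (T : set (R * R)) (p : R * R -> R) (G : R) x y : smooth p -> segment x y `<=` T ->
  (forall z, T z -> `|d1 p z| <= G /\ `|d2 p z| <= G) -> `|p x - p y| <= 2 * G * `|x - y|.
Proof.
move=> sp xyT hT.
pose g s := p (x + s *: (y - x)).
pose dg s := d1 p (x + s *: (y - x)) * (y - x).1 + d2 p (x + s *: (y - x)) * (y - x).2.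
have hg s : is_derive s (1 : R) g (dg s) by exact: smooth_line.
have G0 : 0 <= G.
  have [h _] := hT x (xyT x ltac:(by exists 0; rewrite /= ?in_itv/= ?lexx ?ler01// /seg_pt scale0r addr0)).
  by apply: le_trans h.
have hdg s : 0 <= s <= 1 -> `|dg s - 0| <= 2 * G * `|x - y|.
  move=> hs; rewrite subr0 distrC.
  have [h1 h2] : `|d1 p (x + s *: (y - x))| <= G /\ `|d2 p (x + s *: (y - x))| <= G.
    by apply: hT; apply: xyT; exists s => //=; rewrite in_itv.
  apply: le_trans (ler_normD _ _) _; rewrite !normrM -mulrA mulrDl mul1r.
  by apply: lerD; apply: ler_pM => //; [exact: norm2_fst|exact: norm2_snd].
(* The mean value bound controls the derivative on an interval symmetric about its base point.
   Starting from the midpoint keeps this interval within the segment. *)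
have half (b : R) : `|b - 2^-1| = 2^-1 -> `|g b - g 2^-1| <= G * `|x - y|.
  move=> hb; have := mean_value_bound (a := 2^-1) (b := b) (D := 0) (e := 2 * G * `|x - y|) hg.
  rewrite mul0r subr0 hb => h; have -> : G * `|x - y| = 2 * G * `|x - y| * 2^-1 by field.
  by apply: h => s; rewrite ler_norml => /andP[? ?]; apply: hdg; apply/andP; split; lra.
have h1 := half 1 ltac:(by rewrite ger0_norm; lra).
have h0 := half 0 ltac:(by rewrite ler0_norm; lra).
have <- : g 0 = p x by rewrite /g scale0r addr0.
have <- : g 1 = p y by rewrite /g scale1r addrC subrK.
have -> : g 0 - g 1 = (g 0 - g 2^-1) - (g 1 - g 2^-1) by ring.
by apply: le_trans (ler_normB _ _) _; have -> : 2 * G * `|x - y| = G * `|x - y| + G * `|x - y| by [ring|]; apply: lerD.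
Qed.

End Piecewise_lipschitz.

Section Triangles.
Context {R : realType}.
Implicit Types (T : 'I_3 -> R * R) (x y : R * R).

Lemma bary_affine T i : exists a b e : R, forall x, bary T i x = a * x.1 + b * x.2 + e.
Proof.
exists (((T (ordS i)).2 - (T (ordS (ordS i))).2) / det2 (T (ordS i) - T i) (T (ordS (ordS i)) - T i)).
exists (((T (ordS (ordS i))).1 - (T (ordS i)).1) / det2 (T (ordS i) - T i) (T (ordS (ordS i)) - T i)).
exists (((T (ordS i)).1 * (T (ordS (ordS i))).2 - (T (ordS i)).2 * (T (ordS (ordS i))).1) / det2 (T (ordS i) - T i) (T (ordS (ordS i)) - T i)).
move=> x; rewrite /bary; set d := (det2 (T _ - T i) _)^-1.
by rewrite /det2 /=; ring.
Qed.

Lemma poly_bary T i : poly_le 1 (bary T i).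
Proof.
have [a [b [e E]]] := bary_affine T i.
have := polyD (polyD (polyZ a (@poly_mono R 1 1 0 isT)) (polyZ b (@poly_mono R 1 0 1 isT))) (poly_cst 1 e).
by congr (poly_le _ _); apply/funext => x; rewrite E /mono !expr0 !expr1 mulr1 mul1r.
Qed.

Lemma bary_cont T i : continuous (bary T i).
Proof. exact: smooth_cont (smooth_poly (poly_bary T i)). Qed.

Lemma triangle_closed T : closed (triangle T).
Proof.
have -> : triangle T = \bigcap_i (bary T i @^-1` [set s | 0 <= s]).
  by apply/seteqP; split=> x h i; [move=> _|]; exact: h.
apply: closed_bigI => i _; apply: preimage_closed; last exact: closed_ge.
by move=> x _; exact: bary_cont.
Qed.

Lemma bary_seg T i x y t : bary T i (seg_pt x y t) = (1 - t) * bary T i x + t * bary T i y.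
Proof.
have [a [b [e E]]] := bary_affine T i; rewrite !E /seg_pt /= /GRing.scale /=; ring.
Qed.

Lemma triangle_segment T x y : triangle T x -> triangle T y -> segment x y `<=` triangle T.
Proof.
move=> Tx Ty _ [t /= + <-] i; rewrite in_itv/= => /andP[t0 t1]; rewrite bary_seg.
by apply: addr_ge0; apply: mulr_ge0; rewrite ?subr_ge0.
Qed.

Lemma poly_hom_le (S : set (R * R)) (n : nat) f : poly_hom S n%:Z f -> poly_le n%:Z f.
Proof.
move=> [c H].
have -> : f = fun x => \sum_(i < n.+1) \sum_(j < n.+1 | (i + j == n)%N) c i j *
    ((1 * x.1 + - (centroid S).1) ^+ i * (1 * x.2 + - (centroid S).2) ^+ j).
  apply/funext => x; rewrite H; apply: eq_bigr => i _; apply: eq_bigr => j _.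
  by rewrite !mul1r mulrA.
apply: poly_sum => i _; apply: poly_sum => j /eqP ij; apply: polyZ.
by apply: poly_affine_mono; rewrite ij.
Qed.

(** The cubic bubble times degree k - 2 has degree k + 1, so derivatives of the pieces have degree k
    and one inverse estimate of degree k is enough. For k = 1 the bubble part is zero. *)
Lemma W_local_poly (k : nat) T w : (1 <= k)%N -> W_local k T w ->
  exists P, poly_le k.+1%:Z P /\ forall x, triangle T x -> w x = P x.
Proof.
move=> k1 [p [q [hp hq hw]]]; exists (fun x => p x + bubble T x * q x); split=> //.
apply: polyD; first exact: poly_leW hp.
case: k k1 hp hq hw => [//|[|k]] _ hp hq hw.
  case: hq => c hq; have -> : (fun x => bubble T x * q x) = fun=> 0; last exact: poly_zero.
  apply/funext => x; rewrite hq big1 ?mulr0// => i _; rewrite big_pred0// => j.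
have hq' : poly_hom (triangle T) k%:Z q.
  by move: hq; have -> : k.+2%:Z - 2 = k%:Z by lia.
have pb := poly_mul_affine2 (poly_bary T 0) (poly_mul_affine2 (poly_bary T 1) (poly_mul_affine2 (poly_bary T 2) (poly_hom_le hq'))).
move: pb; congr (poly_le _ _); apply/funext => x; rewrite /bubble !big_ord_recl big_ord0 mulr1.
have -> : lift ord0 ord0 = 1 :> 'I_3 by exact/val_inj.
have -> : lift ord0 (lift ord0 ord0) = 2 :> 'I_3 by exact/val_inj.
by rewrite !mulrA.
Qed.

End Triangles.

(** * Unisolvence of the edge degrees of freedom *)

Section Edge_polynomials.
Context {R : realType}.
Notation mu := (@lebesgue_measure R).

Lemma poly_along_line (n : nat) (f : R * R -> R) (a v : R * R) : poly_le n%:Z f ->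
  exists q : {poly R}, (size q <= n.+1)%N /\ forall t, f (a + t *: v) = q.[t].
Proof.
apply: (@poly_ind R n (fun f => exists q : {poly R}, (size q <= n.+1)%N /\ forall t, f (a + t *: v) = q.[t])).
- by exists 0; rewrite size_poly0; split=> // t; rewrite horner0.
- move=> f1 f2 [q1 [s1 h1]] [q2 [s2 h2]]; exists (q1 + q2); split.
    by apply: leq_trans (size_polyD _ _) _; rewrite geq_max s1 s2.
  by move=> t; rewrite hornerD h1 h2.
- move=> s f1 [q1 [s1 h1]]; exists (s *: q1); split; last by move=> t; rewrite hornerZ h1.
  exact: leq_trans (size_scale_leq _ _) s1.
- move=> i j ij; exists ((a.1%:P + v.1 *: 'X) ^+ i * (a.2%:P + v.2 *: 'X) ^+ j); split.
    have lin (x y : R) : (size (x%:P + y *: 'X : {poly R})%R <= 2)%N.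
      apply: leq_trans (size_polyD _ _) _; rewrite geq_max (leq_trans (size_polyC_leq1 _))//=.
      by apply: leq_trans (size_scale_leq _ _) _; rewrite size_polyX.
    have pw (x y : R) m : (size ((x%:P + y *: 'X : {poly R})%R ^+ m) <= m.+1)%N.
      apply: leq_trans (size_poly_exp_leq _ _) _; rewrite ltnS.
      have := lin x y; case: (size _) => [|[|[|s]]]//=; lia.
    apply: leq_trans (size_polyMleq _ _) _.
    have := pw a.1 v.1 i; have := pw a.2 v.2 j; lia.
  by move=> t; rewrite hornerM !horner_exp !hornerD !hornerC !hornerZ hornerX /mono /= /GRing.scale /= ![t * _]mulrC.
Qed.

(** The vanishing moments cover all polynomials of the degree of [e], hence [e] itself; the integral
    of t (1 - t) e(t)^2 over the unit interval is then 0. *)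
Lemma unit_moments_eq0 (d e : {poly R}) (k : nat) : d = e * 'X * ('X - 1) -> (size e <= k)%N ->
  (forall j, (j < k)%N -> \int[mu]_(t in `[0, 1]) (d.[t] * (t - 2^-1) ^+ j) = 0) -> e = 0.
Proof.
move=> E se hm; have [//|en0] := eqVneq e 0.
have cp (p : {poly R}) := @continuous_poly1 R p.
have mI : measurable (`[0, 1]%classic : set R) by [].
have iP (p : {poly R}) : mu.-integrable `[0, 1] (EFin \o horner p) by exact: continuous_integrable_itv.
(* Re-expansion about the midpoint, where the edge monomials are centred. *)
pose u := e \Po ('X + (2^-1)%:P).
have eu t : e.[t] = \sum_(j < k) u`_j * (t - 2^-1) ^+ j.
  have -> : e.[t] = u.[t - 2^-1] by rewrite horner_comp hornerD hornerX hornerC subrK.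
  rewrite (@horner_coef_wide _ k)//; apply: leq_trans (size_comp_poly_leq _ _) _.
  by rewrite size_XaddC /= muln1 prednK ?size_poly_gt0.
have I0 : \int[mu]_(t in `[0, 1]) (d.[t] * e.[t]) = 0.
  transitivity (\int[mu]_(t in `[0, 1]) (\sum_(j < k) u`_j * (d.[t] * (t - 2^-1) ^+ j))).
    apply: eq_Rintegral => t _; rewrite eu mulr_sumr; apply: eq_bigr => j _; ring.
  have iF (j : nat) : mu.-integrable `[0, 1] (EFin \o (fun t : R => d.[t] * (t - 2^-1) ^+ j)).
    have := iP (d * ('X - (2^-1)%:P) ^+ j); congr (_.-integrable _ _); apply/funext => t /=.
    by rewrite hornerM horner_exp hornerD hornerN hornerX hornerC.
  rewrite Rintegral_lsum//; last by move=> j; exact: (@integrableZl _ _ _ mu _ mI (u`_j) _ (iF j)).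
  rewrite big1// => j _; have -> : \int[mu]_(t in `[0, 1]) (u`_j * (d.[t] * (t - 2^-1) ^+ j)) =
      u`_j * \int[mu]_(t in `[0, 1]) (d.[t] * (t - 2^-1) ^+ j) by apply: RintegralZl.
  by rewrite hm ?mulr0.
pose a (t : R) : R := t * (1 - t); pose f t := (a t + `|a t|) * e.[t] ^+ 2.
have ca : continuous a.
  have -> : a = horner ('X * (1%:P - 'X)); last exact: cp.
  apply/funext => t; by rewrite hornerM hornerD hornerN hornerX hornerC.
have cf : continuous f.
  move=> t; apply: (@continuousM R R (fun t => a t + `|a t|) (fun t => e.[t] ^+ 2)).
    apply: (@continuousD R R R a (fun t => `|a t|)); first exact: ca.
    by apply: (@continuous_comp _ _ _ a (fun s => `|s|)); [exact: ca|exact: norm_continuous].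
  exact: sqr_continuous (cp e) t.
have f0 t : 0 <= f t.
  by rewrite mulr_ge0 ?sqr_ge0//; have := ler_norm (- a t); rewrite normrN; lra.
have foff t : t \notin `[0, 1] -> f t = 0.
  rewrite in_itv/= negb_and -!ltNge => ht; rewrite /f ler0_norm ?subrr ?mul0r//.
  by rewrite /a; case/orP: ht => ht; nra.
have fres : (EFin \o f) = (EFin \o f) \_ (`[0, 1]%classic : set R).
  apply/funext => t; rewrite patchE; case: ifPn => // /negP ht; rewrite /= foff//.
  by apply/negP => h; apply: ht; rewrite inE.
have fI : mu.-integrable setT (EFin \o f).
  by have := (@integrable_mkcond _ _ R mu _ (EFin \o f) mI).1 (continuous_integrable_itv 0 1 cf); rewrite -fres.
have fz : forall t, f t = 0.
  apply: continuous_ge0_integral_eq0 => //.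
  transitivity (\int[mu]_(t in `[0, 1]) f t).
    by rewrite /Rintegral [in RHS]integral_mkcond -fres.
  transitivity (\int[mu]_(t in `[0, 1]) (- 2 * (d.[t] * e.[t]))).
    apply: eq_Rintegral => t; rewrite inE /= in_itv/= => /andP[t0 t1].
    rewrite /f ger0_norm; last by rewrite /a; nra.
    by rewrite E !hornerM hornerD hornerN !hornerX hornerC /a; ring.
  have iD : mu.-integrable `[0, 1] (EFin \o (fun t => d.[t] * e.[t])).
    by have := iP (d * e); congr (_.-integrable _ _); apply/funext => t /=; rewrite hornerM.
  by rewrite RintegralZl// I0 mulr0.
have ez t : 0 < t -> t < 1 -> e.[t] = 0.
  move=> t0 t1; have := fz t; have at0 : 0 < a t by rewrite /a mulr_gt0//; lra.
  rewrite /f gtr0_norm// => /eqP; rewrite mulf_eq0 sqrf_eq0 => /orP[/eqP|/eqP//]; lra.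
(* The translation by 3/4 moves the interval of [poly_null_left] to ]1/4, 3/4], inside the unit
   interval. *)
have v0 : e \Po ('X + (3 / 4)%:P) = 0.
  apply: poly_null_left => s s1 s2; rewrite horner_comp hornerD hornerX hornerC.
  by apply: ez; lra.
apply: poly_null_left => s _ _.
have -> : e.[s] = (e \Po ('X + (3 / 4)%:P)).[s - 3 / 4] by rewrite horner_comp hornerD hornerX hornerC subrK.
by rewrite v0 horner0.
Qed.

Lemma edge_dofs_unisolvent (d : {poly R}) (k : nat) : (1 <= k)%N -> (size d <= k.+1)%N ->
  d.[0] = 0 -> d.[1] = 0 ->
  (forall j, (j%:Z <= k%:Z - 2) -> \int[mu]_(t in `[0, 1]) (d.[t] * (t - 2^-1) ^+ j) = 0) -> d = 0.
Proof.
move=> k1 sd d0 d1 hm.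
have /factor_theorem[q1 E1] : root d 0 by apply/rootP.
have /factor_theorem[e E2] : root q1 1.
  apply/rootP; move: d1; rewrite E1 hornerM hornerD hornerX hornerN hornerC subr0 mulr1.
  exact.
have E : d = e * 'X * ('X - 1) by rewrite E1 E2 subr0 mulrAC.
have [e0|e0] := eqVneq e 0; first by rewrite E e0 !mul0r.
suff e00 : e = 0 by rewrite E e00 !mul0r.
apply: (@unit_moments_eq0 d e (k - 1)) => //.
  have : size d = (size e).+2.
    rewrite E size_mul ?mulf_neq0 ?polyX_eq0 ?polyXsubC_eq0 ?e0// size_mulX//.
    by rewrite size_XsubC addn2.
  by move=> h; move: sd; rewrite h; move: (size e) => m; lia.
by move=> j jk; apply: hm; lia.
Qed.

End Edge_polynomials.

Section Triangle_vertices.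
Context {R : realType}.
Implicit Types (T : 'I_3 -> R * R).

Lemma bary_vertex T (i j : 'I_3) : nondeg_triangle T -> bary T i (T j) = (i == j)%:R.
Proof.
move=> nd; have [<-|ij] := eqVneq i j; first by rewrite /bary divff.
have [->|->] : j = ordS i \/ j = ordS (ordS i).
  by case: i j ij {nd} => [[|[|[|//]]] hi] [[|[|[|//]]] hj]//= _; (left; exact: val_inj) || (right; exact: val_inj).
- by rewrite /bary [X in X / _](_ : _ = 0) ?mul0r// /det2/=; ring.
- by rewrite /bary [X in X / _](_ : _ = 0) ?mul0r// /det2/=; ring.
Qed.

Lemma vertex_in_triangle T j : nondeg_triangle T -> triangle T (T j).
Proof. by move=> nd i; rewrite bary_vertex. Qed.

Lemma edge_in_triangle T (i j : 'I_3) : nondeg_triangle T -> segment (T i) (T j) `<=` triangle T.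
Proof. by move=> nd; apply: triangle_segment; exact: vertex_in_triangle. Qed.

Lemma bubble_edge T (i : 'I_3) x : nondeg_triangle T -> segment (T i) (T (ordS i)) x -> bubble T x = 0.
Proof.
move=> nd [t _ <-]; rewrite /bubble (bigD1 (ordS (ordS i)))//= bary_seg !bary_vertex//.
have /negbTE -> : ordS (ordS i) != i by case: i => [[|[|[|]]]].
have /negbTE -> : ordS (ordS i) != ordS i by case: i => [[|[|[|]]]].
by rewrite !mulr0 addr0 mul0r.
Qed.

End Triangle_vertices.

Section Boundary_interpolation.
Context {R : realType}.
Variables (K : @polygon R) (TK : triangulation K) (k : nat) (w g : R * R -> R).
Hypothesis k1 : (1 <= k)%N.
Hypothesis Ww : W_space TK k w.
Hypothesis Bg : B_space K k g.
Hypothesis wg_vtx : forall i : 'I_(pol_n K), w (pol_vtx i) = g (pol_vtx i).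
Hypothesis wg_mom : forall i : 'I_(pol_n K), forall q,
  edge_monomials (pol_vtx i) (pol_vtx (ordS i)) (k%:Z - 2) q ->
  edge_int (pol_vtx i) (pol_vtx (ordS i)) (fun x => (w x - g x) * q x) = 0.
Notation P := (@pol_vtx R K).
Notation Q i := (@pol_vtx R K (ordS i)).

(** An edge of [K] is an edge of one triangle, on which the bubble vanishes; so [w] has degree [k]
    there, the degree that its edge values and moments determine. *)
Lemma edge_poly i : exists q : {poly R}, (size q <= k.+1)%N /\
  forall t, 0 <= t <= 1 -> w (seg_pt (P i) (Q i) t) = q.[t].
Proof.
have [t [a E]] := tri_boundary_edges TK i.
have [p [q [hp hq hw]]] := Ww.2 t.
have nd : nondeg_triangle (tri t) by exact: tri_nondegenerate.
have [f [sf hf]] := poly_along_line (P i) (Q i - P i) hp.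
exists f; split=> // s hs; rewrite -hf.
have hseg : segment (tri t a) (tri t (ordS a)) (seg_pt (P i) (Q i) s).
  by rewrite E; exists s => //=; rewrite in_itv.
rewrite hw; last exact: edge_in_triangle hseg.
by rewrite (bubble_edge nd hseg) mul0r addr0.
Qed.

Lemma boundary_interp_eq i t : 0 <= t <= 1 -> w (seg_pt (P i) (Q i) t) = g (seg_pt (P i) (Q i) t).
Proof.
move=> ht.
have [qw [sw hw]] := edge_poly i; have [qg [sg hg]] := Bg.2 i.
have hg' s : 0 <= s <= 1 -> g (seg_pt (P i) (Q i) s) = qg.[s].
  by move=> hs; apply: hg; rewrite in_itv.
suff E : qw - qg = 0 by rewrite hw// hg'//; move/eqP: E; rewrite subr_eq0 => /eqP ->.
have I0 : 0 <= (0 : R) <= 1 by rewrite lexx ler01.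
have I1 : 0 <= (1 : R) <= 1 by rewrite lexx ler01.
apply: (edge_dofs_unisolvent k1).
- by apply: leq_trans (size_polyD _ _) _; rewrite size_polyN geq_max sw sg.
- by rewrite hornerD hornerN -hw// -hg'// /seg_pt scale0r addr0 wg_vtx subrr.
- have E1 : seg_pt (P i) (Q i) 1 = Q i by rewrite /seg_pt scale1r addrC subrK.
  by rewrite hornerD hornerN -hw// -hg'// E1 wg_vtx subrr.
move=> j jk.
have := wg_mom (i := i) (q := fun x => (dot (x - seg_pt (P i) (Q i) 2^-1) (Q i - P i) / dot (Q i - P i) (Q i - P i)) ^+ j).
rewrite /edge_int => /(_ ltac:(by exists j)) /eqP.
have el : 0 < enorm (Q i - P i) by exact: edge_len_gt0.
rewrite mulf_eq0 (gt_eqF el) => /eqP E; rewrite -[RHS]E.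
apply: eq_Rintegral => s; rewrite inE /= in_itv/= => hs; rewrite hornerD hornerN hw// hg'//.
(* In the edge parameter t the scaled edge coordinate is t - 1/2. *)
congr (_ * _ ^+ j).
have dd : dot (Q i - P i) (Q i - P i) != 0.
  have := edge_len_gt0 i; rewrite /enorm sqrtr_gt0 => h; exact: lt0r_neq0.
apply: (mulIf dd); rewrite divfK//.
by rewrite /dot /seg_pt /= /GRing.scale/=; ring.
Qed.

End Boundary_interpolation.

(** * Integration over the triangulation *)

Section Almost_disjoint_triangles.
Context {R : realType}.
Notation ae P := {ae (@leb2 R), P}.

#[local] Instance leb2_ae_filter : Filter (nbhs (almost_everywhere (@leb2 R))) :=
  ae_filter_ringOfSetsType _.

Lemma segment_null (a b : R * R) : a != b -> ae (forall x, ~ segment a b x).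
Proof.
move=> ab; exists [set y | det2 (b - a) (y - a) = 0]; split.
- exact: line_measurable.
- by apply: line_null; rewrite subr_eq0 eq_sym.
- move=> x /= /contrapT[t _ <-]; rewrite /seg_pt /det2 /= /GRing.scale/=; ring.
Qed.

Lemma point_null (a : R * R) : ae (forall x, x <> a).
Proof.
have ab : a != a + (1, 0).
  rewrite -subr_eq0 opprD addrA subrr add0r oppr_eq0; apply/eqP => -[/eqP]; by rewrite oner_eq0.
apply: filterS (segment_null ab) => x ns xa; apply: ns; rewrite xa.
by exists 0; rewrite /= ?in_itv/= ?lexx ?ler01// /seg_pt scale0r addr0.
Qed.

Variables (K : @polygon R) (TK : triangulation K).

(** Conformity leaves only empty intersections, points and nondegenerate segments, all of measure
    zero; there are finitely many pairs. *)
Lemma triangles_ae_disjoint : ae (forall x, forall s t : 'I_(tri_n TK), s != t ->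
  ~ (triangle (tri s) x /\ triangle (tri t) x)).
Proof.
have pair (s t : 'I_(tri_n TK)) : ae (forall x, s != t -> ~ (triangle (tri s) x /\ triangle (tri t) x)).
  have [->|st] := eqVneq s t; first by apply: aeW.
  have [I0|[a [b [_ I1]]]|[a [b [a' [b' [ab ab' Ea Eb I2]]]]]] := tri_conforming st.
  - by apply: aeW => x _ [sx tx]; have : (triangle (tri s) `&` triangle (tri t)) x by []; rewrite I0.
  - apply: filterS (point_null (tri s a)) => x xa _ [sx tx].
    by have : (triangle (tri s) `&` triangle (tri t)) x by []; rewrite I1.
  - have nd := tri_nondegenerate s.
    have dab : tri s a != tri s b.
      apply/eqP => E; have := bary_vertex a a nd; rewrite E bary_vertex// eqxx.
      by rewrite (negbTE ab) => /eqP; rewrite eq_sym oner_eq0.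
    apply: filterS (segment_null dab) => x nx _ [sx tx].
    by have : (triangle (tri s) `&` triangle (tri t)) x by []; rewrite I2.
have h1 s : ae (forall x, forall t : 'I_(tri_n TK), s != t -> ~ (triangle (tri s) x /\ triangle (tri t) x)).
  exact: (filter_forall _ (pair s)).
exact: (filter_forall _ h1).
Qed.

Lemma boundary_ae : ae (forall x, ~ (closure K `\` K) x).
Proof.
have h i : ae (forall x, ~ segment (pol_vtx i) (@pol_vtx R K (ordS i)) x).
  by apply: segment_null; exact: vertex_neq.
apply: filterS (filter_forall _ h) => x nx; rewrite pol_boundary => -[i _]; exact: nx.
Qed.

Lemma triangles_ae_partition (F : R * R -> R) :
  ae (forall x, (F \_ K) x = \sum_t (F \_ (triangle (@tri R K TK t))) x).
Proof.
apply: filterS2 triangles_ae_disjoint boundary_ae => x dj nb.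
have [Kx|nK] := pselect (pol_dom K x).
  have [t _ tx] : (\bigcup_t triangle (@tri R K TK t)) x by rewrite tri_cover; exact: subset_closure.
  rewrite patchE mem_set// (bigD1 t)//= patchE mem_set// big1 ?addr0// => s st.
  rewrite patchE memNset// => sx; exact: (dj s t st).
rewrite patchE memNset// big1// => t _; rewrite patchE memNset// => tx; apply: nb; split=> //.
by rewrite -(tri_cover TK); exists t.
Qed.

Lemma triangle_measurable T : measurable (@triangle R T).
Proof. exact: closed2_measurable (@triangle_closed R T). Qed.

Lemma integral_triangles (F : R * R -> R) : leb2.-integrable K (EFin \o F) ->
  (forall t, leb2.-integrable (triangle (@tri R K TK t)) (EFin \o F)) ->
  \int[leb2]_(x in K) F x = \sum_t \int[leb2]_(x in triangle (@tri R K TK t)) F x.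
Proof.
move=> iK iT; have mK := @polygon_measurable R K.
have mT t := triangle_measurable (@tri R K TK t).
have r2i (A : set (R * R)) : measurable A -> leb2.-integrable A (EFin \o F) ->
    leb2.-integrable setT (EFin \o (F \_ A)).
  move=> mA iA; have := (@integrable_mkcond _ _ R leb2 A (EFin \o F) mA).1 iA.
  by rewrite restrict_EFin.
rewrite Rintegral_mkcond; transitivity (\int[leb2]_x (\sum_t (F \_ (triangle (@tri R K TK t))) x)).
  have m1 := measurable_int _ (r2i _ mK iK).
  have m2 : measurable_fun setT (fun x => (\sum_t (F \_ (triangle (@tri R K TK t))) x)%:E).
    apply/measurable_EFinP; apply: measurable_sum => t.
    by apply/measurable_EFinP; exact: measurable_int _ (r2i _ (mT t) (iT t)).
  congr fine; apply: (@ae_eq_integral _ _ _ leb2 setT _ _ measurableT m1 m2).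
  by apply: filterS (triangles_ae_partition F) => x E _; congr EFin.
rewrite Rintegral_lsum//; last by move=> t; apply: r2i.
by apply: eq_bigr => t _; rewrite [RHS]Rintegral_mkcond.
Qed.

End Almost_disjoint_triangles.

Section Moments.
Context {R : realType}.

Lemma ip0r (A : set (R * R)) f : ip leb2 A f (fun=> 0) = 0.
Proof. by rewrite /ip /Rintegral integral0_eq// => x _; rewrite mulr0. Qed.

(** A nonzero diameter allows [q] to be written in the scaled coordinate about the centroid, where
    it is a combination of the given monomials. *)
Lemma monomials_complete (S : set (R * R)) (n : nat) (F q : R * R -> R) (M : R) :
  measurable S -> (forall x, S x -> `|x| <= M) -> sqint leb2 S F -> diam S != 0 ->
  (forall m, monomials S n%:Z m -> ip leb2 S F m = 0) -> poly_le n%:Z q -> ip leb2 S F q = 0.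
Proof.
move=> mS SM sF D0 hm pq; pose cen := centroid S; pose D := diam S.
pose y x : R * R := D^-1 *: (x - cen).
pose f z := q (cen + D *: z).
have pf : poly_le n%:Z f by exact: poly_affine.
have qE : q = f \o y.
  apply/funext => x; rewrite /f /y /= scalerA divff// scale1r; congr q.
  by rewrite addrC subrK.
have affy g : poly_le n%:Z g -> sqint leb2 S (g \o y).
  move=> pg; have h := poly_affine (- (D^-1 *: cen)) D^-1 pg.
  apply: sqint_continuous mS SM _.
  have -> : g \o y = (fun x => g (- (D^-1 *: cen) + D^-1 *: x)).
    by apply/funext => x; rewrite /y /= scalerBr addrC.
  exact: smooth_cont (smooth_poly h).
have [_ E] : poly_le n%:Z f /\ ip leb2 S F (f \o y) = 0.
  move: pf; rewrite {qE}; move: f => f; apply: (@poly_ind R n (fun f => poly_le n%:Z f /\ ip leb2 S F (f \o y) = 0)).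
  - split; first exact: poly_zero.
    exact: ip0r.
  - move=> f1 f2 [p1 h1] [p2 h2]; split; first exact: polyD.
    rewrite ipC (@ip2Dl _ S (f1 \o y) (f2 \o y) F mS (affy _ p1) (affy _ p2) sF).
    by rewrite ipC h1 add0r ipC h2.
  - move=> s f1 [p1 h1]; split; first exact: polyZ.
    by rewrite ipC (@ip2Zl _ S s (f1 \o y) F mS (affy _ p1) sF) ipC h1 mulr0.
  - move=> i j ij; split; first exact: poly_mono.
    apply: hm; exists i, j; split; first by rewrite lez_nat.
    by apply/funext => x; rewrite /mono /y /= /GRing.scale/= ![D^-1 * _]mulrC.
by rewrite qE.
Qed.

Variables (K : @polygon R) (TK : triangulation K) (k : nat) (v w rr : R * R -> R).
Hypothesis k1 : (1 <= k)%N.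
Hypothesis Ww : W_space TK k w.
Hypothesis lv : L2 K v.
Hypothesis lw : L2 K w.
Hypothesis Qv : is_Q K k v rr.
Hypothesis D0 : forall t, diam (triangle (@tri R K TK t)) != 0.
Variable M : R.
Hypothesis KM : forall x, closure K x -> `|x| <= M.
Hypothesis mom : forall t q, let T := triangle (@tri R K TK t) in
  monomials T (k%:Z - 2) q -> inner T (w \- rr) q = 0.

(** The difference w - Q v is orthogonal to [q] on each triangle, hence on [K], and v - Q v is
    orthogonal to [q] on [K] by definition of the projection. For k = 1 the only [q] is zero. *)
Lemma interior_moments_eq0 q : poly_le (k%:Z - 2) q -> inner K (fun x => v x - w x) q = 0.
Proof.
case: k k1 Ww Qv mom => [//|[|n]] _ hW hQ hm pq.
  by rewrite (poly_neg _ pq)//; exact: ip0r.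
have E2 : n.+2%:Z - 2 = n%:Z by lia.
rewrite E2 in pq hm.
have mK := @polygon_measurable R K.
have KMo x : pol_dom K x -> `|x| <= M by move=> /subset_closure; exact: KM.
have [prr hrr] := hQ.
have pq2 : poly_le n.+2%:Z q by apply: poly_leW pq; lia.
have sq : sqint leb2 K q := sqint_continuous mK KMo (smooth_cont (smooth_poly pq2)).
have srr : sqint leb2 K rr := sqint_continuous mK KMo (smooth_cont (smooth_poly prr)).
have TM t x : triangle (@tri R K TK t) x -> `|x| <= M.
  by move=> tx; apply: KM; rewrite -(tri_cover TK); exists t.
have mT t := triangle_measurable (@tri R K TK t).
have swr : sqint leb2 K (fun x => w x - rr x) := sqint2B mK lw srr.
have tri0 t : [/\ sqint leb2 (triangle (@tri R K TK t)) (fun x => w x - rr x) &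
    ip leb2 (triangle (@tri R K TK t)) (fun x => w x - rr x) q = 0].
  have [P [pP hP]] := W_local_poly (isT : (1 <= n.+2)%N) (hW.2 t).
  have sP : sqint leb2 (triangle (@tri R K TK t)) (fun x => P x - rr x).
    apply: sqint2B (mT t) _ _; apply: (sqint_continuous (mT t) (TM t)).
      exact: smooth_cont (smooth_poly pP).
    exact: smooth_cont (smooth_poly prr).
  have sw : sqint leb2 (triangle (@tri R K TK t)) (fun x => w x - rr x).
    by apply: (@eq_sqint _ _ _ leb2 _ (mT t) _ _ _ sP) => x tx; rewrite hP.
  split=> //; apply: (monomials_complete (mT t) (TM t) sw (D0 t) _ pq).
  exact: hm.
have I1 : ip leb2 K (fun x => w x - rr x) q = 0.
  rewrite /ip (@integral_triangles R K TK); last 2 first.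
  - exact: (@sqint_mul _ _ _ leb2 K mK _ _ swr sq).
  - move=> t; have [sw _] := tri0 t.
    apply: (@sqint_mul _ _ _ leb2 _ (mT t) _ _ sw).
    exact: (sqint_continuous (mT t) (TM t) (smooth_cont (smooth_poly pq2))).
  by rewrite big1// => t _; have [_] := tri0 t.
have sv : sqint leb2 K v := lv.
have Ev : ip leb2 K (fun x => v x - w x) q = ip leb2 K v q - ip leb2 K w q.
  by rewrite ipC (ip2Br mK sq lv lw) ipC; congr (_ - _); exact: ipC.
have Ew : ip leb2 K (fun x => w x - rr x) q = ip leb2 K w q - ip leb2 K rr q.
  by rewrite ipC (ip2Br mK sq lw srr) ipC; congr (_ - _); exact: ipC.
rewrite /inner -/(ip leb2 K (fun x => v x - w x) q) Ev.
have -> : ip leb2 K v q = ip leb2 K rr q by exact: esym (hrr q pq2).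
by have := I1; rewrite Ew => /eqP; rewrite subr_eq0 => /eqP ->; rewrite subrr.
Qed.

End Moments.

(** * Uniqueness of edge integrals of the trace *)

Section Trace_uniqueness.
Context {R : realType}.
Notation mu := (@lebesgue_measure R).
Variables (K : @polygon R) (c : R * R) (r : R).
Hypothesis r0 : 0 < r.
Hypothesis dK : disc c r `<=` K.
Hypothesis sK : star_shaped_disc K c r.
Notation P := (@pol_vtx R K).
Notation Q i := (@pol_vtx R K (ordS i)).

Lemma edge_nrm_le i f (e : R) : 0 <= e -> L2_edge (P i) (Q i) f ->
  boundary_int K (fun x => f x ^+ 2) <= enorm (Q i - P i) * e ^+ 2 ->
  nrm mu `[0, 1] (f \o seg_pt (P i) (Q i)) <= e.
Proof.
move=> e0 lf; move=> /(le_trans (edge_int_le_boundary i (f := fun x => f x ^+ 2) (fun x => sqr_ge0 _))).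
rewrite /edge_int ler_pM2l; last exact: edge_len_gt0.
move=> h; rewrite -(ler_pXn2r (n := 2)) ?nnegrE ?nrm_ge0// nrm_sqr.
by apply: le_trans h; apply: le_of_eq; apply: eq_Rintegral => t _; rewrite expr2.
Qed.

(** A trace is given by a relation, and the one defining Pi v may differ from the one defining the
    interpolant. The trace inequality applied to the difference of two approximating sequences shows
    that their edge integrals agree. *)
Lemma trace_unique (v : H1 K) (g g' : R * R -> R) i : is_trace v g -> is_trace v g' ->
  \int[mu]_(t in `[0, 1]) g (seg_pt (P i) (Q i) t) = \int[mu]_(t in `[0, 1]) g' (seg_pt (P i) (Q i) t).
Proof.
move=> [lg [phi [sphi f0 f1 f2 fg]]] [lg' [phi' [sphi' f'0 f'1 f'2 fg']]].
have [M [M0 [KM _]]] := polygon_bounded r0 dK.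
have KMo x : pol_dom K x -> `|x| <= M by move=> /subset_closure; exact: KM.
have [C [C0 hC]] := trace_ineq r0 dK sK.
have mK := @polygon_measurable R K.
have mI : measurable (`[0, 1]%classic : set R) by [].
have el : 0 < enorm (Q i - P i) by exact: edge_len_gt0.
have sE h : L2_edge (P i) (Q i) h -> sqint mu `[0, 1] (h \o seg_pt (P i) (Q i)) by [].
have cE h : continuous h -> sqint mu `[0, 1] (h \o seg_pt (P i) (Q i)).
  move=> ch; have c' : continuous (h \o seg_pt (P i) (Q i)) by exact: (line_cont ch).
  split; first by apply: measurable_funTS; exact: continuous_measurable_fun.
  exact: continuous_integrable_itv (sqr_continuous c').
have s1 : sqint mu `[0, 1] (fun=> 1) := cE (fun=> 1) (@cst_continuous _ R 1).
have n1 : nrm mu `[0, 1] (fun=> 1) = 1.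
  rewrite /nrm (_ : ip mu `[0, 1] (fun=> 1) (fun=> 1) = 1) ?sqrtr1// /ip.
  transitivity (1 * 1 * fine (mu `[0%R, 1%R])); first exact: Rintegral_cst.
  by rewrite lebesgue_measure_itv/= lte_fin ltr01 sube0 !mulr1.
pose gg := fun t => g (seg_pt (P i) (Q i) t) - g' (seg_pt (P i) (Q i) t).
have sgg : sqint mu `[0, 1] gg by exact: (@sqintB _ _ _ mu _ mI _ _ (lg i) (lg' i)).
suff I0 : ip mu `[0, 1] gg (fun=> 1) = 0.
  have i1 := @sqint_mul _ _ _ mu _ mI _ _ (lg i) s1.
  have i2 := @sqint_mul _ _ _ mu _ mI _ _ (lg' i) s1.
  have E := @ipBl _ _ _ mu _ mI (g \o seg_pt (P i) (Q i)) (g' \o seg_pt (P i) (Q i)) (fun=> 1) (lg i) (lg' i) s1.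
  move: I0; rewrite [LHS]E => /eqP; rewrite subr_eq0 => /eqP; rewrite /ip.
  by under eq_Rintegral do rewrite mulr1; move=> ->; apply: eq_Rintegral => t _; rewrite mulr1.
apply/eqP; rewrite -normr_le0; apply: (@le_eps_scale _ _ _ 3) => // e e0; rewrite add0r.
have Ke : 0 < enorm (Q i - P i) * e ^+ 2 by rewrite mulr_gt0// exprn_gt0.
(* The squared norm of the difference and of its two derivatives are at most 4 del each, using del^2
   <= del; the sum 12 del times [C] then stays below the edge length times e^2. *)
pose del := Num.min 1 (enorm (Q i - P i) * e ^+ 2 / (C * 12)).
have del0 : 0 < del by rewrite lt_min ltr01 divr_gt0// mulr_gt0.
have [n [n0 n1' n2 ng]] := eventually_pick f0 f1 f2 fg del0 Ke.
have [m [m0 m1 m2 mg]] := eventually_pick f'0 f'1 f'2 fg' del0 Ke.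
have pos h : 0 <= boundary_int K (fun x => h x ^+ 2) by apply: boundary_int_ge0 => x; exact: sqr_ge0.
rewrite !ger0_norm ?nrm_ge0 ?pos// in n0 n1' n2 ng.
rewrite !ger0_norm ?nrm_ge0 ?pos// in m0 m1 m2 mg.
move: (phi n) (sphi n) n0 n1' n2 ng => f sf n0 n1' n2 ng.
move: (phi' m) (sphi' m) m0 m1 m2 mg => f' sf' m0 m1 m2 mg.
pose y x := f x - f' x; have sy : smooth y by exact: smoothB.
have sc u : smooth u -> sqint leb2 K u by move=> /smooth_cont cu; exact: sqint_continuous mK KMo cu.
have by_ : boundary_int K (fun x => y x ^+ 2) <= enorm (Q i - P i) * e ^+ 2.
  have tri (a b h : R * R -> R) : sqint leb2 K a -> sqint leb2 K b -> sqint leb2 K h ->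
      nrm leb2 K (fun x => a x - h x) <= del -> nrm leb2 K (fun x => b x - h x) <= del ->
      nrm leb2 K (fun x => a x - b x) ^+ 2 <= 4 * del.
    move=> sa sb sh ha hb.
    have E : (fun x => a x - b x) = (fun x => (a x - h x) - (b x - h x)) by apply/funext => x; ring.
    have le : nrm leb2 K (fun x => a x - b x) <= 2 * del.
      rewrite E; apply: le_trans (nrm2B mK (sqint2B mK sa sh) (sqint2B mK sb sh)) _.
      by rewrite mulrDl mul1r; apply: lerD.
    have h0 := nrm_ge0 leb2 K (fun x => a x - b x).
    apply: (@le_trans _ _ ((2 * del) ^+ 2)); first by rewrite lerXn2r ?nnegrE// mulr_ge0// ltW.
    have d1 : del <= 1 by rewrite /del ge_min lexx.
    rewrite exprMn expr2 [2 * 2](_ : _ = 4); last by ring.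
    by rewrite ler_wpM2l// expr2 ler_piMl// ltW.
  apply: le_trans (hC y sy) _.
  rewrite (grad_sqr_integral mK KMo sy) -nrm2_sqr_int.
  have dy1 : d1 y = (fun x => d1 f x - d1 f' x) by exact: d1B.
  have dy2 : d2 y = (fun x => d2 f x - d2 f' x) by exact: d2B.
  have t0 := tri f f' v (sc _ sf) (sc _ sf') (H1_L2 v) n0 m0.
  have t1 := tri (d1 f) (d1 f') (H1_d1 v) (sc _ (smooth_d1 sf)) (sc _ (smooth_d1 sf')) (H1_L2_d1 v) n1' m1.
  have t2 := tri (d2 f) (d2 f') (H1_d2 v) (sc _ (smooth_d2 sf)) (sc _ (smooth_d2 sf')) (H1_L2_d2 v) n2 m2.
  have sum : nrm leb2 K y ^+ 2 + (nrm leb2 K (d1 y) ^+ 2 + nrm leb2 K (d2 y) ^+ 2) <= 12 * del.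
    rewrite dy1 dy2 [12 * del](_ : _ = 4 * del + (4 * del + 4 * del)); last by ring.
    exact: lerD t0 (lerD t1 t2).
  apply: le_trans (ler_wpM2l (ltW C0) sum) _.
  have dle : del <= enorm (Q i - P i) * e ^+ 2 / (C * 12) by rewrite /del ge_min lexx orbT.
  have C12 : 0 < C * 12 by rewrite mulr_gt0.
  by rewrite mulrA mulrC -ler_pdivlMr.
have sfi := cE f (smooth_cont sf); have sf'i := cE f' (smooth_cont sf'); have syi := cE y (smooth_cont sy).
have lfg : L2_edge (P i) (Q i) (fun x => f x - g x) := @sqintB _ _ _ mu _ mI _ _ sfi (lg i).
have lfg' : L2_edge (P i) (Q i) (fun x => f' x - g' x) := @sqintB _ _ _ mu _ mI _ _ sf'i (lg' i).
have a1 := edge_nrm_le (ltW e0) lfg ng.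
have a2 := edge_nrm_le (ltW e0) lfg' mg.
have a3 := edge_nrm_le (ltW e0) syi by_.
apply: le_trans (@ip_le _ _ _ mu _ mI _ _ sgg s1) _; rewrite n1 mulr1.
have -> : gg = (fun t => (y \o seg_pt (P i) (Q i)) t + (((fun x => f' x - g' x) \o seg_pt (P i) (Q i)) t - ((fun x => f x - g x) \o seg_pt (P i) (Q i)) t)).
  by apply/funext => t; rewrite /gg /y /=; ring.
rewrite [e * 3](_ : _ = e + (e + e)); last by ring.
apply: le_trans (@nrmD _ _ _ mu _ mI _ _ syi (@sqintB _ _ _ mu _ mI _ _ lfg' lfg)) _.
apply: lerD a3 _; apply: le_trans (@nrmB _ _ _ mu _ mI _ _ lfg' lfg) _.
exact: lerD a2 a1.
Qed.

End Trace_uniqueness.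

(** * Inverse estimates *)

Section Diameter.
Context {R : realType}.
Variable K : @polygon R.

Lemma enorm_le_diam x y : pol_dom K x -> pol_dom K y -> enorm (x - y) <= diam K.
Proof.
move=> Kx Ky; apply: sup_upper_bound; last by exists x => //; exists y.
split; first by exists (enorm (x - y)), x => //; exists y.
have [M hM] := @pol_bounded R K; exists (2 * (`|M| + `|M|)) => _ [a Ka [b Kb <-]].
have h z : pol_dom K z -> `|z| <= `|M|.
  move=> /hM; rewrite /disc/= subr0 => zM.
  by apply: le_trans (norm_le_enorm z) _; apply: le_trans (ltW zM) (ler_norm _).
apply: le_trans (enorm_le_norm _) _; rewrite ler_wpM2l//.
by apply: le_trans (ler_normB _ _) _; apply: lerD; exact: h.
Qed.

Lemma norm_le_diam x y : closure K x -> closure K y -> `|x - y| <= diam K.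
Proof.
move=> cx cy; apply/ler_addgt0Pr => e e0.
have e2 : 0 < e / 2 by rewrite divr_gt0.
have [x' Kx xx] := closure_approx cx e2; have [y' Ky yy] := closure_approx cy e2.
have -> : x - y = (x' - y') + ((x - x') - (y - y')) by rewrite [LHS]surjective_pairing [RHS]surjective_pairing; congr pair => /=; ring.
apply: le_trans (ler_normD _ _) _; apply: lerD.
  by apply: le_trans (norm_le_enorm _) (enorm_le_diam Kx Ky).
apply: le_trans (ler_normB _ _) _; rewrite [e]splitr; exact: ltW (ltrD xx yy).
Qed.

Lemma diam_gt0 : 0 < diam K.
Proof.
have [x Kx] := @pol_nonempty R K.
have [e e0 he] := (open2P K).1 (@pol_open R K) x Kx.
pose y : R * R := x + (e / 2, 0).
have xy : x - y = - (e / 2, 0) by rewrite /y opprD addrA subrr add0r.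
have Ky : pol_dom K y.
  apply: he; rewrite xy normrN norm2_lt /= normr0 e0 andbT gtr0_norm; lra.
apply: lt_le_trans (enorm_le_diam Kx Ky); apply: enorm_gt0.
rewrite xy oppr_eq0; apply/eqP => -[/eqP]; rewrite gt_eqF//; lra.
Qed.

Lemma nrm_one_le c : closure K c -> nrm leb2 K (fun=> 1) <= 2 * diam K.
Proof.
move=> Kc; have h0 := ltW diam_gt0.
have mK := @polygon_measurable R K.
have box x : pol_dom K x -> `|x - c| <= diam K by move=> /subset_closure Kx; exact: norm_le_diam.
have := leb2_box_le h0 mK box => area_le.
have -> : nrm leb2 K (fun=> 1) = Num.sqrt (fine (leb2 K)).
  rewrite /nrm /ip; congr Num.sqrt; transitivity (1 * 1 * fine (leb2 K)); last by rewrite !mul1r.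
  exact: Rintegral_cst.
have fin : (leb2 K < +oo)%E by apply: le_lt_trans area_le (ltry _).
rewrite -[2 * diam K]ger0_norm ?mulr_ge0// -sqrtr_sqr ler_sqrt ?sqr_ge0//.
by rewrite -lee_fin fineK// ge0_fin_numE.
Qed.

End Diameter.

Section Localization.
Context {R : realType}.
Implicit Types (D K : set (R * R)) (F G psi : R * R -> R).

Lemma test_funS D K psi : D `<=` K -> test_fun D psi -> test_fun K psi.
Proof. by move=> DK [sp [A [cA AD A0]]]; split=> //; exists A; split=> //; exact: subset_trans DK. Qed.

Lemma inner_local D K F G psi : D `<=` K -> (forall x, D x -> F x = G x) ->
  (forall x, ~ D x -> psi x = 0) -> inner D F psi = inner K G psi.
Proof.
move=> DK FG p0; rewrite /inner Rintegral_mkcond [RHS]Rintegral_mkcond.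
apply: eq_Rintegral => x _; rewrite !patchE.
have [Dx|nD] := pselect (D x); first by rewrite mem_set// mem_set ?FG//; exact: DK.
by rewrite memNset// p0// mulr0 if_same.
Qed.

Lemma smooth_ibp K F psi (M : R) : open K -> (forall x, K x -> `|x| <= M) -> smooth F -> test_fun K psi ->
  inner K (d1 F) psi = - inner K F (d1 psi) /\ inner K (d2 F) psi = - inner K F (d2 psi).
Proof.
move=> oK KM sF tp; have mK := open2_measurable oK.
have sp : smooth psi by case: tp.
have sc u : smooth u -> sqint leb2 K u by move=> /smooth_cont cu; exact: sqint_continuous mK KM cu.
have ibp (a b : R * R -> R) : smooth a -> smooth b -> \int[leb2]_(x in K) (F x * b x + psi x * a x) = 0 ->
    inner K a psi = - inner K F b.
  move=> sa sb E; apply/eqP; rewrite -addr_eq0; apply/eqP; rewrite -[RHS]E.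
  have i1 := @sqint_mul _ _ _ leb2 K mK _ _ (sc _ sF) (sc _ sb).
  have i2 := @sqint_mul _ _ _ leb2 K mK _ _ (sc _ sp) (sc _ sa).
  rewrite addrC; transitivity (\int[leb2]_(x in K) (F x * b x) + \int[leb2]_(x in K) (psi x * a x)).
    by congr (_ + _); apply: eq_Rintegral => x _; rewrite mulrC.
  by symmetry; exact: RintegralD.
split; apply: ibp; rewrite ?(smooth_d1 sF, smooth_d2 sF)//.
- exact: smooth_d1.
- exact: smooth_d1.
- by have := test_int_d1 mK (testM sF tp); rewrite (d1M sF sp).
- exact: smooth_d2.
- exact: smooth_d2.
- by have := test_int_d2 mK (testM sF tp); rewrite (d2M sF sp).
Qed.

End Localization.


Section Inverse_estimates.
Context {R : realType}.

Lemma disc_open (c : R * R) r : open (disc c r).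
Proof.
have cd : continuous (fun x : R * R => dot (x - c) (x - c)).
  have -> : (fun x : R * R => dot (x - c) (x - c)) =
      (fun x => (1 * x.1 + - c.1) ^+ 2 * (0 * x.2 + 1) ^+ 0 + (0 * x.1 + 1) ^+ 0 * (1 * x.2 + - c.2) ^+ 2).
    by apply/funext => z; rewrite /dot /= !expr0; ring.
  apply: smooth_cont; apply: (@smooth_poly R 2); apply: polyD; exact: poly_affine_mono.
have cf : continuous (fun x : R * R => enorm (x - c)).
  by move=> x; exact: continuous_comp (cd x) (@sqrt_continuous R _).
have := open_comp (f := fun x : R * R => enorm (x - c)) (D := [set s | s < r]) (fun x _ => cf x) (@open_lt R r).
by [].
Qed.

(** The disc has radius sigma h and the estimate reaches 2 h, which is 2/sigma radii: when h is the
    diameter this covers [K]. The scale is kept explicit as 1/h^2 and sigma goes into the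
    constant. *)
Lemma disc_sup_bound (n : nat) (sigma : R) : 0 < sigma ->
  exists2 C : R, 0 < C & forall (c : R * R) (h : R) (F : R * R -> R) (N : R), 0 < h -> poly_le n%:Z F ->
    (forall psi, test_fun (disc c (sigma * h)) psi -> (forall x, `|psi x| <= 1) ->
       (forall x, `|d1 psi x| <= (sigma * h)^-1) -> (forall x, `|d2 psi x| <= (sigma * h)^-1) ->
       `|inner (disc c (sigma * h)) F psi| <= N) ->
    forall x : R * R, `|x - c| <= 2 * h -> `|F x| <= C * (N / h ^+ 2).
Proof.
move=> s0; have M0 : 0 <= 2 / sigma by rewrite divr_ge0// ltW.
have [C C0 HC] := poly_sup_test n M0.
exists (C / sigma ^+ 2); first by rewrite divr_gt0// exprn_gt0.
move=> c h F N h0 pF hF x xh.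
have sh : 0 < sigma * h by rewrite mulr_gt0.
have := HC (disc c (sigma * h)) c (sigma * h) F (N / (sigma * h) ^+ 2)
  (open2_measurable (@disc_open c _)) sh (fun _ => id) pF _ x _.
have -> : C * (N / (sigma * h) ^+ 2) = C / sigma ^+ 2 * (N / h ^+ 2) by field; rewrite !gt_eqF.
apply.
- by move=> psi tp p0 p1 p2; rewrite divfK ?gt_eqF ?exprn_gt0//; exact: hF.
- by have -> : 2 / sigma * (sigma * h) = 2 * h by field; rewrite gt_eqF.
Qed.

Lemma polygon_box (K : @polygon R) : exists M : R, forall x, pol_dom K x -> `|x| <= M.
Proof.
have [M hM] := @pol_bounded R K; exists M => x /hM; rewrite /disc/= subr0 => h.
by apply: le_trans (norm_le_enorm x) (ltW h).
Qed.

Lemma polygon_sqint (K : @polygon R) (f : R * R -> R) : continuous f -> sqint leb2 K f.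
Proof.
by move=> cf; have [M KM] := polygon_box K; exact: sqint_continuous (@polygon_measurable R K) KM cf.
Qed.

Section Test_norms.
Variables (K : @polygon R) (psi : R * R -> R) (sh : R).
Hypothesis tp : test_fun K psi.
Hypothesis sh0 : 0 < sh.
Hypothesis p0 : forall x, `|psi x| <= 1.
Hypothesis p1 : forall x, `|d1 psi x| <= sh^-1.
Hypothesis p2 : forall x, `|d2 psi x| <= sh^-1.

Lemma test_norms : [/\ nrm leb2 K psi <= 2 * diam K, nrm leb2 K (d1 psi) <= sh^-1 * (2 * diam K)
  & nrm leb2 K (d2 psi) <= sh^-1 * (2 * diam K)].
Proof.
have [c Kc] := @pol_nonempty R K.
have mK := @polygon_measurable R K.
have n1 := nrm_one_le (subset_closure Kc).
have s1 := polygon_sqint K (@cst_continuous _ R 1).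
have sp : smooth psi by case: tp.
have i0 : 0 <= sh^-1 by rewrite invr_ge0 ltW.
split.
- rewrite -[leRHS]mul1r; apply: le_trans (ler_wpM2l ler01 n1).
  exact: nrm2_const mK s1 (polygon_sqint K (smooth_cont sp)) ler01 (fun x _ => p0 x).
- apply: le_trans (ler_wpM2l i0 n1).
  exact: nrm2_const mK s1 (polygon_sqint K (smooth_cont (smooth_d1 sp))) i0 (fun x _ => p1 x).
- apply: le_trans (ler_wpM2l i0 n1).
  exact: nrm2_const mK s1 (polygon_sqint K (smooth_cont (smooth_d2 sp))) i0 (fun x _ => p2 x).
Qed.

End Test_norms.

(** Each partial derivative of a polynomial piece is tested in an inscribed disc. Leaving the
    derivative on [w] gives the seminorm over h; moving it onto the test function costs a further
    1/h and gives the norm over h^2. Continuity across triangles then glues the gradient bounds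
    along segments. *)
Lemma interpolant_lipschitz (k : nat) (sigma : R) : (1 <= k)%N -> 0 < sigma ->
  exists2 C : R, 0 < C & forall (K : @polygon R) (TK : triangulation K) (w : H1 K),
  (forall t, exists c, disc c (sigma * diam K) `<=` triangle (@tri R K TK t) /\
     disc c (sigma * diam K) `<=` K) -> W_space TK k w ->
  lipschitz_along (closure K) (C * (H1seminorm w / diam K)) w /\
  lipschitz_along (closure K) (C * (L2norm K w / diam K ^+ 2)) w.
Proof.
move=> k1 s0; have [C C0 HC] := disc_sup_bound k s0.
(* The 4 is 2 from the square root of the area bound (2 h)^2 times 2 from passing from two partial
   derivatives to a Lipschitz constant; the last factor covers both estimates. *)
pose C' := 4 * C * (1 + sigma^-1); have C'0 : 0 < C' by rewrite !mulr_gt0// addr_gt0// invr_gt0.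
exists C' => // K TK w hD hW.
have mK := @polygon_measurable R K; have h0 := diam_gt0 K.
pose h := diam K; rewrite -/h in h0 *.
have sh : 0 < sigma * h by rewrite mulr_gt0.
have sw : sqint leb2 K w := H1_L2 w.
have sw1 : sqint leb2 K (H1_d1 w) := H1_L2_d1 w.
have sw2 : sqint leb2 K (H1_d2 w) := H1_L2_d2 w.
have H1le : nrm leb2 K (H1_d1 w) <= H1seminorm w /\ nrm leb2 K (H1_d2 w) <= H1seminorm w.
  split; rewrite /H1seminorm /nrm ler_sqrt ?addr_ge0 ?ip_ge0//.
    by rewrite lerDl; exact: ip_ge0.
  by rewrite lerDr; exact: ip_ge0.
have tri_bound t : exists P, [/\ smooth P, forall x, triangle (@tri R K TK t) x -> w x = P x,
   forall x, triangle (@tri R K TK t) x -> `|d1 P x| <= C * (2 * h * H1seminorm w / h ^+ 2) /\ `|d2 P x| <= C * (2 * h * H1seminorm w / h ^+ 2) &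
   forall x, triangle (@tri R K TK t) x -> `|d1 P x| <= C * (L2norm K w * ((sigma * h)^-1 * (2 * h)) / h ^+ 2) /\
      `|d2 P x| <= C * (L2norm K w * ((sigma * h)^-1 * (2 * h)) / h ^+ 2)].
  have [c [DT DK]] := hD t; have [P [pP hP]] := W_local_poly k1 (hW.2 t).
  have sP := smooth_poly pP.
  have [M KM] := polygon_box K.
  have oD := @disc_open c (sigma * h).
  have pd1 : poly_le k%:Z (d1 P) by have := poly_d1 pP; rewrite (_ : k.+1%:Z - 1 = k%:Z)//; lia.
  have pd2 : poly_le k%:Z (d2 P) by have := poly_d2 pP; rewrite (_ : k.+1%:Z - 1 = k%:Z)//; lia.
  have Tc x : triangle (@tri R K TK t) x -> `|x - c| <= 2 * h.
    move=> tx; have cK x' : triangle (@tri R K TK t) x' -> closure K x'.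
      by move=> tx'; rewrite -(tri_cover TK); exists t.
    have Dc : disc c (sigma * h) c.
      by rewrite /disc /= subrr /enorm /dot /= !mulr0 addr0 sqrtr0.
    apply: (@le_trans _ _ h); first exact: norm_le_diam (cK _ tx) (cK _ (DT _ Dc)).
    by rewrite mulrDl mul1r lerDl ltW.
  (* On the disc the piece coincides with [w], so a test function supported there sees the weak
     derivatives of [w] as those of a polynomial. *)
  have loc psi : test_fun (disc c (sigma * h)) psi ->
     [/\ test_fun K psi, inner (disc c (sigma * h)) (d1 P) psi = - inner K w (d1 psi)
      & inner (disc c (sigma * h)) (d2 P) psi = - inner K w (d2 psi)].
    move=> tp; have tK := test_funS DK tp.
    have [e1 e2] := smooth_ibp oD (fun x Dx => KM x (DK x Dx)) sP tp.
    have PW x : disc c (sigma * h) x -> P x = w x by move=> Dx; rewrite hP//; exact: DT.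
    split; first exact: tK.
      rewrite e1; congr (- _); exact: inner_local DK PW (test_off (test_d1 tp)).
    rewrite e2; congr (- _); exact: inner_local DK PW (test_off (test_d2 tp)).
  exists P; split=> //.
  (* The weak derivative is put back on [w]; only the size of the test function is used. *)
  - move=> x tx; split; apply: (HC c h _ _ h0) (Tc x tx) => // psi tp p0 p1 p2.
      have [tK -> _] := loc psi tp; have [n0 _ _] := test_norms tK sh p0 p1 p2.
      rewrite (H1_weak_d1 w tK) opprK mulrC.
      exact (le_trans (ip2_le mK sw1 (polygon_sqint K (smooth_cont tK.1))) (ler_pM (nrm_ge0 _ _ _) (nrm_ge0 _ _ _) H1le.1 n0)).
    have [tK _ ->] := loc psi tp; have [n0 _ _] := test_norms tK sh p0 p1 p2.
    rewrite (H1_weak_d2 w tK) opprK mulrC.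
    exact (le_trans (ip2_le mK sw2 (polygon_sqint K (smooth_cont tK.1))) (ler_pM (nrm_ge0 _ _ _) (nrm_ge0 _ _ _) H1le.2 n0)).
  (* Here the derivative stays on the test function, whose gradient is at most 1/(sigma h). *)
  - move=> x tx; split; apply: (HC c h _ _ h0) (Tc x tx) => // psi tp p0 p1 p2.
      have [tK -> _] := loc psi tp; have [_ n1 _] := test_norms tK sh p0 p1 p2.
      rewrite normrN.
      exact (le_trans (ip2_le mK sw (polygon_sqint K (smooth_cont (smooth_d1 tK.1)))) (ler_wpM2l (nrm_ge0 _ _ _) n1)).
    have [tK _ ->] := loc psi tp; have [_ _ n2] := test_norms tK sh p0 p1 p2.
    rewrite normrN.
    exact (le_trans (ip2_le mK sw (polygon_sqint K (smooth_cont (smooth_d2 tK.1)))) (ler_wpM2l (nrm_ge0 _ _ _) n2)).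
have lip (B G : R) : 2 * B <= G -> 0 <= G ->
    (forall t, exists P, [/\ smooth P, forall x, triangle (@tri R K TK t) x -> w x = P x &
      forall x, triangle (@tri R K TK t) x -> `|d1 P x| <= B /\ `|d2 P x| <= B]) ->
    lipschitz_along (closure K) G w.
  move=> BG G0 hB; apply: (piecewise_lipschitz (T := fun t => triangle (@tri R K TK t))) => //.
  - by move=> t; exact: triangle_closed.
  - by rewrite tri_cover.
  - move=> t x y tx ty; have [P [sP wP dP]] := hB t; rewrite !wP//.
    apply: le_trans (convex_lipschitz sP (triangle_segment tx ty) dP) _.
    by rewrite ler_wpM2r.
have w0 : 0 <= L2norm K w by exact: nrm_ge0.
have w10 : 0 <= H1seminorm w by exact: sqrtr_ge0.
have C'1 : 4 * C <= C' by rewrite /C' ler_peMr ?mulr_ge0 ?(ltW C0)// lerDl invr_ge0 ltW.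
have C'2 : 4 * C / sigma <= C'.
  by rewrite /C' ler_wpM2l ?mulr_ge0 ?(ltW C0)// lerDr.
split; [apply: (lip (C * (2 * h * H1seminorm w / h ^+ 2)))|apply: (lip (C * (L2norm K w * ((sigma * h)^-1 * (2 * h)) / h ^+ 2)))].
- have -> : 2 * (C * (2 * h * H1seminorm w / h ^+ 2)) = 4 * C * (H1seminorm w / h) by field; rewrite gt_eqF.
  by rewrite ler_wpM2r// divr_ge0// ltW.
- by rewrite mulr_ge0 ?divr_ge0// ltW.
- by move=> t; have [P [? ? ? ?]] := tri_bound t; exists P.
- have -> : 2 * (C * (L2norm K w * ((sigma * h)^-1 * (2 * h)) / h ^+ 2)) = 4 * C / sigma * (L2norm K w / h ^+ 2).
    by field; rewrite !gt_eqF.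
  by rewrite ler_wpM2r// divr_ge0// exprn_ge0// ltW.
- by rewrite mulr_ge0 ?divr_ge0 ?exprn_ge0// ltW.
- by move=> t; have [P [? ? ? ?]] := tri_bound t; exists P.
Qed.

End Inverse_estimates.

(** * Leading homogeneous parts of a polynomial *)

Section Homogeneous_parts.
Context {R : realType}.
Notation mu := (@lebesgue_measure R).

(** A coefficient is the integral of the polynomial against its dual function, which is supported in
    [-1/2, 1/2], an interval of length 1. *)
Lemma coef_bound (n : nat) : exists2 B : R, 0 < B & forall (a : 'I_n.+1 -> R) (m : 'I_n.+1) (b : R),
  (forall s : R, `|s| <= 2^-1 -> `|\sum_(j < n.+1) a j * s ^+ j| <= b) -> `|a m| <= B * b.
Proof.
have [B B1 HB] := @dual_bound R n.
exists B; first by apply: lt_le_trans B1.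
move=> a m b hb; set I := `[- 2^-1, 2^-1]%classic : set R.
have mI : measurable I by exact: measurable_itv.
have mu1 : mu I = 1%E.
  rewrite /I lebesgue_measure_itv/= lte_fin ifT; last by lra.
  by rewrite -EFinB; congr EFin; lra.
pose p (s : R) := \sum_(j < n.+1) a j * s ^+ j.
have cp : continuous p.
  have -> : p = horner (\poly_(j < n.+1) a (inord j)); last exact: continuous_poly1.
  by apply/funext => s; rewrite horner_poly; apply: eq_bigr => j _; rewrite inord_val.
have cd : continuous (dual m : R -> R).
  by move=> s; exact: Cline_cont (Cline_dual m 0) _.
have cpd : continuous (fun s => p s * dual m s).
  by move=> s; apply: (@continuousM R R p (dual m)); [exact: cp|exact: cd].
have ij (j : 'I_n.+1) : mu.-integrable I (EFin \o (fun s => s ^+ j * dual m s)).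
  apply: continuous_integrable_itv => s; apply: (@continuousM R R (fun s => s ^+ j) (dual m)); last exact: cd.
  have -> : (fun s : R => s ^+ j) = horner ('X^j : {poly R}) by apply/funext => t; rewrite hornerXn.
  exact: (@continuous_poly1 R).
have on (j : 'I_n.+1) : \int[mu]_(s in I) (s ^+ j * dual m s) = (m == j)%:R.
  rewrite -dual_integral Rintegral_mkcond; apply: eq_Rintegral => s _; rewrite patchE; case: ifPn => //.
  move=> /negP; rewrite inE /I /= in_itv/= => hs; rewrite dual_eq0 ?mulr0// leNgt; apply/negP.
  by rewrite ltr_norml => /andP[h1 h2]; apply: hs; rewrite !ltW.
have -> : a m = \int[mu]_(s in I) (p s * dual m s).
  transitivity (\int[mu]_(s in I) (\sum_(j < n.+1) a j * (s ^+ j * dual m s))); last first.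
    by apply: eq_Rintegral => s _; rewrite /p mulr_suml; apply: eq_bigr => j _; rewrite mulrA.
  rewrite Rintegral_lsum//; last by move=> j; exact: (@integrableZl _ _ _ mu _ mI (a j) _ (ij j)).
  rewrite (bigD1 m)//= big1 ?addr0 => [|j jm].
    have -> : \int[mu]_(s in I) (a m * (s ^+ m * dual m s)) = a m * \int[mu]_(s in I) (s ^+ m * dual m s) by exact: RintegralZl.
    by rewrite on eqxx mulr1.
  have -> : \int[mu]_(s in I) (a j * (s ^+ j * dual m s)) = a j * \int[mu]_(s in I) (s ^+ j * dual m s) by exact: RintegralZl.
  by rewrite on eq_sym (negbTE jm) mulr0.
have b0 : 0 <= b by apply: le_trans (hb 0 _); rewrite ?normr0.
have int1 : mu.-integrable I (EFin \o (fun s => `|p s * dual m s|)).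
  apply: continuous_integrable_itv => s; apply: (@continuous_comp _ _ _ (fun s => p s * dual m s) (fun x => `|x|)); first exact: cpd.
  exact: norm_continuous.
have ii : mu.-integrable I (EFin \o (fun s => p s * dual m s)) by exact: continuous_integrable_itv.
have nn : `|\int[mu]_(s in I) (p s * dual m s)| <= \int[mu]_(s in I) `|p s * dual m s| by exact: le_normr_Rintegral.
apply: (le_trans nn).
have fin : (mu I < +oo)%E by rewrite mu1 ltry.
have -> : B * b = \int[mu]_(s in I) (B * b).
  transitivity (B * b * fine (mu I)); first by rewrite mu1 mulr1.
  by symmetry; exact: Rintegral_cst.
apply: le_Rintegral => //; first exact: (@integrable_const _ _ _ mu _ mI _ fin).
move=> s; rewrite /I /= in_itv/= => /andP[s1 s2]; rewrite normrM mulrC.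
apply: ler_pM => //; first by case: (HB m s).
by apply: hb; rewrite ler_norml s1 s2.
Qed.

Definition hom_part (a : nat -> nat -> R) (N m : nat) (y : R * R) : R :=
  \sum_(i < N) \sum_(j < N | (i + j == m)%N) a i j * mono i j y.

Lemma hom_part_scale a N m (s : R) y : hom_part a N m (s *: y) = s ^+ m * hom_part a N m y.
Proof.
rewrite /hom_part mulr_sumr; apply: eq_bigr => i _; rewrite mulr_sumr; apply: eq_bigr => j /eqP <-.
by rewrite /mono /= /GRing.scale/= !exprMn exprD; ring.
Qed.

Lemma hom_part_widen (a : nat -> nat -> R) N m (y : R * R) : (m < N)%N -> hom_part a N m y = hom_part a m.+1 m y.
Proof.
move=> mN; rewrite /hom_part [RHS](big_ord_widen N (fun i => \sum_(j < m.+1 | (i + j == m)%N) a i j * mono i j y))//.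
rewrite [RHS]big_mkcond/=; apply: eq_bigr => i _; case: ifPn => [im|]; last first.
  by rewrite -leqNgt => im; rewrite big_pred0// => j; apply/negbTE; lia.
rewrite [RHS](big_ord_widen_cond N (fun j => (i + j == m)%N) (fun j => a i j * mono i j y))//.
apply: eq_bigl => j; have [E|//] := eqVneq (i + j)%N m.
by rewrite /=; symmetry; lia.
Qed.

Lemma hom_part_sum (a : nat -> nat -> R) k (y : R * R) : \sum_(i < k.+1) \sum_(j < k.+1 | (i + j <= k)%N) a i j * mono i j y =
  \sum_(m < k.+1) hom_part a k.+1 m y.
Proof.
rewrite /hom_part exchange_big /=; apply: eq_bigr => i _.
rewrite (exchange_big_dep (fun j : 'I_k.+1 => (i + j <= k)%N)) /=; last first.
  by move=> m j _ /eqP E; rewrite E -ltnS.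
apply: eq_bigr => j ij; rewrite (big_pred1 (inord (i + j)))// => m.
apply/eqP/eqP => [E|-> /=]; last by rewrite inordK.
by apply/val_inj; rewrite /= inordK.
Qed.

Lemma poly_hom_part (S : set (R * R)) a m : poly_hom S m%:Z (fun x => hom_part a m.+1 m (x - centroid S)).
Proof.
exists a => x; apply: eq_bigr => i _; apply: eq_bigr => j _; by rewrite /mono mulrA.
Qed.

(** Along the line from the centroid through [x], the coefficients of the polynomial in s are the
    values at [x] of its homogeneous parts. The two leading ones are therefore bounded by the values
    of [f] for |s| at most 1/2, and f0 keeps the parts of degree at most k - 2. *)
Lemma homogeneous_split (k : nat) : (1 <= k)%N -> exists2 C : R, 0 < C & forall (S : set (R * R)) (f : R * R -> R),
  poly_le k%:Z f -> exists f0 q1 q2, [/\ poly_le (k%:Z - 2) f0, poly_hom S k%:Z q1, poly_hom S (k%:Z - 1) q2,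
    forall x, f x = f0 x + (q1 x + q2 x) &
    forall x b, (forall s : R, `|s| <= 2^-1 -> `|f (centroid S + s *: (x - centroid S))| <= b) ->
      `|q1 x + q2 x| <= C * b].
Proof.
case: k => [//|k] _; have [B B0 HB] := coef_bound k.+1.
exists (B + B); first by rewrite addr_gt0.
move=> S f pf; set cen := centroid S.
have [a Ha] := (poly_leE _ _).1 (poly_affine cen 1 pf).
have FE y : f (cen + y) = \sum_(m < k.+2) hom_part a k.+2 m y.
  by have := Ha y; rewrite scale1r => ->; exact: hom_part_sum.
have ph m : (m < k.+2)%N -> poly_hom S m%:Z (fun x => hom_part a k.+2 m (x - cen)).
  move=> mk; have := poly_hom_part S a m; congr (poly_hom _ _); apply/funext => x.
  by rewrite [RHS]hom_part_widen.
exists (fun x => \sum_(m < k) hom_part a k.+2 m (x - cen)).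
exists (fun x => hom_part a k.+2 k.+1 (x - cen)), (fun x => hom_part a k.+2 k (x - cen)); split.
- case: k {B B0 HB FE Ha} pf ph => [|k] pf ph.
    by under eq_fun do rewrite big_ord0; exact: poly_zero.
  have -> : k.+2%:Z - 2 = k%:Z by lia.
  apply: poly_sum => m _; apply: (@poly_leW R m); first by have := ltn_ord m; lia.
  by apply: poly_hom_le; apply: ph; have := ltn_ord m; lia.
- exact: ph.
- by have -> : k.+1%:Z - 1 = k%:Z by [lia|]; apply: ph.
- move=> x; rewrite -{1}(subrK cen x) addrC FE !big_ord_recr /= -addrA; congr (_ + _); exact: addrC.
move=> x b hb.
have co m := HB (fun m => hom_part a k.+2 m (x - cen)) m b.
have hs (s : R) : `|s| <= 2^-1 -> `|\sum_(j < k.+2) hom_part a k.+2 j (x - cen) * s ^+ j| <= b.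
  move=> /hb; rewrite FE; congr (`|_| <= _); apply: eq_bigr => j _.
  by rewrite hom_part_scale mulrC.
apply: le_trans (ler_normD _ _) _; rewrite mulrDl; apply: lerD.
  exact: (co ord_max hs).
have := co (inord k) hs; by rewrite inordK.
Qed.

End Homogeneous_parts.

(** * Stability of the interpolation *)

Section Centroid.
Context {R : realType}.
Variable K : @polygon R.

Lemma quotient_near (A X c h : R) : 0 < A -> `|X - c * A| <= h * A -> `|X / A - c| <= h.
Proof.
move=> A0; have -> : X / A - c = (X - c * A) / A by field; rewrite gt_eqF.
by rewrite normrM normfV (gtr0_norm A0) ler_pdivrMr.
Qed.

Let mK : measurable K := @polygon_measurable R K.
Let s1 : sqint leb2 K (fun=> 1) := polygon_sqint K (@cst_continuous _ R 1).

(** If the norm of 1 were zero, all pairings of the constant 1 with test functions would vanish, and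
    the inverse estimate applied to that constant would give 1 <= 0. *)
Lemma disc_nrm_gt0 c (r : R) : 0 < r -> disc c r `<=` K -> 0 < nrm leb2 K (fun=> 1).
Proof.
move=> r0 dK; rewrite lt_def nrm_ge0 andbT; apply/eqP => n0.
have [C C0 HC] := disc_sup_bound 0 (@ltr01 R).
have := HC c r (fun=> 1) 0 r0 (poly_cst 0 1) _ c; rewrite mul0r mulr0 normr1 subrr normr0 mul1r.
move=> H; suff : (1 : R) <= 0 by rewrite ler10.
apply: H; last by rewrite mulr_ge0// ltW.
move=> psi tp _ _ _; have tK := test_funS dK tp.
have -> : inner (disc c r) (fun=> 1) psi = inner K (fun=> 1) psi.
  exact: inner_local dK (fun x _ => erefl) (test_off tp).
have := ip2_le mK s1 (polygon_sqint K (smooth_cont tK.1)); rewrite n0 mul0r; exact.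
Qed.

(** The centroid need not lie in the nonconvex [K], but its coordinates are means of coordinates
    over [K], so it is no farther than the diameter from any point of the closure. The homogeneous
    parts are taken about it. *)
Lemma centroid_near c0 (r : R) c : 0 < r -> disc c0 r `<=` K -> closure K c ->
  `|centroid K - c| <= diam K.
Proof.
move=> r0 dK Kc; have n0 := disc_nrm_gt0 r0 dK; have h0 := diam_gt0 K.
have A0 : 0 < ip leb2 K (fun=> 1) (fun=> 1) by rewrite -nrm2_sqr exprn_gt0.
have aE : area K = ip leb2 K (fun=> 1) (fun=> 1).
  rewrite /ip; transitivity (1 * 1 * fine (leb2 K)); first by rewrite !mul1r.
  by symmetry; exact: Rintegral_cst.
have main (u : R * R -> R) : continuous u -> (forall x, closure K x -> `|u x - u c| <= diam K) ->
    `|(\int[leb2]_(x in K) u x) / area K - u c| <= diam K.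
  move=> cu hu; rewrite aE; apply: quotient_near => //.
  have su := polygon_sqint K cu.
  have E : \int[leb2]_(x in K) u x = ip leb2 K (fun=> 1) u.
    by apply: eq_Rintegral => x _; rewrite mul1r.
  have sc := polygon_sqint K (@cst_continuous _ R (u c)).
  have E2 : ip leb2 K (fun=> 1) (fun x => u x - u c) = \int[leb2]_(x in K) u x - u c * ip leb2 K (fun=> 1) (fun=> 1).
    rewrite (ip2Br mK s1 su sc) -E; congr (_ - _).
    rewrite ipC; rewrite -(ip2Zl (u c) mK s1 s1); by apply: eq_Rintegral => x _; rewrite !mulr1.
  rewrite -E2 -nrm2_sqr expr2 mulrA.
  have sB := sqint2B mK su sc.
  exact (ip2_le_bound mK s1 sB (nrm2_const mK s1 sB (ltW h0) (fun x Kx => hu x (subset_closure Kx)))).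
have near1 x : closure K x -> `|x.1 - c.1| <= diam K.
  by move=> Kx; apply: le_trans (norm_le_diam Kx Kc); exact: norm2_fst (x - c).
have near2 x : closure K x -> `|x.2 - c.2| <= diam K.
  by move=> Kx; apply: le_trans (norm_le_diam Kx Kc); exact: norm2_snd (x - c).
have := main fst (fun x => cvg_fst) near1; have := main snd (fun x => cvg_snd) near2.
by rewrite norm2_le => -> ->.
Qed.

End Centroid.

(** * Control of a function by its boundary mean *)

Section Boundary_mean.
Context {R : realType}.
Notation mu := (@lebesgue_measure R).
Variables (K : @polygon R) (c : R * R) (r : R).
Hypotheses (r0 : 0 < r) (sK : star_shaped_disc K c r) (Kc : closure K c).

Lemma segment_center x : closure K x -> segment x c `<=` closure K.
Proof.
move=> Kx _ [t /= + <-]; rewrite in_itv /= => /andP[t0 t1].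
have E (y : R * R) (s : R) : seg_pt y c s = homot c (1 - s) y.
  by rewrite /seg_pt /homot scalerBl scale1r addrA [c + (y - c)]addrC subrK -scalerN opprB.
rewrite E; apply: (star_homot_closure r0 sK Kx); lra.
Qed.

Lemma mean_arith (n : nat) (l m : 'I_n -> R) (a e : R) : (forall i, 0 < l i) -> (0 < n)%N ->
  (forall i, `|m i - a| <= e) -> \sum_i l i * m i = 0 -> `|a| <= e.
Proof.
move=> l0 n0 hm E; have L0 : 0 < \sum_i l i.
  case: n n0 l l0 m hm E => // n _ l l0 m hm E; rewrite big_ord_recl /= ltr_wpDr// sumr_ge0// => i _.
  by rewrite ltW.
rewrite -(ler_pM2r L0) -[X in _ * X <= _](gtr0_norm L0) -normrM.
have -> : a * \sum_i l i = \sum_i l i * (a - m i).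
  under [RHS]eq_bigr do rewrite mulrBr.
  by rewrite sumrB E subr0 mulr_sumr; apply: eq_bigr => i _; rewrite mulrC.
apply: le_trans (ler_norm_sum _ _ _) _; rewrite mulr_sumr; apply: ler_sum => i _.
by rewrite normrM gtr0_norm// mulrC ler_wpM2r ?(ltW (l0 i))// distrC.
Qed.

(** Star-shapedness joins every point to [c] by a segment, so p - w differs from its value at [c] by
    at most [G * diam K]. Averaging over the boundary, where the mean of p - w vanishes, bounds that
    value too; hence the factor 2. *)
Lemma boundary_mean_bound (p w : R * R -> R) (G : R) : 0 <= G ->
  lipschitz_along (closure K) G (fun x => p x - w x) ->
  (forall i : 'I_(pol_n K), exists q : {poly R}, forall t, 0 <= t <= 1 -> p (seg_pt (pol_vtx i) (pol_vtx (ordS i)) t) = q.[t]) ->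
  (forall i : 'I_(pol_n K), exists q : {poly R}, forall t, 0 <= t <= 1 -> w (seg_pt (pol_vtx i) (pol_vtx (ordS i)) t) = q.[t]) ->
  boundary_int K p = boundary_int K w ->
  forall x, closure K x -> `|p x - w x| <= 2 * (G * diam K).
Proof.
move=> G0 lip ep ew E.
have near_c x : closure K x -> `|(p x - w x) - (p c - w c)| <= G * diam K.
  move=> Kx; apply: le_trans (lip x c (segment_center Kx)) _.
  by apply: ler_wpM2l => //; exact: norm_le_diam.
suff at_c : `|p c - w c| <= G * diam K.
  move=> x Kx; rewrite -[p x - w x](subrK (p c - w c)).
  by apply: le_trans (ler_normD _ _) _; rewrite mulrDl mul1r; apply: lerD => //; exact: near_c.
pose m i := \int[mu]_(t in `[0, 1]) (p (seg_pt (pol_vtx i) (pol_vtx (ordS i)) t) - w (seg_pt (pol_vtx i) (@pol_vtx R K (ordS i)) t)).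
have mI : measurable (`[0, 1]%classic : set R) by [].
have mid i : exists q : {poly R}, [/\ forall t, 0 <= t <= 1 ->
    p (seg_pt (pol_vtx i) (pol_vtx (ordS i)) t) - w (seg_pt (pol_vtx i) (@pol_vtx R K (ordS i)) t) = q.[t],
    m i = \int[mu]_(t in `[0, 1]) q.[t] &
    enorm (pol_vtx (ordS i) - pol_vtx i) * m i = edge_int (pol_vtx i) (pol_vtx (ordS i)) p - edge_int (pol_vtx i) (@pol_vtx R K (ordS i)) w].
  have [q hq] := ep i; have [q' hq'] := ew i; exists (q - q').
  have ii (u : {poly R}) : mu.-integrable `[0, 1] (EFin \o horner u).
    exact: continuous_integrable_itv (@continuous_poly1 R u).
  have e0 t : 0 <= t <= 1 -> p (seg_pt (pol_vtx i) (pol_vtx (ordS i)) t) - w (seg_pt (pol_vtx i) (@pol_vtx R K (ordS i)) t) = (q - q').[t].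
    by move=> t01; rewrite hq// hq'// hornerD hornerN.
  have eI (f : R -> R) (u : {poly R}) : (forall t, 0 <= t <= 1 -> f t = u.[t]) -> \int[mu]_(t in `[0, 1]) f t = \int[mu]_(t in `[0, 1]) u.[t].
    by move=> fu; apply: eq_Rintegral => t; rewrite inE /= in_itv /= => t01; exact: fu.
  split; [exact: e0|exact: eI e0|].
  rewrite /m /edge_int (eI _ _ e0) (eI _ _ hq) (eI _ _ hq') -mulrBr; congr (_ * _).
  transitivity (\int[mu]_(t in `[0, 1]) (q.[t] - q'.[t])).
    by apply: eq_Rintegral => t _; rewrite hornerD hornerN.
  exact: RintegralB.
apply: (@mean_arith (pol_n K) (fun i => enorm (pol_vtx (ordS i) - pol_vtx i)) m).
- exact: edge_len_gt0.
- by have := @pol_n_ge3 R K; lia.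
- move=> i; have [q [hq -> _]] := mid i.
  have one : \int[mu]_(t in `[0, 1]) (p c - w c) = p c - w c.
    transitivity ((p c - w c) * fine (mu `[0%R, 1%R])); first exact: Rintegral_cst.
    by rewrite lebesgue_measure_itv/= lte_fin ltr01 sube0 mulr1.
  pose u : {poly R} := q - (p c - w c)%:P.
  have -> : \int[mu]_(t in `[0, 1]) q.[t] - (p c - w c) = \int[mu]_(t in `[0, 1]) u.[t].
    rewrite -[in LHS]one; transitivity (\int[mu]_(t in `[0, 1]) (q.[t] - (p c - w c))); last first.
      by apply: eq_Rintegral => t _; rewrite hornerD hornerN hornerC.
    symmetry; apply: RintegralB => //; first exact: continuous_integrable_itv (@continuous_poly1 R q).
    exact: (@continuous_integrable_itv R (fun=> p c - w c) 0 1 (@cst_continuous _ _ _)).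
  have iu : mu.-integrable `[0, 1] (EFin \o horner u) by exact: continuous_integrable_itv (@continuous_poly1 R u).
  have nn : `|\int[mu]_(t in `[0, 1]) u.[t]| <= \int[mu]_(t in `[0, 1]) `|u.[t]| by exact: le_normr_Rintegral.
  apply: (le_trans nn).
  have -> : G * diam K = \int[mu]_(t in `[0, 1]) (G * diam K).
    transitivity ((G * diam K) * fine (mu `[0%R, 1%R])); last by symmetry; exact: Rintegral_cst.
    by rewrite lebesgue_measure_itv/= lte_fin ltr01 sube0 mulr1.
  apply: le_Rintegral => //.
  + apply: continuous_integrable_itv => s; apply: (@continuous_comp _ _ _ (horner u) (fun x => `|x|)); first exact: continuous_poly1.
    exact: norm_continuous.
  + exact: (@continuous_integrable_itv R (fun=> G * diam K) 0 1 (@cst_continuous _ _ _)).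
  move=> t; rewrite /= in_itv /= => t01; rewrite hornerD hornerN hornerC -hq//.
  apply: near_c; apply: (@edge_boundary R K i _ _).1; exists t => //=.
- under eq_bigr => i _.
    have [q [_ _ ->]] := mid i; over.
  by rewrite sumrB; apply/eqP; rewrite subr_eq0; apply/eqP.
Qed.

End Boundary_mean.

Section Stability.
Context {R : realType}.


Lemma L2norm_sqr (A : set (R * R)) (f : R * R -> R) : L2norm A f ^+ 2 = inner A f f.
Proof. exact: nrm2_sqr. Qed.

Lemma innerC (A : set (R * R)) (f u : R * R -> R) : inner A f u = inner A u f.
Proof. exact: ipC. Qed.

Lemma smooth_poly_int (m : int) (f : R * R -> R) : poly_le m f -> smooth f.
Proof.
case: m => n; first exact: smooth_poly.
by move=> pf; rewrite (poly_neg _ pf)//; exact: smooth_cst.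
Qed.

Lemma sum_sqr_absorb (a b X : R) : 0 <= a -> 0 <= b -> 0 <= X ->
  a ^+ 2 + b ^+ 2 <= X * (a + b) -> a + b <= 2 * X.
Proof.
move=> a0 b0 X0 h; rewrite leNgt; apply/negP => lt.
have ab : 0 < a + b by apply: le_lt_trans lt; rewrite mulr_ge0.
have h2 : (2 * X) * (a + b) < (a + b) * (a + b) by rewrite ltr_pM2r.
have h3 : 0 <= (a - b) ^+ 2 by exact: sqr_ge0.
have h4 : (a + b) * (a + b) + (a - b) ^+ 2 = 2 * (a ^+ 2 + b ^+ 2) by ring.
lra.
Qed.

Variables (K : @polygon R) (c : R * R) (r : R).
Hypotheses (r0 : 0 < r) (dK : disc c r `<=` K) (sK : star_shaped_disc K c r).
Variables (k : nat) (TK : triangulation K) (v w : H1 K) (g : R * R -> R) (B G : R).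
Hypotheses (B0 : 0 <= B) (G0 : 0 <= G) (Ww : W_space TK k w) (tg : is_trace v g).
Hypothesis approx : forall eps, 0 < eps -> exists psi W, [/\ test_fun K psi, smooth W,
    L2norm K (fun x => psi x - (v x - w x)) <= eps,
    L2norm K (fun x => d1 psi x - (H1_d1 v x - d1 W x)) <= eps /\
    L2norm K (fun x => d2 psi x - (H1_d2 v x - d2 W x)) <= eps &
    forall x, pol_dom K x -> `|d1 W x| <= B * G /\ `|d2 W x| <= B * G].
Hypothesis lip : lipschitz_along (closure K) G w.
Hypothesis wg : forall (i : 'I_(pol_n K)) t, 0 <= t <= 1 ->
  w (seg_pt (pol_vtx i) (pol_vtx (ordS i)) t) = g (seg_pt (pol_vtx i) (pol_vtx (ordS i)) t).
Hypothesis moments : forall q, poly_le (k%:Z - 2) q -> inner K (fun x => v x - w x) q = 0.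
Variables (sigma C C' : R).
Hypotheses (s0 : 0 < sigma) (dsK : disc c (sigma * diam K) `<=` K) (C0 : 0 < C) (C'0 : 0 < C').
Hypothesis HC : forall (c : R * R) (h : R) (F : R * R -> R) (N : R), 0 < h -> poly_le k%:Z F ->
  (forall psi, test_fun (disc c (sigma * h)) psi -> (forall x, `|psi x| <= 1) ->
     (forall x, `|d1 psi x| <= (sigma * h)^-1) -> (forall x, `|d2 psi x| <= (sigma * h)^-1) ->
     `|inner (disc c (sigma * h)) F psi| <= N) ->
  forall x, `|x - c| <= 2 * h -> `|F x| <= C * (N / h ^+ 2).
Variable p : R * R -> R.
Hypothesis Pp : is_Pi k v p.

Notation h := (diam K).
Let h0 : 0 < h := diam_gt0 K.
Let mK : measurable K := @polygon_measurable R K.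
Let Kc : closure K c.
Proof. by apply/subset_closure/dK; rewrite /disc /= subrr /enorm /dot /= !mulr0 addr0 sqrtr0. Qed.
Let sc u : smooth u -> sqint leb2 K u.
Proof. by move=> /smooth_cont; exact: polygon_sqint. Qed.
Let s1 : sqint leb2 K (fun=> 1) := polygon_sqint K (@cst_continuous _ R 1).
Let n1 : nrm leb2 K (fun=> 1) <= 2 * h := nrm_one_le Kc.
Let sv : sqint leb2 K v := H1_L2 v.
Let sv1 : sqint leb2 K (H1_d1 v) := H1_L2_d1 v.
Let sv2 : sqint leb2 K (H1_d2 v) := H1_L2_d2 v.
Let sw : sqint leb2 K w := H1_L2 w.
Let svw : sqint leb2 K (fun x => v x - w x) := sqint2B mK sv sw.
Let pp : poly_le k%:Z p. Proof. by case: Pp. Qed.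
Let sp : smooth p := smooth_poly pp.

Lemma interpolation_green (V1 V2 F : R * R -> R) : L2 K V1 -> L2 K V2 -> L2 K F ->
  (forall phi, test_fun K phi -> inner K F phi = - (inner K V1 (d1 phi) + inner K V2 (d2 phi))) ->
  `|inner K V1 (H1_d1 v) + inner K V2 (H1_d2 v) + inner K F (fun x => v x - w x)| <=
  2 * B * G * h * (L2norm K V1 + L2norm K V2).
Proof.
move=> l1 l2 lF weak; have [M KM] := polygon_box K.
have N0 : 0 <= L2norm K V1 + L2norm K V2 by rewrite addr_ge0 ?nrm_ge0.
apply: (le_trans (zero_trace_green B0 G0 KM sw approx l1 l2 lF weak)).
apply: ler_wpM2r => //.
have -> : 2 * B * G * h = B * G * (2 * h) by ring.
apply: ler_wpM2l n1; exact: mulr_ge0.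
Qed.

(** Green's formula for the gradient of p: the Laplacian of p has degree k - 2 and is orthogonal to
    v - w, and the definition of Pi turns the pairing with the gradient of v into ||grad p||^2. One
    factor of the norm cancels. *)
Lemma projection_gradient_le : L2norm K (d1 p) + L2norm K (d2 p) <= 4 * B * G * h.
Proof.
have sl : smooth (fun x => d1 (d1 p) x + d2 (d2 p) x).
  by apply: smoothD; [exact: smooth_d1 (smooth_d1 sp)|exact: smooth_d2 (smooth_d2 sp)].
have weak phi : test_fun K phi -> inner K (fun x => d1 (d1 p) x + d2 (d2 p) x) phi =
    - (inner K (d1 p) (d1 phi) + inner K (d2 p) (d2 phi)).
  move=> tp; have [M KM] := polygon_box K.
  rewrite [LHS](ip2Dl mK (sc (smooth_d1 (smooth_d1 sp))) (sc (smooth_d2 (smooth_d2 sp))) (sc tp.1)) opprD.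
  have [e _] := smooth_ibp (@pol_open R K) KM (smooth_d1 sp) tp.
  have [_ e'] := smooth_ibp (@pol_open R K) KM (smooth_d2 sp) tp.
  exact (f_equal2 (fun a b : R => a + b) e e').
have := interpolation_green (sc (smooth_d1 sp)) (sc (smooth_d2 sp)) (sc sl) weak.
have -> : inner K (fun x => d1 (d1 p) x + d2 (d2 p) x) (fun x => v x - w x) = 0.
  by rewrite [LHS]ipC; apply: moments; exact: poly_laplacian.
have [_ Pq _] := Pp.
have -> : inner K (d1 p) (H1_d1 v) + inner K (d2 p) (H1_d2 v) = L2norm K (d1 p) ^+ 2 + L2norm K (d2 p) ^+ 2.
  pose add (a b : R) := a + b.
  exact (etrans (f_equal2 add (innerC K (d1 p) (H1_d1 v)) (innerC K (d2 p) (H1_d2 v)))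
    (etrans (esym (Pq p pp)) (f_equal2 add (esym (L2norm_sqr K (d1 p))) (esym (L2norm_sqr K (d2 p)))))).
rewrite addr0 ger0_norm ?addr_ge0 ?sqr_ge0// => H.
have -> : 4 * B * G * h = 2 * (2 * B * G * h) by ring.
apply: sum_sqr_absorb H; [exact: nrm_ge0|exact: nrm_ge0|].
by rewrite !mulr_ge0// ltW.
Qed.

Let near2 x : closure K x -> `|x - c| <= 2 * h.
Proof.
move=> Kx; apply: le_trans (norm_le_diam Kx Kc) _.
by rewrite mulrDl mul1r lerDl ltW.
Qed.

(** The L^2 bound becomes pointwise by the inverse estimate on a disc of radius sigma h. *)
Lemma projection_derivative_le x : closure K x ->
  `|d1 p x| <= C * (8 * B * G) /\ `|d2 p x| <= C * (8 * B * G).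
Proof.
move=> /near2 Kx.
have sh : 0 < sigma * h by rewrite mulr_gt0.
have E : 8 * B * G = 4 * B * G * h * (2 * h) / h ^+ 2 by field; rewrite gt_eqF.
have bound (q : R * R -> R) : poly_le k%:Z q -> L2norm K q <= 4 * B * G * h -> `|q x| <= C * (8 * B * G).
  move=> pq nq; rewrite E; apply: (HC h0 pq) Kx => psi tp p0 p1 p2.
  have tK := test_funS dsK tp; have [m0 _ _] := test_norms tK sh p0 p1 p2.
  have -> : inner (disc c (sigma * h)) q psi = inner K q psi.
    exact: inner_local dsK (fun x _ => erefl) (test_off tp).
  exact (le_trans (ip2_le mK (sc (smooth_poly pq)) (sc tK.1)) (ler_pM (nrm_ge0 _ _ _) (nrm_ge0 _ _ _) nq m0)).
have := projection_gradient_le => L.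
split; apply: bound; [exact: poly_pred (poly_d1 pp)| |exact: poly_pred (poly_d2 pp)|].
  by apply: le_trans L; rewrite lerDl; exact: nrm_ge0.
by apply: le_trans L; rewrite lerDr; exact: nrm_ge0.
Qed.

Notation D := (16 * C * B + 1).

(** [D * G] is a Lipschitz constant of p - w: twice the pointwise bound [8 * C * B * G] on the
    partial derivatives of p, plus [G] for w. Equality of boundary means removes the additive
    constant. *)
Lemma projection_interpolant_le x : closure K x -> `|p x - w x| <= 2 * (D * G * h).
Proof.
apply: (@boundary_mean_bound R K c r r0 sK Kc p w (D * G)).
- by rewrite mulr_ge0// addr_ge0// !mulr_ge0// ltW.
- move=> y z yz; have -> : p y - w y - (p z - w z) = (p y - p z) - (w y - w z) by ring.
  apply: le_trans (ler_normB _ _) _.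
  have -> : D * G = 2 * (C * (8 * B * G)) + G by ring.
  rewrite [X in _ <= X]mulrDl; apply: lerD; last exact: lip.
  exact: convex_lipschitz sp yz projection_derivative_le.
- move=> i; have [q [_ hq]] := poly_along_line (pol_vtx i) (pol_vtx (ordS i) - pol_vtx i) pp.
  by exists q => t _; exact: hq.
- by move=> i; have [q [_ hq]] := edge_poly Ww i; exists q.
(* The trace [g'] used for the boundary mean of p is not given as [g]; uniqueness of traces
   identifies their edge integrals. *)
have [_ _ [g' [tg' ->]]] := Pp.
apply: eq_bigr => i _; rewrite /edge_int; congr (_ * _).
rewrite (trace_unique r0 dK sK i tg' tg); apply: eq_Rintegral => t; rewrite inE /= in_itv /= => t01.
by rewrite wg.
Qed.

Variable f : R * R -> R.
Hypotheses (pf : poly_le k%:Z f) (lf : weak_laplacian v f).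
Hypothesis split : exists f0 q1 q2, [/\ poly_le (k%:Z - 2) f0, poly_hom K k%:Z q1, poly_hom K (k%:Z - 1) q2,
    forall x, f x = f0 x + (q1 x + q2 x) &
    forall x b, (forall s : R, `|s| <= 2^-1 -> `|f (centroid K + s *: (x - centroid K))| <= b) ->
      `|q1 x + q2 x| <= C' * b].
Hypothesis enhanced : forall q1 q2, poly_hom K k%:Z q1 -> poly_hom K (k%:Z - 1) q2 ->
  inner K v (q1 \+ q2) = inner K p (q1 \+ q2).

Notation N := (L2norm K (H1_d1 v) + L2norm K (H1_d2 v)).

(** The Laplacian is a polynomial known only weakly. Pairing it with a test function moves one
    derivative onto the latter, which gives the norm of grad v times 2/sigma, and the inverse
    estimate divides by h^2. *)
Lemma laplacian_le x : `|x - c| <= 2 * h -> `|f x| <= C * (N * (2 / sigma) / h ^+ 2).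
Proof.
have sh : 0 < sigma * h by rewrite mulr_gt0.
apply: (HC h0 pf) => psi tp p0 p1 p2.
have tK := test_funS dsK tp; have [_ m1 m2] := test_norms tK sh p0 p1 p2.
have -> : inner (disc c (sigma * h)) f psi = inner K f psi.
  exact: inner_local dsK (fun x _ => erefl) (test_off tp).
rewrite (lf tK) normrN mulrDl.
have E : 2 / sigma = (sigma * h)^-1 * (2 * h) by field; rewrite !gt_eqF.
rewrite E.
have a1 := ip2_le mK sv1 (sc (smooth_d1 tK.1)); have a2 := ip2_le mK sv2 (sc (smooth_d2 tK.1)).
exact (le_trans (ler_normD _ _) (lerD (le_trans a1 (ler_wpM2l (nrm_ge0 _ _ _) m1)) (le_trans a2 (ler_wpM2l (nrm_ge0 _ _ _) m2)))).
Qed.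

(* The part [f0] of degree [k - 2] is orthogonal to [v - w]; the two leading
   homogeneous parts see only [p] in [v], by the enhancement condition. *)
Lemma laplacian_pairing_le :
  `|inner K f (fun x => v x - w x)| <= 16 * C' * C * D / sigma * G * h * N.
Proof.
have [f0 [q1 [q2 [pf0 hq1 hq2 fE fb]]]] := split.
have sf : smooth f := smooth_poly pf; have sf0 := smooth_poly_int pf0.
pose f' x := q1 x + q2 x.
have sf' : sqint leb2 K f'.
  have -> : f' = (fun x => f x - f0 x) by apply/funext => x; rewrite fE addrAC subrr add0r.
  exact: sc (smoothB sf sf0).
have Ef : inner K f (fun x => v x - w x) = ip leb2 K f' (fun x => p x - w x).
  have e1 : inner K f (fun x => v x - w x) = ip leb2 K (fun x => f0 x + f' x) (fun x => v x - w x).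
    by congr (inner K _ _); apply/funext => x; rewrite fE.
  have e2 := ip2Dl mK (sc sf0) sf' svw.
  have e3 : ip leb2 K f0 (fun x => v x - w x) = 0 by rewrite ipC; exact: moments.
  have e4 := ip2Br mK sf' sv sw; have e5 := ip2Br mK sf' (sc sp) sw.
  have e6 : ip leb2 K f' v = ip leb2 K f' p by exact (etrans (ipC _ _ _ _) (etrans (enhanced hq1 hq2) (ipC _ _ _ _))).
  rewrite e1 e2 e3 add0r; exact (etrans e4 (etrans (f_equal (fun a => a - ip leb2 K f' w) e6) (esym e5))).
rewrite Ef; move: sf'; rewrite -/f' => sf'.
have b0 : 0 <= C' * (C * (N * (2 / sigma) / h ^+ 2)).
  have N0 : 0 <= N by rewrite addr_ge0 ?nrm_ge0.
  apply: mulr_ge0; first exact: ltW.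
  apply: mulr_ge0; first exact: ltW.
  apply: divr_ge0; last exact: sqr_ge0.
  apply: mulr_ge0 => //; apply: divr_ge0 => //; exact: ltW.
have cen := centroid_near r0 dK Kc.
have bf x : pol_dom K x -> `|f' x| <= C' * (C * (N * (2 / sigma) / h ^+ 2)).
  (* The sampled points remain within 2 h of [c]: the centroid is within h of [c], and half of the
     distance from the centroid to [x] is at most h. *)
  move=> Kx; apply: fb => s s2; apply: laplacian_le.
  have -> : centroid K + s *: (x - centroid K) - c = (centroid K - c) + s *: (x - centroid K) by rewrite addrAC.
  apply: (le_trans (ler_normD _ _)).
  have -> : 2 * h = h + 2^-1 * (2 * h) by field.
  refine (lerD cen _); rewrite normrZ.
  have xc : `|x - centroid K| <= 2 * h.
    have -> : x - centroid K = (x - c) - (centroid K - c) by rewrite opprB addrA subrK.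
    apply: (le_trans (ler_normB _ _)); rewrite mulrDl mul1r.
    exact (lerD (norm_le_diam (subset_closure Kx) Kc) cen).
  exact: ler_pM.
have E0 : 0 <= 2 * (D * G * h).
  by rewrite mulr_ge0// mulr_ge0 ?(ltW h0)// mulr_ge0// addr_ge0// !mulr_ge0// ltW.
have spw := sqint2B mK (sc sp) sw.
have nf := le_trans (nrm2_const mK s1 sf' b0 bf) (ler_wpM2l b0 n1).
have npw := le_trans (nrm2_const mK s1 spw E0 (fun x Kx => projection_interpolant_le (subset_closure Kx))) (ler_wpM2l E0 n1).
apply: (le_trans (ip2_le mK sf' spw)).
apply: (le_trans (ler_pM (nrm_ge0 _ _ _) (nrm_ge0 _ _ _) nf npw)).
by apply: le_of_eq; field; rewrite !gt_eqF.
Qed.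

Notation E := (4 * B + 32 * C' * C * D / sigma).

(** By Green's formula ||grad v||^2 is [- inner K f (v - w)] up to a term of order [G * h * N], and
    that pairing is of the same order. One factor [N] is cancelled, which doubles the constant. *)
Lemma gradient_le : N <= E * G * h.
Proof.
have := interpolation_green (H1_L2_d1 v) (H1_L2_d2 v) (sc (smooth_poly pf)) lf.
have l := laplacian_pairing_le.
rewrite -(L2norm_sqr K (H1_d1 v)) -(L2norm_sqr K (H1_d2 v)) => gr.
pose X := (2 * B + 16 * C' * C * D / sigma) * G * h.
have -> : E * G * h = 2 * X by rewrite /X; field; rewrite gt_eqF.
have X0 : 0 <= X.
  rewrite /X mulr_ge0 ?(ltW h0)// mulr_ge0//.
  apply: addr_ge0; first exact: mulr_ge0.
  apply: divr_ge0; last exact: ltW.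
  by rewrite mulr_ge0 ?addr_ge0 ?mulr_ge0 ?(ltW C0) ?(ltW C'0).
apply: sum_sqr_absorb X0 _; [exact: nrm_ge0|exact: nrm_ge0|].
have -> : X * N = 2 * B * G * h * N + 16 * C' * C * D / sigma * G * h * N by rewrite /X; ring.
move: gr l; set A := (A in `|A + _| <= _); set F := inner K f _ => gr l.
have AE : A = (A + F) - F by rewrite addrK.
rewrite -/A AE.
apply: (le_trans (ler_norm _)); apply: (le_trans (ler_normB _ _)); exact: lerD gr l.
Qed.

Lemma difference_le : L2norm K (fun x => v x - w x) <= (2 * E + 4 * B) * G * h ^+ 2.
Proof.
have [M KM] := polygon_box K.
have KMc x : pol_dom K x -> `|x - c| <= h by move=> /subset_closure Kx; exact: norm_le_diam.
apply: (le_trans (zero_trace_friedrichs B0 G0 (ltW h0) KM KMc sw approx)).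
have -> : (2 * E + 4 * B) * G * h ^+ 2 = 2 * h * (E * G * h + B * G * (2 * h)) by ring.
apply: ler_wpM2l; first by rewrite mulr_ge0// ltW.
apply: lerD; last by apply: ler_wpM2l n1; exact: mulr_ge0.
by apply: le_trans gradient_le; rewrite lerDl; exact: nrm_ge0.
Qed.

Lemma seminorm_le : H1seminorm v <= E * G * h.
Proof.
apply: le_trans gradient_le.
have a0 : 0 <= L2norm K (H1_d1 v) by exact: nrm_ge0.
have b0 : 0 <= L2norm K (H1_d2 v) by exact: nrm_ge0.
rewrite /H1seminorm -(L2norm_sqr K (H1_d1 v)) -(L2norm_sqr K (H1_d2 v)).
move: (L2norm K (H1_d1 v)) (L2norm K (H1_d2 v)) a0 b0 => a b a0 b0.
rewrite -[leRHS]ger0_norm ?addr_ge0// -sqrtr_sqr ler_sqrt ?sqr_ge0//.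
by rewrite sqrrD addrAC lerDl mulrn_wge0// mulr_ge0.
Qed.

End Stability.

Lemma interpolant_stability (R : realType) (k : nat) (rho : R) : (1 <= k)%N -> 0 < rho ->
  exists2 C : R, 0 < C & forall (K : @polygon R) (TK : triangulation K) c r (v w : H1 K) (G : R),
  rho * diam K <= r -> disc c r `<=` K -> star_shaped_disc K c r ->
  (forall t, diam (triangle (@tri R K TK t)) != 0) -> vem k v -> is_interp TK k v w ->
  0 <= G -> lipschitz_along (closure K) G w ->
  H1seminorm v <= C * (G * diam K) /\ L2norm K (fun x => v x - w x) <= C * (G * diam K ^+ 2).
Proof.
move=> k1 rho0; have [B B0 HB] := @zero_trace_approximation R.
have [C C0 HC] := disc_sup_bound k rho0; have [C' C'0 HC'] := @homogeneous_split R k k1.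
pose E := 4 * B + 32 * C' * C * (16 * C * B + 1) / rho.
have E0 : 0 < E.
  apply: addr_gt0; first exact: mulr_gt0.
  by rewrite divr_gt0// !mulr_gt0// addr_gt0// !mulr_gt0.
exists (2 * E + 4 * B); first by rewrite addr_gt0// mulr_gt0.
move=> K TK c r v w G rh dK sK D0 Vv Iw G0 lip.
have h0 := diam_gt0 K; have r0 : 0 < r by apply: lt_le_trans rh; rewrite mulr_gt0.
have dsK : disc c (rho * diam K) `<=` K by move=> x Dx; apply: dK; exact: lt_le_trans Dx rh.
have [[f [pf lf]] _ [p [Pp enh]]] := Vv.
have [Ww [g [_ [rr [[tg Bg] _ Qr [wg_vtx _ wg_mom _ wt_mom]]]]]] := Iw.
have wg := boundary_interp_eq k1 Ww Bg wg_vtx wg_mom.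
have approx := HB K c r v g w G r0 dK sK tg (H1_L2 w) G0 lip wg.
have [M [_ [KM _]]] := polygon_bounded r0 dK.
have moments q := interior_moments_eq0 k1 Ww (H1_L2 v) (H1_L2 w) Qr D0 KM wt_mom (q := q).
have GH : 0 <= G * diam K by rewrite mulr_ge0// ltW.
split.
- apply: (le_trans (seminorm_le r0 dK sK (ltW B0) G0 Ww tg approx lip wg moments rho0 dsK C0 C'0 HC Pp pf lf (HC' K f pf) enh)).
  rewrite -mulrA; apply: ler_wpM2r => //.
  by rewrite -/E [2 * E]mulrDl mul1r -addrA lerDl addr_ge0 ?mulr_ge0// ltW.
- apply: (le_trans (difference_le r0 dK sK (ltW B0) G0 Ww tg approx lip wg moments rho0 dsK C0 C'0 HC Pp pf lf (HC' K f pf) enh)).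
  by rewrite -mulrA.
Qed.

Theorem lemma4p1 (R : realType) (k : nat) (hk : (1 <= k)%N)
    (rho gamma c1 c2 : R)
    (hrho : 0 < rho) (hgamma : 0 < gamma) (hc1 : 0 < c1) (hc2 : 0 < c2) :
  exists C : R, 0 < C /\
    forall (K : @polygon R) (TK : triangulation K),
      mesh_regular rho K -> tri_regular gamma c1 c2 TK ->
      forall v w : H1 K, vem k v -> is_interp TK k v w ->
        L2norm K v <= C * L2norm K w /\ H1seminorm v <= C * H1seminorm w.
Proof.
(* A triangle contains a disc of radius at least gamma times its own diameter, hence at least gamma
   c1 times the diameter of [K]. *)
have sigma0 : 0 < gamma * c1 by rewrite mulr_gt0.
have [C C0 HC] := @interpolant_stability R k rho hk hrho.
have [L L0 HL] := @interpolant_lipschitz R k (gamma * c1) hk sigma0.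
exists (1 + C * L); split; first by rewrite addr_gt0// mulr_gt0.
move=> K TK [[c [r [rh dK sK]]] _] regT v w Vv Iw.
have h0 := diam_gt0 K; have r0 : 0 < r by apply: lt_le_trans rh; rewrite mulr_gt0.
have mK := @polygon_measurable R K.
have D0 t : diam (triangle (@tri R K TK t)) != 0.
  by have [_ hT _] := regT t; rewrite gt_eqF//; apply: lt_le_trans hT; rewrite mulr_gt0.
have discT t : exists c', disc c' (gamma * c1 * diam K) `<=` triangle (@tri R K TK t) /\
    disc c' (gamma * c1 * diam K) `<=` K.
  (* The disc is open and contained in the closure of [K], hence in [K] itself, where test functions
     must be supported. *)
  have [[c' [r' [rT dT]]] hT _] := regT t; exists c'.
  have dT' : disc c' (gamma * c1 * diam K) `<=` triangle (@tri R K TK t).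
    move=> x Dx; apply: dT; apply: lt_le_trans Dx _; apply: le_trans rT.
    by rewrite -mulrA; apply: ler_wpM2l hT; exact: ltW.
  split=> //; apply: (open_sub_closure r0 sK (@disc_open R _ _)) => x /dT' Tx.
  by rewrite -(tri_cover TK); exists t.
have [lip1 lip0] := HL K TK w discT Iw.1.
have w0 : 0 <= L2norm K w by exact: nrm_ge0.
have w1 : 0 <= H1seminorm w by exact: sqrtr_ge0.
have G1 : 0 <= L * (H1seminorm w / diam K) by rewrite mulr_ge0 ?divr_ge0// ltW.
have G2 : 0 <= L * (L2norm K w / diam K ^+ 2) by rewrite mulr_ge0 ?divr_ge0 ?exprn_ge0// ltW.
(* Stability is applied once for each Lipschitz constant: the seminorm bound carries one power of
   the diameter, which cancels the denominator of the first, and the norm bound carries two, which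
   cancel that of the second. In the latter case the triangle inequality accounts for the summand 1
   of the constant. *)
have [h1 _] := HC K TK c r v w _ rh dK sK D0 Vv Iw G1 lip1.
have [_ h2] := HC K TK c r v w _ rh dK sK D0 Vv Iw G2 lip0.
split; last first.
  apply: (le_trans h1); have -> : C * (L * (H1seminorm w / diam K) * diam K) = C * L * H1seminorm w.
    by field; rewrite gt_eqF.
  by apply: ler_wpM2r => //; rewrite lerDr.
have E : (H1_val v : R * R -> R) = (fun x => (v x - w x) + w x) by apply/funext => x; rewrite subrK.
have tri_le : L2norm K v <= L2norm K (fun x => v x - w x) + L2norm K w.
  rewrite {1}E; exact: nrm2D mK (sqint2B mK (H1_L2 v) (H1_L2 w)) (H1_L2 w).
apply: (le_trans tri_le); rewrite [X in _ <= X]mulrDl mul1r addrC lerD2l.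
apply: (le_trans h2); apply: le_of_eq; by field; rewrite gt_eqF.
Qed.
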